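(* Assume the setting and hypotheses described in the context. Then $$\big|\langle\mathbf v,G(z)\mathbf w\rangle-m(z)\langle\mathbf v,\mathbf w\rangle\big|\prec\sqrt{\frac{\operatorname{Im}m(z)}{N\eta}}$$ uniformly in $z\in\widetilde{\mathbf S}_W$ and in all deterministic unit vectors $\mathbf v,\mathbf w\in\mathbb C^N$.
   Context: Let $H=H^*$ be a random $N\times N$ Hermitian matrix whose entries $H_{ij}$, $i\le j$, are independent complex random variables with $\mathbb E H_{ij}=0$, whose variances $S_{ij}=\mathbb E|H_{ij}|^2$ satisfy $C^{-1}\le NS_{ij}\le C$ and $\sum_jS_{ij}=1$ for all $i$ (for a constant $C>0$), and such that for every $p\in\mathbb N$ there is a constant $C_p$ with $\mathbb E|\sqrt N H_{ij}|^p\le C_p$ for all $N,i,j$. Let $m(z)=\frac{-z+\sqrt{z^2-4}}2$ be the Stieltjes transform of the semicircle law $\varrho(\mathrm dx)=\frac1{2\pi}\sqrt{(4-x^2)_+}\,\mathrm dx$ (branch chosen so that $m$ is holomorphic in the upper half-plane and $m(z)\to0$ as $z\to\infty$). For $z=E+\mathrm i\eta$, $\eta>0$, let $G(z)=(H-z)^{-1}$. Fix $\omega\in(0,1)$ and let $\widetilde{\mathbf S}_W=\{z=E+\mathrm i\eta:2+N^{-2/3+\omega}\le|E|\le\omega^{-1},\ 0<\eta\le\omega^{-1}\}$. Stochastic domination: for families of nonnegative random variables $\xi=(\xi^{(N)}(u))$, $\zeta=(\zeta^{(N)}(u))$, we write $\xi\prec\zeta$ (uniformly in $u$) if for every $\varepsilon>0$,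 $D>0$, $\sup_u\mathbb P[\xi^{(N)}(u)>N^\varepsilon\zeta^{(N)}(u)]\le N^{-D}$ for $N\ge N_0(\varepsilon,D)$, with $N_0$ depending only on the constants in the hypotheses. *)

(* Defs.v *)
From HB Require Import structures.
From mathcomp Require Import all_boot all_order all_algebra.
From mathcomp Require Import all_classical all_reals.
From mathcomp Require Import topology normedtype sequences exp measure lebesgue_measure
  lebesgue_integral probability random_variable.
From mathcomp Require Import complex.
Set Implicit Arguments. Unset Strict Implicit. Unset Printing Implicit Defensive.
Import Order.TTheory GRing.Theory Num.Theory.
Local Open Scope ring_scope.
Local Open Scope classical_set_scope.

Definition cabs {R : rcfType} (z : R[i]) : R := Normc.normc z.

Definition cpair {R : rcfType} (z : R[i]) : (R * R)%type := (complex.Re z, complex.Im z).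

Definition cdot {R : rcfType} (N : nat) (v w : 'cV[R[i]]_N) : R[i] :=
  \sum_(k < N) (conjc (v k 0)) * w k 0.

Definition unit_vec {R : rcfType} (N : nat) (v : 'cV[R[i]]_N) : Prop :=
  \sum_(k < N) cabs (v k 0) ^+ 2 = 1.

Definition resolvent {R : rcfType} (N : nat) (H : 'M[R[i]]_N) (z : R[i]) : 'M[R[i]]_N :=
  invmx (H - z%:M).

(* Stieltjes transform of the semicircle law, m(z) = (-z + sqrt(z^2-4))/2 with the
   branch sqrt(z^2-4) = sqrt(z-2) sqrt(z+2) (principal square roots), which is the
   branch holomorphic in the upper half plane with m(z) -> 0 at infinity. *)
Definition msc {R : rcfType} (z : R[i]) : R[i] :=
  (- z + sqrtc (z - 2%:R) * sqrtc (z + 2%:R)) / 2%:R.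

Definition SW {R : realType} (omega : R) (N : nat) : set R[i] :=
  [set z | 2 + (N%:R `^ (- (2%:R / 3%:R) + omega)) <= `|complex.Re z| <= omega^-1
           /\ 0 < complex.Im z <= omega^-1].

Definition mutually_independent d (T : measurableType d) (R : realType)
  (P : probability T R) (I : finType) (D : {set I}) (X : I -> T -> (R * R)%type) : Prop :=
  forall (J : {set I}) (A : I -> set (R * R)%type),
    J \subset D -> (forall i, measurable (A i)) ->
    P (\big[setI/setT]_(i in J) (X i @^-1` A i)) = (\prod_(i in J) P (X i @^-1` A i))%E.

(* Main.v *)
Require Import Defs.
From HB Require Import structures.
From mathcomp Require Import all_boot all_order all_algebra.
From mathcomp Require Import all_classical all_reals.
From mathcomp Require Import topology normedtype sequences exp measure lebesgue_measure
  measurable_realfun numfun lebesgue_integral probability random_variable.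
From mathcomp Require Import interval_inference complex.
From mathcomp Require Import ring lra zify.
Set Implicit Arguments. Unset Strict Implicit. Unset Printing Implicit Defensive.
Import Order.TTheory GRing.Theory Num.Theory.
Local Open Scope ring_scope.
Local Open Scope classical_set_scope.

(* Outside the spectrum Im m is comparable to Im z / rho with rho^2 = |E| - 2 + Im z, so the claim is
   an error p = (N rho)^(-1/2).  Write d_i for the error in the Dyson equation of G_ii and
   X = <v, G w> - m <v, w>.  Each of these, as well as weighted averages of the d_i, has the form
   sum_ij H_ij Z_ij + Q, and expanding E|Y|^(2k) in one entry H_ij at a time (the entry being
   independent of the matrix with that entry removed) bounds it with high probability, provided that
   rho * |G v|^2 is at most a small power of N; by Ward's identity |G v|^2 = Im <v, G v> / Im z.
   Averaging improves the bound on d_i enough for the Dyson equation, whose stability constant is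
   only rho, to give G_ii close to m; then X is of order p.

   The a priori bound holds for large Im z, and |G v|^2 grows by at most a small power of N when Im z
   is divided by a small power of N.  Hence one descends in finitely many steps, with a fine grid and
   continuity inside each step, as long as Im z is above N^(-1/2) (|E| - 2)^(1/4) up to a small power
   of N.  Slightly below that height Im z * tr Im G is small, so there is no eigenvalue near E, and the
   resolvents at all lower heights are controlled by the one at that height. *)

(** * Complex numbers and resolvents *)

(** The main terms of the expansion use only [E h = 0], the two second moments of an entry [h], and
    independence. The price is a cubic remainder: [|H_ij|^3] summed over [N^2] pairs loses [sqrt N],
    and this loss is recovered because rows and columns of [G] are controlled in l2 by Ward's
    identity. The bound for a weighted mean of the [d_i] is of order [sqrt (p y)], where [y] bounds
    its derivative in one entry. Averaging gains because a mean varies less with a single entry than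
    one [d_i] does. For uniform weights the linear part moreover carries the factor [z + 2 m], of
    size [rho], which compensates the degenerate stability near the edge. The distance to the edge
    enters through [N^2 (|E| - 2)^3 >= N^(3 om)], which makes [p] smaller than [rho] by a power of
    [N]. The stopping height is where [p] becomes comparable with [Im z / rho], the order of [Im m]:
    below it the law no longer returns the a priori bound on [|G v|^2]. *)

Notation ReC := (@complex.Re _).
Notation ImC := (@complex.Im _).

Section ComplexModulus.
Context {R : realType}.
Implicit Types z w : R[i].

Lemma cabs_sqr z : cabs z ^+ 2 = ReC z ^+ 2 + ImC z ^+ 2.
Proof. by case: z => a b; rewrite /cabs /= sqr_sqrtr // addr_ge0 ?sqr_ge0. Qed.
Lemma cabs_ge0 z : 0 <= cabs z. Proof. by case: z => a b; exact: sqrtr_ge0. Qed.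
Hint Resolve cabs_ge0 : core.
Lemma cabs0 : cabs (0 : R[i]) = 0. Proof. exact: Normc.normc0. Qed.
Lemma cabs1 : cabs (1 : R[i]) = 1. Proof. exact: Normc.normc1. Qed.
Lemma cabsM z w : cabs (z * w) = cabs z * cabs w. Proof. exact: Normc.normcM. Qed.
Lemma cabsN z : cabs (- z) = cabs z. Proof. exact: normcN. Qed.
Lemma cabsD z w : cabs (z + w) <= cabs z + cabs w. Proof. exact: le_normcD. Qed.
Lemma cabsB z w : cabs (z - w) <= cabs z + cabs w.
Proof. by rewrite -[cabs w]cabsN cabsD. Qed.
Lemma cabsBC z w : cabs (z - w) = cabs (w - z). Proof. by rewrite -cabsN opprB. Qed.
Lemma cabsV z : cabs z^-1 = (cabs z)^-1. Proof. exact: Normc.normcV. Qed.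
Lemma cabsX z n : cabs (z ^+ n) = cabs z ^+ n.
Proof. by elim: n => [|n IH]; rewrite ?expr0 ?cabs1 // !exprS cabsM IH. Qed.
Lemma cabs_conj z : cabs (conjc z) = cabs z.
Proof. by case: z => a b; rewrite /cabs /= sqrrN. Qed.
Lemma cabs_eq0 z : (cabs z == 0) = (z == 0).
Proof.
apply/eqP/eqP => [/Normc.eq0_normc //|->]; exact: cabs0.
Qed.
Lemma cabs_gt0 z : (0 < cabs z) = (z != 0).
Proof. by rewrite lt_def cabs_ge0 andbT cabs_eq0. Qed.
Lemma cabs_re z : `|ReC z| <= cabs z.
Proof.
rewrite -(@ler_pXn2r _ 2) ?nnegrE ?normr_ge0 //.
by rewrite real_normK ?num_real // cabs_sqr lerDl sqr_ge0.
Qed.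
Lemma cabs_im z : `|ImC z| <= cabs z.
Proof.
rewrite -(@ler_pXn2r _ 2) ?nnegrE ?normr_ge0 //.
by rewrite real_normK ?num_real // cabs_sqr lerDr sqr_ge0.
Qed.
Lemma re_le_cabs z : ReC z <= cabs z. Proof. exact: le_trans (ler_norm _) (cabs_re z). Qed.
Lemma im_le_cabs z : ImC z <= cabs z. Proof. exact: le_trans (ler_norm _) (cabs_im z). Qed.
Lemma cabs_le_reim z : cabs z <= `|ReC z| + `|ImC z|.
Proof.
rewrite -(@ler_pXn2r _ 2) ?nnegrE ?addr_ge0 ?normr_ge0 //.
rewrite cabs_sqr sqrrD !real_normK ?num_real // -addrA lerD2l.
by rewrite lerDr mulrn_wge0 // mulr_ge0.
Qed.
Lemma cabs_real (x : R) : cabs (x%:C)%C = `|x|.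
Proof. by rewrite /cabs /= expr0n /= addr0 sqrtr_sqr. Qed.
Lemma conjcM_norm z : conjc z * z = ((cabs z ^+ 2)%:C)%C.
Proof.
by rewrite cabs_sqr; case: z => a b; apply/eqP; rewrite eq_complex /=; apply/andP; split; apply/eqP; ring.
Qed.
Lemma cabs_sum (I : Type) (r : seq I) (Q : pred I) (F : I -> R[i]) :
  cabs (\sum_(i <- r | Q i) F i) <= \sum_(i <- r | Q i) cabs (F i).
Proof.
elim/big_rec2: _ => [|i y x _ IH]; first by rewrite cabs0.
by apply: le_trans (cabsD _ _) _; rewrite lerD2l.
Qed.
Lemma cabs_dist z w : cabs z - cabs w <= cabs (z - w).
Proof. by rewrite lerBlDr -[in leLHS](subrK w z) cabsD. Qed.
Lemma cReD z w : ReC (z + w) = ReC z + ReC w. Proof. by case: z; case: w. Qed.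
Lemma cImD z w : ImC (z + w) = ImC z + ImC w. Proof. by case: z; case: w. Qed.
Lemma cReN z : ReC (- z) = - ReC z. Proof. by case: z. Qed.
Lemma cImN z : ImC (- z) = - ImC z. Proof. by case: z. Qed.
Lemma cReM z w : ReC (z * w) = ReC z * ReC w - ImC z * ImC w. Proof. by case: z; case: w. Qed.
Lemma cImM z w : ImC (z * w) = ReC z * ImC w + ImC z * ReC w. Proof. by case: z; case: w. Qed.
Lemma cReJ z : ReC (conjc z) = ReC z. Proof. by case: z. Qed.
Lemma cImJ z : ImC (conjc z) = - ImC z. Proof. by case: z. Qed.
Lemma cReRC (x : R) : ReC (x%:C)%C = x. Proof. by []. Qed.
Lemma cImRC (x : R) : ImC (x%:C)%C = 0. Proof. by []. Qed.
Lemma cRe_sum (I : Type) (r : seq I) (Q : pred I) (F : I -> R[i]) :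
  ReC (\sum_(i <- r | Q i) F i) = \sum_(i <- r | Q i) ReC (F i).
Proof. by elim/big_rec2: _ => // i y x _ <-; rewrite cReD. Qed.
Lemma cIm_sum (I : Type) (r : seq I) (Q : pred I) (F : I -> R[i]) :
  ImC (\sum_(i <- r | Q i) F i) = \sum_(i <- r | Q i) ImC (F i).
Proof. by elim/big_rec2: _ => // i y x _ <-; rewrite cImD. Qed.
Lemma complex_ext z w : ReC z = ReC w -> ImC z = ImC w -> z = w.
Proof. by case: z => a b; case: w => c d /= -> ->. Qed.
End ComplexModulus.
#[global] Hint Resolve cabs_ge0 : core.

(** * Cauchy-Schwarz inequalities for finite real sums *)

Section RealSums.
Context {R : realType}.

(** Lagrange's identity: the difference of the two sides is half the double sum of the squares of
    [a i * b j - a j * b i]. *)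
Lemma sum_mul_sqr_le (I : finType) (a b : I -> R) :
  (\sum_i a i * b i) ^+ 2 <= (\sum_i a i ^+ 2) * (\sum_i b i ^+ 2).
Proof.
rewrite -subr_ge0.
have -> : (\sum_i a i ^+ 2) * (\sum_i b i ^+ 2) - (\sum_i a i * b i) ^+ 2 =
   2^-1 * \sum_i \sum_j (a i * b j - a j * b i) ^+ 2.
  have e1 : (\sum_i a i ^+ 2) * (\sum_i b i ^+ 2) = \sum_i \sum_j a i ^+ 2 * b j ^+ 2.
    by rewrite mulr_suml; apply: eq_bigr => i _; rewrite mulr_sumr.
  have e2 : (\sum_i a i ^+ 2) * (\sum_i b i ^+ 2) = \sum_i \sum_j a j ^+ 2 * b i ^+ 2.
    by rewrite e1 exchange_big.
  have e3 : (\sum_i a i * b i) ^+ 2 = \sum_i \sum_j a i * b i * (a j * b j).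
    by rewrite expr2 mulr_suml; apply: eq_bigr => i _; rewrite mulr_sumr.
  have -> : \sum_i \sum_j (a i * b j - a j * b i) ^+ 2 =
    \sum_i \sum_j a i ^+ 2 * b j ^+ 2 + \sum_i \sum_j a j ^+ 2 * b i ^+ 2
     - 2 * \sum_i \sum_j a i * b i * (a j * b j).
    rewrite mulr_sumr -!big_split /= -sumrB; apply: eq_bigr => i _.
    rewrite mulr_sumr -!big_split /= -sumrB; apply: eq_bigr => j _; ring.
  rewrite -e1 -e2 -e3; by field.
apply: mulr_ge0; first by rewrite invr_ge0.
by apply: sumr_ge0 => i _; apply: sumr_ge0 => j _; rewrite sqr_ge0.
Qed.

(** The bounds are given as squares because the later sums come with explicit square roots such as
    [n] or [L / r]. *)
Lemma sum_mul_le (I : finType) (a b : I -> R) (A B : R) :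
  0 <= A -> 0 <= B ->
  \sum_i a i ^+ 2 <= A ^+ 2 -> \sum_i b i ^+ 2 <= B ^+ 2 ->
  \sum_i a i * b i <= A * B.
Proof.
move=> A0 B0 hA hB.
have [h|h] := leP 0 (\sum_i a i * b i); last first.
  by apply: le_trans (ltW h) _; rewrite mulr_ge0.
rewrite -(@ler_pXn2r _ 2) ?nnegrE ?mulr_ge0 // exprMn.
apply: le_trans (sum_mul_sqr_le a b) _.
by apply: ler_pM => //; apply: sumr_ge0 => i _; rewrite sqr_ge0.
Qed.

Lemma sum_le_sqrt (N : nat) (a : 'I_N -> R) (n A : R) :
  0 <= n -> 0 <= A -> n ^+ 2 = N%:R -> \sum_i a i ^+ 2 <= A ^+ 2 ->
  \sum_i a i <= n * A.
Proof.
move=> n0 A0 hn hA.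
rewrite (eq_bigr (fun i => 1 * a i)) => [|i _]; last by rewrite mul1r.
apply: sum_mul_le => //.
by rewrite (eq_bigr (fun _ => 1)) ?sumr_const ?card_ord ?hn // => i _; rewrite expr1n.
Qed.

End RealSums.

(** * Hermitian matrices, resolvents and the Ward identity *)

Section LinearAlgebra.
Context {R : realType}.
Variable N : nat.
Notation C := R[i].
Implicit Types (x y v : 'cV[C]_N) (A B H : 'M[C]_N) (z w c : C).

Definition norm2 x : R := \sum_(k < N) cabs (x k 0) ^+ 2.
Definition ebasis (i : 'I_N) : 'cV[C]_N := delta_mx i 0.
Definition adj A : 'M[C]_N := map_mx conjc A^T.
Definition hermitian H := forall i j, H j i = conjc (H i j).

Lemma norm2_ge0 x : 0 <= norm2 x. Proof. by apply: sumr_ge0 => k _; rewrite sqr_ge0. Qed.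
Lemma norm2_eq0 x : norm2 x = 0 -> x = 0.
Proof.
move=> /eqP; rewrite psumr_eq0; last by move=> k _; rewrite sqr_ge0.
move=> /allP h; apply/matrixP => i j; rewrite ord1 mxE.
have := h i (mem_index_enum i); rewrite sqrf_eq0 cabs_eq0 => /eqP -> //.
Qed.
Lemma norm2Z (c : C) x : norm2 (c *: x) = cabs c ^+ 2 * norm2 x.
Proof.
by rewrite /norm2 mulr_sumr; apply: eq_bigr => k _; rewrite mxE cabsM exprMn.
Qed.
Lemma norm2_ebasis i : norm2 (ebasis i) = 1.
Proof.
rewrite /norm2 (bigD1 i) //= mxE !eqxx [cabs _]cabs1 expr1n big1 ?addr0 // => k ki.
by rewrite mxE (negbTE ki) [cabs _]cabs0 expr0n.
Qed.

Lemma cdotDr x y v : cdot x (y + v) = cdot x y + cdot x v.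
Proof. by rewrite /cdot -big_split; apply: eq_bigr => k _; rewrite mxE mulrDr. Qed.
Lemma cdotDl x y v : cdot (x + y) v = cdot x v + cdot y v.
Proof. by rewrite /cdot -big_split; apply: eq_bigr => k _; rewrite mxE rmorphD mulrDl. Qed.
Lemma cdotZr c x y : cdot x (c *: y) = c * cdot x y.
Proof. by rewrite /cdot mulr_sumr; apply: eq_bigr => k _; rewrite mxE mulrCA. Qed.
Lemma cdotZl c x y : cdot (c *: x) y = conjc c * cdot x y.
Proof. by rewrite /cdot mulr_sumr; apply: eq_bigr => k _; rewrite mxE rmorphM mulrA. Qed.
Lemma cdotNr x y : cdot x (- y) = - cdot x y.
Proof. by rewrite -scaleN1r cdotZr mulN1r. Qed.
Lemma cdotBr x y v : cdot x (y - v) = cdot x y - cdot x v.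
Proof. by rewrite cdotDr cdotNr. Qed.
Lemma cdotC x y : cdot y x = conjc (cdot x y).
Proof. by rewrite /cdot rmorph_sum; apply: eq_bigr => k _; rewrite rmorphM /= conjcK mulrC. Qed.
Lemma cdot_norm2 x : cdot x x = ((norm2 x)%:C)%C.
Proof. by rewrite /cdot /norm2 rmorph_sum; apply: eq_bigr => k _; rewrite conjcM_norm. Qed.
Lemma cdot_ebasisl i y : cdot (ebasis i) y = y i 0.
Proof.
rewrite /cdot (bigD1 i) //= mxE !eqxx [conjc _]conjc1 mul1r big1 ?addr0 // => k ki.
by rewrite mxE (negbTE ki) [conjc _]conjc0 mul0r.
Qed.
Lemma cdot_ebasisr i x : cdot x (ebasis i) = conjc (x i 0).
Proof. by rewrite cdotC cdot_ebasisl. Qed.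
Lemma mulmx_ebasis A i j : (A *m ebasis j) i 0 = A i j.
Proof. by rewrite -colE mxE. Qed.
Lemma cdot_CS x y : cabs (cdot x y) ^+ 2 <= norm2 x * norm2 y.
Proof.
apply: (le_trans (y := (\sum_k cabs (x k 0) * cabs (y k 0)) ^+ 2)).
  have h0 : 0 <= \sum_k cabs (x k 0) * cabs (y k 0).
    by apply: sumr_ge0 => k _; rewrite mulr_ge0 ?cabs_ge0.
  rewrite ler_pXn2r ?nnegrE ?cabs_ge0 //.
  apply: le_trans (cabs_sum _ _ _) _.
  by apply: ler_sum => k _; rewrite cabsM cabs_conj.
exact: sum_mul_sqr_le.
Qed.
Lemma cdot_le x y (a b : R) : 0 <= a -> 0 <= b -> norm2 x <= a ^+ 2 -> norm2 y <= b ^+ 2 ->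
  cabs (cdot x y) <= a * b.
Proof.
move=> a0 b0 ha hb; rewrite -(@ler_pXn2r _ 2) ?nnegrE ?mulr_ge0 ?cabs_ge0 // exprMn.
by apply: le_trans (cdot_CS x y) _; apply: ler_pM => //; exact: norm2_ge0.
Qed.
Lemma cdot_adj A x y : cdot x (A *m y) = cdot (adj A *m x) y.
Proof.
rewrite /cdot; under eq_bigr => k _ do rewrite mxE mulr_sumr.
rewrite exchange_big; apply: eq_bigr => l _ /=.
rewrite mxE rmorph_sum mulr_suml; apply: eq_bigr => k _.
by rewrite !mxE rmorphM /= conjcK mulrA [conjc _ * _]mulrC.
Qed.
Lemma adjK A : adj (adj A) = A.
Proof. by apply/matrixP => i j; rewrite !mxE conjcK. Qed.
Lemma adj_herm H : hermitian H -> adj H = H.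
Proof. by move=> h; apply/matrixP => i j; rewrite !mxE -h. Qed.
Lemma adjM A B : adj (A *m B) = adj B *m adj A.
Proof. by rewrite /adj trmx_mul map_mxM. Qed.
Lemma adj1 : adj (1%:M) = 1%:M.
Proof. by rewrite /adj trmx1 map_mx1. Qed.
Lemma adjB A B : adj (A - B) = adj A - adj B.
Proof. by apply/matrixP => i j; rewrite !mxE rmorphB. Qed.
Lemma adj_scalar z : adj z%:M = (conjc z)%:M.
Proof. by rewrite /adj tr_scalar_mx map_scalar_mx. Qed.

Lemma im_cdot_herm H x : hermitian H -> ImC (cdot x (H *m x)) = 0.
Proof.
move=> hH; have : cdot x (H *m x) = conjc (cdot x (H *m x)).
  by rewrite -[RHS]cdotC [LHS]cdot_adj adj_herm.
by move/(congr1 ImC); rewrite cImJ => h; lra.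
Qed.

Lemma im_cdot_shift H z x : hermitian H ->
  ImC (cdot x ((H - z%:M) *m x)) = - ImC z * norm2 x.
Proof.
move=> hH; rewrite mulmxBl cdotBr cImD im_cdot_herm // add0r cImN.
by rewrite mul_scalar_mx cdotZr cdot_norm2 cImM cReRC cImRC mulr0 add0r mulNr.
Qed.

(** A kernel vector of [H - z] makes the form in [im_cdot_shift] vanish, hence has norm zero. The
    transpose appears because [kermx] collects row vectors. *)
Lemma shift_unit H z : hermitian H -> ImC z != 0 -> (H - z%:M) \in unitmx.
Proof.
move=> hH hz; rewrite -unitmx_tr -row_free_unit -kermx_eq0; apply/eqP.
apply/row_matrixP => i; rewrite row0.
set u := row i _.
have hu : u *m (H - z%:M)^T = 0 by apply/sub_kermxP; exact: row_sub.
pose x := u^T.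
have hx : (H - z%:M) *m x = 0 by rewrite /x -[H - _]trmxK -trmx_mul hu trmx0.
have := im_cdot_shift z x hH; rewrite hx.
have -> : cdot x 0 = 0 :> C by rewrite -(scale0r 0) cdotZr mul0r.
move=> /= /eqP; rewrite eq_sym mulf_eq0 oppr_eq0 (negbTE hz) /= => /eqP /norm2_eq0 h.
by rewrite -[u]trmxK -/x h trmx0.
Qed.

Lemma resolventK H z : hermitian H -> ImC z != 0 -> (H - z%:M) *m resolvent H z = 1%:M.
Proof. by move=> hH hz; rewrite mulmxV // shift_unit. Qed.
Lemma resolventVK H z : hermitian H -> ImC z != 0 -> resolvent H z *m (H - z%:M) = 1%:M.
Proof. by move=> hH hz; rewrite mulVmx // shift_unit. Qed.

Lemma adj_resolvent H z : hermitian H -> ImC z != 0 ->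
  adj (resolvent H z) = resolvent H (conjc z).
Proof.
move=> hH hz.
have h : adj (resolvent H z) *m (H - (conjc z)%:M) = 1%:M.
  by rewrite -[in H - _](adj_herm hH) -adj_scalar -adjB -adjM resolventK // adj1.
have hz' : ImC (conjc z) != 0 by rewrite cImJ oppr_eq0.
by rewrite -[LHS]mulmx1 -(resolventK hH hz') mulmxA h mul1mx.
Qed.

Lemma resolvent_identity H z w : hermitian H -> ImC z != 0 -> ImC w != 0 ->
  resolvent H z - resolvent H w = (z - w) *: (resolvent H z *m resolvent H w).
Proof.
move=> hH hz hw.
rewrite -[X in X - _]mulmx1 -(resolventK hH hw) -[X in _ - X]mul1mx -(resolventVK hH hz).
rewrite !mulmxA -mulmxBl -mulmxBr.
have -> : H - w%:M - (H - z%:M) = (z - w)%:M.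
  by rewrite opprB addrC addrA subrK raddfB.
by rewrite mul_mx_scalar -scalemxAl.
Qed.

Lemma resolvent_perturb H K z : hermitian H -> hermitian K -> ImC z != 0 ->
  resolvent H z - resolvent K z = - (resolvent K z *m (H - K) *m resolvent H z).
Proof.
move=> hH hK hz.
have -> : H - K = (H - z%:M) - (K - z%:M) by rewrite opprB addrA subrK.
by rewrite mulmxBr mulmxBl -mulmxA resolventK // mulmx1 resolventVK // mul1mx opprB.
Qed.

(** Apply [im_cdot_shift] to [G y]: since [(H - z) G y = y], the form becomes the conjugate of
    [<y, G y>]. *)
Lemma ward H z y : hermitian H -> ImC z != 0 ->
  ImC z * norm2 (resolvent H z *m y) = ImC (cdot y (resolvent H z *m y)).
Proof.
move=> hH hz; set G := resolvent H z.
have := im_cdot_shift z (G *m y) hH.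
by rewrite mulmxA resolventK // mul1mx cdotC cImJ mulNr => /oppr_inj ->.
Qed.

(** The adjoint is the resolvent at the conjugate point, where both sides of Ward's identity change
    sign. *)
Lemma ward_adj H z y : hermitian H -> ImC z != 0 ->
  norm2 (adj (resolvent H z) *m y) = norm2 (resolvent H z *m y).
Proof.
move=> hH hz; apply: (mulfI hz); rewrite ward // adj_resolvent //.
have hz' : ImC (conjc z) != 0 by rewrite cImJ oppr_eq0.
apply: oppr_inj; rewrite -mulNr -cImJ ward // -adj_resolvent //.
by rewrite cdot_adj adjK cdotC cImJ.
Qed.

(** Ward's identity and Cauchy-Schwarz bound [Im z * norm2 v] by [|y| |v|]; after squaring, one
    factor [norm2 v] is cancelled. *)
Lemma resolvent_norm H z y : hermitian H -> ImC z != 0 ->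
  ImC z ^+ 2 * norm2 (resolvent H z *m y) <= norm2 y.
Proof.
move=> hH hz; set v := resolvent H z *m y.
have [->|v0] := eqVneq (norm2 v) 0; first by rewrite mulr0 norm2_ge0.
have v1 : 0 < norm2 v by rewrite lt_def v0 norm2_ge0.
rewrite -(ler_pM2r v1).
have <- : (ImC z * norm2 v) ^+ 2 = ImC z ^+ 2 * norm2 v * norm2 v by ring.
rewrite ward //; apply: le_trans (cdot_CS y v).
rewrite -[_ ^+ 2]real_normK ?num_real // ler_pXn2r ?nnegrE ?normr_ge0 ?cabs_ge0 //.
exact: cabs_im.
Qed.

(** Rows of [G] are conjugated columns of its adjoint, so [ward_adj] gives the row sum the same
    value as the column sum in [sum_col_sqr]. *)
Lemma sum_row_sqr H z x : hermitian H -> ImC z != 0 ->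
  \sum_j cabs (cdot x (resolvent H z *m ebasis j)) ^+ 2 = norm2 (resolvent H z *m x).
Proof.
move=> hH hz; rewrite -ward_adj //; apply: eq_bigr => j _.
by rewrite cdot_adj cdot_ebasisr cabs_conj.
Qed.

Lemma sum_col_sqr H z x :
  \sum_j cabs (cdot (ebasis j) (resolvent H z *m x)) ^+ 2 = norm2 (resolvent H z *m x).
Proof. by apply: eq_bigr => j _; rewrite cdot_ebasisl. Qed.

End LinearAlgebra.

(** * Random variables with all moments *)

Section Moments.
Context {R : realType} d (T : measurableType d) (P : probability T R).
Implicit Types f g : T -> R.

(** Finite moments of every order form an algebra, so any polynomial in the entries and in bounded
    statistics is integrable without further checks. *)
Definition Linf f : Prop := measurable_fun setT f /\
  forall k : nat, P.-integrable setT (EFin \o (fun t => `|f t| ^+ k)).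

Definition Ex f : R := Rintegral P setT f.

Lemma integrable_dom f g : measurable_fun setT f -> (forall t, `|f t| <= g t) ->
  P.-integrable setT (EFin \o g) -> P.-integrable setT (EFin \o f).
Proof.
move=> mf fg; apply: le_integrable => //; first exact/measurable_EFinP.
move=> t _ /=; rewrite lee_fin; apply: le_trans (fg t) _; exact: ler_norm.
Qed.

Lemma Linf_integrable f : Linf f -> P.-integrable setT (EFin \o f).
Proof.
move=> [mf /(_ 1%N)]; apply: integrable_dom => // t; rewrite expr1 //.
Qed.

Lemma Linf_dom f g : measurable_fun setT f -> Linf g -> (forall t, `|f t| <= `|g t|) -> Linf f.
Proof.
move=> mf [mg ig] fg; split => // k; apply: integrable_dom (ig k).
  by apply: measurable_funX; exact: measurableT_comp.
by move=> t; rewrite normrX normr_id lerXn2r // nnegrE.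
Qed.

Lemma Linf_cst c : Linf (fun=> c).
Proof.
split; first exact: measurable_cst.
by move=> k; exact: finite_measure_integrable_cst.
Qed.

Lemma Linf_bounded f c : measurable_fun setT f -> (forall t, `|f t| <= c) -> Linf f.
Proof.
move=> mf h; apply: (Linf_dom mf (Linf_cst c)) => t.
by apply: le_trans (h t) _; exact: ler_norm.
Qed.

Lemma LinfM f g : Linf f -> Linf g -> Linf (fun t => f t * g t).
Proof.
move=> [mf hf] [mg hg]; split; first exact: measurable_funM.
(* The dominating function comes from [a * b <= a ^+ 2 + b ^+ 2] with [a], [b] the [k]-th powers. *)
move=> k; apply: (@integrable_dom _ (fun t => `|f t| ^+ (k * 2) + `|g t| ^+ (k * 2))).
- by apply: measurable_funX; apply: measurableT_comp => //; exact: measurable_funM.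
- move=> t; rewrite normrX normr_id normrM exprMn !exprM.
  have h0 := sqr_ge0 (`|f t| ^+ k - `|g t| ^+ k).
  have h1 : 0 <= `|f t| ^+ k * `|g t| ^+ k by rewrite mulr_ge0 ?exprn_ge0.
  move: h0 h1; move: (`|f t| ^+ k) (`|g t| ^+ k) => a b h0 h1; nra.
- have := integrableD measurableT (hf (k * 2)%N) (hg (k * 2)%N).
  by apply: eq_integrable.
Qed.

Lemma exprD_le (a b : R) k : 0 <= a -> 0 <= b -> (a + b) ^+ k <= 2 ^+ k * (a ^+ k + b ^+ k).
Proof.
move=> a0 b0; wlog ab : a b a0 b0 / a <= b.
  by move=> h; case: (leP a b) => ab; [exact: h|rewrite addrC [a ^+ k + _]addrC; apply: h => //; exact: ltW].
apply: (@le_trans _ _ ((2 * b) ^+ k)); first by rewrite lerXn2r ?nnegrE; lra.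
by rewrite exprMn ler_pM2l ?exprn_gt0 // lerDr exprn_ge0.
Qed.

Lemma LinfD f g : Linf f -> Linf g -> Linf (fun t => f t + g t).
Proof.
move=> [mf hf] [mg hg]; split; first exact: measurable_funD.
move=> k; apply: (@integrable_dom _ (fun t => 2 ^+ k * (`|f t| ^+ k + `|g t| ^+ k))).
- by apply: measurable_funX; apply: measurableT_comp => //; exact: measurable_funD.
- move=> t; rewrite normrX normr_id; apply: le_trans (exprD_le k (normr_ge0 _) (normr_ge0 _)).
  by rewrite lerXn2r ?nnegrE ?addr_ge0 // ler_normD.
- have := integrableZl (measurableT) (2 ^+ k) (integrableD measurableT (hf k) (hg k)).
  by apply: eq_integrable.
Qed.

Lemma LinfN f : Linf f -> Linf (fun t => - f t).
Proof.
move=> hf; apply: (Linf_dom _ hf) => [|t]; last by rewrite normrN.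
by apply: measurableT_comp => //; exact: hf.1.
Qed.
Lemma LinfB f g : Linf f -> Linf g -> Linf (fun t => f t - g t).
Proof. by move=> hf hg; apply: LinfD => //; exact: LinfN. Qed.
Lemma Linf_norm f : Linf f -> Linf (fun t => `|f t|).
Proof.
move=> hf; apply: (Linf_dom _ hf) => [|t]; last by rewrite normr_id.
by apply: measurableT_comp => //; exact: hf.1.
Qed.
Lemma LinfX f k : Linf f -> Linf (fun t => f t ^+ k).
Proof.
move=> hf; elim: k => [|k IH].
  by rewrite (_ : (fun t => _) = fun=> 1); [exact: Linf_cst|apply/funext => t].
by rewrite (_ : (fun t => _) = fun t => f t * f t ^+ k); [exact: LinfM|apply/funext => t; rewrite exprS].
Qed.
Lemma Linf_sum (I : Type) (r : seq I) (Q : pred I) (F : I -> T -> R) :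
  (forall i, Linf (F i)) -> Linf (fun t => \sum_(i <- r | Q i) F i t).
Proof.
move=> h; elim: r => [|i r IH].
  by rewrite (_ : (fun t => _) = fun=> 0); [exact: Linf_cst|apply/funext => t; rewrite big_nil].
case: (boolP (Q i)) => Qi.
  rewrite (_ : (fun t => _) = fun t => F i t + \sum_(j <- r | Q j) F j t); first exact: LinfD.
  by apply/funext => t; rewrite big_cons Qi.
by rewrite (_ : (fun t => _) = fun t => \sum_(j <- r | Q j) F j t) //; apply/funext => t; rewrite big_cons (negbTE Qi).
Qed.
Lemma LinfZ c f : Linf f -> Linf (fun t => c * f t).
Proof. by move=> h; apply: LinfM => //; exact: Linf_cst. Qed.

Lemma ExD f g : Linf f -> Linf g -> Ex (fun t => f t + g t) = Ex f + Ex g.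
Proof. by move=> hf hg; rewrite /Ex RintegralD //; exact: Linf_integrable. Qed.
Lemma ExB f g : Linf f -> Linf g -> Ex (fun t => f t - g t) = Ex f - Ex g.
Proof. by move=> hf hg; rewrite /Ex RintegralB //; exact: Linf_integrable. Qed.
Lemma ExZ c f : Linf f -> Ex (fun t => c * f t) = c * Ex f.
Proof. by move=> hf; rewrite /Ex RintegralZl //; exact: Linf_integrable. Qed.
Lemma Ex_cst c : Ex (fun=> c) = c.
Proof. rewrite /Ex Rintegral_cst // (_ : fine _ = 1) ?mulr1 //.
by rewrite -[RHS]/(fine 1%E); congr fine; exact: probability_setT. Qed.
Lemma Ex_le f g : Linf f -> Linf g -> (forall t, f t <= g t) -> Ex f <= Ex g.
Proof. by move=> hf hg h; apply: le_Rintegral => //; exact: Linf_integrable. Qed.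
Lemma Ex_ge0 f : (forall t, 0 <= f t) -> 0 <= Ex f.
Proof. by move=> h; apply: Rintegral_ge0 => t _; exact: h. Qed.
Lemma Ex_sum (I : Type) (r : seq I) (Q : pred I) (F : I -> T -> R) :
  (forall i, Linf (F i)) ->
  Ex (fun t => \sum_(i <- r | Q i) F i t) = \sum_(i <- r | Q i) Ex (F i).
Proof.
move=> h; elim: r => [|i r IH].
  rewrite big_nil -[RHS](Ex_cst 0); congr Ex; apply/funext => t; by rewrite big_nil.
rewrite big_cons -IH; case: ifP => Qi.
  rewrite -ExD //; last exact: Linf_sum.
  by congr Ex; apply/funext => t; rewrite big_cons Qi.
by congr Ex; apply/funext => t; rewrite big_cons Qi.
Qed.
Lemma EFin_Ex f : Linf f -> ((Ex f)%:E = \int[P]_t (f t)%:E)%E.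
Proof.
by move=> hf; rewrite /Ex /Rintegral fineK //; apply: integrable_fin_num => //; exact: Linf_integrable.
Qed.

Definition bool_fun (b : T -> bool) : T -> R := fun t => (b t)%:R.
Lemma bool_fun_indic (b : T -> bool) : bool_fun b = \1_[set t | b t].
Proof.
apply/funext => t; rewrite /bool_fun indicE; congr (_%:R); apply/esym.
by case: (boolP (b t)) => h; [congr nat_of_bool; apply/mem_set|congr nat_of_bool; apply/negbTE; rewrite notin_setE; apply/negP].
Qed.
Lemma Linf_bool (b : T -> bool) : measurable [set t | b t] -> Linf (bool_fun b).
Proof.
move=> mb; apply: (@Linf_bounded _ 1); last by move=> t; rewrite /bool_fun; case: (b t); rewrite ?normr1 ?normr0.
by rewrite bool_fun_indic; exact: measurable_indic.
Qed.
Lemma Ex_bool (b : T -> bool) : measurable [set t | b t] -> ((Ex (bool_fun b))%:E = P [set t | b t])%E.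
Proof.
move=> mb; rewrite EFin_Ex; last exact: Linf_bool.
by rewrite bool_fun_indic integral_indic // setIT.
Qed.


(** Markov's inequality: the indicator of [b] is at most [f / c]. *)
Lemma Ex_markov f (c : R) (b : T -> bool) : Linf f -> 0 < c -> (forall t, 0 <= f t) ->
  measurable [set t | b t] -> (forall t, b t -> c <= f t) ->
  (P [set t | b t] <= (c^-1 * Ex f)%:E)%E.
Proof.
move=> hf c0 f0 mb h; rewrite -Ex_bool // lee_fin -ExZ //.
apply: Ex_le; [exact: Linf_bool|exact: LinfZ|move=> t].
rewrite /bool_fun; case: (boolP (b t)) => bt; last by rewrite mulr_ge0 // invr_ge0 ltW.
by rewrite -(ler_pM2l c0) mulr1 mulrA mulfV ?mul1r ?h // gt_eqF.
Qed.

Implicit Types F G : T -> R[i].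

Definition cmeas F : Prop := measurable_fun setT (fun t => ReC (F t)) /\ measurable_fun setT (fun t => ImC (F t)).
Definition cLinf F : Prop := Linf (fun t => ReC (F t)) /\ Linf (fun t => ImC (F t)).
Definition Ec F : R[i] := (Ex (fun t => ReC (F t)) +i* Ex (fun t => ImC (F t)))%C.

Lemma Linf_ext f g : (forall t, f t = g t) -> Linf g -> Linf f.
Proof. by move=> /funext ->. Qed.
Lemma Ex_ext f g : (forall t, f t = g t) -> Ex f = Ex g.
Proof. by move=> /funext ->. Qed.
Lemma Ec_ext F G : (forall t, F t = G t) -> Ec F = Ec G.
Proof. by move=> /funext ->. Qed.

Lemma measurable_cabs F : cmeas F -> measurable_fun setT (fun t => cabs (F t)).
Proof.
move=> [h1 h2].
rewrite (_ : (fun t => _) = (@powR R ^~ 2^-1) \o (fun t => ReC (F t) ^+ 2 + ImC (F t) ^+ 2)).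
  apply: measurableT_comp; first exact: measurable_powR.
  by apply: measurable_funD; apply: measurable_funX.
apply/funext => t /=; rewrite powR12_sqrt ?addr_ge0 ?sqr_ge0 // -cabs_sqr.
by rewrite sqrtr_sqr ger0_norm ?cabs_ge0.
Qed.

Lemma cLinf_meas F : cLinf F -> cmeas F.
Proof. by move=> [[h1 _] [h2 _]]. Qed.

Lemma Linf_cabs F : cLinf F -> Linf (fun t => cabs (F t)).
Proof.
move=> hF; apply: (@Linf_dom _ (fun t => `|ReC (F t)| + `|ImC (F t)|)).
- by apply: measurable_cabs; exact: cLinf_meas.
- by apply: LinfD; apply: Linf_norm; [exact: hF.1|exact: hF.2].
- move=> t; rewrite [leLHS]ger0_norm ?cabs_ge0 // [leRHS]ger0_norm ?addr_ge0 //.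
  exact: cabs_le_reim.
Qed.

Lemma cLinf_dom F g : cmeas F -> Linf g -> (forall t, cabs (F t) <= g t) -> cLinf F.
Proof.
move=> mF hg h; split; apply: (Linf_dom _ hg) => [|t]; rewrite ?mF.1 ?mF.2 //.
- exact: mF.1.
- by apply: le_trans (cabs_re _) _; apply: le_trans (h t) _; exact: ler_norm.
- exact: mF.2.
- by apply: le_trans (cabs_im _) _; apply: le_trans (h t) _; exact: ler_norm.
Qed.

Lemma cLinfD F G : cLinf F -> cLinf G -> cLinf (fun t => F t + G t).
Proof.
move=> [h1 h2] [h3 h4]; split; [apply: Linf_ext (LinfD h1 h3)|apply: Linf_ext (LinfD h2 h4)] => t;
 [exact: cReD|exact: cImD].
Qed.
Lemma cLinfM F G : cLinf F -> cLinf G -> cLinf (fun t => F t * G t).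
Proof.
move=> [h1 h2] [h3 h4]; split.
  by apply: Linf_ext (LinfB (LinfM h1 h3) (LinfM h2 h4)) => t; exact: cReM.
by apply: Linf_ext (LinfD (LinfM h1 h4) (LinfM h2 h3)) => t; exact: cImM.
Qed.
Lemma cLinfN F : cLinf F -> cLinf (fun t => - F t).
Proof.
move=> [h1 h2]; split; [apply: Linf_ext (LinfN h1)|apply: Linf_ext (LinfN h2)] => t;
 [exact: cReN|exact: cImN].
Qed.
Lemma cLinfB F G : cLinf F -> cLinf G -> cLinf (fun t => F t - G t).
Proof. by move=> hF hG; apply: cLinfD => //; exact: cLinfN. Qed.
Lemma cLinfJ F : cLinf F -> cLinf (fun t => conjc (F t)).
Proof.
move=> [h1 h2]; split; [apply: Linf_ext h1|apply: Linf_ext (LinfN h2)] => t;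
 [exact: cReJ|exact: cImJ].
Qed.
Lemma cLinf_cst c : cLinf (fun=> c).
Proof. by split; exact: Linf_cst. Qed.
Lemma cLinf_sum (I : Type) (r : seq I) (Q : pred I) (F : I -> T -> R[i]) :
  (forall i, cLinf (F i)) -> cLinf (fun t => \sum_(i <- r | Q i) F i t).
Proof.
move=> h; split.
  by apply: Linf_ext (Linf_sum r Q (fun i => (h i).1)) => t; exact: cRe_sum.
by apply: Linf_ext (Linf_sum r Q (fun i => (h i).2)) => t; exact: cIm_sum.
Qed.

Lemma EcD F G : cLinf F -> cLinf G -> Ec (fun t => F t + G t) = Ec F + Ec G.
Proof.
move=> [h1 h2] [h3 h4]; rewrite /Ec; congr (_ +i* _)%C; rewrite -ExD //;
 apply: Ex_ext => t; [exact: cReD|exact: cImD].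
Qed.
Lemma EcZ c F : cLinf F -> Ec (fun t => c * F t) = c * Ec F.
Proof.
move=> [h1 h2]; rewrite /Ec; apply: complex_ext; rewrite ?cReM ?cImM /= -!ExZ // -?ExD -?ExB;
 try exact: LinfZ; apply: Ex_ext => t; [exact: cReM|exact: cImM].
Qed.
Lemma EcN F : cLinf F -> Ec (fun t => - F t) = - Ec F.
Proof. by move=> h; rewrite -mulN1r -EcZ //; apply: Ec_ext => t; rewrite mulN1r. Qed.
Lemma EcB F G : cLinf F -> cLinf G -> Ec (fun t => F t - G t) = Ec F - Ec G.
Proof. by move=> h1 h2; rewrite EcD ?EcN //; exact: cLinfN. Qed.
Lemma Ec_sum (I : Type) (r : seq I) (Q : pred I) (F : I -> T -> R[i]) :
  (forall i, cLinf (F i)) ->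
  Ec (fun t => \sum_(i <- r | Q i) F i t) = \sum_(i <- r | Q i) Ec (F i).
Proof.
move=> h; apply: complex_ext; rewrite ?cRe_sum ?cIm_sum /= -Ex_sum; try by [move=> i; exact: (h i).1|move=> i; exact: (h i).2];
 apply: Ex_ext => t; [exact: cRe_sum|exact: cIm_sum].
Qed.
Lemma Ec_real f : Linf f -> Ec (fun t => ((f t)%:C)%C) = ((Ex f)%:C)%C.
Proof. by move=> h; rewrite /Ec /= Ex_cst. Qed.

(* Multiplying by the conjugate of [Ec F] makes the expectation real and nonnegative. *)
Lemma cabs_Ec F : cLinf F -> cabs (Ec F) <= Ex (fun t => cabs (F t)).
Proof.
move=> hF; have hn := Linf_cabs hF.
have [->|n0] := eqVneq (Ec F) 0; first by rewrite cabs0; apply: Ex_ge0 => t; exact: cabs_ge0.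
have c0 : 0 < cabs (Ec F) by rewrite cabs_gt0.
rewrite -(ler_pM2l c0) -expr2 -ExZ //.
have -> : cabs (Ec F) ^+ 2 = ReC (Ec (fun t => conjc (Ec F) * F t)).
  by rewrite EcZ // conjcM_norm.
have hL : cLinf (fun t => conjc (Ec F) * F t) by apply: cLinfM => //; exact: cLinf_cst.
apply: Ex_le; [exact: hL.1|exact: LinfZ|move=> t].
by apply: le_trans (re_le_cabs _) _; rewrite cabsM cabs_conj.
Qed.

End Moments.

(** * Measurability of resolvent entries; bounded spectral statistics *)

Section MatrixMeasurability.
Context {R : realType}.

Section cmeas.
Context d (T : measurableType d).
Implicit Types F G : T -> R[i].

Lemma cmeas_ext F G : (forall t, F t = G t) -> cmeas G -> cmeas F.
Proof. by move=> /funext ->. Qed.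
Lemma cmeas_cst (c : R[i]) : cmeas (fun _ : T => c).
Proof. by split; exact: measurable_cst. Qed.
Lemma cmeasD F G : cmeas F -> cmeas G -> cmeas (fun t => F t + G t).
Proof.
move=> [a b] [a' b']; split.
  rewrite (_ : (fun t => _) = fun t => ReC (F t) + ReC (G t)); first exact: measurable_funD.
  by apply/funext => t; exact: cReD.
rewrite (_ : (fun t => _) = fun t => ImC (F t) + ImC (G t)); first exact: measurable_funD.
by apply/funext => t; exact: cImD.
Qed.
Lemma cmeasM F G : cmeas F -> cmeas G -> cmeas (fun t => F t * G t).
Proof.
move=> [a b] [a' b']; split.
  rewrite (_ : (fun t => _) = fun t => ReC (F t) * ReC (G t) - ImC (F t) * ImC (G t)).
    by apply: measurable_funB; exact: measurable_funM.
  by apply/funext => t; exact: cReM.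
rewrite (_ : (fun t => _) = fun t => ReC (F t) * ImC (G t) + ImC (F t) * ReC (G t)).
  by apply: measurable_funD; exact: measurable_funM.
by apply/funext => t; exact: cImM.
Qed.
Lemma cmeasJ F : cmeas F -> cmeas (fun t => conjc (F t)).
Proof.
move=> [a b]; split.
  by rewrite (_ : (fun t => _) = fun t => ReC (F t)) //; apply/funext => t; exact: cReJ.
rewrite (_ : (fun t => _) = fun t => - ImC (F t)); first exact: measurable_funN.
by apply/funext => t; exact: cImJ.
Qed.
Lemma cmeas_real (f : T -> R) : measurable_fun setT f -> cmeas (fun t => ((f t)%:C)%C).
Proof. by move=> h; split => //; exact: measurable_cst. Qed.
Lemma cmeas_sum (I : Type) (r : seq I) (Q : pred I) (F : I -> T -> R[i]) :
  (forall i, cmeas (F i)) -> cmeas (fun t => \sum_(i <- r | Q i) F i t).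
Proof.
move=> h; elim: r => [|i r IH].
  by apply: (@cmeas_ext _ (fun=> 0)) => [t|]; [rewrite big_nil|exact: cmeas_cst].
case: (boolP (Q i)) => Qi.
  by apply: (cmeas_ext _ (cmeasD (h i) IH)) => t; rewrite big_cons Qi.
by apply: (cmeas_ext _ IH) => t; rewrite big_cons (negbTE Qi).
Qed.
Lemma cmeas_prod (I : Type) (r : seq I) (Q : pred I) (F : I -> T -> R[i]) :
  (forall i, cmeas (F i)) -> cmeas (fun t => \prod_(i <- r | Q i) F i t).
Proof.
move=> h; elim: r => [|i r IH].
  by apply: (@cmeas_ext _ (fun=> 1)) => [t|]; [rewrite big_nil|exact: cmeas_cst].
case: (boolP (Q i)) => Qi.
  by apply: (cmeas_ext _ (cmeasM (h i) IH)) => t; rewrite big_cons Qi.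
by apply: (cmeas_ext _ IH) => t; rewrite big_cons (negbTE Qi).
Qed.
(** The inverse is the conjugate divided by the squared modulus; at 0 both sides vanish by the
    convention for inverses. *)
Lemma cmeasV F : cmeas F -> cmeas (fun t => (F t)^-1).
Proof.
move=> h; apply: (@cmeas_ext _ (fun t => conjc (F t) * ((((@powR R ^~ (-1)) (cabs (F t) ^+ 2))%:C)%C))).
  move=> t; rewrite powR_inv1 ?sqr_ge0 //.
  have [->|n0] := eqVneq (F t) 0; first by rewrite invr0 conjc0 mul0r.
  apply: (mulIf n0); rewrite mulVf // mulrAC conjcM_norm -rmorphM mulfV //.
  by rewrite expf_neq0 // cabs_eq0.
apply: cmeasM; first exact: cmeasJ.
apply: cmeas_real; apply: (measurableT_comp (measurable_powR (-1))).
by apply: measurable_funX; exact: measurable_cabs.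
Qed.

Definition mmat N (M : T -> 'M[R[i]]_N) := forall i j, cmeas (fun t => M t i j).

Lemma cmeas_det N (M : T -> 'M[R[i]]_N) : mmat M -> cmeas (fun t => \det (M t)).
Proof.
move=> h; apply: cmeas_sum => s; apply: cmeasM; first exact: cmeas_cst.
by apply: cmeas_prod => i; exact: h.
Qed.

Lemma cmeas_adjugate N (M : T -> 'M[R[i]]_N) i j : mmat M -> cmeas (fun t => \adj (M t) i j).
Proof.
move=> h; apply: (@cmeas_ext _ (fun t => cofactor (M t) j i)) => [t|]; first by rewrite mxE.
apply: cmeasM; first exact: cmeas_cst.
by apply: cmeas_det => k l; apply: (cmeas_ext _ (h (lift j k) (lift i l))) => t; rewrite !mxE.
Qed.

(** Cramer's rule: each entry is a cofactor, polynomial in the matrix, divided by the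
    determinant. *)
Lemma cmeas_resolvent N (M : T -> 'M[R[i]]_N) (z : R[i]) i j : ImC z != 0 ->
  (forall t, hermitian (M t)) -> mmat M -> cmeas (fun t => resolvent (M t) z i j).
Proof.
move=> hz hM h.
have h' : mmat (fun t => M t - z%:M).
  move=> k l; apply: (@cmeas_ext _ (fun t => M t k l + (- ((z%:M : 'M[R[i]]_N) k l)))) => [t|]; first by rewrite !mxE.
  by apply: cmeasD => //; exact: cmeas_cst.
apply: (@cmeas_ext _ (fun t => (\det (M t - z%:M))^-1 * (\adj (M t - z%:M)) i j)) => [t|].
  by rewrite /resolvent /invmx shift_unit // mxE.
by apply: cmeasM; [apply: cmeasV; exact: cmeas_det|exact: cmeas_adjugate].
Qed.
End cmeas.

Section admissible.
Variable N : nat.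
Notation Mat := 'M[R[i]]_N.
Implicit Types (f g : Mat -> R) (F G : Mat -> R[i]) (b : Mat -> bool).

(* Bounded measurable statistics of a Hermitian matrix; measurability is required on every
   measurable space, so that it can be used both on the probability space and on a
   sub-sigma-algebra. *)
Definition adm F : Prop :=
  (forall d (T : measurableType d) (M : T -> Mat), (forall t, hermitian (M t)) -> mmat M ->
     cmeas (fun t => F (M t))) /\
  (exists c : R, forall H, hermitian H -> cabs (F H) <= c).
Definition admR f : Prop :=
  (forall d (T : measurableType d) (M : T -> Mat), (forall t, hermitian (M t)) -> mmat M ->
     measurable_fun setT (fun t => f (M t))) /\
  (exists c : R, forall H, hermitian H -> `|f H| <= c).
Definition admb b : Prop :=
  forall d (T : measurableType d) (M : T -> Mat), (forall t, hermitian (M t)) -> mmat M ->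
     measurable [set t | b (M t)].

Lemma adm_ext F G : (forall H, F H = G H) -> adm G -> adm F.
Proof. by move=> /funext ->. Qed.
Lemma adm_cst c : adm (fun=> c).
Proof. by split => [d T M _ _|]; [exact: cmeas_cst|exists (cabs c)]. Qed.
Lemma admD F G : adm F -> adm G -> adm (fun H => F H + G H).
Proof.
move=> [h1 [c1 k1]] [h2 [c2 k2]]; split => [d T M hM mM|].
  by apply: cmeasD; [exact: h1|exact: h2].
exists (c1 + c2) => H hH; apply: le_trans (cabsD _ _) _; apply: lerD; [exact: k1|exact: k2].
Qed.
Lemma admM F G : adm F -> adm G -> adm (fun H => F H * G H).
Proof.
move=> [h1 [c1 k1]] [h2 [c2 k2]]; split => [d T M hM mM|].
  by apply: cmeasM; [exact: h1|exact: h2].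
exists (c1 * c2) => H hH; rewrite cabsM; apply: ler_pM; rewrite ?cabs_ge0 //; [exact: k1|exact: k2].
Qed.
Lemma admN F : adm F -> adm (fun H => - F H).
Proof.
move=> h; apply: (@adm_ext _ (fun H => (-1) * F H)) => [H|]; first by rewrite mulN1r.
by apply: admM => //; exact: adm_cst.
Qed.
Lemma admB F G : adm F -> adm G -> adm (fun H => F H - G H).
Proof. by move=> h1 h2; apply: admD => //; exact: admN. Qed.
Lemma admZ c F : adm F -> adm (fun H => c * F H).
Proof. by move=> h; apply: admM => //; exact: adm_cst. Qed.
Lemma admJ F : adm F -> adm (fun H => conjc (F H)).
Proof.
move=> [h1 [c1 k1]]; split => [d T M hM mM|]; first by apply: cmeasJ; exact: h1.
by exists c1 => H hH; rewrite cabs_conj; exact: k1.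
Qed.
Lemma adm_sum (I : Type) (r : seq I) (Q : pred I) (F : I -> Mat -> R[i]) :
  (forall i, adm (F i)) -> adm (fun H => \sum_(i <- r | Q i) F i H).
Proof.
move=> h; elim: r => [|i r IH].
  by apply: (@adm_ext _ (fun=> 0)) => [t|]; [rewrite big_nil|exact: adm_cst].
case: (boolP (Q i)) => Qi.
  by apply: (adm_ext _ (admD (h i) IH)) => t; rewrite big_cons Qi.
by apply: (adm_ext _ IH) => t; rewrite big_cons (negbTE Qi).
Qed.
Lemma admX F k : adm F -> adm (fun H => F H ^+ k).
Proof.
move=> h; elim: k => [|k IH]; first by apply: (@adm_ext _ (fun=> 1)) => //; exact: adm_cst.
by apply: (adm_ext _ (admM h IH)) => H; rewrite exprS.
Qed.
Lemma adm_bilin z (x y : 'cV[R[i]]_N) : ImC z != 0 -> adm (fun H => cdot x (resolvent H z *m y)).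
Proof.
move=> hz; split => [d T M hM mM|].
  apply: cmeas_sum => k; apply: cmeasM; first exact: cmeas_cst.
  apply: (@cmeas_ext _ _ _ (fun t => \sum_j resolvent (M t) z k j * y j 0)) => [t|]; first by rewrite mxE.
  by apply: cmeas_sum => j; apply: cmeasM; [exact: cmeas_resolvent|exact: cmeas_cst].
have s0 : 0 < ImC z ^+ 2 by rewrite exprn_even_gt0.
exists (Num.sqrt (norm2 x) * Num.sqrt (norm2 y / ImC z ^+ 2)) => H hH.
apply: cdot_le; rewrite ?sqrtr_ge0 // sqr_sqrtr ?divr_ge0 ?norm2_ge0 ?sqr_ge0 //.
by rewrite ler_pdivlMr // mulrC; exact: resolvent_norm.
Qed.

Lemma admR_ext f g : (forall H, f H = g H) -> admR g -> admR f.
Proof. by move=> /funext ->. Qed.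
Lemma admR_cst c : admR (fun=> c).
Proof. by split => [d T M _ _|]; [exact: measurable_cst|exists `|c|]. Qed.
Lemma admRD f g : admR f -> admR g -> admR (fun H => f H + g H).
Proof.
move=> [h1 [c1 k1]] [h2 [c2 k2]]; split => [d T M hM mM|].
  by apply: measurable_funD; [exact: h1|exact: h2].
exists (c1 + c2) => H hH; apply: le_trans (ler_normD _ _) _; apply: lerD; [exact: k1|exact: k2].
Qed.
Lemma admRM f g : admR f -> admR g -> admR (fun H => f H * g H).
Proof.
move=> [h1 [c1 k1]] [h2 [c2 k2]]; split => [d T M hM mM|].
  by apply: measurable_funM; [exact: h1|exact: h2].
exists (c1 * c2) => H hH; rewrite normrM; apply: ler_pM; rewrite ?normr_ge0 //; [exact: k1|exact: k2].
Qed.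
Lemma admRX f k : admR f -> admR (fun H => f H ^+ k).
Proof.
move=> h; elim: k => [|k IH]; first by apply: (@admR_ext _ (fun=> 1)) => //; exact: admR_cst.
by apply: (admR_ext _ (admRM h IH)) => H; rewrite exprS.
Qed.
Lemma admR_sum (I : Type) (r : seq I) (Q : pred I) (F : I -> Mat -> R) :
  (forall i, admR (F i)) -> admR (fun H => \sum_(i <- r | Q i) F i H).
Proof.
move=> h; elim: r => [|i r IH].
  by apply: (@admR_ext _ (fun=> 0)) => [t|]; [rewrite big_nil|exact: admR_cst].
case: (boolP (Q i)) => Qi.
  by apply: (admR_ext _ (admRD (h i) IH)) => t; rewrite big_cons Qi.
by apply: (admR_ext _ IH) => t; rewrite big_cons (negbTE Qi).
Qed.
Lemma admR_cabs F : adm F -> admR (fun H => cabs (F H)).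
Proof.
move=> [h1 [c1 k1]]; split => [d T M hM mM|]; first by apply: measurable_cabs; exact: h1.
by exists c1 => H hH; rewrite ger0_norm ?cabs_ge0 //; exact: k1.
Qed.

Lemma admb_le f g : admR f -> admR g -> admb (fun H => f H <= g H).
Proof.
move=> [h1 _] [h2 _] d T M hM mM.
have := measurable_fun_ler (h1 _ _ _ hM mM) (h2 _ _ _ hM mM).
move=> /(_ measurableT [set true]); rewrite setTI => /(_ I).
by congr measurable; apply/seteqP; split => t /=; case: (_ <= _).
Qed.
Lemma admb_and b1 b2 : admb b1 -> admb b2 -> admb (fun H => b1 H && b2 H).
Proof.
move=> h1 h2 d T M hM mM.
rewrite (_ : [set t | _] = [set t | b1 (M t)] `&` [set t | b2 (M t)]).
  by apply: measurableI; [exact: h1|exact: h2].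
by apply/seteqP; split => t /=; [move/andP|move=> h; apply/andP].
Qed.
Lemma admb_forall (I : finType) (B : I -> Mat -> bool) :
  (forall i, admb (B i)) -> admb (fun H => [forall i, B i H]).
Proof.
move=> h d T M hM mM.
rewrite (_ : [set t | _] = \bigcap_(i in [set: I]) [set t | B i (M t)]).
  by apply: fin_bigcap_measurable => // i _; exact: h.
apply/seteqP; split => t /=; first by move=> /forallP h' i _; exact: h'.
by move=> h'; apply/forallP => i; exact: h'.
Qed.
Lemma admR_bool b : admb b -> admR (fun H => (b H)%:R).
Proof.
move=> hb; split => [d T M hM mM|].
  rewrite (_ : (fun t => _) = \1_[set t | b (M t)]); first by apply: measurable_indic; exact: hb.
  exact: bool_fun_indic.
by exists 1 => H _; case: (b H); rewrite ?normr1 ?normr0.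
Qed.
Lemma admR_if b f g : admb b -> admR f -> admR g -> admR (fun H => if b H then f H else g H).
Proof.
move=> hb hf hg; apply: (@admR_ext _ (fun H => (b H)%:R * f H + (1 + (-1) * (b H)%:R) * g H)).
  by move=> H; case: (b H); rewrite /= ?mulr1 ?mulr0 ?subrr ?mul0r ?addr0 ?mul1r ?add0r.
apply: admRD; apply: admRM => //; first exact: admR_bool.
by apply: admRD; [exact: admR_cst|apply: admRM; [exact: admR_cst|exact: admR_bool]].
Qed.
Lemma admb_not b : admb b -> admb (fun H => ~~ b H).
Proof.
move=> hb d T M hM mM.
rewrite (_ : [set t | _] = ~` [set t | b (M t)]); first by apply: measurableC; exact: hb.
by apply/seteqP; split => t /=; move/negP.
Qed.

(** Both mirror positions are cleared, so that the matrix stays Hermitian and depends only on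
    entries independent of [H i j]. *)
Definition zer (i j : 'I_N) (H : Mat) : Mat :=
  \matrix_(k, l) (if ((k == i) && (l == j)) || ((k == j) && (l == i)) then 0 else H k l).

Lemma zer_herm i j H : hermitian H -> hermitian (zer i j H).
Proof.
move=> hH k l; rewrite !mxE orbC.
rewrite [(l == j) && _]andbC [(l == i) && _]andbC; case: ifP => _; by rewrite ?conjc0 // hH.
Qed.

End admissible.
End MatrixMeasurability.

(** * From independence of events to factorisation of expectations *)

Section Independence.
Context {R : realType} d (T : measurableType d) (P : probability T R).
Context d1 (T1 : measurableType d1) (X : T -> T1) (G : set (set T)).
Hypothesis mX : measurable_fun setT X.
Hypothesis mG : G `<=` measurable.
Hypothesis IG : setI_closed G.
Hypothesis GT : G setT.
Hypothesis indG : forall A B, measurable A -> G B ->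
  P (X @^-1` A `&` B) = (P (X @^-1` A) * P B)%E.

Let T2 := g_sigma_algebraType G.

Lemma g_sigma_sub (B : set T) : G.-sigma.-measurable B -> measurable B.
Proof. by apply: smallest_sub => //; exact: sigma_algebra_measurable. Qed.

Lemma preimage_measurable A : measurable A -> measurable (X @^-1` A).
Proof. by move=> mA; rewrite -[X in measurable X]setTI; exact: mX. Qed.

(** As functions of [B], both sides are finite measures that agree on the pi-system [G]; uniqueness
    of measures extends the equality to the generated sigma-algebra. *)
Lemma indep_sigma A (B : set T2) : measurable A -> measurable B ->
  P (X @^-1` A `&` B) = (P (X @^-1` A) * P B)%E.
Proof.
move=> mA mB; have mXA := preimage_measurable mA.
pose f1 (C : set T2) : \bar R := P (C `&` X @^-1` A).
pose f2 (C : set T2) : \bar R := (P (X @^-1` A) * P C)%E.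
have f10 : f1 set0 = 0%E by rewrite /f1 set0I measure0.
have f1ge C : (0 <= f1 C)%E by exact: measure_ge0.
have f1s : semi_sigma_additive f1.
  move=> F mF tF mU.
  apply: (@measure_semi_sigma_additive _ _ _ (mrestr P mXA) F) => //.
  - by move=> i; exact: g_sigma_sub.
  - exact: g_sigma_sub.
have f20 : f2 set0 = 0%E by rewrite /f2 measure0 mule0.
have f2ge C : (0 <= f2 C)%E by rewrite /f2 mule_ge0.
have f2s : semi_sigma_additive f2.
  move=> F mF tF mU.
  have pf : P (X @^-1` A) = (fine (P (X @^-1` A)))%:E by rewrite fineK // fin_num_measure.
  have p0 : 0 <= fine (P (X @^-1` A)) by rewrite fine_ge0.
  have -> : f2 = mscale (NngNum p0) P.
    by apply/funext => C; rewrite /f2 /mscale [in LHS]pf.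
  apply: (@measure_semi_sigma_additive _ _ _ (mscale (NngNum p0) P) F) => //.
  - by move=> i; exact: g_sigma_sub.
  - exact: g_sigma_sub.
pose m1 : {measure set T2 -> \bar R} := HB.pack f1 (isMeasure.Build _ _ _ f1 f10 f1ge f1s).
pose m2 : {measure set T2 -> \bar R} := HB.pack f2 (isMeasure.Build _ _ _ f2 f20 f2ge f2s).
rewrite setIC -[LHS]/(m1 B) -[RHS]/(m2 B).
apply: (@measure_unique _ R T2 G (fun=> setT) erefl IG (fun=> GT) _ m1 m2) => //.
- by rewrite bigcup_const.
- by move=> C GC; rewrite /m1 /m2 /= /f1 /f2 setIC indG.
- by move=> _; rewrite /m1 /= /f1 setTI ltey_eq fin_num_measure.
Qed.

Lemma measurable_id_g : measurable_fun setT (idfun : T -> T2).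
Proof. by move=> _ B mB; rewrite setTI; exact: g_sigma_sub. Qed.


(** The identity into [T2] serves as second random variable, which covers every [Y] measurable for
    the sub-sigma-algebra at once. By [indep_sigma] its joint law with [X] is a product measure, and
    Fubini factorises the integral. *)
Lemma indep_Ex (f : T1 -> R) (Y : T -> R) : measurable_fun setT f ->
  measurable_fun setT (Y : T2 -> R) -> Linf P (f \o X) -> Linf P Y ->
  Ex P (fun t => f (X t) * Y t) = Ex P (f \o X) * Ex P Y.
Proof.
move=> mf mY Lf LY.
pose X' : {mfun T >-> T1} := HB.pack X (isMeasurableFun.Build _ _ _ _ X mX).
pose I' : {mfun T >-> T2} := HB.pack (idfun : T -> T2) (isMeasurableFun.Build _ _ _ _ (idfun : T -> T2) measurable_id_g).
have mphi : measurable_fun setT (fun t : T => (X t, (t : T2))).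
  by apply/measurable_fun_pair => //; exact: measurable_id_g.
pose phi : {mfun T >-> (T1 * T2)%type} := HB.pack (fun t : T => (X t, (t : T2)))
  (isMeasurableFun.Build _ _ _ _ _ mphi).
pose m1 := distribution P X'. pose m2 := distribution P I'. pose m := distribution P phi.
have e : forall B, measurable B -> (m1 \x m2)%E B = m B.
  apply: product_measure_unique => A B mA mB.
  by rewrite /m /m1 /m2 /distribution /pushforward /= -indep_sigma.
pose F (xy : T1 * T2) : \bar R := (f xy.1 * Y xy.2)%:E.
have mF : measurable_fun setT F.
  apply/measurable_EFinP; apply: measurable_funM; exact: measurableT_comp.
have LfY := LinfM Lf LY.
have iF : m.-integrable setT F.
  by apply: integrable_pushforward => //; exact: Linf_integrable.
have iF' : (m1 \x m2)%E.-integrable setT F.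
  move/integrableP : iF => [_ h]; apply/integrableP; split => //.
  by rewrite (eq_measure_integral m) // => A mA _; exact: e.
rewrite /Ex /Rintegral.
have -> : (\int[P]_t (f (X t) * Y t)%:E = \int[(m1 \x m2)%E]_z F z)%E.
  rewrite (eq_measure_integral m); last by move=> A mA _; exact: e.
  by rewrite integral_distribution //; exact: Linf_integrable.
rewrite -integral12_prod_meas1 //.
have iY : m2.-integrable setT (EFin \o (Y : T2 -> R)).
  by apply: integrable_pushforward => //; [exact/measurable_EFinP|exact: Linf_integrable].
have if_ : m1.-integrable setT (EFin \o f).
  by apply: integrable_pushforward => //; [exact/measurable_EFinP|exact: Linf_integrable].
have EY : (\int[m2]_y (Y y)%:E = (fine (\int[P]_t (Y t)%:E))%:E)%E.
  rewrite integral_distribution //; [|exact/measurable_EFinP|exact: Linf_integrable].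
  by rewrite fineK //; apply: integrable_fin_num => //; exact: Linf_integrable.
transitivity (fine (\int[m1]_x ((f x)%:E * (fine (\int[P]_t (Y t)%:E))%:E))%E).
  congr fine; apply: eq_integral => x _; rewrite /fubini_F /F /=.
  under eq_integral do rewrite EFinM.
  by rewrite integralZl // EY.
rewrite integralZr // integral_distribution //; [|exact/measurable_EFinP|exact: Linf_integrable].
rewrite fineM //; apply: integrable_fin_num => //; exact: Linf_integrable.
Qed.

End Independence.

(** * Expansion in a single matrix entry *)

Section Model.
Context {R : realType}.

(** The hypotheses of the theorem in one fixed dimension. Thresholds in later lemmas are chosen from
    [C], [Cp] and the exponents before any such model is given, which yields the required
    uniformity. *)
Record wigner (C : R) (Cp : nat -> R) N d (T : measurableType d) (P : probability T R)
    (H : T -> 'M[R[i]]_N) : Prop := Wigner {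
  wig_meas : mmat H;
  wig_herm : forall t, hermitian (H t);
  wig_ind : mutually_independent P [set p : 'I_N * 'I_N | (p.1 <= p.2)%N]
                 (fun p t => cpair (H t p.1 p.2));
  wig_mean : forall i j : 'I_N, ('E_P[fun t => complex.Re (H t i j)] = 0)%E /\
                            ('E_P[fun t => complex.Im (H t i j)] = 0)%E;
  wig_var : forall i j : 'I_N,
       ((C^-1)%:E <= (N%:R)%:E * 'E_P[fun t => (cabs (H t i j) ^+ 2)%R])%E /\
       ((N%:R)%:E * 'E_P[fun t => (cabs (H t i j) ^+ 2)%R] <= C%:E)%E;
  wig_sum : forall i : 'I_N, (\sum_(j < N) 'E_P[fun t => (cabs (H t i j) ^+ 2)%R])%E = 1%E;
  wig_mom : forall (p : nat) (i j : 'I_N),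
       ('E_P[fun t => (cabs (((Num.sqrt (N%:R))%:C)%C * H t i j) ^+ p)%R] <= (Cp p)%:E)%E }.

Section fixed_model.
Context (C : R) (Cp : nat -> R) (N : nat) d (T : measurableType d) (P : probability T R).
Variable H : T -> 'M[R[i]]_N.
Hypothesis W : wigner C Cp P H.
Notation n := (Num.sqrt (N%:R : R)).

Lemma dim_gt0 (i : 'I_N) : 0 < (N%:R : R).
Proof. by rewrite ltr0n; case: i => k; case: (N). Qed.

Lemma Linf_entry i j : cLinf P (fun t => H t i j).
Proof.
have mH := wig_meas W i j.
have N0 := dim_gt0 i.
have n0 : 0 < n by rewrite sqrtr_gt0.
suff h : Linf P (fun t => cabs (H t i j)) by exact: cLinf_dom mH h (fun t => lexx _).
have mc := measurable_cabs mH.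
split => // k; apply/integrableP; split.
  by apply/measurable_EFinP; apply: measurable_funX; exact: measurableT_comp.
have := wig_mom W k i j; rewrite unlock.
have e : (\int[P]_w (cabs ((n%:C)%C * H w i j) ^+ k)%:E =
   (n ^+ k)%:E * \int[P]_w (cabs (H w i j) ^+ k)%:E)%E.
  rewrite -ge0_integralZl //.
  - by apply: eq_integral => t _; rewrite cabsM cabs_real ger0_norm ?sqrtr_ge0 // exprMn EFinM.
  - by apply/measurable_EFinP; apply: measurable_funX.
  - by move=> t _; rewrite lee_fin exprn_ge0 ?cabs_ge0.
rewrite e => h.
rewrite (eq_integral (fun w => (cabs (H w i j) ^+ k)%:E)); last first.
  by move=> t _ /=; rewrite normrX normr_id ger0_norm ?cabs_ge0.
(* An infinite moment, multiplied by the positive factor [n ^+ k], would exceed the finite bound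
   [Cp k]. *)
rewrite ltNge; apply/negP; rewrite leye_eq => /eqP h2.
by move: h; rewrite h2 gt0_muley ?lte_fin ?exprn_gt0.
Qed.

Definition Svar i j : R := Ex P (fun t => cabs (H t i j) ^+ 2).
(** The pseudo-variance: it equals [Svar] for real entries and vanishes off the diagonal for the
    GUE. In general only [Tvar_le] is available, so its terms are estimated and never cancelled. *)
Definition Tvar i j : R[i] := Ec P (fun t => H t i j ^+ 2).

Lemma Linf_cabsX i j k : Linf P (fun t => cabs (H t i j) ^+ k).
Proof. by apply: LinfX; apply: Linf_cabs; exact: Linf_entry. Qed.

Lemma EFin_cabsX i j k : ((Ex P (fun t => cabs (H t i j) ^+ k))%:E = 'E_P[fun t => (cabs (H t i j) ^+ k)%R])%E.
Proof. by rewrite unlock EFin_Ex //; exact: Linf_cabsX. Qed.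

Lemma Ex_cabsX_le i j k : n ^+ k * Ex P (fun t => cabs (H t i j) ^+ k) <= Cp k.
Proof.
have := wig_mom W k i j.
rewrite (_ : (fun t => _) = fun t => n ^+ k * cabs (H t i j) ^+ k); last first.
  by apply/funext => t; rewrite cabsM cabs_real ger0_norm ?sqrtr_ge0 // exprMn.
rewrite -ExZ; last exact: Linf_cabsX.
by rewrite unlock -EFin_Ex ?lee_fin //; apply: LinfZ; exact: Linf_cabsX.
Qed.

Lemma Svar_ge0 i j : 0 <= Svar i j.
Proof. by apply: Ex_ge0 => t; rewrite exprn_ge0 ?cabs_ge0. Qed.
Lemma Svar_ub i j : N%:R * Svar i j <= C.
Proof. by have [_] := wig_var W i j; rewrite -EFin_cabsX -EFinM lee_fin. Qed.
Lemma Svar_lb i j : C^-1 <= N%:R * Svar i j.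
Proof. by have [+ _] := wig_var W i j; rewrite -EFin_cabsX -EFinM lee_fin. Qed.
Lemma Svar_sum i : \sum_j Svar i j = 1.
Proof.
have := wig_sum W i; under eq_bigr do rewrite -EFin_cabsX.
by rewrite sumEFin => -[].
Qed.
Lemma Svar_sym i j : Svar i j = Svar j i.
Proof. by apply: Ex_ext => t; rewrite (wig_herm W t j i) cabs_conj. Qed.
Lemma Svar_sum' i : \sum_j Svar j i = 1.
Proof. by rewrite -(Svar_sum i); apply: eq_bigr => j _; exact: Svar_sym. Qed.

Lemma cLinfX F k : cLinf P F -> cLinf P (fun t => F t ^+ k).
Proof.
move=> h; elim: k => [|k IH].
  rewrite (_ : (fun t => _) = fun=> 1); [exact: cLinf_cst|exact/funext].
by rewrite (_ : (fun t => _) = fun t => F t * F t ^+ k); [exact: cLinfM|apply/funext => t; rewrite exprS].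
Qed.

Lemma Tvar_le i j : cabs (Tvar i j) <= Svar i j.
Proof.
rewrite /Tvar.
apply: le_trans (cabs_Ec _) _; first by apply: cLinfX; exact: Linf_entry.
by rewrite (_ : (fun t => _) = fun t => cabs (H t i j) ^+ 2) //; apply/funext => t; rewrite cabsX.
Qed.

Lemma Ec_entry0 i j : Ec P (fun t => H t i j) = 0.
Proof.
have [h1 h2] := wig_mean W i j; have [l1 l2] := Linf_entry i j.
move: h1 h2; rewrite unlock => h1 h2.
by apply: complex_ext; rewrite /Ec /=; apply: EFin_inj; rewrite EFin_Ex.
Qed.

Lemma cLinf_adm F : adm F -> cLinf P (fun t => F (H t)).
Proof.
move=> [h1 [c k1]]; apply: (cLinf_dom (h1 _ _ _ (wig_herm W) (wig_meas W)) (Linf_cst P c)) => t.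
by apply: k1; exact: wig_herm W t.
Qed.
Lemma Linf_admR f : admR f -> Linf P (fun t => f (H t)).
Proof.
move=> [h1 [c k1]]; apply: (@Linf_bounded _ _ _ _ _ c); first exact: h1 (wig_herm W) (wig_meas W).
by move=> t; apply: k1; exact: wig_herm W t.
Qed.

Section single_entry.
Variables i j : 'I_N.
Let D : {set 'I_N * 'I_N} := [set p : 'I_N * 'I_N | (p.1 <= p.2)%N].
(** The independent family lives on the upper triangle, so below the diagonal [H i j] is the
    conjugate of the member indexed by [(j, i)]. *)
Let p0 : 'I_N * 'I_N := if (i <= j)%N then (i, j) else (j, i).
Let X (p : 'I_N * 'I_N) t := cpair (H t p.1 p.2).
(** The pi-system of cylinder events in all upper-triangular entries other than [p0]. *)
Let G : set (set T) := [set B | exists A : 'I_N * 'I_N -> set (R * R)%type,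
   (forall q, measurable (A q)) /\ B = \big[setI/setT]_(q in D :\ p0) (X q @^-1` A q)].

Lemma pair_in_upper : p0 \in D.
Proof. by rewrite inE /p0; case: (leqP i j) => //= /ltnW. Qed.

Lemma measurable_entry_pair p : measurable_fun setT (X p).
Proof. by apply/measurable_fun_pair; [exact: (wig_meas W p.1 p.2).1|exact: (wig_meas W p.1 p.2).2]. Qed.

Lemma others_measurable : G `<=` measurable.
Proof.
move=> B [A [mA ->]]; apply: bigsetI_measurable => q _.
by rewrite -[X in measurable X]setTI; exact: measurable_entry_pair.
Qed.

Lemma others_setI : setI_closed G.
Proof.
move=> B1 B2 [A1 [m1 ->]] [A2 [m2 ->]]; exists (fun q => A1 q `&` A2 q); split.
  by move=> q; exact: measurableI.
by rewrite -big_split.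
Qed.

Lemma others_setT : G setT.
Proof.
exists (fun=> setT); split; first by move=> q.
by rewrite big1.
Qed.

(** Mutual independence is applied to the whole upper triangle and to the triangle without [p0]; the
    two products differ by the factor of [p0]. *)
Lemma others_indep A B : measurable A -> G B ->
  P (X p0 @^-1` A `&` B) = (P (X p0 @^-1` A) * P B)%E.
Proof.
move=> mA [A' [mA' ->]].
pose A'' q := if q == p0 then A else A' q.
have mA'' q : measurable (A'' q) by rewrite /A''; case: ifP.
have eB : \big[setI/setT]_(q in D :\ p0) (X q @^-1` A' q) = \big[setI/setT]_(q in D :\ p0) (X q @^-1` A'' q).
  by apply: eq_bigr => q; rewrite !inE /A'' => /andP[/negbTE -> _].
have e1 := wig_ind W (J := D) (subxx _) mA''.
have e2 := wig_ind W (J := D :\ p0) (subD1set _ _) mA''.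
have eA : A'' p0 = A by rewrite /A'' eqxx.
rewrite eB e2 -[in RHS]eA.
move: e1; rewrite (big_setD1 p0) ?pair_in_upper //= eA => ->.
by rewrite (big_setD1 p0) ?pair_in_upper //= eA.
Qed.

(** Every entry of the cleared matrix is zero, an upper entry other than [p0], or the conjugate of
    one. *)
Lemma zer_others : @mmat R _ (g_sigma_algebraType G) N (fun t => zer i j (H t)).
Proof.
have mX q : q \in D :\ p0 -> @cmeas R _ (g_sigma_algebraType G) (fun t => H t q.1 q.2).
  move=> qD.
  have h : @measurable_fun _ _ (g_sigma_algebraType G) _ setT (X q).
    move=> _ A mA; rewrite setTI; apply: sub_sigma_algebra.
    exists (fun q' => if q' == q then A else setT); split; first by move=> q'; case: ifP.
    rewrite (big_setD1 q) //= eqxx big1 ?setIT // => q'.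
    by rewrite !inE => /andP[/negbTE -> _]; rewrite preimage_setT.
  split.
    rewrite (_ : (fun t => _) = fst \o X q) //; apply: measurableT_comp => //.
  rewrite (_ : (fun t => _) = snd \o X q) //; apply: measurableT_comp => //.
move=> k l.
case: (boolP (((k == i) && (l == j)) || ((k == j) && (l == i)))) => kl.
  by apply: (@cmeas_ext _ _ (g_sigma_algebraType G) _ (fun=> 0)) => [t|]; [rewrite mxE kl|exact: cmeas_cst].
apply: (@cmeas_ext _ _ (g_sigma_algebraType G) _ (fun t => H t k l)) => [t|]; first by rewrite mxE (negbTE kl).
have kp : (k, l) != p0 /\ (l, k) != p0.
  move: kl; rewrite negb_or !negb_and /p0 => /andP[k1 k2].
  by case: leqP => _ /=; split => //; rewrite orbC.
case: (leqP k l) => kl'.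
  by apply: (mX (k, l)); rewrite !inE /= kp.1.
apply: (@cmeas_ext _ _ (g_sigma_algebraType G) _ (fun t => conjc (H t l k))) => [t|]; first exact: wig_herm W t l k.
by apply: cmeasJ; apply: (mX (l, k)); rewrite !inE /= kp.2 /= ltnW.
Qed.

Lemma zer_meas : mmat (fun t => zer i j (H t)).
Proof.
move=> k l; case: (boolP (((k == i) && (l == j)) || ((k == j) && (l == i)))) => kl.
  by apply: (@cmeas_ext _ _ _ _ (fun=> 0)) => [t|]; [rewrite mxE kl|exact: cmeas_cst].
by apply: (@cmeas_ext _ _ _ _ (fun t => H t k l)) => [t|]; [rewrite mxE (negbTE kl)|exact: wig_meas W k l].
Qed.

Lemma cLinf_adm_zer F : adm F -> cLinf P (fun t => F (zer i j (H t))).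
Proof.
have hz t : hermitian (zer i j (H t)) by apply: zer_herm; exact: wig_herm W t.
move=> [h1 [c k1]]; apply: (cLinf_dom (h1 _ _ _ hz zer_meas) (Linf_cst P c)) => t.
exact: k1.
Qed.

Lemma indep_entry_real (f : R * R -> R) (Y : T -> R) : measurable_fun setT f ->
  @measurable_fun _ _ (g_sigma_algebraType G) _ setT Y ->
  Linf P (f \o X p0) -> Linf P Y ->
  Ex P (fun t => f (X p0 t) * Y t) = Ex P (f \o X p0) * Ex P Y.
Proof.
apply: (indep_Ex (measurable_entry_pair p0) others_measurable others_setI others_setT).
exact: others_indep.
Qed.

(* The entry itself, up to conjugation, is a function of the independent pair indexed by [p0]. *)
Lemma indep_entry (q : R[i] -> R[i]) F : adm F ->
  (measurable_fun setT (fun x : R * R => ReC (q (x.1 +i* x.2)%C))) ->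
  (measurable_fun setT (fun x : R * R => ImC (q (x.1 +i* x.2)%C))) ->
  cLinf P (fun t => q (H t p0.1 p0.2)) ->
  Ec P (fun t => q (H t p0.1 p0.2) * F (zer i j (H t))) =
  Ec P (fun t => q (H t p0.1 p0.2)) * Ec P (fun t => F (zer i j (H t))).
Proof.
move=> hF m1 m2 hq.
have hz t : hermitian (zer i j (H t)) by apply: zer_herm; exact: wig_herm W t.
have [g1 g2] := hF.1 _ (g_sigma_algebraType G) _ hz zer_others.
have [l1 l2] := cLinf_adm_zer hF.
have [q1 q2] := hq.
have eH t : ((X p0 t).1 +i* (X p0 t).2)%C = H t p0.1 p0.2.
  by rewrite /X /cpair /=; case: (H t p0.1 p0.2).
have eqr : (fun x : R * R => ReC (q (x.1 +i* x.2)%C)) \o X p0 = fun t => ReC (q (H t p0.1 p0.2)).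
  by apply/funext => t /=; rewrite -[(_ +i* _)%C]/(((X p0 t).1 +i* (X p0 t).2)%C) eH.
have eqi : (fun x : R * R => ImC (q (x.1 +i* x.2)%C)) \o X p0 = fun t => ImC (q (H t p0.1 p0.2)).
  by apply/funext => t /=; rewrite -[(_ +i* _)%C]/(((X p0 t).1 +i* (X p0 t).2)%C) eH.
have K (f : R * R -> R) (g Y : T -> R) : measurable_fun setT f ->
    @measurable_fun _ _ (g_sigma_algebraType G) _ setT Y -> f \o X p0 = g ->
    Linf P g -> Linf P Y -> Ex P (fun t => g t * Y t) = Ex P g * Ex P Y.
  by move=> mf mY <- Lg LY; exact: indep_entry_real.
apply: complex_ext; rewrite ?cReM ?cImM /=.
  rewrite -(K _ _ _ m1 g1 eqr q1 l1) -(K _ _ _ m2 g2 eqi q2 l2) -ExB; [|exact: LinfM|exact: LinfM].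
  by apply: Ex_ext => t; rewrite cReM.
rewrite -(K _ _ _ m1 g2 eqr q1 l2) -(K _ _ _ m2 g1 eqi q2 l1) -ExD; [|exact: LinfM|exact: LinfM].
by apply: Ex_ext => t; rewrite cImM.
Qed.

End single_entry.

Lemma indep_ij i j (q : R[i] -> R[i]) F : adm F ->
  (forall K : R * R -> R[i], cmeas K -> cmeas (fun x => q (K x))) ->
  cLinf P (fun t => q (H t i j)) ->
  Ec P (fun t => q (H t i j) * F (zer i j (H t))) =
  Ec P (fun t => q (H t i j)) * Ec P (fun t => F (zer i j (H t))).
Proof.
move=> hF hq Lq.
have mid : cmeas (fun x : R * R => (x.1 +i* x.2)%C).
  by split; [exact: measurable_fst|exact: measurable_snd].
have := indep_entry (i := i) (j := j) (F := F).
case: (leqP i j) => ij /=; first by apply => //; [exact: (hq _ mid).1|exact: (hq _ mid).2].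
(* Below the diagonal the entry is the conjugate of the family member, so [q \o conjc] takes the
   place of [q]. *)
have mJ := hq _ (cmeasJ mid).
move=> /(_ (q \o conjc) hF mJ.1 mJ.2).
have e t : q (conjc (H t j i)) = q (H t i j) by rewrite -(wig_herm W t).
rewrite (_ : (fun t => (q \o conjc) (H t j i)) = fun t => q (H t i j)); last exact/funext.
rewrite (_ : (fun t => (q \o conjc) (H t j i) * _) = fun t => q (H t i j) * F (zer i j (H t))).
  by apply.
by apply/funext => t /=; rewrite e.
Qed.

(** Second-order integration by parts. Expand [F] at the cleared matrix: independence and [E h = 0]
    leave [T E Fh + S E Fb] at that matrix. The term with [|h|^3] is the Taylor remainder, and
    [2 * S * |h|] is the cost of moving the two derivatives back to [H]. *)
Lemma single_entry i j F Fh Fb (k : T -> R) : adm F -> adm Fh -> adm Fb -> Linf P k ->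
  (forall t, let h := H t i j in let M := H t in let M0 := zer i j M in
     [/\ cabs (F M - F M0 - (h * Fh M0 + conjc h * Fb M0)) <= cabs h ^+ 2 * k t,
         cabs (Fh M - Fh M0) <= cabs h * k t & cabs (Fb M - Fb M0) <= cabs h * k t]) ->
  cabs (Ec P (fun t => H t i j * F (H t)) -
     (Tvar i j * Ec P (fun t => Fh (H t)) + ((Svar i j)%:C)%C * Ec P (fun t => Fb (H t)))) <=
  Ex P (fun t => (cabs (H t i j) ^+ 3 + 2 * Svar i j * cabs (H t i j)) * k t).
Proof.
move=> hF hFh hFb Lk bd.
have Lh := Linf_entry i j.
have LF := cLinf_adm hF; have LFh := cLinf_adm hFh; have LFb := cLinf_adm hFb.
have LF0 := cLinf_adm_zer i j hF; have LFh0 := cLinf_adm_zer i j hFh; have LFb0 := cLinf_adm_zer i j hFb.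
pose h t := H t i j.
have Lhh : cLinf P (fun t => h t ^+ 2) by exact: cLinfX.
have LhJ : cLinf P (fun t => h t * conjc (h t)) by apply: cLinfM => //; exact: cLinfJ.
have e0 : Ec P (fun t => h t * F (zer i j (H t))) = 0.
  by rewrite (indep_ij (q := id)) // /h Ec_entry0 mul0r.
have e1 : Ec P (fun t => h t ^+ 2 * Fh (zer i j (H t))) = Tvar i j * Ec P (fun t => Fh (zer i j (H t))).
  rewrite /Tvar (indep_ij (q := fun x => x ^+ 2)) // => K mK.
  by apply: (cmeas_ext _ (cmeasM mK mK)) => x; rewrite expr2.
have e2 : Ec P (fun t => h t * conjc (h t) * Fb (zer i j (H t))) = ((Svar i j)%:C)%C * Ec P (fun t => Fb (zer i j (H t))).
  rewrite (indep_ij (q := fun x => x * conjc x)) //; last by move=> K mK; apply: cmeasM => //; exact: cmeasJ.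
  congr (_ * _); rewrite -Ec_real; last exact: Linf_cabsX.
  by apply: Ec_ext => t; rewrite mulrC conjcM_norm.
pose r1 t := F (H t) - F (zer i j (H t)) - (h t * Fh (zer i j (H t)) + conjc (h t) * Fb (zer i j (H t))).
have LhFh : cLinf P (fun t => h t * Fh (zer i j (H t))) by exact: cLinfM.
have LhFb : cLinf P (fun t => conjc (h t) * Fb (zer i j (H t))) by apply: cLinfM => //; exact: cLinfJ.
have Lr1 : cLinf P r1 by apply: cLinfB; [exact: cLinfB|exact: cLinfD].
pose r2 t := Fh (H t) - Fh (zer i j (H t)).
pose r3 t := Fb (H t) - Fb (zer i j (H t)).
have Lr2 : cLinf P r2 by exact: cLinfB.
have Lr3 : cLinf P r3 by exact: cLinfB.
(* Exact form of the error: [r1] is the Taylor remainder of [F], and [r2], [r3] are the increments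
   of the two derivatives. *)
have eqn : Ec P (fun t => H t i j * F (H t)) -
     (Tvar i j * Ec P (fun t => Fh (H t)) + ((Svar i j)%:C)%C * Ec P (fun t => Fb (H t))) =
   Ec P (fun t => h t * r1 t) - (Tvar i j * Ec P r2 + ((Svar i j)%:C)%C * Ec P r3).
  rewrite /r2 /r3 (EcB LFh LFh0) (EcB LFb LFb0).
  have -> : Ec P (fun t => H t i j * F (H t)) = Ec P (fun t => h t * r1 t) +
     (0 + Tvar i j * Ec P (fun t => Fh (zer i j (H t))) + ((Svar i j)%:C)%C * Ec P (fun t => Fb (zer i j (H t)))).
    have L0 : cLinf P (fun t => h t * F (zer i j (H t))) by exact: cLinfM.
    have L1 : cLinf P (fun t => h t ^+ 2 * Fh (zer i j (H t))) by exact: cLinfM.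
    have L2 : cLinf P (fun t => h t * conjc (h t) * Fb (zer i j (H t))) by exact: cLinfM.
    have L3 : cLinf P (fun t => h t * r1 t) by exact: cLinfM.
    have L01 := cLinfD L0 L1.
    rewrite -e0 -e1 -e2 -(EcD L0 L1) -(EcD L01 L2) -(EcD L3 (cLinfD L01 L2)).
    by apply: Ec_ext => t; rewrite /r1 -/(h t); ring.
  ring.
rewrite eqn; set S := Svar i j; set Tv := Tvar i j.
have S0 : 0 <= S by exact: Svar_ge0.
have Tle : cabs Tv <= S by exact: Tvar_le.
have Lch := Linf_cabs Lh.
have LB1 : Linf P (fun t => cabs (h t) ^+ 3 * k t) by apply: LinfM => //; exact: LinfX.
have LB2 : Linf P (fun t => cabs (h t) * k t) by exact: LinfM.
have b1 : cabs (Ec P (fun t => h t * r1 t)) <= Ex P (fun t => cabs (h t) ^+ 3 * k t).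
  have L1 : cLinf P (fun t => h t * r1 t) by exact: cLinfM.
  apply: le_trans (cabs_Ec L1) _; apply: Ex_le => //; first exact: Linf_cabs.
  move=> t; rewrite cabsM exprS -mulrA ler_wpM2l ?cabs_ge0 //; by have [] := bd t.
have b2 : cabs (Ec P r2) <= Ex P (fun t => cabs (h t) * k t).
  apply: le_trans (cabs_Ec Lr2) _; apply: Ex_le => //; first exact: Linf_cabs.
  by move=> t; have [] := bd t.
have b3 : cabs (Ec P r3) <= Ex P (fun t => cabs (h t) * k t).
  apply: le_trans (cabs_Ec Lr3) _; apply: Ex_le => //; first exact: Linf_cabs.
  by move=> t; have [] := bd t.
have -> : Ex P (fun t => (cabs (H t i j) ^+ 3 + 2 * S * cabs (H t i j)) * k t) =
   Ex P (fun t => cabs (h t) ^+ 3 * k t) + 2 * S * Ex P (fun t => cabs (h t) * k t).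
  rewrite -ExZ // -ExD //; last exact: LinfZ.
  by apply: Ex_ext => t; rewrite mulrDl mulrA.
apply: le_trans (cabsB _ _) _; apply: lerD => //.
apply: le_trans (cabsD _ _) _; rewrite !cabsM cabs_real (ger0_norm S0).
have E0 : 0 <= Ex P (fun t => cabs (h t) * k t) by apply: le_trans b2; exact: cabs_ge0.
rewrite -mulrA mulr2n mulrDl !mul1r; apply: lerD; last by rewrite ler_wpM2l.
by apply: ler_pM => //; exact: cabs_ge0.
Qed.

End fixed_model.
End Model.

(** * Calculus of second-order expansions in one entry *)

Section Jets.
Context {R : realType}.
Notation C := R[i].
Implicit Types (h f g : C) (k : R).

(* Second-order Taylor data of a statistic in one entry [h] and its conjugate: [f] is the value,
   [f0] the value with the entry set to zero, [fh] and [fb] the formal derivatives in [h] and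
   [conjc h], and [fh0], [fb0] these derivatives with the entry set to zero. *)
Record jet h f f0 fh fb fh0 fb0 k0 k1 k2 : Prop := Jet {
  jet_k2 : 0 <= k2;
  jet_v : cabs f <= k0; jet_v0 : cabs f0 <= k0;
  jet_h : cabs fh <= k1; jet_b : cabs fb <= k1;
  jet_h0 : cabs fh0 <= k1; jet_b0 : cabs fb0 <= k1;
  jet_d : cabs (f - f0) <= cabs h * k1;
  jet_2 : cabs (f - f0 - (h * fh0 + conjc h * fb0)) <= cabs h ^+ 2 * k2;
  jet_dh : cabs (fh - fh0) <= cabs h * k2;
  jet_db : cabs (fb - fb0) <= cabs h * k2 }.

Lemma jet_k0 h f f0 fh fb fh0 fb0 k0 k1 k2 : jet h f f0 fh fb fh0 fb0 k0 k1 k2 -> 0 <= k0.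
Proof. by case=> _ h1 *; apply: le_trans h1; exact: cabs_ge0. Qed.
Lemma jet_k1 h f f0 fh fb fh0 fb0 k0 k1 k2 : jet h f f0 fh fb fh0 fb0 k0 k1 k2 -> 0 <= k1.
Proof. by case=> _ _ _ h1 *; apply: le_trans h1; exact: cabs_ge0. Qed.

Lemma jet_le h f f0 fh fb fh0 fb0 k0 k1 k2 k0' k1' k2' :
  k0 <= k0' -> k1 <= k1' -> k2 <= k2' ->
  jet h f f0 fh fb fh0 fb0 k0 k1 k2 -> jet h f f0 fh fb fh0 fb0 k0' k1' k2'.
Proof.
move=> e0 e1 e2 [a0 a1 a2 a3 a4 a5 a6 a7 a8 a9 a10].
have hh := cabs_ge0 h.
split; try exact: le_trans e0; try exact: le_trans e1.
- exact: le_trans e2.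
- by apply: le_trans a7 _; rewrite ler_wpM2l.
- by apply: le_trans a8 _; rewrite ler_wpM2l ?exprn_ge0.
- by apply: le_trans a9 _; rewrite ler_wpM2l.
- by apply: le_trans a10 _; rewrite ler_wpM2l.
Qed.

Lemma jet_cst h f : jet h f f 0 0 0 0 (cabs f) 0 0.
Proof.
split; rewrite ?cabs0 ?subrr ?mulr0 ?addr0 ?subr0 ?cabs0 //.
Qed.

Lemma jetD h f f0 fh fb fh0 fb0 k0 k1 k2 g g0 gh gb gh0 gb0 l0 l1 l2 :
  jet h f f0 fh fb fh0 fb0 k0 k1 k2 -> jet h g g0 gh gb gh0 gb0 l0 l1 l2 ->
  jet h (f + g) (f0 + g0) (fh + gh) (fb + gb) (fh0 + gh0) (fb0 + gb0) (k0 + l0) (k1 + l1) (k2 + l2).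
Proof.
move=> [a0 a1 a2 a3 a4 a5 a6 a7 a8 a9 a10] [b0 b1 b2 b3 b4 b5 b6 b7 b8 b9 b10].
have tri (x y u v : C) (k l : R) : cabs x <= k -> cabs y <= l -> u = x + y -> cabs u <= k + l.
  by move=> hx hy ->; apply: le_trans (cabsD _ _) _; exact: lerD.
split; rewrite ?mulrDr ?addr_ge0 //.
- exact: tri a1 b1 _.
- exact: tri a2 b2 _.
- exact: tri a3 b3 _.
- exact: tri a4 b4 _.
- exact: tri a5 b5 _.
- exact: tri a6 b6 _.
- by apply: tri a7 b7 _ => //; ring.
- by apply: tri a8 b8 _ => //; ring.
- by apply: tri a9 b9 _ => //; ring.
- by apply: tri a10 b10 _ => //; ring.
Qed.

Lemma jetJ h f f0 fh fb fh0 fb0 k0 k1 k2 : jet h f f0 fh fb fh0 fb0 k0 k1 k2 ->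
  jet h (conjc f) (conjc f0) (conjc fb) (conjc fh) (conjc fb0) (conjc fh0) k0 k1 k2.
Proof.
move=> [a0 a1 a2 a3 a4 a5 a6 a7 a8 a9 a10].
split; rewrite -?rmorphB ?cabs_conj //.
rewrite (_ : _ - _ = conjc (f - f0 - (h * fh0 + conjc h * fb0))) ?cabs_conj //.
by rewrite !rmorphB rmorphD !rmorphM /= conjcK; ring.
Qed.

(** The cross term [2 * (k1 * l1)] pays for the product of the two increments in the expansion and
    for the two mixed terms in the increment of each derivative. *)
Lemma jetM h f f0 fh fb fh0 fb0 k0 k1 k2 g g0 gh gb gh0 gb0 l0 l1 l2 :
  jet h f f0 fh fb fh0 fb0 k0 k1 k2 -> jet h g g0 gh gb gh0 gb0 l0 l1 l2 ->
  jet h (f * g) (f0 * g0) (fh * g + f * gh) (fb * g + f * gb) (fh0 * g0 + f0 * gh0)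
    (fb0 * g0 + f0 * gb0) (k0 * l0) (k1 * l0 + k0 * l1) (k2 * l0 + k0 * l2 + 2 * (k1 * l1)).
Proof.
move=> hf hg.
have K0 := jet_k0 hf; have K1 := jet_k1 hf; have L0 := jet_k0 hg; have L1 := jet_k1 hg.
case: hf => [a0 a1 a2 a3 a4 a5 a6 a7 a8 a9 a10]; case: hg => [b0 b1 b2 b3 b4 b5 b6 b7 b8 b9 b10].
have hh := cabs_ge0 h.
have m2 (x y : C) (k l : R) : cabs x <= k -> cabs y <= l -> cabs (x * y) <= k * l.
  by move=> hx hy; rewrite cabsM; apply: ler_pM; rewrite ?cabs_ge0.
have t2 (x y : C) (k l : R) : cabs x <= k -> cabs y <= l -> cabs (x + y) <= k + l.
  by move=> hx hy; apply: le_trans (cabsD _ _) _; exact: lerD.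
split; try by [exact: m2|apply: t2; exact: m2].
- by rewrite !addr_ge0 ?mulr_ge0.
- rewrite (_ : f * g - f0 * g0 = (f - f0) * g + f0 * (g - g0)); last by ring.
  rewrite (_ : cabs h * _ = cabs h * k1 * l0 + k0 * (cabs h * l1)); last by ring.
  apply: t2; exact: m2.
- rewrite (_ : _ - _ = (f - f0 - (h * fh0 + conjc h * fb0)) * g0
     + f0 * (g - g0 - (h * gh0 + conjc h * gb0)) + (f - f0) * (g - g0)); last by ring.
  rewrite (_ : _ * _ = cabs h ^+ 2 * k2 * l0 + k0 * (cabs h ^+ 2 * l2)
     + (cabs h * k1) * (cabs h * (2 * l1))); last by ring.
  apply: (t2); first by apply: (t2); exact: m2.
  apply: m2 => //; apply: le_trans b7 _; rewrite ler_wpM2l // ler_peMl //; lra.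
- rewrite (_ : _ - _ = (fh - fh0) * g + fh0 * (g - g0) + ((f - f0) * gh + f0 * (gh - gh0))); last by ring.
  rewrite (_ : _ * _ = cabs h * k2 * l0 + k1 * (cabs h * l1) + (cabs h * k1 * l1 + k0 * (cabs h * l2))); last by ring.
  by apply: (t2); apply: (t2); exact: m2.
- rewrite (_ : _ - _ = (fb - fb0) * g + fb0 * (g - g0) + ((f - f0) * gb + f0 * (gb - gb0))); last by ring.
  rewrite (_ : _ * _ = cabs h * k2 * l0 + k1 * (cabs h * l1) + (cabs h * k1 * l1 + k0 * (cabs h * l2))); last by ring.
  by apply: (t2); apply: (t2); exact: m2.
Qed.

Lemma jetZ h (c : C) f f0 fh fb fh0 fb0 k0 k1 k2 :
  jet h f f0 fh fb fh0 fb0 k0 k1 k2 ->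
  jet h (c * f) (c * f0) (c * fh) (c * fb) (c * fh0) (c * fb0) (cabs c * k0) (cabs c * k1) (cabs c * k2).
Proof.
move=> hf; have := jetM (jet_cst h c) hf.
by rewrite !mul0r !add0r mulr0 addr0.
Qed.

Lemma jet_sum h (I : Type) (r : seq I) (f f0 fh fb fh0 fb0 : I -> C) (k0 k1 k2 : I -> R) :
  (forall i, jet h (f i) (f0 i) (fh i) (fb i) (fh0 i) (fb0 i) (k0 i) (k1 i) (k2 i)) ->
  jet h (\sum_(i <- r) f i) (\sum_(i <- r) f0 i) (\sum_(i <- r) fh i) (\sum_(i <- r) fb i)
    (\sum_(i <- r) fh0 i) (\sum_(i <- r) fb0 i) (\sum_(i <- r) k0 i) (\sum_(i <- r) k1 i)
    (\sum_(i <- r) k2 i).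
Proof.
move=> H; elim: r => [|i r IH]; last by rewrite !big_cons; exact: jetD.
by rewrite !big_nil; have := jet_cst h 0; rewrite cabs0.
Qed.

(** Bounds relative to the size [k]. Like logarithmic derivatives they add under products, so a high
    power of a statistic only costs factors polynomial in the exponent. *)
Definition jetr h f f0 fh fb fh0 fb0 k (a b : R) := jet h f f0 fh fb fh0 fb0 k (k * a) (k * b).

(** For [q = 0] the truncated exponent [q.-1] is harmless, being multiplied by [q%:R = 0]. *)
Lemma jetrX h f f0 fh fb fh0 fb0 k a b q : 0 <= a -> 0 <= b ->
  jetr h f f0 fh fb fh0 fb0 k a b ->
  jetr h (f ^+ q) (f0 ^+ q) (q%:R * f ^+ q.-1 * fh) (q%:R * f ^+ q.-1 * fb)
    (q%:R * f0 ^+ q.-1 * fh0) (q%:R * f0 ^+ q.-1 * fb0) (k ^+ q)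
    (q%:R * a) (q%:R * b + q%:R ^+ 2 * a ^+ 2).
Proof.
move=> a0 b0 hf; have k0 := jet_k0 hf.
elim: q => [|q IH].
  rewrite /jetr !expr0 !mul0r expr0n /= !mul0r addr0 mulr0.
  by have := jet_cst h 1; rewrite cabs1.
have := jetM hf IH.
have der (x xh : C) : xh * x ^+ q + x * (q%:R * x ^+ q.-1 * xh) = q.+1%:R * x ^+ q * xh.
  case: (q) => [|q']; rewrite /= ?expr0 -?natr1; first by ring.
  by rewrite [x ^+ q'.+1]exprS; ring.
rewrite /jetr -!exprS !der /=; apply: jet_le => //.
  by rewrite exprS -natr1 le_eqVlt; apply/orP; left; apply/eqP; ring.
rewrite -subr_ge0 (_ : _ - _ = k ^+ q.+1 * a ^+ 2); first by rewrite mulr_ge0 ?exprn_ge0.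
by rewrite exprS -natr1; ring.
Qed.

Lemma jetr_mul h f f0 fh fb fh0 fb0 k a b g g0 gh gb gh0 gb0 l a' b' :
  jetr h f f0 fh fb fh0 fb0 k a b -> jetr h g g0 gh gb gh0 gb0 l a' b' ->
  jetr h (f * g) (f0 * g0) (fh * g + f * gh) (fb * g + f * gb) (fh0 * g0 + f0 * gh0)
    (fb0 * g0 + f0 * gb0) (k * l) (a + a') (b + b' + 2 * (a * a')).
Proof.
move=> hf hg; have := jetM hf hg; rewrite /jetr.
apply: jet_le => //; rewrite le_eqVlt; apply/orP; left; apply/eqP; ring.
Qed.

(* The weight of the moment method and its formal derivatives in [Y] and in its conjugate. *)
Definition mom_w (q : nat) (Y : C) : C := Y ^+ q * conjc Y ^+ q.+1.
Definition mom_w1 (q : nat) (Y : C) : C := q%:R * Y ^+ q.-1 * conjc Y ^+ q.+1.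
Definition mom_w2 (q : nat) (Y : C) : C := Y ^+ q * (q.+1%:R * conjc Y ^+ q).

Lemma jetr_mom_w h Y Y0 Yh Yb Yh0 Yb0 y a b q : 0 <= a -> 0 <= b ->
  jetr h Y Y0 Yh Yb Yh0 Yb0 y a b ->
  jetr h (mom_w q Y) (mom_w q Y0) (mom_w1 q Y * Yh + mom_w2 q Y * conjc Yb)
   (mom_w1 q Y * Yb + mom_w2 q Y * conjc Yh) (mom_w1 q Y0 * Yh0 + mom_w2 q Y0 * conjc Yb0)
   (mom_w1 q Y0 * Yb0 + mom_w2 q Y0 * conjc Yh0)
   (y ^+ (q + q.+1)) ((q + q.+1)%:R * a) ((q + q.+1)%:R * b + (q + q.+1)%:R ^+ 2 * a ^+ 2).
Proof.
move=> a0 b0 hY.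
have h1 := jetrX q a0 b0 hY; have h2 := jetrX q.+1 a0 b0 (jetJ hY).
have := jetr_mul h1 h2.
rewrite /jetr /= !exprD => hj.
have e (x xh xb : C) : q%:R * x ^+ q.-1 * xh * conjc x ^+ q.+1 +
    x ^+ q * (q.+1%:R * conjc x ^+ q * xb) = mom_w1 q x * xh + mom_w2 q x * xb.
  by rewrite /mom_w1 /mom_w2; ring.
move: hj; rewrite !e; apply: jet_le => //; rewrite natrD le_eqVlt; apply/orP; left; apply/eqP; ring.
Qed.

(** The dependence on [q] is pulled out as one numerical factor, so that the remaining bound can be
    the same for all moments. *)
Lemma jet_mom_F h Y Y0 Yh Yb Yh0 Yb0 y a b q Z Z0 Zh Zb Zh0 Zb0 z0 z1 z2 : 0 <= a -> 0 <= b ->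
  jetr h Y Y0 Yh Yb Yh0 Yb0 y a b -> jet h Z Z0 Zh Zb Zh0 Zb0 z0 z1 z2 ->
  let k := (q + q.+1)%:R * 2 * (q + q.+1)%:R * y ^+ (q + q.+1) * (z2 + z1 * a + z0 * (b + a ^+ 2)) in
  [/\ cabs (Z * mom_w q Y - Z0 * mom_w q Y0 -
     (h * (Zh0 * mom_w q Y0 + Z0 * (mom_w1 q Y0 * Yh0 + mom_w2 q Y0 * conjc Yb0)) +
      conjc h * (Zb0 * mom_w q Y0 + Z0 * (mom_w1 q Y0 * Yb0 + mom_w2 q Y0 * conjc Yh0))))
      <= cabs h ^+ 2 * k,
   cabs (Zh * mom_w q Y + Z * (mom_w1 q Y * Yh + mom_w2 q Y * conjc Yb) -
      (Zh0 * mom_w q Y0 + Z0 * (mom_w1 q Y0 * Yh0 + mom_w2 q Y0 * conjc Yb0))) <= cabs h * k &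
   cabs (Zb * mom_w q Y + Z * (mom_w1 q Y * Yb + mom_w2 q Y * conjc Yh) -
      (Zb0 * mom_w q Y0 + Z0 * (mom_w1 q Y0 * Yb0 + mom_w2 q Y0 * conjc Yh0))) <= cabs h * k].
Proof.
move=> a0 b0 hY hZ k.
have y0 := jet_k0 hY; have z00 := jet_k0 hZ; have z10 := jet_k1 hZ; have z20 := jet_k2 hZ.
have := jetM hZ (jetr_mom_w q a0 b0 hY).
set k2 := (X in jet _ _ _ _ _ _ _ _ _ X).
have hk : k2 <= k.
  rewrite /k2 /k; set Q : R := (q + q.+1)%:R; set yq := y ^+ _.
  have Q1 : 1 <= Q :> R by rewrite /Q ler1n addnS.
  have yq0 : 0 <= yq by rewrite exprn_ge0.
  rewrite (_ : _ + _ = yq * (z2 + Q * 2 * (z1 * a) + z0 * (Q * b + Q ^+ 2 * a ^+ 2))); last by ring.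
  rewrite (_ : Q * 2 * Q * yq * _ = yq * (Q * 2 * Q * (z2 + z1 * a + z0 * (b + a ^+ 2)))); last by ring.
  rewrite ler_wpM2l //.
  rewrite (_ : Q * 2 * Q * _ = Q * 2 * Q * z2 + Q * 2 * Q * (z1 * a) +
     (Q * 2 * Q * (z0 * b) + Q * 2 * Q * (z0 * a ^+ 2))); last by ring.
  rewrite [z0 * (_ + _)]mulrDr.
  have t1 : 0 <= z1 * a by rewrite mulr_ge0.
  have t2 : 0 <= z0 * b by rewrite mulr_ge0.
  have t3 : 0 <= z0 * a ^+ 2 by rewrite mulr_ge0 ?sqr_ge0.
  have e1 : z2 <= Q * 2 * Q * z2 by rewrite ler_peMl //; nra.
  have e2 : Q * 2 * (z1 * a) <= Q * 2 * Q * (z1 * a) by rewrite ler_wpM2r //; nra.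
  have e3 : z0 * (Q * b) <= Q * 2 * Q * (z0 * b) by rewrite mulrCA ler_wpM2r //; nra.
  have e4 : z0 * (Q ^+ 2 * a ^+ 2) <= Q * 2 * Q * (z0 * a ^+ 2) by rewrite mulrCA ler_wpM2r //; nra.
  by apply: lerD; exact: lerD.
case=> _ _ _ _ _ _ _ _ h2 h3 h4; split.
- by apply: le_trans h2 _; rewrite ler_wpM2l // exprn_ge0 ?cabs_ge0.
- by apply: le_trans h3 _; rewrite ler_wpM2l // cabs_ge0.
- by apply: le_trans h4 _; rewrite ler_wpM2l // cabs_ge0.
Qed.

End Jets.

(** * High moments *)

Section MomentMethod.
Context {R : realType} (C : R) (Cp : nat -> R) (N : nat) d (T : measurableType d) (P : probability T R).
Variable H : T -> 'M[R[i]]_N.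
Hypothesis W : wigner C Cp P H.
Notation Mat := 'M[R[i]]_N.
Notation S := (Svar P H).
Notation Tv := (Tvar P H).

(* A statistic [Y] written as [sum_ij H_ij Z_ij + Q], together with formal derivatives of [Y] and
   of [Z] in the entry [H_ij]. *)
Variables (Y Q : Mat -> R[i]) (Yh Yb Z Zh Zb : 'I_N -> 'I_N -> Mat -> R[i]).
Variables (y : Mat -> R) (K : 'I_N -> 'I_N -> Mat -> R).
Hypothesis aY : adm Y.
Hypothesis aQ : adm Q.
Hypothesis aYh : forall i j, adm (Yh i j).
Hypothesis aYb : forall i j, adm (Yb i j).
Hypothesis aZ : forall i j, adm (Z i j).
Hypothesis aZh : forall i j, adm (Zh i j).
Hypothesis aZb : forall i j, adm (Zb i j).
Hypothesis ay : admR y.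
Hypothesis aK : forall i j, admR (K i j).
Hypothesis y0 : forall t, 0 <= y (H t).
Hypothesis YE : forall t, Y (H t) = \sum_i \sum_j H t i j * Z i j (H t) + Q (H t).
Hypothesis jets : forall t i j, let M := H t in let M0 := zer i j M in
  exists a b z0 z1 z2 : R, [/\ 0 <= a, 0 <= b,
    jetr (M i j) (Y M) (Y M0) (Yh i j M) (Yb i j M) (Yh i j M0) (Yb i j M0) (y M) a b,
    jet (M i j) (Z i j M) (Z i j M0) (Zh i j M) (Zb i j M) (Zh i j M0) (Zb i j M0) z0 z1 z2 &
    z2 + z1 * a + z0 * (b + a ^+ 2) <= K i j M].

(** [term1] collects the derivative falling on [Z] together with [Q], which are meant to cancel to
    leading order; [term2] and [term3] collect the derivatives falling on the powers of [Y] and of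
    its conjugate. *)
Definition term1 (M : Mat) := \sum_i \sum_j (Tv i j * Zh i j M + ((S i j)%:C)%C * Zb i j M) + Q M.
Definition term2 (M : Mat) := \sum_i \sum_j Z i j M * (Tv i j * Yh i j M + ((S i j)%:C)%C * Yb i j M).
Definition term3 (M : Mat) :=
  \sum_i \sum_j Z i j M * (Tv i j * conjc (Yb i j M) + ((S i j)%:C)%C * conjc (Yh i j M)).

Lemma adm_mom_w q : adm (fun M => mom_w q (Y M)).
Proof. by apply: admM; apply: admX => //; exact: admJ. Qed.
Lemma adm_mom_w1 q : adm (fun M => mom_w1 q (Y M)).
Proof. by apply: admM; [apply: admZ; exact: admX|apply: admX; exact: admJ]. Qed.
Lemma adm_mom_w2 q : adm (fun M => mom_w2 q (Y M)).
Proof. by apply: admM; [exact: admX|apply: admZ; apply: admX; exact: admJ]. Qed.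
Lemma adm_term1 : adm term1.
Proof. by apply: admD => //; apply: adm_sum => i; apply: adm_sum => j; apply: admD; exact: admZ. Qed.
Lemma adm_term2 : adm term2.
Proof.
by apply: adm_sum => i; apply: adm_sum => j; apply: admM => //; apply: admD; exact: admZ.
Qed.
Lemma adm_term3 : adm term3.
Proof.
apply: adm_sum => i; apply: adm_sum => j; apply: admM => //.
by apply: admD; apply: admZ; exact: admJ.
Qed.

Let cq (q : nat) : R := (q + q.+1)%:R * 2 * (q + q.+1)%:R.

(** Write [|Y|^(2q+2)] as [Y] times the weight [mom_w q Y], insert [YE] for the first factor, and
    apply [single_entry] to each [Z_ij] times the weight. *)
Lemma moment_expansion q :
  Ex P (fun t => cabs (Y (H t)) ^+ (q + q.+2)) <=
  Ex P (fun t => cabs (term1 (H t)) * cabs (Y (H t)) ^+ (q + q.+1) +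
     (q%:R * cabs (term2 (H t)) + q.+1%:R * cabs (term3 (H t))) * cabs (Y (H t)) ^+ (q + q)) +
  \sum_i \sum_j Ex P (fun t => (cabs (H t i j) ^+ 3 + 2 * S i j * cabs (H t i j)) *
     (cq q * y (H t) ^+ (q + q.+1) * K i j (H t))).
Proof.
pose F i j M := Z i j M * mom_w q (Y M).
pose Fh i j M := Zh i j M * mom_w q (Y M) + Z i j M * (mom_w1 q (Y M) * Yh i j M + mom_w2 q (Y M) * conjc (Yb i j M)).
pose Fb i j M := Zb i j M * mom_w q (Y M) + Z i j M * (mom_w1 q (Y M) * Yb i j M + mom_w2 q (Y M) * conjc (Yh i j M)).
have aw := adm_mom_w q; have aw1 := adm_mom_w1 q; have aw2 := adm_mom_w2 q.
have aF i j : adm (F i j) by exact: admM.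
have aFh i j : adm (Fh i j).
  by apply: admD; [exact: admM|apply: admM => //; apply: admD; apply: admM => //; exact: admJ].
have aFb i j : adm (Fb i j).
  by apply: admD; [exact: admM|apply: admM => //; apply: admD; apply: admM => //; exact: admJ].
pose k i j t := cq q * y (H t) ^+ (q + q.+1) * K i j (H t).
have Lk i j : Linf P (k i j).
  apply: (Linf_admR W (f := fun M => cq q * y M ^+ (q + q.+1) * K i j M)).
  by apply: admRM => //; apply: admRM; [exact: admR_cst|exact: admRX].
have LH i j := Linf_entry W i j.
have LF i j : cLinf P (fun t => H t i j * F i j (H t)) by apply: cLinfM => //; exact: (cLinf_adm W).
have single i j := single_entry W (i := i) (j := j) (aF i j) (aFh i j) (aFb i j) (Lk i j).
have {}single i j : cabs (Ec P (fun t => H t i j * F i j (H t)) -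
     (Tv i j * Ec P (fun t => Fh i j (H t)) + ((S i j)%:C)%C * Ec P (fun t => Fb i j (H t)))) <=
     Ex P (fun t => (cabs (H t i j) ^+ 3 + 2 * S i j * cabs (H t i j)) * k i j t).
  apply: single => t.
  have [a [b [z0 [z1 [z2 [a0 b0 jY jZ hK]]]]]] := jets t i j.
  have [h1 h2 h3] := jet_mom_F q a0 b0 jY jZ.
  have kk : (q + q.+1)%:R * 2 * (q + q.+1)%:R * y (H t) ^+ (q + q.+1) * (z2 + z1 * a + z0 * (b + a ^+ 2)) <= k i j t.
    by rewrite /k /cq ler_wpM2l // mulr_ge0 ?mulr_ge0 ?exprn_ge0.
  split.
  - by apply: le_trans h1 _; rewrite ler_wpM2l // exprn_ge0 ?cabs_ge0.
  - by apply: le_trans h2 _; rewrite ler_wpM2l // cabs_ge0.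
  - by apply: le_trans h3 _; rewrite ler_wpM2l // cabs_ge0.
have LEF i j : cLinf P (fun t => Tv i j * Fh i j (H t) + ((S i j)%:C)%C * Fb i j (H t)).
  by apply: (cLinf_adm W (F := fun M => Tv i j * Fh i j M + ((S i j)%:C)%C * Fb i j M)); apply: admD; exact: admZ.
pose main M := term1 M * mom_w q (Y M) + mom_w1 q (Y M) * term2 M + mom_w2 q (Y M) * term3 M.
have mainE t : main (H t) = \sum_i \sum_j (Tv i j * Fh i j (H t) + ((S i j)%:C)%C * Fb i j (H t)) +
    Q (H t) * mom_w q (Y (H t)).
  rewrite /main /term1 mulrDl.
  have e (a b c e : R[i]) : a + b + c + e = a + c + e + b by ring.
  rewrite e; congr (_ + _); rewrite /term2 /term3.
  rewrite mulr_suml !mulr_sumr -!big_split /=; apply: eq_bigr => i _.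
  rewrite mulr_suml !mulr_sumr -!big_split /=; apply: eq_bigr => j _.
  by rewrite /Fh /Fb; ring.
have amain : adm main.
  by apply: admD; [apply: admD|]; apply: admM => //; [exact: adm_term1|exact: adm_term2|exact: adm_term3].
have Lmain := cLinf_adm W amain.
have LQw : cLinf P (fun t => Q (H t) * mom_w q (Y (H t))).
  exact: (cLinf_adm W (admM aQ aw)).
have E2p : ((Ex P (fun t => cabs (Y (H t)) ^+ (q + q.+2)))%:C)%C =
   \sum_i \sum_j (Ec P (fun t => H t i j * F i j (H t)) -
     (Tv i j * Ec P (fun t => Fh i j (H t)) + ((S i j)%:C)%C * Ec P (fun t => Fb i j (H t)))) + Ec P (fun t => main (H t)).
  have -> : Ec P (fun t => main (H t)) = \sum_i \sum_j
     (Tv i j * Ec P (fun t => Fh i j (H t)) + ((S i j)%:C)%C * Ec P (fun t => Fb i j (H t))) +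
      Ec P (fun t => Q (H t) * mom_w q (Y (H t))).
    rewrite (_ : (fun t => main (H t)) = fun t => \sum_i \sum_j (Tv i j * Fh i j (H t) + ((S i j)%:C)%C * Fb i j (H t)) +
      Q (H t) * mom_w q (Y (H t))); last by apply/funext => t; exact: mainE.
    rewrite EcD //; last by apply: cLinf_sum => i; exact: cLinf_sum.
    congr (_ + _); rewrite Ec_sum; last by move=> i; exact: cLinf_sum.
    apply: eq_bigr => i _; rewrite Ec_sum //; apply: eq_bigr => j _.
    have l1 := cLinf_adm W (aFh i j); have l2 := cLinf_adm W (aFb i j).
    by rewrite EcD ?EcZ //; apply: cLinfM => //; exact: cLinf_cst.
  rewrite addrA -big_split /=; under eq_bigr => i _.
    rewrite -big_split /=; under eq_bigr => j _ do rewrite subrK.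
    rewrite -Ec_sum //; over.
  rewrite -Ec_sum; last by move=> i; exact: cLinf_sum.
  rewrite -EcD //; last by apply: cLinf_sum => i; exact: cLinf_sum.
  rewrite -Ec_real; last by apply: (Linf_admR W (f := fun M => cabs (Y M) ^+ (q + q.+2))); apply: admRX; exact: admR_cabs.
  apply: Ec_ext => t.
  transitivity (Y (H t) * mom_w q (Y (H t))).
    rewrite /mom_w mulrA -exprS -exprMn mulrC conjcM_norm -rmorphXn /= -exprM; congr ((_ ^+ _)%:C)%C.
    by rewrite addnS -addSn addnn mul2n.
  rewrite [in X in X * _]YE mulrDl mulr_suml; congr (_ + _); apply: eq_bigr => i _.
  by rewrite mulr_suml; apply: eq_bigr => j _; rewrite /F mulrA.
have LR f : admR f -> Linf P (fun t => f (H t)) := Linf_admR W (f := f).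
have bmain : cabs (Ec P (fun t => main (H t))) <=
  Ex P (fun t => cabs (term1 (H t)) * cabs (Y (H t)) ^+ (q + q.+1) +
     (q%:R * cabs (term2 (H t)) + q.+1%:R * cabs (term3 (H t))) * cabs (Y (H t)) ^+ (q + q)).
  apply: le_trans (cabs_Ec Lmain) _; apply: Ex_le.
  - exact: Linf_cabs.
  - apply: (LR (fun M => cabs (term1 M) * cabs (Y M) ^+ (q + q.+1) +
     (q%:R * cabs (term2 M) + q.+1%:R * cabs (term3 M)) * cabs (Y M) ^+ (q + q))).
    have aY' := admR_cabs aY.
    apply: admRD; first by apply: admRM; [apply: admR_cabs; exact: adm_term1|exact: admRX].
    apply: admRM; last exact: admRX.
    by apply: admRD; apply: admRM; [exact: admR_cst|apply: admR_cabs; exact: adm_term2|exact: admR_cst|apply: admR_cabs; exact: adm_term3].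
  - move=> t; rewrite /main -addrA; apply: le_trans (cabsD _ _) _; apply: lerD.
      by rewrite cabsM /mom_w cabsM !cabsX cabs_conj exprD.
    apply: le_trans (cabsD _ _) _; rewrite mulrDl; apply: lerD.
      rewrite cabsM /mom_w1 !cabsM !cabsX cabs_conj -mulrA mulrC.
      rewrite (_ : cabs (q%:R : R[i]) = q%:R); last by rewrite -(rmorph_nat (real_complex R)) cabs_real ger0_norm.
      case: (q) => [|q'] /=; first by rewrite !(mul0r, mulr0).
      rewrite (_ : (q'.+1 + q'.+1 = q'.+2 + q')%N); last by lia.
      by rewrite exprD le_eqVlt; apply/orP; left; apply/eqP; ring.
    rewrite cabsM /mom_w2 !cabsM !cabsX cabs_conj.
    rewrite (_ : cabs (q.+1%:R : R[i]) = q.+1%:R); last by rewrite -(rmorph_nat (real_complex R)) cabs_real ger0_norm.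
    rewrite le_eqVlt; apply/orP; left; apply/eqP; rewrite exprD; ring.
have -> : Ex P (fun t => cabs (Y (H t)) ^+ (q + q.+2)) = cabs (((Ex P (fun t => cabs (Y (H t)) ^+ (q + q.+2)))%:C)%C).
  by rewrite cabs_real ger0_norm //; apply: Ex_ge0 => t; rewrite exprn_ge0 ?cabs_ge0.
rewrite E2p addrC; apply: le_trans (cabsD _ _) _; apply: lerD => //.
apply: le_trans (cabs_sum _ _ _) _; apply: ler_sum => i _.
by apply: le_trans (cabs_sum _ _ _) _; apply: ler_sum => j _.
Qed.


(** With [a = 2 ^+ k.+1 * c1]: if [s >= a * B], then [s + B <= 2 * s] and the factor [B] is absorbed
    into [s / a], which leaves one half; otherwise everything is at most a power of [B]. *)
Lemma young_power (c1 B s : R) k : 1 <= c1 -> 0 < B -> 0 <= s ->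
  c1 * B * (s + B) ^+ k <= 2^-1 * s ^+ k.+1 + c1 * (2 ^+ k.+1 * c1 + 1) ^+ k * B ^+ k.+1.
Proof.
move=> c11 B0 s0; set a := 2 ^+ k.+1 * c1.
have a1 : 1 <= a.
  have : 1 <= (2 : R) ^+ k.+1 by apply: exprn_ege1; lra.
  by rewrite /a => h; nra.
have [h|h] := leP (a * B) s.
  apply: (@le_trans _ _ (2^-1 * s ^+ k.+1)); last first.
    rewrite lerDl mulr_ge0 // ?exprn_ge0 ?(ltW B0) //; rewrite mulr_ge0 ?exprn_ge0 //; lra.
  have sB : B <= s by apply: le_trans h; rewrite ler_peMl // ltW.
  apply: (@le_trans _ _ (c1 * B * (2 ^+ k * s ^+ k))).
    rewrite ler_wpM2l ?mulr_ge0 ?(ltW B0) //; first by lra.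
    by rewrite -exprMn lerXn2r ?nnegrE; lra.
  rewrite exprS mulrA [2^-1 * _]mulrA ler_wpM2r ?exprn_ge0 //.
  have : a * B = 2 * (c1 * B * 2 ^+ k) by rewrite /a exprS; ring.
  lra.
apply: (@le_trans _ _ (c1 * (a + 1) ^+ k * B ^+ k.+1)); last first.
  by rewrite lerDr mulr_ge0 ?exprn_ge0.
rewrite exprS -!mulrA ler_wpM2l //; first by lra.
rewrite mulrCA ler_wpM2l ?(ltW B0) // -exprMn lerXn2r ?nnegrE ?addr_ge0 ?mulr_ge0 ?(ltW B0) //; lra.
Qed.

Lemma Ex_entry6 i j : Ex P (fun t => cabs (H t i j) ^+ 6) <= Cp 6.
Proof.
apply: le_trans (Ex_cabsX_le W i j 6); rewrite ler_peMl //.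
  by apply: Ex_ge0 => t; rewrite exprn_ge0 ?cabs_ge0.
apply: exprn_ege1; rewrite -[leLHS]sqrtr1; apply: ler_wsqrtr; rewrite ler1n.
by case: (N) i => // -[].
Qed.

Lemma Svar_le1 i j : S i j <= 1.
Proof.
rewrite -(Svar_sum W i) (bigD1 j) //= lerDl; apply: sumr_ge0 => l _; exact: Svar_ge0.
Qed.

Definition mom_cst (q : nat) : R :=
  let c1 := 1 + (q + q.+1)%:R + 3 * cq q in
  2 * (c1 * (2 ^+ (q + q.+2) * c1 + 1) ^+ (q + q.+1) + 3 * c1).

(** Used where only crude bounds hold. The inequality [x ^+ 3 <= tau * x ^+ 6 + tau^-1] is AM-GM,
    and each [1] on the right stands for the indicator of the bad event. *)
Let cube_split (sv x tau : R) : 0 <= x -> 0 <= sv -> sv <= 1 -> 0 < tau ->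
  x ^+ 3 + 2 * sv * x <= 2 * 1 + 3 * (tau * x ^+ 6 + tau^-1 * 1).
Proof.
move=> x0 s0 s1 tau0.
have xs : sv * x <= x by rewrite ler_piMl.
have x3 : x <= 1 + x ^+ 3.
  have [x1|x1] := leP x 1; first by have := exprn_ge0 3 x0; lra.
  have : 1 <= x ^+ 2 by apply: exprn_ege1; lra.
  by rewrite exprS => ?; nra.
have t6 : x ^+ 3 <= tau * x ^+ 6 + tau^-1 * 1.
  rewrite mulr1 (_ : x ^+ 6 = (x ^+ 3) ^+ 2); last by rewrite -exprM.
  move: (x ^+ 3) (exprn_ge0 3 x0) => w w0.
  have tv : tau * tau^-1 = 1 by rewrite mulfV // gt_eqF.
  rewrite -(ler_pM2l tau0) mulrDr tv.
  by have := sqr_ge0 (tau * w - 1); nra.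
by rewrite -[2 * _ * _]mulrA; lra.
Qed.

Let cube_sum (u v s h : R) : u <= h -> s * v <= h -> u + 2 * (s * v) <= 3 * h.
Proof. by move=> h1 h2; lra. Qed.

(** On the good event the integrand is at most [c1 * B * (|Y| + B) ^+ k], to which [young_power]
    applies; on its complement [V] bounds every statistic, while the entries, which are unbounded,
    go through [cube_split]. *)
Lemma moment_bound q (good : Mat -> bool) (B hs V tau pb : R) : (0 < N)%N ->
  admb good -> 0 < B -> 0 <= hs -> 1 <= V -> 0 < tau -> tau <= 1 -> 0 <= Cp 6 ->
  (forall t, good (H t) -> [/\ y (H t) <= cabs (Y (H t)) + B, cabs (term1 (H t)) <= B,
     cabs (term2 (H t)) <= B ^+ 2, cabs (term3 (H t)) <= B ^+ 2 &
     (forall i j, cabs (H t i j) <= hs) /\ hs ^+ 3 * \sum_i \sum_j K i j (H t) <= B]) ->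
  (forall i j, S i j <= hs ^+ 2) ->
  (forall t, [/\ cabs (Y (H t)) <= V, y (H t) <= V, cabs (term1 (H t)) <= V,
     cabs (term2 (H t)) <= V & cabs (term3 (H t)) <= V]) ->
  (forall t i j, 0 <= K i j (H t) <= V) ->
  (P [set t | ~~ good (H t)] <= pb%:E)%E ->
  Ex P (fun t => cabs (Y (H t)) ^+ (q + q.+2)) <=
    mom_cst q * (B ^+ (q + q.+2) + V ^+ (q + q.+2) * N%:R ^+ 2 * (tau * Cp 6 + tau^-1 * pb)).
Proof.
move=> N0 ag B0 hs0 V1 tau0 tau1 C60 hgood hS hV hK hpb.
set k := (q + q.+1)%N; have ek : (q + q.+2)%N = k.+1 by rewrite /k !addnS.
have kE : k = (q + q).+1 by rewrite /k addnS.
have kR : k%:R = q%:R + q.+1%:R :> R by rewrite /k natrD.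
set c1 : R := 1 + k%:R + 3 * cq q.
have cq0 : 0 <= cq q by rewrite /cq !mulr_ge0.
have c11 : 1 <= c1 by rewrite /c1 -addrA lerDl addr_ge0 ?mulr_ge0.
have c10 : 0 <= c1 by exact: le_trans ler01 c11.
have V0 : 0 < V by exact: lt_le_trans ltr01 V1.
pose bad t : bool := ~~ good (H t).
have mbad : measurable [set t | bad t] by exact: (admb_not ag (wig_herm W) (wig_meas W)).
have Lbad : Linf P (bool_fun bad) by exact: Linf_bool.
have pb_ge : Ex P (bool_fun bad) <= pb by rewrite -lee_fin Ex_bool.
have Ebad0 : 0 <= Ex P (bool_fun bad) by apply: Ex_ge0 => t; rewrite /bool_fun.
have LR f : admR f -> Linf P (fun t => f (H t)) := Linf_admR W (f := f).
have aY' := admR_cabs aY.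
pose f1 M := cabs (term1 M) * cabs (Y M) ^+ k + (q%:R * cabs (term2 M) + q.+1%:R * cabs (term3 M)) * cabs (Y M) ^+ (q + q).
have af1 : admR f1.
  apply: admRD; first by apply: admRM; [apply: admR_cabs; exact: adm_term1|exact: admRX].
  apply: admRM; last exact: admRX.
  by apply: admRD; apply: admRM; [exact: admR_cst|apply: admR_cabs; exact: adm_term2|exact: admR_cst|apply: admR_cabs; exact: adm_term3].
pose f2 i j t := (cabs (H t i j) ^+ 3 + 2 * S i j * cabs (H t i j)) * (cq q * y (H t) ^+ k * K i j (H t)).
have Lh i j m : Linf P (fun t => cabs (H t i j) ^+ m) by exact: (Linf_cabsX W).
have Lf2 i j : Linf P (f2 i j).
  apply: LinfM; last first.
    apply: (LR (fun M => cq q * y M ^+ k * K i j M)).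
    by apply: admRM => //; apply: admRM; [exact: admR_cst|exact: admRX].
  by apply: LinfD => //; apply: LinfZ; exact: (Lh i j 1%N).
have main := moment_expansion q; rewrite ek in main *.
have main2 : Ex P (fun t => cabs (Y (H t)) ^+ k.+1) <= Ex P (fun t => f1 (H t) + \sum_i \sum_j f2 i j t).
  apply: le_trans main _; have L2 : Linf P (fun t => \sum_i \sum_j f2 i j t) by apply: Linf_sum => i; exact: Linf_sum.
  rewrite (ExD (LR f1 af1) L2).
  rewrite Ex_sum; last by move=> i; exact: Linf_sum.
  by rewrite lerD2l; apply: ler_sum => i _; rewrite Ex_sum.
have LYk : Linf P (fun t => cabs (Y (H t)) ^+ k.+1) by apply: (LR (fun M => cabs (Y M) ^+ k.+1)); exact: admRX.
set c2 := c1 * (2 ^+ k.+1 * c1 + 1) ^+ k.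
pose f3 i j t := 2 * bool_fun bad t + 3 * (tau * cabs (H t i j) ^+ 6 + tau^-1 * bool_fun bad t).
have Lf3 i j : Linf P (f3 i j).
  apply: LinfD; first exact: LinfZ.
  by apply: LinfZ; apply: LinfD; exact: LinfZ.
(* A majorant valid on both events. Its first summand is half of the moment being estimated and is
   finally absorbed by the left-hand side. *)
pose f4 t := 2^-1 * cabs (Y (H t)) ^+ k.+1 + (c2 * B ^+ k.+1 +
   V ^+ k.+1 * (c1 * bool_fun bad t + cq q * \sum_i \sum_j f3 i j t)).
have ptw t : f1 (H t) + \sum_i \sum_j f2 i j t <= f4 t.
  have yt := y0 t; have Yt := cabs_ge0 (Y (H t)).
  have f3_0 i j : 0 <= f3 i j t.
    by rewrite /f3 addr_ge0 ?mulr_ge0 ?addr_ge0 ?mulr_ge0 ?invr_ge0 ?exprn_ge0 ?cabs_ge0 ?(ltW tau0) // /bool_fun.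
  have S3_0 : 0 <= \sum_i \sum_j f3 i j t by apply: sumr_ge0 => i _; apply: sumr_ge0.
  case: (boolP (good (H t))) => gt.
    have [g1 g2 g3 g4 [g5 g6]] := hgood t gt.
    apply: (@le_trans _ _ (c1 * B * (cabs (Y (H t)) + B) ^+ k)); last first.
      apply: le_trans (young_power k c11 B0 Yt) _.
      rewrite /f4 -/c2 lerD2l lerDl; apply: mulr_ge0; first by rewrite exprn_ge0 // ltW.
      have bf0 : 0 <= bool_fun bad t :> R by rewrite /bool_fun.
      by apply: addr_ge0; exact: mulr_ge0.
    set s := cabs (Y (H t)) in g1 Yt *.
    have sB : s <= s + B by rewrite lerDl ltW.
    have sB0 : 0 <= s + B by rewrite addr_ge0 // ltW.
    have sk m : s ^+ m <= (s + B) ^+ m by rewrite lerXn2r ?nnegrE.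
    have h1 : cabs (term1 (H t)) * s ^+ k <= B * (s + B) ^+ k.
      by apply: ler_pM; rewrite ?cabs_ge0 ?exprn_ge0.
    have h2 : (q%:R * cabs (term2 (H t)) + q.+1%:R * cabs (term3 (H t))) * s ^+ (q + q) <= k%:R * (B * (s + B) ^+ k).
      have -> : k%:R * (B * (s + B) ^+ k) = (q%:R * (B * (s + B)) + q.+1%:R * (B * (s + B))) * (s + B) ^+ (q + q).
        by rewrite kR kE exprS; ring.
      have Bs : B ^+ 2 <= B * (s + B) by rewrite expr2 ler_pM2l // lerDr.
      apply: ler_pM; rewrite ?exprn_ge0 ?addr_ge0 ?mulr_ge0 ?cabs_ge0 //.
      by apply: lerD; rewrite ler_wpM2l //; [apply: le_trans g3 _|apply: le_trans g4 _].
    have h3 : \sum_i \sum_j f2 i j t <= 3 * cq q * (B * (s + B) ^+ k).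
      apply: (@le_trans _ _ (\sum_i \sum_j 3 * hs ^+ 3 * (cq q * (s + B) ^+ k * K i j (H t)))).
        apply: ler_sum => i _; apply: ler_sum => j _; have /andP[K0 _] := hK t i j.
        apply: ler_pM.
        - by rewrite addr_ge0 ?mulr_ge0 ?exprn_ge0 ?cabs_ge0 // Svar_ge0.
        - by rewrite !mulr_ge0 ?exprn_ge0.
        - have a1 : cabs (H t i j) ^+ 3 <= hs ^+ 3 by rewrite lerXn2r ?nnegrE ?cabs_ge0.
          have a2 : S i j * cabs (H t i j) <= hs ^+ 2 * hs by apply: ler_pM; rewrite ?cabs_ge0 ?Svar_ge0.
          by rewrite -[2 * _ * _]mulrA; apply: cube_sum => //; rewrite exprSr.
        - by rewrite ler_wpM2r // ler_wpM2l // lerXn2r ?nnegrE ?(y0 t).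
      rewrite (_ : \sum_i _ = 3 * cq q * (s + B) ^+ k * (hs ^+ 3 * \sum_i \sum_j K i j (H t))); last first.
        rewrite !mulr_sumr; apply: eq_bigr => i _; rewrite !mulr_sumr; apply: eq_bigr => j _; ring.
      rewrite -[leLHS]mulrA [B * (s + B) ^+ k]mulrC; apply: ler_wpM2l; first by rewrite mulr_ge0.
      by apply: ler_wpM2l => //; exact: exprn_ge0.
    apply: (@le_trans _ _ (B * (s + B) ^+ k + k%:R * (B * (s + B) ^+ k) + 3 * cq q * (B * (s + B) ^+ k))).
      by rewrite /f1 -/s; apply: lerD => //; exact: lerD.
    rewrite /c1 le_eqVlt; apply/orP; left; apply/eqP; ring.
  have [v1 v2 v3 v4 v5] := hV t.
  have bt : bool_fun bad t = 1 :> R by rewrite /bool_fun /bad gt.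
  have h0 : 0 <= 2^-1 * cabs (Y (H t)) ^+ k.+1 by rewrite mulr_ge0 ?exprn_ge0.
  have h1 : 0 <= c2 * B ^+ k.+1.
    by rewrite /c2 !mulr_ge0 ?exprn_ge0 ?(ltW B0) ?addr_ge0 ?mulr_ge0 ?exprn_ge0.
  apply: (@le_trans _ _ (V ^+ k.+1 * (c1 * bool_fun bad t + cq q * \sum_i \sum_j f3 i j t))); last first.
    by rewrite /f4 addrA lerDr addr_ge0.
  rewrite bt mulr1 mulrDr; apply: lerD.
    have e1 : cabs (term1 (H t)) * cabs (Y (H t)) ^+ k <= V ^+ k.+1.
      by rewrite exprS; apply: ler_pM; rewrite ?cabs_ge0 ?exprn_ge0 // lerXn2r ?nnegrE // ltW.
    have e2 : (q%:R * cabs (term2 (H t)) + q.+1%:R * cabs (term3 (H t))) * cabs (Y (H t)) ^+ (q + q) <= k%:R * V ^+ k.+1.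
      apply: (@le_trans _ _ (k%:R * V * V ^+ (q + q))).
        apply: ler_pM; rewrite ?exprn_ge0 ?addr_ge0 ?mulr_ge0 ?cabs_ge0 //; last first.
          by rewrite lerXn2r ?nnegrE // ltW.
        by rewrite /k natrD mulrDl; apply: lerD; rewrite ler_wpM2l.
      rewrite -mulrA ler_wpM2l // -exprS /k !addnS; apply: ler_weXn2l => //; lia.
    apply: le_trans (lerD e1 e2) _; rewrite mulrC.
    have VV : 0 <= V ^+ k.+1 by rewrite exprn_ge0 // ltW.
    have cV : 0 <= 3 * cq q * V ^+ k.+1 by rewrite !mulr_ge0.
    rewrite /c1 !mulrDl mul1r; lra.
  rewrite mulrA !mulr_sumr; apply: ler_sum => i _; rewrite !mulr_sumr; apply: ler_sum => j _.
  have /andP[K0 K1] := hK t i j.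
  rewrite /f2 mulrC.
  have e1 : cq q * y (H t) ^+ k * K i j (H t) <= V ^+ k.+1 * cq q.
    rewrite [V ^+ _ * _]mulrC exprS -mulrA ler_wpM2l // mulrC; apply: ler_pM; rewrite ?exprn_ge0 //.
    by rewrite lerXn2r ?nnegrE // ltW.
  apply: ler_pM; rewrite ?mulr_ge0 ?exprn_ge0 ?addr_ge0 ?mulr_ge0 ?exprn_ge0 ?cabs_ge0 ?Svar_ge0 //.
  rewrite /f3 bt; have := Svar_le1 i j; have := Svar_ge0 P H i j; have := cabs_ge0 (H t i j).
  by move=> x0 s0 s1; exact: cube_split.
have Lf4 : Linf P f4.
  apply: LinfD; first exact: LinfZ.
  apply: LinfD; first exact: Linf_cst.
  apply: LinfZ; apply: LinfD; first exact: LinfZ.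
  by apply: LinfZ; apply: Linf_sum => i; exact: Linf_sum.
have main3 : Ex P (fun t => cabs (Y (H t)) ^+ k.+1) <= Ex P f4.
  apply: le_trans main2 _; apply: Ex_le => //.
  by apply: LinfD; [exact: (LR f1)|apply: Linf_sum => i; exact: Linf_sum].
have Ef3 i j : Ex P (f3 i j) <= 5 * (tau * Cp 6 + tau^-1 * pb).
  rewrite /f3 ExD; [|exact: LinfZ|by apply: LinfZ; apply: LinfD; exact: LinfZ].
  rewrite !ExZ //; last by apply: LinfD; exact: LinfZ.
  rewrite ExD; [|exact: LinfZ|exact: LinfZ].
  rewrite !ExZ //.
  have e6 : tau * Ex P (fun t => cabs (H t i j) ^+ 6) <= tau * Cp 6 by rewrite ler_pM2l // Ex_entry6.
  have ti : 1 <= tau^-1 by rewrite invf_ge1.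
  have eb : tau^-1 * Ex P (bool_fun bad) <= tau^-1 * pb by rewrite ler_pM2l ?invr_gt0.
  have eb' : Ex P (bool_fun bad) <= tau^-1 * Ex P (bool_fun bad) by rewrite ler_peMl.
  have t6 : 0 <= tau * Cp 6 by rewrite mulr_ge0 // ltW.
  lra.
have Ef4 : Ex P f4 = 2^-1 * Ex P (fun t => cabs (Y (H t)) ^+ k.+1) + (c2 * B ^+ k.+1 +
   V ^+ k.+1 * (c1 * Ex P (bool_fun bad) + cq q * \sum_i \sum_j Ex P (f3 i j))).
  have L1 : Linf P (fun t => cq q * \sum_i \sum_j f3 i j t).
    by apply: LinfZ; apply: Linf_sum => i; exact: Linf_sum.
  have L2 : Linf P (fun t => c1 * bool_fun bad t + cq q * \sum_i \sum_j f3 i j t).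
    by apply: LinfD => //; exact: LinfZ.
  rewrite /f4 ExD; [|exact: LinfZ|by apply: LinfD; [exact: Linf_cst|exact: LinfZ]].
  rewrite ExZ // ExD; [|exact: Linf_cst|exact: LinfZ].
  rewrite Ex_cst ExZ // ExD //; last exact: LinfZ.
  rewrite ExZ // ExZ; last by apply: Linf_sum => i; exact: Linf_sum.
  rewrite Ex_sum; last by move=> i; exact: Linf_sum.
  by congr (_ + (_ + _ * (_ + _ * _))); apply: eq_bigr => i _; rewrite Ex_sum.
move: main3; rewrite Ef4 => main3.
clear hgood hS hV hK hpb ag main main2 LR af1 Lf2 Lf3 ptw Lf4 Lh Lbad mbad Ef4 LYk f1 f2 f4 aY' kE kR.
set w := tau * Cp 6 + tau^-1 * pb in Ef3 *.
have ti : 1 <= tau^-1 by rewrite invf_ge1.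
have pb0 : 0 <= pb by apply: le_trans pb_ge.
have w0 : 0 <= w by rewrite /w addr_ge0 ?mulr_ge0 ?invr_ge0 ?(ltW tau0).
have bw : Ex P (bool_fun bad) <= w.
  apply: (@le_trans _ _ (tau^-1 * pb)); first by apply: le_trans pb_ge _; rewrite ler_peMl.
  by rewrite /w lerDr mulr_ge0 // ltW.
have N1 : 1 <= N%:R ^+ 2 :> R by apply: exprn_ege1; rewrite ler1n.
have sumf3 : \sum_i \sum_j Ex P (f3 i j) <= N%:R ^+ 2 * (5 * w).
  apply: (@le_trans _ _ (\sum_(i < N) \sum_(j < N) 5 * w)).
    by apply: ler_sum => i _; apply: ler_sum => j _.
  by rewrite sumr_const card_ord sumr_const card_ord -mulrnA -[leLHS]mulr_natl natrM expr2.
have VV : 0 <= V ^+ k.+1 by rewrite exprn_ge0 // ltW.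
have last : V ^+ k.+1 * (c1 * Ex P (bool_fun bad) + cq q * \sum_i \sum_j Ex P (f3 i j)) <=
   V ^+ k.+1 * N%:R ^+ 2 * w * (3 * c1).
  have e : V ^+ k.+1 * N%:R ^+ 2 * w * (3 * c1) = V ^+ k.+1 * (3 * c1 * (N%:R ^+ 2 * w)) by ring.
  rewrite e ler_wpM2l //.
  have a1 : c1 * Ex P (bool_fun bad) <= c1 * w by rewrite ler_wpM2l.
  have a2 : cq q * \sum_i \sum_j Ex P (f3 i j) <= cq q * (N%:R ^+ 2 * (5 * w)) by rewrite ler_wpM2l.
  have a3 : w <= N%:R ^+ 2 * w by rewrite ler_peMl.
  have a4 : 0 <= N%:R ^+ 2 * w by rewrite mulr_ge0 // exprn_ge0.
  have a5 : c1 * w <= c1 * (N%:R ^+ 2 * w) by rewrite ler_wpM2l.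
  have a6 : cq q * (N%:R ^+ 2 * (5 * w)) = 5 * cq q * (N%:R ^+ 2 * w) by ring.
  have a7 : 5 * cq q * (N%:R ^+ 2 * w) <= 2 * c1 * (N%:R ^+ 2 * w).
    by rewrite ler_wpM2r // /c1; have : 0 <= k%:R :> R by []; lra.
  lra.
rewrite /mom_cst -/k ek -/c1.
have c20 : 0 <= c1 * (2 ^+ k.+1 * c1 + 1) ^+ k.
  by rewrite mulr_ge0 ?exprn_ge0 ?addr_ge0 ?mulr_ge0 ?exprn_ge0.
have BB : 0 <= B ^+ k.+1 by rewrite exprn_ge0 // ltW.
have Vw : 0 <= V ^+ k.+1 * N%:R ^+ 2 * w by apply: mulr_ge0 => //; apply: mulr_ge0 => //; exact: exprn_ge0.
have x1 : 0 <= 3 * c1 * B ^+ k.+1 by apply: mulr_ge0 => //; exact: mulr_ge0.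
have x2 : 0 <= c1 * (2 ^+ k.+1 * c1 + 1) ^+ k * (V ^+ k.+1 * N%:R ^+ 2 * w) by rewrite mulr_ge0.
rewrite -/c1 in main3 last *; rewrite -/c2 in c20 x2 *.
move: main3 last x1 x2; move: (Ex P (fun t => cabs (Y (H t)) ^+ k.+1)) => E.
move: (V ^+ k.+1 * N%:R ^+ 2 * w) (V ^+ k.+1 * (_ + _)) (B ^+ k.+1) => X1 X2 X3 h1 h2 h3 h4.
have : 2 * (c2 + 3 * c1) * (X3 + X1) = 2 * (c2 * X3 + X1 * (3 * c1)) + 2 * (3 * c1 * X3 + c2 * X1) by ring.
lra.
Qed.

End MomentMethod.

#[global] Hint Extern 0 (is_true (_ <= cabs _)) => apply: cabs_ge0 : core.

Lemma ler_wXn2r {R : realType} (a b : R) n : 0 <= a -> a <= b -> a ^+ n <= b ^+ n.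
Proof. by move=> a0 ab; rewrite lerXn2r // nnegrE // (le_trans a0). Qed.

(** * Sharp bounds on a good event, crude bounds elsewhere *)

Section TwoRegimes.
Context {R : realType} (C : R) (Cp : nat -> R) (N : nat) d (T : measurableType d) (P : probability T R).
Variable H : T -> 'M[R[i]]_N.
Hypothesis W : wigner C Cp P H.
Notation Mat := 'M[R[i]]_N.
Notation S := (Svar P H).
Notation Tv := (Tvar P H).

Lemma admb_entry i j (c : R) : admb (fun M : Mat => cabs (M i j) <= c).
Proof.
move=> d' T' M _ mM; have := measurable_fun_ler (measurable_cabs (mM i j)) (@measurable_cst _ _ T' R setT c).
move=> /(_ measurableT [set true]); rewrite setTI => /(_ I).
by [].
Qed.

Variables (Y Q : Mat -> R[i]) (Yh Yb Z Zh Zb : 'I_N -> 'I_N -> Mat -> R[i]).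
Variables (y1 y2 z0 z1 z2 : 'I_N -> 'I_N -> Mat -> R).
Variables (good : Mat -> bool) (B V hs : R).
Hypothesis aY : adm Y.
Hypothesis aQ : adm Q.
Hypothesis aYh : forall i j, adm (Yh i j).
Hypothesis aYb : forall i j, adm (Yb i j).
Hypothesis aZ : forall i j, adm (Z i j).
Hypothesis aZh : forall i j, adm (Zh i j).
Hypothesis aZb : forall i j, adm (Zb i j).
Hypothesis ay1 : forall i j, admR (y1 i j).
Hypothesis ay2 : forall i j, admR (y2 i j).
Hypothesis az0 : forall i j, admR (z0 i j).
Hypothesis az1 : forall i j, admR (z1 i j).
Hypothesis az2 : forall i j, admR (z2 i j).
Hypothesis ag : admb good.
Hypothesis YE : forall t, Y (H t) = \sum_i \sum_j H t i j * Z i j (H t) + Q (H t).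
Hypothesis crude : forall t i j, let M := H t in let M0 := zer i j M in
  jet (M i j) (Y M) (Y M0) (Yh i j M) (Yb i j M) (Yh i j M0) (Yb i j M0) V V V /\
  jet (M i j) (Z i j M) (Z i j M0) (Zh i j M) (Zb i j M) (Zh i j M0) (Zb i j M0) V V V.
Hypothesis crudeQ : forall t, cabs (Q (H t)) <= V.
Hypothesis crudeY : forall t, cabs (Y (H t)) <= V.
Hypothesis sharp : forall t, good (H t) -> forall i j, let M := H t in let M0 := zer i j M in
  [/\ jet (M i j) (Y M) (Y M0) (Yh i j M) (Yb i j M) (Yh i j M0) (Yb i j M0)
     (cabs (Y M) + B) (y1 i j M) (y2 i j M),
   jet (M i j) (Z i j M) (Z i j M0) (Zh i j M) (Zb i j M) (Zh i j M0) (Zb i j M0)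
     (z0 i j M) (z1 i j M) (z2 i j M),
   [/\ y1 i j M <= V, y2 i j M <= V & z0 i j M <= V] & [/\ z1 i j M <= V, z2 i j M <= V & cabs (M i j) <= hs]].
Hypothesis hterm : forall t, good (H t) ->
  [/\ cabs (term1 P H Q Zh Zb (H t)) <= B, cabs (term2 P H Yh Yb Z (H t)) <= B ^+ 2,
      cabs (term3 P H Yh Yb Z (H t)) <= B ^+ 2 &
      hs ^+ 3 * \sum_i \sum_j (z2 i j (H t) + z1 i j (H t) * (y1 i j (H t) / B)
        + z0 i j (H t) * (y2 i j (H t) / B + (y1 i j (H t) / B) ^+ 2)) <= B].
Hypothesis N0 : (0 < N)%N.
Hypothesis V2 : 2 <= V.
Hypothesis NV : N%:R <= V.
Hypothesis BV : V^-1 <= B.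
Hypothesis VB : B <= V.
Hypothesis hs0 : 0 <= hs.
Hypothesis hS : forall i j, S i j <= hs ^+ 2.

Lemma two_regime_moment q (tau pb : R) : 0 < tau -> tau <= 1 -> 0 <= Cp 6 ->
  (P [set t | ~~ good (H t)] <= pb%:E)%E ->
  Ex P (fun t => cabs (Y (H t)) ^+ (q + q.+2)) <=
    mom_cst q * (B ^+ (q + q.+2) + (V ^+ 8) ^+ (q + q.+2) * N%:R ^+ 2 * (tau * Cp 6 + tau^-1 * pb)).
Proof.
move=> tau0 tau1 C60 hpb.
have V0 : 0 < V by apply: lt_le_trans V2.
have B0 : 0 < B by apply: lt_le_trans BV; rewrite invr_gt0.
have Bi : B^-1 <= V by rewrite -[leRHS]invrK lef_pV2 // posrE ?invr_gt0.
have Bi0 : 0 <= B^-1 by rewrite invr_ge0 ltW.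
have V0' := ltW V0.
have V1 : 1 <= V by apply: le_trans V2; rewrite ler1n.
(* Outside [good] the jets are used with [a = b = 1] and all other bounds equal to [V], whence
   [V + V * 1 + V * (1 + 1 ^+ 2)]. *)
pose K i j M := if good M then z2 i j M + z1 i j M * (y1 i j M / B)
        + z0 i j M * (y2 i j M / B + (y1 i j M / B) ^+ 2) else V + V + V * 2.
pose y M := if good M then cabs (Y M) + B else V.
have pw m n : (m <= n)%N -> V ^+ m <= V ^+ n by move=> mn; exact: ler_weXn2l.
have two m : 2 * V ^+ m <= V ^+ m.+1 by rewrite exprS ler_wpM2r ?exprn_ge0.
have four m : 4 * V ^+ m <= V ^+ m.+2.
  by apply: le_trans (two _); rewrite (_ : 4 = 2 * 2) -?mulrA ?ler_pM2l // -natrM.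
have Vp m : 0 <= V ^+ m by rewrite exprn_ge0.
have VV8 : V <= V ^+ 8 by rewrite -[leLHS]expr1 pw.
apply: (@moment_bound _ _ _ _ _ _ _ _ W Y Q Yh Yb Z Zh Zb y K _ _ _ _ _ _ _ _ _ _ _ _ q good B hs (V ^+ 8) tau pb) => //.
- apply: admR_if => //; last exact: admR_cst.
  by apply: admRD; [exact: admR_cabs|exact: admR_cst].
- move=> i j; apply: admR_if => //; last exact: admR_cst.
  have hc := admR_cst N B^-1.
  have h1 : admR (fun M => y1 i j M / B) by exact: admRM.
  by apply: admRD; [apply: admRD => //; exact: admRM|apply: admRM => //; apply: admRD; [exact: admRM|exact: admRX]].
- by move=> t; rewrite /y; case: ifP => _ //; apply: addr_ge0; [exact: cabs_ge0|exact: ltW].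
- move=> t i j M M0; have [cY cZ] := crude t i j; rewrite /K -/M.
  case: (boolP (good M)) => gM; last first.
    exists 1, 1, V, V, V; split; rewrite // /jetr /y ?(negbTE gM) ?mulr1 //.
    by rewrite expr1n -(natrD _ 1 1).
  have [sY sZ _ _] := sharp gM i j.
  have k1 := jet_k1 sY; have k2 := jet_k2 sY.
  (* The bounds become relative by dividing by [B], since the size used for [Y] is at least [B]. *)
  exists (y1 i j M / B), (y2 i j M / B), (z0 i j M), (z1 i j M), (z2 i j M); split => //.
  - by rewrite mulr_ge0.
  - by rewrite mulr_ge0.
  rewrite /jetr /y gM; apply: jet_le sY => //.
    by rewrite mulrCA ler_peMr // ler_pdivlMr // mul1r lerDr cabs_ge0.
  by rewrite mulrCA ler_peMr // ler_pdivlMr // mul1r lerDr cabs_ge0.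
- by apply: exprn_ege1.
- move=> t gt; have [h1 h2 h3 h4] := hterm gt; split => //; first by rewrite /y gt.
  split; first by move=> i j; have [_ _ _ []] := sharp gt i j.
  apply: le_trans h4; rewrite ler_wpM2l ?exprn_ge0 //.
  by apply: ler_sum => i _; apply: ler_sum => j _; rewrite /K gt.
- move=> t; have Tb i j : cabs (Tv i j) <= 1 by apply: le_trans (Tvar_le W i j) (Svar_le1 W i j).
  have Sb i j : cabs (((S i j)%:C)%C) <= 1.
    by rewrite cabs_real ger0_norm ?Svar_ge0 //; exact: (Svar_le1 W i j).
  have two_le i j (u v : R[i]) : cabs u <= V -> cabs v <= V -> cabs (Tv i j * u + ((S i j)%:C)%C * v) <= 2 * V.
    move=> hu hv; rewrite (_ : 2 * V = 1 * V + 1 * V); last by ring.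
    by apply: le_trans (cabsD _ _) _; rewrite !cabsM; apply: lerD; apply: ler_pM.
  have dsum (F : 'I_N -> 'I_N -> R[i]) m : (forall i j, cabs (F i j) <= 2 * V ^+ m) ->
     cabs (\sum_i \sum_j F i j) <= V ^+ m.+3.
    move=> hF; apply: (@le_trans _ _ (\sum_(i < N) \sum_(j < N) 2 * V ^+ m)).
      apply: le_trans (cabs_sum _ _ _) _; apply: ler_sum => i _.
      by apply: le_trans (cabs_sum _ _ _) _; apply: ler_sum => j _.
    rewrite sumr_const card_ord sumr_const card_ord -mulrnA -[leLHS]mulr_natl natrM -mulrA.
    rewrite exprS [V ^+ m.+2]exprS.
    by apply: ler_pM => //; [rewrite !mulr_ge0|apply: ler_pM => //; rewrite mulr_ge0].
  have jY i j := (crude t i j).1; have jZ i j := (crude t i j).2.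
  have mul_le (u v : R[i]) : cabs u <= V -> cabs v <= 2 * V -> cabs (u * v) <= 2 * V ^+ 2.
    by move=> hu hv; rewrite cabsM expr2 mulrCA; apply: ler_pM.
  split.
  - exact: le_trans (crudeY t) _.
  - rewrite /y; case: ifP => // _; apply: (@le_trans _ _ (V ^+ 2)); last exact: pw.
    apply: le_trans (two 1%N); rewrite expr1 (_ : 2 * V = V + V); last by ring.
    by apply: lerD => //; exact: crudeY.
  - apply: le_trans (cabsD _ _) _; apply: (@le_trans _ _ (V ^+ 4 + V ^+ 4)).
      apply: lerD; last by apply: le_trans (crudeQ t) _; rewrite -[leLHS]expr1 pw.
      by apply: dsum => i j; apply: two_le; [case: (jZ i j)|case: (jZ i j)].
    by rewrite (_ : _ + _ = 2 * V ^+ 4); [apply: le_trans (two _) _; exact: pw|ring].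
  - apply: (@le_trans _ _ (V ^+ 5)); last exact: pw.
    by apply: dsum => i j; apply: mul_le; [case: (jZ i j)|apply: two_le; case: (jY i j)].
  - apply: (@le_trans _ _ (V ^+ 5)); last exact: pw.
    by apply: dsum => i j; apply: mul_le; [case: (jZ i j)|apply: two_le; rewrite cabs_conj; case: (jY i j)].
- move=> t i j; rewrite /K; case: ifP => gt; last first.
    rewrite (_ : _ + _ = 4 * V ^+ 1) ?expr1; last by ring.
    by rewrite mulr_ge0 //= -[X in 4 * X]expr1; apply: le_trans (four _) _; exact: pw.
  have [sY sZ [l1 l2 l3] [l4 l5 _]] := sharp gt i j.
  have b1 := jet_k1 sY; have b2 := jet_k2 sY; have b3 := jet_k0 sZ; have b4 := jet_k1 sZ; have b5 := jet_k2 sZ.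
  have e1 : y1 i j (H t) / B <= V ^+ 2 by rewrite expr2; apply: ler_pM.
  have e2 : y2 i j (H t) / B <= V ^+ 2 by rewrite expr2; apply: ler_pM.
  have p1 : 0 <= y1 i j (H t) / B by rewrite mulr_ge0.
  have p2 : 0 <= y2 i j (H t) / B by rewrite mulr_ge0.
  have e3 : (y1 i j (H t) / B) ^+ 2 <= V ^+ 4.
    by rewrite (exprM V 2 2); exact: ler_wXn2r.
  apply/andP; split; first by rewrite !addr_ge0 ?mulr_ge0 ?addr_ge0 ?exprn_ge0.
  apply: (@le_trans _ _ (V ^+ 5 + V ^+ 5 + V ^+ 5 * 2)); last first.
    by rewrite (_ : _ + _ = 4 * V ^+ 5); [apply: le_trans (four _) _; exact: pw|ring].
  apply: lerD; first apply: lerD.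
  - by apply: le_trans l5 _; rewrite -[leLHS]expr1 pw.
  - apply: (@le_trans _ _ (V * V ^+ 2)); last by rewrite -exprS pw.
    exact: ler_pM.
  - rewrite [V ^+ 5]exprS -mulrA; apply: ler_pM => //; first by apply: addr_ge0 => //; exact: exprn_ge0.
    rewrite (_ : V ^+ 4 * 2 = V ^+ 4 + V ^+ 4); last by ring.
    by apply: lerD => //; apply: le_trans e2 _; exact: pw.
Qed.

(** Markov's inequality for the moment of order [p = q + q.+2]. Dividing by [B ^+ p] costs [V ^+ p],
    and [N ^+ 2] costs [V ^+ 2]; with [(V ^+ 8) ^+ p] this gives the exponent [9 * p + 2]. *)
Lemma two_regime_tail q (tau pb l : R) : 0 < tau -> tau <= 1 -> 0 <= Cp 6 -> 1 <= l -> (0 <= mom_cst q :> R) ->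
  0 <= pb -> (P [set t | ~~ good (H t)] <= pb%:E)%E ->
  (P [set t | ~~ (cabs (Y (H t)) <= l * B)%R] <=
    (mom_cst q * (l ^- (q + q.+2) + V ^+ (9 * (q + q.+2) + 2) * (tau * Cp 6 + tau^-1 * pb)))%:E)%E.
Proof.
move=> tau0 tau1 C60 l1 c0 pb0 hpb.
have V0 : 0 < V by apply: lt_le_trans V2.
have B0 : 0 < B by apply: lt_le_trans BV; rewrite invr_gt0.
have Bi : B^-1 <= V by rewrite -[leRHS]invrK lef_pV2 // posrE ?invr_gt0.
have Bi0 : 0 <= B^-1 by rewrite invr_ge0 ltW.
have l0 : 0 < l by apply: lt_le_trans l1.
have := two_regime_moment q tau0 tau1 C60 hpb.
set p := (q + q.+2)%N => hE.
have aYp : admR (fun M => cabs (Y M) ^+ p) by apply: admRX; exact: admR_cabs.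
have mb : measurable [set t | ~~ (cabs (Y (H t)) <= l * B)%R].
  have := admb_not (admb_le (admR_cabs aY) (admR_cst N (l * B))).
  by move=> /(_ _ _ _ (wig_herm W) (wig_meas W)).
apply: (@le_trans _ _ (((l * B) ^+ p)^-1 * Ex P (fun t => cabs (Y (H t)) ^+ p))%:E).
  apply: (Ex_markov (f := fun t => cabs (Y (H t)) ^+ p)) => //.
  - exact: (Linf_admR W aYp).
  - by rewrite exprn_gt0 // mulr_gt0.
  - by move=> t; rewrite exprn_ge0.
  by move=> t; rewrite -ltNge => /ltW h; apply: ler_wXn2r => //; rewrite mulr_ge0 // ltW.
rewrite lee_fin.
have w0 : 0 <= tau * Cp 6 + tau^-1 * pb by rewrite addr_ge0 ?mulr_ge0 ?invr_ge0 ?(ltW tau0).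
apply: (@le_trans _ _ (((l * B) ^+ p)^-1 * (mom_cst q * (B ^+ p + (V ^+ 8) ^+ p * N%:R ^+ 2 * (tau * Cp 6 + tau^-1 * pb))))).
  by rewrite ler_wpM2l // invr_ge0 exprn_ge0 // mulr_ge0 ?ltW.
rewrite mulrCA ler_wpM2l // mulrDr; apply: lerD.
  by rewrite exprMn invfM -mulrA mulVf ?mulr1 // expf_neq0 // gt_eqF.
rewrite mulrA ler_wpM2r // exprMn invfM mulnC exprD mulrA.
have Vp m : 0 <= V ^+ m by rewrite exprn_ge0 // ltW.
apply: ler_pM; rewrite ?mulr_ge0 ?invr_ge0 ?exprn_ge0 ?(ltW V0) ?(ltW B0) ?(ltW l0) //; last exact: ler_wXn2r.
rewrite -mulrA; apply: (@le_trans _ _ (1 * (V ^+ p * (V ^+ 8) ^+ p))).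
  apply: ler_pM; rewrite ?mulr_ge0 ?invr_ge0 ?exprn_ge0 ?(ltW B0) ?(ltW l0) ?(ltW V0) //.
    by rewrite invf_le1 ?exprn_gt0 // exprn_ege1.
  by rewrite ler_wpM2r ?exprn_ge0 ?(ltW V0) // -exprVn; exact: ler_wXn2r.
by rewrite mul1r -exprMn -exprS -exprM mulnC.
Qed.
End TwoRegimes.

Lemma mom_cst_ge0 {R : realType} q : 0 <= mom_cst q :> R.
Proof.
rewrite /mom_cst; set k := (q + q.+1)%:R; set c1 := 1 + _ + _.
have k0 : 0 <= k :> R by [].
have c0 : 0 <= c1 by rewrite /c1 !addr_ge0 ?mulr_ge0.
rewrite mulr_ge0 // addr_ge0 ?mulr_ge0 // exprn_ge0 // addr_ge0 ?mulr_ge0 // exprn_ge0 //.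
Qed.

(** * Choice of parameters in large dimension *)

Section Asymptotics.
Context {R : realType}.

Lemma natr_archi (A : R) : exists n0 : nat, forall n, (n0 <= n)%N -> A <= n%:R.
Proof.
exists (Num.bound `|A|) => n hn.
have h : `|A| < (Num.bound `|A|)%:R by exact: archi_boundP.
apply: le_trans (ler_norm A) _; apply: le_trans (ltW h) _; by rewrite ler_nat.
Qed.

Lemma powR_archi (th A : R) : 0 < th -> exists n0 : nat, forall n, (n0 <= n)%N ->
  [/\ (0 < n)%N, A <= n%:R & A <= n%:R `^ th].
Proof.
move=> th0; set a := Num.max A 1.
have [n0 h] := natr_archi (Num.max a (a `^ th^-1)).
exists n0 => n /h; rewrite ge_max => /andP[n1 hn].
have a0 : 0 < a by rewrite lt_max ltr01 orbT.
have Aa : A <= a by rewrite le_max lexx.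
split; first by rewrite -(ltr_nat R) (lt_le_trans a0).
  exact: le_trans n1.
apply: (le_trans Aa); rewrite -[leLHS]powRr1 ?(ltW a0) //.
rewrite -[X in a `^ X](mulVf (lt0r_neq0 th0)).
by rewrite powRrM; apply: ge0_ler_powR; rewrite ?nnegrE ?powR_ge0 // ltW.
Qed.

(* The order [q] of the moment makes the power of [N] from the sharp bound win; [tau] trades the sixth
   moment of an entry against the probability of the bad event, where only crude bounds hold. *)
Lemma tail_params (th C6 : R) (D c : nat) : 0 < th -> 0 <= C6 ->
  exists D' N0 : nat, forall N, (N0 <= N)%N -> exists q, exists2 tau, 0 < tau <= 1 &
  [/\ (0 < N)%N, 1 <= (N%:R : R) `^ th &
   mom_cst q * ((N%:R `^ th) ^- (q + q.+2) + (N%:R ^+ c) ^+ (9 * (q + q.+2) + 2) *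
     (tau * C6 + tau^-1 * N%:R ^- D')) <= N%:R ^- D].
Proof.
move=> th0 C60.
have [q hq] := natr_archi (D.+1%:R / th).
pose p := (q + q.+2)%N.
(* With [tau = N ^- m] and [D' = 2 m], both [tau] and [tau^-1 * N ^- D'] equal [N ^- m]; this beats
   the crude power of [N] and leaves [N ^- D.+1], whose spare factor absorbs
   [mom_cst q * (C6 + 2)]. *)
pose m := (c * (9 * p + 2) + D.+1)%N.
have [N0 hN] := powR_archi (Num.max 1 (mom_cst q * (C6 + 2))) th0.
exists (m + m)%N, N0 => N /hN[N1]; rewrite !ge_max => /andP[NR1 Nm] /andP[L1 _].
have N0' : 0 < N%:R :> R by rewrite ltr0n.
have pw k : 0 < N%:R ^+ k :> R by rewrite exprn_gt0.
exists q, (N%:R ^- m).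
  by rewrite invr_gt0 pw invf_le1 ?pw // exprn_ege1.
split => //.
have e1 : (N%:R `^ th) ^- p <= N%:R ^- D.+1 :> R.
  rewrite lef_pV2 ?posrE ?exprn_gt0 ?powR_gt0 //.
  rewrite -!powR_mulrn ?powR_ge0 ?ler0n // -powRrM; apply: ler_powR => //.
  have := hq q (leqnn q); rewrite ler_pdivrMr // mulrC => h.
  apply: le_trans h _; rewrite ler_pM2l // ler_nat /p; lia.
have e2 : (N%:R ^+ c) ^+ (9 * p + 2) * (N%:R ^- m * C6 + (N%:R ^- m)^-1 * N%:R ^- (m + m)) = N%:R ^- D.+1 * (C6 + 1) :> R.
  rewrite invrK -exprM; have -> : N%:R ^+ m = N%:R ^+ (c * (9 * p + 2)) * N%:R ^+ D.+1 :> R by rewrite -exprD.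
  rewrite [N%:R ^+ (m + m)]exprD {}/m exprD.
  have a0 := lt0r_neq0 (pw (c * (9 * p + 2))%N); have b0 := lt0r_neq0 (pw D.+1).
  move: (N%:R ^+ (c * _)) (N%:R ^+ D.+1) a0 b0 => a b a0 b0.
  by field; rewrite a0 b0.
rewrite -/p e2; have m0 := mom_cst_ge0 (R := R) q.
apply: (@le_trans _ _ (mom_cst q * (N%:R ^- D.+1 * (C6 + 2)))).
  rewrite ler_wpM2l //; move: e1; set x := _ ^- D.+1; lra.
rewrite mulrCA -[leRHS]mulr1 exprSr invfM -mulrA ler_wpM2l ?invr_ge0 ?exprn_ge0 //.
by rewrite ler_pdivrMl // mulr1.
Qed.

End Asymptotics.

(** * Events of overwhelming probability *)

Section HighProbability.
Context {R : realType} (C : R) (Cp : nat -> R) (N : nat) d (T : measurableType d) (P : probability T R).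
Variable H : T -> 'M[R[i]]_N.
Hypothesis W : wigner C Cp P H.
Notation Mat := 'M[R[i]]_N.

(** The exponent is explicit because each union or conjunction lowers it by a fixed amount that has
    to be provided for in advance. *)
Definition whp (D : nat) (b : Mat -> bool) : Prop := (P [set t | ~~ b (H t)] <= (N%:R ^- D)%:E)%E.

Lemma admb_meas b : admb b -> measurable [set t | b (H t)].
Proof. by move=> /(_ _ _ _ (wig_herm W) (wig_meas W)). Qed.

Lemma whp_Ex D b : admb b -> whp D b <-> Ex P (bool_fun (fun t => ~~ b (H t))) <= N%:R ^- D.
Proof.
move=> ab; rewrite /whp -lee_fin Ex_bool //; exact: (admb_meas (admb_not ab)).
Qed.

Lemma whp_imp D D' b b' : (0 < N)%N -> (D' <= D)%N -> admb b -> admb b' ->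
  (forall t, b (H t) -> b' (H t)) -> whp D b -> whp D' b'.
Proof.
move=> N0 DD ab ab' h; rewrite /whp => hb.
have mn b0 : admb b0 -> measurable [set t | ~~ b0 (H t)] by move=> a; exact: (admb_meas (admb_not a)).
apply: (@le_trans _ _ (P [set t | ~~ b (H t)])).
  apply: le_measure; rewrite ?inE; [exact: mn|exact: mn|].
  by move=> t /=; apply: contra; exact: h.
apply: (le_trans hb); rewrite lee_fin lef_pV2 ?posrE ?exprn_gt0 ?ltr0n //.
by apply: ler_weXn2l => //; rewrite ler1n.
Qed.

(** Union bound: [N ^ k] events cost [k] in the exponent. *)
Lemma whp_forall (I : finType) D k (b : I -> Mat -> bool) : (0 < N)%N -> (#|I| <= N ^ k)%N ->
  (forall i, admb (b i)) -> (forall i, whp (D + k) (b i)) -> whp D (fun M => [forall i, b i M]).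
Proof.
move=> N0 Ik ab hb; rewrite whp_Ex; last exact: admb_forall.
have L i : Linf P (bool_fun (fun t => ~~ b i (H t))).
  by apply: Linf_bool; exact: (admb_meas (admb_not (ab i))).
apply: (@le_trans _ _ (Ex P (fun t => \sum_i bool_fun (fun t => ~~ b i (H t)) t))).
  apply: Ex_le; [|exact: Linf_sum|].
    by apply: Linf_bool; exact: (admb_meas (admb_not (admb_forall ab))).
  move=> t; rewrite /bool_fun; case: (boolP [forall i, b i (H t)]) => /= h.
    by apply: sumr_ge0.
  move: h; rewrite negb_forall => /existsP[i bi].
  by rewrite (bigD1 i) //= bi lerDl sumr_ge0.
rewrite Ex_sum //; apply: (@le_trans _ _ (\sum_(i : I) N%:R ^- (D + k))).
  by apply: ler_sum => i _; apply/whp_Ex.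
rewrite sumr_const -[leLHS]mulr_natl exprD invfM mulrCA -[leRHS]mulr1 ler_wpM2l ?invr_ge0 ?exprn_ge0 //.
by rewrite ler_pdivrMr ?exprn_gt0 ?ltr0n // mul1r -natrX ler_nat.
Qed.

Lemma whp_and D b1 b2 : (1 < N)%N -> admb b1 -> admb b2 ->
  whp D.+1 b1 -> whp D.+1 b2 -> whp D (fun M => b1 M && b2 M).
Proof.
move=> N1 a1 a2 h1 h2.
have N0 : (0 < N)%N by apply: ltnW.
have a12 : admb (fun M => b1 M && b2 M) by exact: admb_and.
pose b (i : bool) := if i then b1 else b2.
have ab i : admb (b i) by case: i.
apply: (@whp_imp D D (fun M => [forall i, b i M])) => //; first exact: admb_forall.
  by move=> t /forallP h; have := h true; have := h false; rewrite /b => -> ->.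
by apply: (@whp_forall _ D 1) => //; [rewrite card_bool expn1|case; rewrite addn1].
Qed.

End HighProbability.

(** Markov's inequality with a moment [q] such that [N ^ (th * q)] exceeds [N ^ (D + 3)]: two powers
    of [N] pay for the union over the entries, and the third absorbs [Cp q]. *)
Lemma whp_entries {R : realType} (C : R) (Cp : nat -> R) (th : R) (D : nat) : 0 < th ->
  exists N0 : nat, forall N, (N0 <= N)%N -> forall d (T : measurableType d) (P : probability T R)
   (H : T -> 'M[R[i]]_N), wigner C Cp P H ->
   whp P H D (fun M => [forall i, [forall j, cabs (M i j) <= N%:R `^ th / Num.sqrt N%:R]]).
Proof.
move=> th0.
have [q hq] := natr_archi ((D + 3)%:R / th).
have [N0 hN] := powR_archi (Num.max 1 (Cp q)) th0.
exists N0 => N /hN[N1]; rewrite !ge_max => /andP[NR1 Nm] /andP[L1 _] d T P H W.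
have N0' : 0 < N%:R :> R by rewrite ltr0n.
have n0 : 0 < Num.sqrt (N%:R : R) by rewrite sqrtr_gt0.
have L0 : 0 < (N%:R : R) `^ th by rewrite powR_gt0.
have ae (i j : 'I_N) : admb (fun M : 'M[R[i]]_N => cabs (M i j) <= N%:R `^ th / Num.sqrt N%:R) by exact: admb_entry.
apply: (whp_forall W (k := 1)) => //.
- by rewrite card_ord expn1.
- by move=> i; exact: admb_forall.
move=> i; apply: (whp_forall W (k := 1)) => //; first by rewrite card_ord expn1.
move=> j.
rewrite /whp; set l := _ / _.
have l0 : 0 < l by rewrite divr_gt0.
apply: (@le_trans _ _ (((l ^+ q)^-1 * Ex P (fun t => cabs (H t i j) ^+ q))%:E)).
  apply: (Ex_markov (f := fun t => cabs (H t i j) ^+ q)) => //.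
  - exact: (Linf_cabsX W).
  - by rewrite exprn_gt0.
  - by move=> t; apply: exprn_ge0.
  - exact: (admb_meas W (admb_not (ae i j))).
  by move=> t; rewrite -ltNge => /ltW h; apply: ler_wXn2r => //; exact: ltW.
rewrite lee_fin.
have := Ex_cabsX_le W i j q.
have e1 : N%:R ^+ (D + 3) <= (N%:R `^ th) ^+ q :> R.
  rewrite -!powR_mulrn ?powR_ge0 ?ler0n // -powRrM; apply: ler_powR => //.
  by have := hq q (leqnn q); rewrite ler_pdivrMr // mulrC.
move=> h; rewrite /l exprMn exprVn invfM invrK -mulrA.
apply: (@le_trans _ _ ((N%:R `^ th) ^- q * N%:R)).
  by rewrite ler_wpM2l ?invr_ge0 ?exprn_ge0 ?(ltW L0) //; apply: le_trans h _.
apply: (@le_trans _ _ (N%:R ^- (D + 3) * N%:R)).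
  by rewrite ler_wpM2r // lef_pV2 // posrE exprn_gt0.
have -> : (D + 1 + 1 = D + 2)%N by rewrite -addnA.
have -> : (D + 3 = (D + 2).+1)%N by rewrite -addnS.
by rewrite exprSr invfM -mulrA mulVf ?mulr1 // gt_eqF.
Qed.

(** * Resolvent entries *)

Section ResolventJets.
Context {R : realType} (N : nat) (z : R[i]).
Hypothesis z0 : ImC z != 0.
Notation Mat := 'M[R[i]]_N.
Notation Vec := 'cV[R[i]]_N.
Implicit Types (M : Mat) (x y : Vec).

Definition gq M x y : R[i] := cdot x (resolvent M z *m y).

Lemma adm_gq x y : adm (fun M => gq M x y).
Proof. exact: adm_bilin. Qed.

Lemma delta_mulmx (i j : 'I_N) (v : Vec) : delta_mx i j *m v = v j 0 *: ebasis i.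
Proof.
apply/matrixP => k l; rewrite ord1 !mxE (bigD1 j) //= big1 ?addr0 => [|l' hl].
  by rewrite !mxE !eqxx andbT mulrC; case: (k == i); rewrite ?mulr1 ?mulr0.
by rewrite mxE (negbTE hl) andbF mul0r.
Qed.

(** On the diagonal [M i j] and its conjugate are the same real entry, which [zer_diff] must
    subtract only once. *)
Definition offd (i j : 'I_N) : R[i] := (i != j)%:R.
Lemma offd_le1 i j : cabs (offd i j) <= 1.
Proof. by rewrite /offd; case: (i != j); rewrite ?cabs0 ?cabs1. Qed.

Lemma zer_diff M i j : hermitian M ->
  M - zer i j M = (offd i j * M i j) *: delta_mx i j + conjc (M i j) *: delta_mx j i.
Proof.
move=> hM; apply/matrixP => k l; rewrite !mxE /offd.
have [->|ki] := eqVneq k i; have [->|lj] := eqVneq l j; rewrite /= ?andbT ?andbF ?orbT ?orbF.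
- have [->|ij] := eqVneq i j; last by rewrite subr0 /= mul1r mulr1 mulr0 addr0.
  by rewrite /= subr0 mul0r mul0r add0r mulr1 -hM.
- have [->|li] := eqVneq i j; last first.
    by rewrite /= subrr !mulr0 addr0.
  by rewrite (negbTE lj) /= subrr !mulr0 addr0.
- have [kj|kj] := eqVneq k j; last by rewrite /= subrr !mulr0 addr0.
  have [ji|ji] := eqVneq j i; first by rewrite kj ji eqxx in ki.
  by rewrite /= subrr !mulr0 addr0.
- have [->|kj] := eqVneq k j; have [->|li] := eqVneq l i; rewrite /= ?subrr ?mulr0 ?addr0 //.
  by rewrite subr0 mulr1 add0r -hM.
Qed.

Lemma gq_zer M i j x y : hermitian M ->
  gq M x y - gq (zer i j M) x y =
    - (offd i j * M i j * (gq (zer i j M) x (ebasis i) * gq M (ebasis j) y)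
      + conjc (M i j) * (gq (zer i j M) x (ebasis j) * gq M (ebasis i) y)).
Proof.
move=> hM; rewrite /gq -cdotBr -mulmxBl resolvent_perturb //; last exact: zer_herm.
rewrite mulNmx cdotNr zer_diff // mulmxDr !mulmxDl cdotDr; congr (- (_ + _)).
  by rewrite -!mulmxA -scalemxAl -scalemxAr cdotZr delta_mulmx -scalemxAr cdotZr -cdot_ebasisl; ring.
by rewrite -!mulmxA -scalemxAl -scalemxAr cdotZr delta_mulmx -scalemxAr cdotZr -cdot_ebasisl; ring.
Qed.

(** Here [x] meets the resolvent of the full matrix, as needed in [gq_zer_row]: the only unknown
    factors are then matrix entries already bounded by [gq_zer_entry]. *)
Lemma gq_zer' M i j x y : hermitian M ->
  gq M x y - gq (zer i j M) x y =
    - (offd i j * M i j * (gq M x (ebasis i) * gq (zer i j M) (ebasis j) y)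
      + conjc (M i j) * (gq M x (ebasis j) * gq (zer i j M) (ebasis i) y)).
Proof.
move=> hM; apply: oppr_inj; rewrite opprB opprK /gq -cdotBr -mulmxBl resolvent_perturb //; last exact: zer_herm.
rewrite -[zer i j M - M]opprB mulmxN [- _ *m resolvent _ _]mulNmx opprK zer_diff // mulmxDr !mulmxDl cdotDr; congr (_ + _).
  by rewrite -!mulmxA -scalemxAl -scalemxAr cdotZr delta_mulmx -scalemxAr cdotZr -cdot_ebasisl; ring.
by rewrite -!mulmxA -scalemxAl -scalemxAr cdotZr delta_mulmx -scalemxAr cdotZr -cdot_ebasisl; ring.
Qed.

(* Formal derivatives of [G_xy] in [H_ij] and in its conjugate; on the diagonal the whole
   derivative is attributed to the conjugate variable. *)
Definition gh i j M x y : R[i] := - (offd i j * (gq M x (ebasis i) * gq M (ebasis j) y)).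
Definition gb i j M x y : R[i] := - (gq M x (ebasis j) * gq M (ebasis i) y).

Lemma adm_gh i j x y : adm (fun M => gh i j M x y).
Proof. by apply: admN; apply: admZ; apply: admM; exact: adm_gq. Qed.
Lemma adm_gb i j x y : adm (fun M => gb i j M x y).
Proof. by apply: admN; apply: admM; exact: adm_gq. Qed.

(** The bound [o] for the two off-diagonal entries is kept apart from [g], because off-diagonal
    entries can be summed by Ward's identity while the diagonal ones are of order one. *)
Record jet_bounds M i j x y (k0 pi pj qi qj g o : R) : Prop := JetBounds {
  jb_v : cabs (gq M x y) <= k0;
  jb_pi : cabs (gq M x (ebasis i)) <= pi; jb_pj : cabs (gq M x (ebasis j)) <= pj;
  jb_qi : cabs (gq M (ebasis i) y) <= qi; jb_qj : cabs (gq M (ebasis j) y) <= qj;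
  jb_ii : cabs (gq M (ebasis i) (ebasis i)) <= g;
  jb_jj : cabs (gq M (ebasis j) (ebasis j)) <= g;
  jb_ij : cabs (gq M (ebasis i) (ebasis j)) <= o;
  jb_ji : cabs (gq M (ebasis j) (ebasis i)) <= o }.

Lemma cabs_comb2 (e h a b : R[i]) (A B : R) : cabs e <= 1 -> cabs a <= A -> cabs b <= B ->
  cabs (- (e * h * a + conjc h * b)) <= cabs h * (A + B).
Proof.
move=> he ha hb; rewrite cabsN mulrDr; apply: le_trans (cabsD _ _) _; rewrite !cabsM cabs_conj.
apply: lerD; last exact: ler_wpM2l.
by apply: ler_pM => //; [rewrite mulr_ge0|rewrite ler_piMl].
Qed.

Lemma cabsM_le (a b : R[i]) (A B : R) : cabs a <= A -> cabs b <= B -> cabs (a * b) <= A * B.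
Proof. by move=> ha hb; rewrite cabsM; exact: ler_pM. Qed.

(** Every increment is rewritten by [gq_zer]. Varying a first derivative inserts one more resolvent
    entry between [i] and [j], either diagonal ([g]) or off-diagonal ([o]). *)
Lemma jet_gq M i j x y k0 pi pj qi qj g o : hermitian M ->
  jet_bounds M i j x y k0 pi pj qi qj g o -> jet_bounds (zer i j M) i j x y k0 pi pj qi qj g o ->
  jet (M i j) (gq M x y) (gq (zer i j M) x y) (gh i j M x y) (gb i j M x y)
    (gh i j (zer i j M) x y) (gb i j (zer i j M) x y)
    k0 (pi * qj + pj * qi) (2 * (g * (pi * qi + pj * qj) + o * (pi * qj + pj * qi))).
Proof.
move=> hM [v a1 a2 b1 b2 c1 c2 c3 c4] [v' a1' a2' b1' b2' c1' c2' c3' c4'].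
have p1 : 0 <= pi by apply: le_trans a1.
have p2 : 0 <= pj by apply: le_trans a2.
have q1 : 0 <= qi by apply: le_trans b1.
have q2 : 0 <= qj by apply: le_trans b2.
have g0 : 0 <= g by apply: le_trans c1.
have o0 : 0 <= o by apply: le_trans c3.
have e1 := offd_le1 i j.
set h := M i j; set e := offd i j in e1 *.
have dyj : cabs (gq M (ebasis j) y - gq (zer i j M) (ebasis j) y) <= cabs h * (o * qj + g * qi).
  by rewrite gq_zer //; apply: cabs_comb2 => //; exact: cabsM_le.
have dyi : cabs (gq M (ebasis i) y - gq (zer i j M) (ebasis i) y) <= cabs h * (g * qj + o * qi).
  by rewrite gq_zer //; apply: cabs_comb2 => //; exact: cabsM_le.
have dxi : cabs (gq M x (ebasis i) - gq (zer i j M) x (ebasis i)) <= cabs h * (pi * o + pj * g).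
  by rewrite gq_zer //; apply: cabs_comb2 => //; exact: cabsM_le.
have dxj : cabs (gq M x (ebasis j) - gq (zer i j M) x (ebasis j)) <= cabs h * (pi * g + pj * o).
  by rewrite gq_zer //; apply: cabs_comb2 => //; exact: cabsM_le.
have h0 : 0 <= cabs h by [].
have fh_le a b (A B : R) : cabs a <= A -> cabs b <= B -> 0 <= pj * qi -> A * B = pi * qj ->
   cabs (- (e * (a * b))) <= pi * qj + pj * qi.
  move=> ha hb r0 E; rewrite cabsN cabsM -[leRHS]mul1r; apply: ler_pM => //.
  by apply: le_trans (cabsM_le ha hb) _; rewrite E lerDl.
have fb_le a b (A B : R) : cabs a <= A -> cabs b <= B -> 0 <= pi * qj -> A * B = pj * qi ->
   cabs (- (a * b)) <= pi * qj + pj * qi.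
  by move=> ha hb r0 E; rewrite cabsN; apply: le_trans (cabsM_le ha hb) _; rewrite E lerDr.
have K20 : 0 <= o * (pi * qj + pj * qi) + g * (pi * qi + pj * qj) by rewrite addr_ge0 ?mulr_ge0 ?addr_ge0 ?mulr_ge0.
split => //.
- by rewrite !mulr_ge0 ?addr_ge0 ?mulr_ge0 ?addr_ge0 ?mulr_ge0.
- by apply: fh_le a1 b2 _ _ => //; exact: mulr_ge0.
- by apply: fb_le a2 b1 _ _ => //; exact: mulr_ge0.
- by apply: fh_le a1' b2' _ _ => //; exact: mulr_ge0.
- by apply: fb_le a2' b1' _ _ => //; exact: mulr_ge0.
- by rewrite gq_zer //; apply: cabs_comb2 => //; exact: cabsM_le.
- rewrite gq_zer // (_ : _ - _ = - (e * h * (gq (zer i j M) x (ebasis i) * (gq M (ebasis j) y - gq (zer i j M) (ebasis j) y))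
     + conjc h * (gq (zer i j M) x (ebasis j) * (gq M (ebasis i) y - gq (zer i j M) (ebasis i) y)))); last first.
    by rewrite /gh /gb -/h -/e; do 8?[move: (gq _ _ _) => ?]; ring.
  apply: le_trans (cabs_comb2 h e1 (cabsM_le a1' dyj) (cabsM_le a2' dyi)) _.
  rewrite (_ : cabs h * _ = cabs h ^+ 2 * (o * (pi * qj + pj * qi) + g * (pi * qi + pj * qj))); last by ring.
  by rewrite ler_wpM2l ?exprn_ge0 // addrC ler_peMl // ?ler1n // addrC.
- rewrite (_ : _ - _ = - (e * ((gq M x (ebasis i) - gq (zer i j M) x (ebasis i)) * gq M (ebasis j) y
    + gq (zer i j M) x (ebasis i) * (gq M (ebasis j) y - gq (zer i j M) (ebasis j) y)))); last first.
    by rewrite /gh -/e; do 8?[move: (gq _ _ _) => ?]; ring.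
  rewrite cabsN cabsM; apply: (@le_trans _ _ (1 * (cabs h * (pi * o + pj * g) * qj + pi * (cabs h * (o * qj + g * qi))))).
    by apply: ler_pM => //; apply: le_trans (cabsD _ _) _; apply: lerD; exact: cabsM_le.
  rewrite mul1r (_ : _ + _ = cabs h * (2 * (o * (pi * qj)) + g * (pi * qi + pj * qj))); last by ring.
  rewrite ler_wpM2l // [2 * (_ + _)]mulrDr addrC lerD //.
    by rewrite ler_peMl ?ler1n // mulr_ge0 // addr_ge0 // mulr_ge0.
  by rewrite ler_pM2l // ler_wpM2l // lerDl mulr_ge0.
- rewrite (_ : _ - _ = - ((gq M x (ebasis j) - gq (zer i j M) x (ebasis j)) * gq M (ebasis i) y
    + gq (zer i j M) x (ebasis j) * (gq M (ebasis i) y - gq (zer i j M) (ebasis i) y))); last first.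
    by rewrite /gb; do 8?[move: (gq _ _ _) => ?]; ring.
  rewrite cabsN; apply: (@le_trans _ _ (cabs h * (pi * g + pj * o) * qi + pj * (cabs h * (g * qj + o * qi)))).
    by apply: le_trans (cabsD _ _) _; apply: lerD; exact: cabsM_le.
  rewrite (_ : _ + _ = cabs h * (2 * (o * (pj * qi)) + g * (pi * qi + pj * qj))); last by ring.
  rewrite ler_wpM2l // [2 * (_ + _)]mulrDr addrC lerD //.
    by rewrite ler_peMl ?ler1n // mulr_ge0 // addr_ge0 // mulr_ge0.
  by rewrite ler_pM2l // ler_wpM2l // lerDr mulr_ge0.
Qed.

Lemma jet_value h (f f0 fh fb fh0 fb0 c : R[i]) (k0 k1 k2 k : R) : cabs (f - c) <= k -> cabs (f0 - c) <= k ->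
  jet h f f0 fh fb fh0 fb0 k0 k1 k2 -> jet h (f - c) (f0 - c) fh fb fh0 fb0 k k1 k2.
Proof.
move=> h1 h2 [a0 a1 a2 a3 a4 a5 a6 a7 a8 a9 a10].
by split => //; rewrite (_ : f - c - (f0 - c) = f - f0) //; ring.
Qed.

(** A self-consistent bound: by the resolvent identity the larger entry [X] of the row satisfies
    [X <= g + X / 2], because [4 * g * hs <= 1]. *)
Lemma gq_zer_entry M i j (g hs : R) a b : hermitian M -> cabs (M i j) <= hs -> 4 * g * hs <= 1 ->
  (forall k l, cabs (gq M (ebasis k) (ebasis l)) <= g) ->
  a = i \/ a = j -> b = i \/ b = j -> cabs (gq (zer i j M) (ebasis a) (ebasis b)) <= 2 * g.
Proof.
move=> hM hh gh1 hg ha hb.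
have g0 : 0 <= g by apply: le_trans (hg a b).
set X := Num.max (cabs (gq (zer i j M) (ebasis a) (ebasis i))) (cabs (gq (zer i j M) (ebasis a) (ebasis j))).
have X1 : cabs (gq (zer i j M) (ebasis a) (ebasis i)) <= X by rewrite le_max lexx.
have X2 : cabs (gq (zer i j M) (ebasis a) (ebasis j)) <= X by rewrite le_max lexx orbT.
have X0 : 0 <= X by apply: le_trans X1.
have step c : cabs (gq (zer i j M) (ebasis a) (ebasis c)) <= g + 2^-1 * X.
  rewrite -[X in cabs X](subKr (gq M (ebasis a) (ebasis c))); apply: le_trans (cabsB _ _) _; apply: lerD => //.
  rewrite gq_zer //.
  apply: le_trans (cabs_comb2 _ (offd_le1 i j) (cabsM_le X1 (hg _ _)) (cabsM_le X2 (hg _ _))) _.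
  apply: (@le_trans _ _ (hs * (X * g + X * g))).
    by apply: ler_wpM2r => //; rewrite addr_ge0 ?mulr_ge0.
  rewrite (_ : hs * _ = (4 * g * hs) * (2^-1 * X)); last by field.
  by rewrite ler_piMl // mulr_ge0.
have XX : X <= g + 2^-1 * X by rewrite {1}/X ge_max !step.
have : X <= 2 * g by lra.
by apply: le_trans; case: hb => ->.
Qed.

(** The entry itself reappears with a small factor and is absorbed in the 2; the entry at the other
    index is only known to be at most [g], which gives the additive error. *)
Lemma gq_zer_row M i j x (g hs : R) b : hermitian M -> cabs (M i j) <= hs -> 4 * g * hs <= 1 ->
  (forall k l, cabs (gq M (ebasis k) (ebasis l)) <= g) ->
  (forall k, cabs (gq M x (ebasis k)) <= g) ->
  b = i \/ b = j ->
  cabs (gq (zer i j M) x (ebasis b)) <= 2 * cabs (gq M x (ebasis b)) + 2 * g ^+ 2 * hs.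
Proof.
move=> hM hh gh1 hg hx hb.
have g0 : 0 <= g by apply: le_trans (hx i).
have hs0 : 0 <= hs by apply: le_trans hh.
have E a : a = i \/ a = j -> cabs (gq (zer i j M) (ebasis a) (ebasis b)) <= 2 * g.
  by move=> ha; exact: gq_zer_entry hM hh gh1 hg ha hb.
rewrite -[X in cabs X](subKr (gq M x (ebasis b))); apply: le_trans (cabsB _ _) _.
rewrite gq_zer' //.
have hi : cabs (gq (zer i j M) (ebasis i) (ebasis b)) <= 2 * g by apply: E; left.
have hj : cabs (gq (zer i j M) (ebasis j) (ebasis b)) <= 2 * g by apply: E; right.
set t := cabs (gq M x (ebasis b)).
have t0 : 0 <= t by exact: cabs_ge0.
apply: (@le_trans _ _ (t + hs * (t * (2 * g) + g * (2 * g)))); last first.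
  rewrite (_ : _ + _ = t + (4 * g * hs) * t * 2^-1 + 2 * g ^+ 2 * hs); last by field.
  rewrite lerD2r (_ : 2 * t = t + t); last by ring.
  rewrite lerD2l; apply: (@le_trans _ _ (1 * t * 2^-1)); last by lra.
  by rewrite ler_pM2r ?invr_gt0 // ler_wpM2r.
rewrite lerD2l; case: hb => bE; rewrite /t bE in hi hj *.
  apply: le_trans (cabs_comb2 _ (offd_le1 i j) (cabsM_le (lexx _) hj) (cabsM_le (hx _) hi)) _.
  by apply: ler_wpM2r => //; rewrite addr_ge0 ?mulr_ge0.
apply: le_trans (cabs_comb2 _ (offd_le1 i j) (cabsM_le (hx _) hj) (cabsM_le (lexx _) hi)) _.
by rewrite [X in _ * X]addrC; apply: ler_wpM2r => //; rewrite addr_ge0 ?mulr_ge0.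
Qed.

Lemma gq_zer_col M i j y (g hs : R) b : hermitian M -> cabs (M i j) <= hs -> 4 * g * hs <= 1 ->
  (forall k l, cabs (gq M (ebasis k) (ebasis l)) <= g) ->
  (forall k, cabs (gq M (ebasis k) y) <= g) ->
  b = i \/ b = j ->
  cabs (gq (zer i j M) (ebasis b) y) <= 2 * cabs (gq M (ebasis b) y) + 2 * g ^+ 2 * hs.
Proof.
move=> hM hh gh1 hg hx hb.
have g0 : 0 <= g by apply: le_trans (hx i).
have hs0 : 0 <= hs by apply: le_trans hh.
have E a := gq_zer_entry (b := a) hM hh gh1 hg hb.
rewrite -[X in cabs X](subKr (gq M (ebasis b) y)); apply: le_trans (cabsB _ _) _.
rewrite gq_zer //.
have hi : cabs (gq (zer i j M) (ebasis b) (ebasis i)) <= 2 * g by apply: E; left.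
have hj : cabs (gq (zer i j M) (ebasis b) (ebasis j)) <= 2 * g by apply: E; right.
set t := cabs (gq M (ebasis b) y).
have t0 : 0 <= t by exact: cabs_ge0.
apply: (@le_trans _ _ (t + hs * (2 * g * t + 2 * g * g))); last first.
  rewrite (_ : _ + _ = t + (4 * g * hs) * t * 2^-1 + 2 * g ^+ 2 * hs); last by field.
  rewrite lerD2r (_ : 2 * t = t + t); last by ring.
  rewrite lerD2l; apply: (@le_trans _ _ (1 * t * 2^-1)); last by lra.
  by rewrite ler_pM2r ?invr_gt0 // ler_wpM2r.
rewrite lerD2l; case: hb => bE; rewrite /t bE in hi hj *.
  apply: le_trans (cabs_comb2 _ (offd_le1 i j) (cabsM_le hi (hx _)) (cabsM_le hj (lexx _))) _.
  by rewrite [X in _ * X]addrC; apply: ler_wpM2r => //; rewrite addr_ge0 ?mulr_ge0.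
apply: le_trans (cabs_comb2 _ (offd_le1 i j) (cabsM_le hi (lexx _)) (cabsM_le hj (hx _))) _.
by apply: ler_wpM2r => //; rewrite addr_ge0 ?mulr_ge0.
Qed.

Lemma gq_crude M x y (c : R) : hermitian M -> 0 <= c -> 1 <= c * `|ImC z| ->
  norm2 x <= 1 -> norm2 y <= 1 -> cabs (gq M x y) <= c.
Proof.
move=> hM c0 hc hx hy.
have h := resolvent_norm y hM z0.
rewrite -[leRHS]mul1r; apply: cdot_le => //; first by rewrite expr1n.
have a0 : 0 < `|ImC z| by rewrite normr_gt0.
rewrite -(ler_pM2l (exprn_gt0 2 a0)) -exprMn real_normK ?num_real //.
apply: le_trans h _; apply: le_trans hy _.
by rewrite mulrC -[leLHS](expr1n _ 2) ler_wXn2r.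
Qed.

Lemma jet_gq_crude M i j x y (c : R) : hermitian M -> 0 <= c -> 1 <= c * `|ImC z| ->
  norm2 x <= 1 -> norm2 y <= 1 ->
  jet (M i j) (gq M x y) (gq (zer i j M) x y) (gh i j M x y) (gb i j M x y)
    (gh i j (zer i j M) x y) (gb i j (zer i j M) x y) c (2 * c ^+ 2) (8 * c ^+ 3).
Proof.
move=> hM c0 hc hx hy.
have he k : norm2 (ebasis k : Vec) <= 1 by rewrite norm2_ebasis.
have B M' : hermitian M' -> jet_bounds M' i j x y c c c c c c c.
  by move=> hM'; split; exact: gq_crude.
have := jet_gq hM (B _ hM) (B _ (zer_herm i j hM)).
by apply: jet_le => //; rewrite le_eqVlt; apply/orP; left; apply/eqP; ring.
Qed.

End ResolventJets.

Ltac pos := lazymatch goal with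
  | |- is_true (0 <= _ + _) => apply: addr_ge0; pos
  | |- is_true (0 <= _ * _) => apply: mulr_ge0; pos
  | |- is_true (0 <= _ ^+ _) => apply: exprn_ge0; pos
  | |- is_true (0 <= _^-1) => rewrite invr_ge0; pos
  | |- is_true (0 <= cabs _) => exact: cabs_ge0
  | |- is_true (0 <= \sum_(_ <- _ | _) _) => apply: sumr_ge0 => ? _; pos
  | |- is_true (0 <= 1) => exact: ler01
  | |- is_true (0 <= _%:R) => exact: ler0n
  | |- is_true (0 <= _) => first [assumption | apply: ltW; assumption | by apply: ltW; auto | solve [auto]]
  end.

(** * Scales and the basic good event *)

Section GoodEvent.
Context {R : realType} (N : nat) (z : R[i]) (L n r p : R).
Hypothesis z0 : ImC z != 0.
Notation Mat := 'M[R[i]]_N.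
Notation Vec := 'cV[R[i]]_N.
Notation gq := (gq z).
Implicit Types (M : Mat) (x y : Vec).

(* The scales: [n] is [sqrt N], [r ^ 2] is [rho z], [p] is the target error [1 / sqrt (N rho)], and
   [L] is a small power of [N]. *)
Record scales (C : R) : Prop := Scales {
  sc_L : 10 ^+ 3 <= L; sc_C : C <= L; sc_r : 0 < r; sc_rL : r <= L;
  sc_n : 0 < n; sc_N : n ^+ 2 = N%:R; sc_p : n * (p * r) = 1; sc_pr : L ^+ 40 * p <= r ^+ 2 }.

(** This is [|G y|^2] ([gam_norm2]), hence [Im <y, G y> / Im z] by Ward's identity; written as a sum
    of entries it is visibly admissible. *)
Definition gam M y : R := \sum_k cabs (gq M (ebasis k) y) ^+ 2.

Lemma gam_norm2 M y : gam M y = norm2 (resolvent M z *m y).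
Proof. by rewrite /gam sum_col_sqr. Qed.
Lemma gam_row M x : hermitian M -> \sum_k cabs (gq M x (ebasis k)) ^+ 2 = gam M x.
Proof. by move=> hM; rewrite gam_norm2 sum_row_sqr. Qed.

Definition good_entries M : bool := [forall i, [forall j, cabs (M i j) <= L / n]].
Definition good1 M : bool :=
  good_entries M && [forall i, [forall j, cabs (gq M (ebasis i) (ebasis j)) <= L]].

(** [dl] is the error [2 * g ^+ 2 * hs] of [gq_zer_row] at [g = L], [hs = L / n]. Thus [al] and [ar]
    bound row and column entries for the matrix and for its cleared version, and [jk1], [jk2] are
    the resulting bounds of [jet_gq]. *)
Definition dl : R := 2 * L ^+ 2 * (L / n).
Definition al M x k : R := 2 * cabs (gq M x (ebasis k)) + dl.
Definition ar M y k : R := 2 * cabs (gq M (ebasis k) y) + dl.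
Definition jk1 M i j x y : R := al M x i * ar M y j + al M x j * ar M y i.
Definition jk2 M i j x y : R :=
  2 * (2 * L * (al M x i * ar M y i + al M x j * ar M y j) + (al M (ebasis i) j + al M (ebasis j) i) * jk1 M i j x y).

Lemma admR_al x k : admR (fun M => al M x k).
Proof.
apply: admRD; last exact: admR_cst.
by apply: admRM; [exact: admR_cst|apply: admR_cabs; exact: adm_gq].
Qed.
Lemma admR_ar y k : admR (fun M => ar M y k).
Proof.
apply: admRD; last exact: admR_cst.
by apply: admRM; [exact: admR_cst|apply: admR_cabs; exact: adm_gq].
Qed.
Lemma admR_gam y : admR (fun M => gam M y).
Proof. by apply: admR_sum => k; apply: admRX; apply: admR_cabs; exact: adm_gq. Qed.
Lemma admR_jk1 i j x y : admR (fun M => jk1 M i j x y).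
Proof. by apply: admRD; apply: admRM; rewrite ?admR_al ?admR_ar //; [exact: admR_al|exact: admR_ar|exact: admR_al|exact: admR_ar]. Qed.
Lemma admb_good_entries : admb good_entries.
Proof. by apply: admb_forall => i; apply: admb_forall => j; exact: admb_entry. Qed.
Lemma admb_good1 : admb good1.
Proof.
apply: admb_and; first exact: admb_good_entries.
apply: admb_forall => i; apply: admb_forall => j; apply: admb_le; last exact: admR_cst.
by apply: admR_cabs; exact: adm_gq.
Qed.

Section Facts.
Variable C : R.
Hypothesis sc : scales C.

Let L1000 := sc_L sc.
Let r0 := sc_r sc.
Let n0 := sc_n sc.
Let rL := sc_rL sc.

Lemma sc_L0 : 0 < L. Proof. by apply: lt_le_trans L1000; rewrite exprn_gt0 // ltr0n. Qed.
Lemma sc_L1 : 1 <= L. Proof. by apply: le_trans L1000; rewrite exprn_ege1 // ler1n. Qed.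
Lemma sc_Lpow a b : (a <= b)%N -> L ^+ a <= L ^+ b.
Proof. by move=> ab; apply: ler_weXn2l => //; exact: sc_L1. Qed.
Lemma sc_cst (k : nat) a : (k <= 10 ^ 3)%N -> k%:R * L ^+ a <= L ^+ a.+1.
Proof. move=> hk; rewrite exprS ler_wpM2r ?exprn_ge0 ?(ltW sc_L0) //.
by apply: le_trans L1000; rewrite -natrX ler_nat. Qed.
Lemma sc_Lpow0 a : 0 <= L ^+ a. Proof. by rewrite exprn_ge0 // ltW // sc_L0. Qed.
Lemma sc_p0 : 0 < p.
Proof.
have h := sc_p sc; have : 0 < n * (p * r) by rewrite h.
by rewrite pmulr_rgt0 // pmulr_lgt0.
Qed.
Lemma sc_inv : n^-1 = p * r.
Proof. by apply: (mulfI (lt0r_neq0 n0)); rewrite mulfV ?lt0r_neq0 // (sc_p sc). Qed.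
(** Two of the forty powers of [L] in [sc_pr] pay for [r ^+ 2 <= L ^+ 2]. *)
Lemma sc_p18 : L ^+ 38 * p <= 1.
Proof.
have h := sc_pr sc; have L2 : 0 < L ^+ 2 by rewrite exprn_gt0 // sc_L0.
rewrite -(ler_pM2l L2) mulr1 mulrA -exprD; apply: le_trans h _.
by apply: ler_wXn2r => //; exact: ltW.
Qed.
Lemma sc_Lp a : (a <= 38)%N -> L ^+ a * p <= 1.
Proof.
move=> h; apply: le_trans sc_p18; rewrite ler_wpM2r ?(ltW sc_p0) //; exact: sc_Lpow.
Qed.
Lemma sc_p1 : p <= 1. Proof. by have := @sc_Lp 0 isT; rewrite expr0 mul1r. Qed.
Lemma sc_Ninv : (N%:R)^-1 = p ^+ 2 * r ^+ 2.
Proof. by rewrite -(sc_N sc) -exprVn sc_inv exprMn. Qed.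
Lemma sc_hs : L / n = L * (p * r). Proof. by rewrite sc_inv. Qed.
Lemma sc_hs0 : 0 < L / n. Proof. by rewrite divr_gt0 // sc_L0. Qed.
Lemma sc_hs_le : L / n <= L ^+ 2 * p.
Proof.
rewrite sc_hs expr2 -mulrA ler_pM2l ?sc_L0 // mulrC.
by rewrite ler_wpM2r ?(ltW sc_p0).
Qed.
Lemma sc_hs4 : 4 * L * (L / n) <= 1.
Proof.
apply: le_trans (@sc_Lp 4 isT).
apply: (@le_trans _ _ (4 * L * (L ^+ 2 * p))).
  by rewrite ler_wpM2l ?sc_hs_le // mulr_ge0 // ltW // sc_L0.
rewrite (_ : _ * _ = 4 * L ^+ 3 * p); last by ring.
by rewrite ler_wpM2r ?(ltW sc_p0) //; apply: sc_cst.
Qed.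
Lemma sc_dl : dl = 2 * L ^+ 3 * (p * r). Proof. by rewrite /dl sc_hs; ring. Qed.
Lemma sc_dl0 : 0 < dl.
Proof. by rewrite /dl !mulr_gt0 ?exprn_gt0 ?sc_L0 ?invr_gt0. Qed.
Lemma sc_dlL : dl <= 1.
Proof.
apply: le_trans (@sc_Lp 5 isT); rewrite /dl; apply: (@le_trans _ _ (2 * L ^+ 2 * (L ^+ 2 * p))).
  by rewrite ler_wpM2l ?sc_hs_le // mulr_ge0 ?sc_Lpow0.
rewrite (_ : _ * _ = 2 * L ^+ 4 * p); last by ring.
by rewrite ler_wpM2r ?(ltW sc_p0) //; apply: sc_cst.
Qed.
Lemma sc_dl2 : dl ^+ 2 <= L ^+ 9 * p ^+ 2.
Proof.
rewrite sc_dl (_ : _ ^+ 2 = 4 * L ^+ 6 * r ^+ 2 * p ^+ 2); last by ring.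
rewrite ler_wpM2r ?sqr_ge0 //; apply: (@le_trans _ _ (4 * L ^+ 6 * L ^+ 2)).
  have l0 := sc_L0; apply: ler_wpM2l; [pos|apply: ler_wXn2r => //; pos].
by rewrite -mulrA -exprD; apply: sc_cst.
Qed.

Lemma good1_entry M i j : good1 M -> cabs (M i j) <= L / n.
Proof. by case/andP => /forallP /(_ i) /forallP /(_ j). Qed.
Lemma good1_gq M i j : good1 M -> cabs (gq M (ebasis i) (ebasis j)) <= L.
Proof. by case/andP => _ /forallP /(_ i) /forallP /(_ j). Qed.

Lemma al_ge0 M x k : 0 <= al M x k.
Proof. have := sc_dl0; rewrite /al; move: dl => ? ?; pos. Qed.
Lemma ar_ge0 M x k : 0 <= ar M x k.
Proof. have := sc_dl0; rewrite /ar; move: dl => ? ?; pos. Qed.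
Lemma jk1_ge0 M i j x y : 0 <= jk1 M i j x y.
Proof. have := al_ge0; have := ar_ge0; rewrite /jk1 => ? ?; pos. Qed.

Lemma al_le M x k : cabs (gq M x (ebasis k)) <= L -> al M x k <= 3 * L.
Proof. by move=> h; rewrite /al; have := sc_dlL; have := sc_L1; move: h; lra. Qed.
Lemma ar_le M y k : cabs (gq M (ebasis k) y) <= L -> ar M y k <= 3 * L.
Proof. by move=> h; rewrite /ar; have := sc_dlL; have := sc_L1; move: h; lra. Qed.
Lemma al_sqr M x k : al M x k ^+ 2 <= 8 * cabs (gq M x (ebasis k)) ^+ 2 + 2 * dl ^+ 2.
Proof. by rewrite /al -subr_ge0 (_ : _ - _ = (2 * cabs (gq M x (ebasis k)) - dl) ^+ 2) ?sqr_ge0 //; ring. Qed.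
Lemma ar_sqr M y k : ar M y k ^+ 2 <= 8 * cabs (gq M (ebasis k) y) ^+ 2 + 2 * dl ^+ 2.
Proof. by rewrite /ar -subr_ge0 (_ : _ - _ = (2 * cabs (gq M (ebasis k) y) - dl) ^+ 2) ?sqr_ge0 //; ring. Qed.

(** On the good event the bounds for the full matrix survive clearing one entry up to a factor 2 and
    the error [dl], so [jet_gq] applies with statistics of the full matrix alone. *)
Lemma jet_vec M i j x y : hermitian M -> good1 M ->
  (forall k, cabs (gq M x (ebasis k)) <= L) -> (forall k, cabs (gq M (ebasis k) y) <= L) ->
  jet (M i j) (gq M x y) (gq (zer i j M) x y) (gh z i j M x y) (gb z i j M x y)
    (gh z i j (zer i j M) x y) (gb z i j (zer i j M) x y)
    (cabs (gq M x y) + L / n * jk1 M i j x y) (jk1 M i j x y) (jk2 M i j x y).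
Proof.
move=> hM gM hx hy; set k0 := _ + _.
have hh := good1_entry i j gM; have hg k l := good1_gq k l gM.
have h4 := sc_hs4.
have dle (w : R[i]) : cabs w <= 2 * cabs w + dl.
  by have := cabs_ge0 w; have := sc_dl0; lra.
have gL k l : cabs (gq M (ebasis k) (ebasis l)) <= 2 * L.
  by apply: le_trans (hg k l) _; rewrite ler_peMl ?ler1n // ltW // sc_L0.
have aa k l : 0 <= al M (ebasis k) l by exact: al_ge0.
have x0 b : b = i \/ b = j -> cabs (gq (zer i j M) x (ebasis b)) <= al M x b.
  by move=> hb; exact: gq_zer_row hM hh h4 hg hx hb.
have y0 b : b = i \/ b = j -> cabs (gq (zer i j M) (ebasis b) y) <= ar M y b.
  by move=> hb; exact: gq_zer_col hM hh h4 hg hy hb.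
have e0 a b : a = i \/ a = j -> b = i \/ b = j -> cabs (gq (zer i j M) (ebasis a) (ebasis b)) <= 2 * L.
  by move=> ha hb; exact: gq_zer_entry hM hh h4 hg ha hb.
have o0 a b : b = i \/ b = j -> cabs (gq (zer i j M) (ebasis a) (ebasis b)) <= al M (ebasis a) b.
  by move=> hb; apply: (gq_zer_row z0 hM hh h4 hg _ hb) => k.
have il : i = i \/ i = j by left.
have jr : j = i \/ j = j by right.
have L0 := ltW sc_L0.
have v0 : cabs (gq M x y - gq (zer i j M) x y) <= L / n * jk1 M i j x y.
  rewrite gq_zer //; apply: le_trans (cabs_comb2 _ (offd_le1 i j) (cabsM_le (x0 _ il) (dle _)) (cabsM_le (x0 _ jr) (dle _))) _.
  by rewrite ler_wpM2r //; exact: jk1_ge0.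
have kk : 0 <= L / n * jk1 M i j x y by rewrite mulr_ge0 ?jk1_ge0 ?(ltW sc_hs0).
apply: jet_gq; [exact: z0|exact: hM|split|split].
- by rewrite /k0 lerDl.
- exact: (dle (gq M x (ebasis i))).
- exact: (dle (gq M x (ebasis j))).
- exact: (dle (gq M (ebasis i) y)).
- exact: (dle (gq M (ebasis j) y)).
- exact: (gL i i).
- exact: (gL j j).
- by apply: le_trans (dle _) _; rewrite lerDl; exact: (aa j i).
- by apply: le_trans (dle _) _; rewrite lerDr; exact: (aa i j).
- by rewrite -[X in cabs X](subKr (gq M x y)); apply: le_trans (cabsB _ _) _; rewrite /k0 lerD2l.
- exact: (x0 i il).
- exact: (x0 j jr).
- exact: (y0 i il).
- exact: (y0 j jr).
- exact: (e0 i i il il).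
- exact: (e0 j j jr jr).
- by apply: le_trans (o0 i j jr) _; rewrite lerDl; exact: (aa j i).
- by apply: le_trans (o0 j i il) _; rewrite lerDr; exact: (aa i j).
Qed.

End Facts.
End GoodEvent.

(** * The diagonal of the resolvent *)

Arguments cabs {R} z : simpl never.

(** AM-GM turns products of row and column entries into squares, which Ward's identity can sum. *)
Lemma kap_arith {R : realType} (L a a' e e' o g1 g2 g3 g4 dd : R) : 1 <= L ->
  0 <= a -> 0 <= a' -> 0 <= e -> 0 <= e' -> 0 <= o ->
  a ^+ 2 <= 8 * g1 + 2 * dd -> a' ^+ 2 <= 8 * g2 + 2 * dd ->
  e ^+ 2 <= 8 * g3 + 2 * dd -> e' ^+ 2 <= 8 * g4 + 2 * dd -> o <= 6 * L ->
  a * e' + a' * e <= 96 * L * (g1 + g2 + g3 + g4 + dd) /\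
  2 * (2 * L * (a * e + a' * e') + o * (a * e' + a' * e)) <= 96 * L * (g1 + g2 + g3 + g4 + dd).
Proof.
move=> L1 a0 a'0 e0 e'0 o0 s1 s2 s3 s4 o6; have L0 : 0 <= L by lra.
have x1 : a * e' + a' * e <= (a ^+ 2 + e' ^+ 2) / 2 + (a' ^+ 2 + e ^+ 2) / 2.
  by have := sqr_ge0 (a - e'); have := sqr_ge0 (a' - e); clear; nra.
have x2 : a * e + a' * e' <= (a ^+ 2 + e ^+ 2) / 2 + (a' ^+ 2 + e' ^+ 2) / 2.
  by have := sqr_ge0 (a - e); have := sqr_ge0 (a' - e'); clear; nra.
set X := g1 + g2 + g3 + g4 + dd.
have y1 : a * e' + a' * e <= 4 * X by rewrite /X; lra.
have y2 : a * e + a' * e' <= 4 * X by rewrite /X; lra.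
have y0 : 0 <= a * e' + a' * e by pos.
have X0 : 0 <= 4 * X by apply: le_trans y1.
split.
  apply: le_trans y1 _; rewrite (_ : 96 * L * X = (24 * L) * (4 * X)); last by ring.
  by rewrite ler_peMl //; lra.
have z1 : 2 * L * (a * e + a' * e') <= 2 * L * (4 * X) by apply: ler_wpM2l => //; pos.
have z2 : o * (a * e' + a' * e) <= 6 * L * (4 * X) by exact: ler_pM.
rewrite (_ : 96 * L * X = 2 * (2 * L * (4 * X) + 6 * L * (4 * X)) + 8 * L * (4 * X)); last by ring.
have : 0 <= 8 * L * (4 * X) by apply: mulr_ge0 => //; pos.
by move: z1 z2; clear; lra.
Qed.

Lemma sum_lin5 {R : realType} (I : finType) (s a b c d : I -> R) (K e : R) :
  \sum_l s l * (K * (a l + b l + c l + d l + e)) =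
  K * (\sum_l s l * a l + \sum_l s l * b l + \sum_l s l * c l + \sum_l s l * d l + \sum_l s l * e).
Proof. by rewrite -!big_split mulr_sumr /=; apply: eq_bigr => l _; ring. Qed.

Lemma mul_lin4 {R : comNzRingType} (h b k1 k2 u v n y w : R) :
  h * (b * (k1 * (u + v) + k2 * n * y + v * w)) = b * (k1 * (h * u + h * v) + k2 * (h * n) * y + h * v * w).
Proof. by ring. Qed.

Lemma sum_lin4 {R : realType} (I : finType) (u v : I -> R) (b K1 K2 y w : R) :
  \sum_j (b * (K1 * (u j + v j)) + b * K2 * y + b * v j * w) =
  b * (K1 * (\sum_j u j + \sum_j v j) + K2 * #|I|%:R * y + (\sum_j v j) * w).
Proof.
rewrite 2!big_split /= sumr_const -[b * K2 * y *+ _]mulr_natl -mulr_suml -!mulr_sumr big_split /=.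
by move: (\sum_j u j) (\sum_j v j) => a c; ring.
Qed.

Section DiagonalLaw.
Context {R : realType} (C : R) (Cp : nat -> R) (N : nat) d (T : measurableType d) (P : probability T R).
Variable H : T -> 'M[R[i]]_N.
Hypothesis W : wigner C Cp P H.
Notation Mat := 'M[R[i]]_N.
Notation S := (Svar P H).
Notation Tv := (Tvar P H).
Variables (z m : R[i]) (L n r p c V B Ys : R) (b : 'I_N -> R).
Hypothesis z0 : ImC z != 0.
Hypothesis sc : scales N L n r p C.
Hypothesis mE : (z + m) * m = -1.
Hypothesis m1 : cabs m <= 1.
Hypothesis c1 : 1 <= c.
Hypothesis cz : 1 <= c * `|ImC z|.
Hypothesis cz2 : cabs z + 2 <= c.
Hypothesis Lc : L <= c.
Hypothesis cV : 400 * c ^+ 6 <= V.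
Hypothesis b0 : forall i, 0 <= b i.
Hypothesis b1 : \sum_i b i <= 1.
Notation gq := (gq z).
Notation gh := (gh z).
Notation gb := (gb z).

Definition dev k (M : Mat) : R[i] := gq M (ebasis k) (ebasis k) - m.
(** Coefficient of the deviation at [k] in the linear part: one term comes from [d_k], the other
    from [S] acting on the deviations. When the weights are constant the two add up to a multiple of
    [z + 2 m]. *)
Definition dcoef k : R[i] := ((b k)%:C)%C * (z + m) + m * ((\sum_l b l * S l k)%:C)%C.
Definition dstat (M : Mat) : R[i] :=
  \sum_k dcoef k * dev k M + \sum_k \sum_l ((b k * S k l)%:C)%C * (dev k M * dev l M).
Definition dstat_h i j (M : Mat) : R[i] :=
  \sum_k dcoef k * gh i j M (ebasis k) (ebasis k) + \sum_k \sum_l ((b k * S k l)%:C)%C *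
    (gh i j M (ebasis k) (ebasis k) * dev l M + dev k M * gh i j M (ebasis l) (ebasis l)).
Definition dstat_b i j (M : Mat) : R[i] :=
  \sum_k dcoef k * gb i j M (ebasis k) (ebasis k) + \sum_k \sum_l ((b k * S k l)%:C)%C *
    (gb i j M (ebasis k) (ebasis k) * dev l M + dev k M * gb i j M (ebasis l) (ebasis l)).
Definition dz (i j : 'I_N) (M : Mat) : R[i] := ((b i)%:C)%C * gq M (ebasis j) (ebasis i).
Definition dzh i j (M : Mat) : R[i] := ((b i)%:C)%C * gh i j M (ebasis j) (ebasis i).
Definition dzb i j (M : Mat) : R[i] := ((b i)%:C)%C * gb i j M (ebasis j) (ebasis i).
Definition dq (M : Mat) : R[i] :=
  \sum_i ((b i)%:C)%C * ((\sum_l ((S i l)%:C)%C * gq M (ebasis l) (ebasis l)) * gq M (ebasis i) (ebasis i)).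
(** The error in the vector Dyson equation [- 1 / g_i = z + sum_l S_il g_l] at [g_i = G_ii]. *)
Definition ddiag i (M : Mat) : R[i] :=
  1 + (z + \sum_l ((S i l)%:C)%C * gq M (ebasis l) (ebasis l)) * gq M (ebasis i) (ebasis i).

(** Expanding around [m] removes the constant term since [(z + m) * m = -1]. The form in deviations
    shows the small coefficients that the weighted sum of the [ddiag] hides. *)
Lemma dstatE M : dstat M = \sum_i ((b i)%:C)%C * ddiag i M.
Proof.
have S1 i : \sum_l ((S i l)%:C)%C = 1 :> R[i] by rewrite -rmorph_sum (Svar_sum W).
rewrite (eq_bigr (fun i => ((b i)%:C)%C * (z + m) * dev i M + (\sum_l m * ((b i * S i l)%:C)%C * dev l M
   + \sum_l ((b i * S i l)%:C)%C * (dev i M * dev l M)))) => [|i _]; last first.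
  have -> : ddiag i M = (z + m) * dev i M + m * \sum_l ((S i l)%:C)%C * dev l M
     + dev i M * \sum_l ((S i l)%:C)%C * dev l M.
    rewrite /ddiag (_ : \sum_l _ = m + \sum_l ((S i l)%:C)%C * dev l M); last first.
      rewrite -[X in X + _]mul1r -(S1 i) mulr_suml -big_split /=; apply: eq_bigr => l _.
      by rewrite -mulrDr /dev addrC subrK.
    have -> : gq M (ebasis i) (ebasis i) = m + dev i M by rewrite /dev addrC subrK.
    move: (dev i M) (\sum_l _) => u s; rewrite -[1]opprK -mE; ring.
  rewrite [LHS]mulrDr [X in X + _ = _]mulrDr mulrA -addrA; congr (_ + (_ + _)).
    rewrite !mulr_sumr; apply: eq_bigr => l _; rewrite rmorphM /=; ring.
  rewrite !mulr_sumr; apply: eq_bigr => l _; rewrite rmorphM /=; ring.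
rewrite !big_split /= addrA; congr (_ + _).
rewrite exchange_big -big_split /=; apply: eq_bigr => k _.
rewrite -!mulr_suml -mulrDl; congr (_ * _); rewrite /dcoef; congr (_ + _).
by rewrite -mulr_sumr rmorph_sum.
Qed.

(** The diagonal of [H G = 1 + z G] replaces [1 + z G_ii] by [sum_j H_ij G_ji]. *)
Lemma dstat_eq t : dstat (H t) = \sum_i \sum_j H t i j * dz i j (H t) + dq (H t).
Proof.
rewrite dstatE /dq -big_split /=; apply: eq_bigr => i _; rewrite /ddiag.
have E : \sum_j H t i j * gq (H t) (ebasis j) (ebasis i) = 1 + z * gq (H t) (ebasis i) (ebasis i).
  have := congr1 (fun A : Mat => A i i) (resolventK (wig_herm W t) z0).
  rewrite mulmxBl mul_scalar_mx !mxE eqxx mulr1n => h.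
  rewrite /gq cdot_ebasisl mulmx_ebasis -h subrK; apply: eq_bigr => j _.
  by rewrite cdot_ebasisl mulmx_ebasis.
rewrite mulrDl addrA -E mulrDr mulr_sumr; congr (_ + _); apply: eq_bigr => j _.
by rewrite /dz mulrCA.
Qed.

Lemma adm_dev k : adm (dev k).
Proof. by apply: admB; [exact: adm_gq|exact: adm_cst]. Qed.
Lemma adm_dstat : adm dstat.
Proof.
apply: admD; apply: adm_sum => k; first by apply: admZ; exact: adm_dev.
by apply: adm_sum => l; apply: admZ; apply: admM; exact: adm_dev.
Qed.
Lemma adm_dstat_h i j : adm (dstat_h i j).
Proof.
apply: admD; apply: adm_sum => k; first by apply: admZ; exact: adm_gh.
apply: adm_sum => l; apply: admZ; apply: admD.
  by apply: admM; [exact: adm_gh|exact: adm_dev].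
by apply: admM; [exact: adm_dev|exact: adm_gh].
Qed.
Lemma adm_dstat_b i j : adm (dstat_b i j).
Proof.
apply: admD; apply: adm_sum => k; first by apply: admZ; exact: adm_gb.
apply: adm_sum => l; apply: admZ; apply: admD.
  by apply: admM; [exact: adm_gb|exact: adm_dev].
by apply: admM; [exact: adm_dev|exact: adm_gb].
Qed.
Lemma adm_dz i j : adm (dz i j). Proof. by apply: admZ; exact: adm_gq. Qed.
Lemma adm_dzh i j : adm (dzh i j). Proof. by apply: admZ; exact: adm_gh. Qed.
Lemma adm_dzb i j : adm (dzb i j). Proof. by apply: admZ; exact: adm_gb. Qed.
Lemma adm_dq : adm dq.
Proof.
apply: adm_sum => i; apply: admZ; apply: admM; last exact: adm_gq.
by apply: adm_sum => l; apply: admZ; exact: adm_gq.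
Qed.

Definition good2 (M : Mat) : bool :=
  good1 z L n M && ([forall i, r ^+ 2 * gam z M (ebasis i) <= L] && [forall k, cabs (dev k M) <= L * r ^+ 2]).

Lemma admb_good2 : admb good2.
Proof.
apply: admb_and; first exact: admb_good1.
apply: admb_and; apply: admb_forall => k; apply: admb_le; try exact: admR_cst.
  by apply: admRM; [exact: admR_cst|exact: admR_gam].
by apply: admR_cabs; exact: adm_dev.
Qed.

(** One bound for the first and second derivatives of [G_kk] in [H_ij]. It is quadratic in the
    entries joining [k] to [i] or [j], so its sums over [k] are controlled by Ward's identity. *)
Definition kap k i j (M : Mat) : R := 96 * L * (cabs (gq M (ebasis k) (ebasis i)) ^+ 2
  + cabs (gq M (ebasis k) (ebasis j)) ^+ 2 + cabs (gq M (ebasis i) (ebasis k)) ^+ 2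
  + cabs (gq M (ebasis j) (ebasis k)) ^+ 2 + dl L n ^+ 2).

Let L0 : 0 < L. Proof. exact: sc_L0 sc. Qed.
Let L1 : 1 <= L. Proof. exact: sc_L1 sc. Qed.
Let p0 : 0 < p. Proof. exact: sc_p0 sc. Qed.
Let r0 : 0 < r. Proof. exact: sc_r sc. Qed.
Let n0 : 0 < n. Proof. exact: sc_n sc. Qed.
Let hs0 : 0 < L / n. Proof. exact: sc_hs0 sc. Qed.
Let dl0 : 0 < dl L n. Proof. exact: sc_dl0 sc. Qed.

Lemma kap_ge0 k i j M : 0 <= kap k i j M.
Proof. by have := L0; have := dl0; rewrite /kap => ? ?; pos. Qed.

Lemma jk_kap k i j M : good1 z L n M ->
  jk1 z L n M i j (ebasis k) (ebasis k) <= kap k i j M /\ jk2 z L n M i j (ebasis k) (ebasis k) <= kap k i j M.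
Proof.
move=> gM; have h := al_ge0 z sc; have h' := ar_ge0 z sc.
have l3 a a' : al z L n M (ebasis a) a' <= 3 * L by apply: (al_le sc); exact: (good1_gq a a' gM).
have s1 := al_sqr z L n M (ebasis k) i; have s2 := al_sqr z L n M (ebasis k) j.
have s3 := ar_sqr z L n M (ebasis k) i; have s4 := ar_sqr z L n M (ebasis k) j.
have o6 : al z L n M (ebasis i) j + al z L n M (ebasis j) i <= 6 * L.
  by rewrite (_ : 6 * L = 3 * L + 3 * L); [exact: lerD (l3 i j) (l3 j i)|ring].
exact: (kap_arith L1 (h M (ebasis k) i) (h M (ebasis k) j) (h' M (ebasis k) i) (h' M (ebasis k) j)
  (addr_ge0 (h M (ebasis i) j) (h M (ebasis j) i)) s1 s2 s3 s4 o6).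
Qed.

Lemma kap_le k i j M : good1 z L n M -> kap k i j M <= L ^+ 4.
Proof.
move=> gM; rewrite /kap.
have g2 a a' : cabs (gq M (ebasis a) (ebasis a')) ^+ 2 <= L ^+ 2.
  by apply: ler_wXn2r; [exact: cabs_ge0|exact: (good1_gq a a' gM)].
have d2 : dl L n ^+ 2 <= 1 by rewrite -(expr1n _ 2); apply: ler_wXn2r; [exact: ltW|exact: sc_dlL sc].
have L2 : 1 <= L ^+ 2 by apply: exprn_ege1.
apply: (@le_trans _ _ (96 * L * (5 * L ^+ 2))).
  apply: ler_wpM2l; first by have := L0; move=> ?; pos.
  rewrite (_ : 5 * L ^+ 2 = L ^+ 2 + L ^+ 2 + L ^+ 2 + L ^+ 2 + L ^+ 2); last by ring.
  apply: lerD; last exact: le_trans d2 L2.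
  exact: lerD (lerD (lerD (g2 k i) (g2 k j)) (g2 i k)) (g2 j k).
rewrite (_ : 96 * L * (5 * L ^+ 2) = 480 * L ^+ 3); last by ring.
by apply: (sc_cst sc).
Qed.

Lemma hs_kap : L / n * L ^+ 4 <= L * r ^+ 2.
Proof.
have h := sc_pr sc.
apply: (@le_trans _ _ (L ^+ 2 * p * L ^+ 4)); first by rewrite ler_wpM2r ?(sc_Lpow0 sc) // (sc_hs_le sc).
rewrite (_ : _ * L ^+ 4 = L * (L ^+ 5 * p)); last by ring.
rewrite ler_pM2l //; apply: le_trans h; rewrite ler_wpM2r ?(ltW p0) //.
by apply: (sc_Lpow sc).
Qed.

Lemma dev_jet k i j M : hermitian M -> good2 M ->
  jet (M i j) (dev k M) (dev k (zer i j M)) (gh i j M (ebasis k) (ebasis k)) (gb i j M (ebasis k) (ebasis k))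
    (gh i j (zer i j M) (ebasis k) (ebasis k)) (gb i j (zer i j M) (ebasis k) (ebasis k))
    (2 * (L * r ^+ 2)) (kap k i j M) (kap k i j M).
Proof.
move=> hM /andP[gM /andP[_ /forallP hu]].
have hx k' : cabs (gq M (ebasis k) (ebasis k')) <= L by exact: (good1_gq k k' gM).
have hy k' : cabs (gq M (ebasis k') (ebasis k)) <= L by exact: (good1_gq k' k gM).
have := jet_vec z0 sc i j hM gM hx hy.
have [k1 k2] := jk_kap k i j gM.
set K := kap k i j M in k1 k2 *.
have KL : L / n * K <= L * r ^+ 2.
  by apply: le_trans hs_kap; rewrite ler_wpM2l ?(ltW hs0) //; exact: kap_le.
move=> J; have := jet_le (lexx _) k1 k2 J => {}J.
have d0 := jet_d J; have hij := good1_entry i j gM.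
have K0 : 0 <= K by exact: kap_ge0.
have dd : cabs (gq M (ebasis k) (ebasis k) - gq (zer i j M) (ebasis k) (ebasis k)) <= L * r ^+ 2.
  by apply: le_trans d0 _; apply: le_trans KL; rewrite ler_wpM2r.
have uk := hu k; have LR : 0 <= L * r ^+ 2 by apply: le_trans uk.
rewrite /dev; apply: jet_value J.
  by apply: le_trans uk _; rewrite ler_peMl ?ler1n.
rewrite -[X in cabs X](subKr (dev k M)) (_ : dev k M - (gq (zer i j M) (ebasis k) (ebasis k) - m) = gq M (ebasis k) (ebasis k) - gq (zer i j M) (ebasis k) (ebasis k)); last first.
  by rewrite /dev; move: (gq _ _ _) (gq _ _ _) => u v; ring.
by apply: le_trans (cabsB _ _) _; rewrite (_ : 2 * _ = L * r ^+ 2 + L * r ^+ 2); [exact: lerD|ring].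
Qed.


Lemma jet_val (h f f0 fh fb fh0 fb0 : R[i]) (k0 k1 k2 k : R) : cabs f <= k -> cabs f0 <= k ->
  jet h f f0 fh fb fh0 fb0 k0 k1 k2 -> jet h f f0 fh fb fh0 fb0 k k1 k2.
Proof. by move=> h1 h2 []; split. Qed.

Let bS0 k l : 0 <= b k * S k l. Proof. by rewrite mulr_ge0 ?Svar_ge0. Qed.
Let cbS k l : cabs (((b k * S k l)%:C)%C) = b k * S k l.
Proof. by rewrite cabs_real ger0_norm. Qed.

Lemma weight_sum (U : R) (x : 'I_N -> R) :
  \sum_k cabs (dcoef k) * x k + \sum_k \sum_l cabs (((b k * S k l)%:C)%C) * (x k * U + U * x l) =
  \sum_k (cabs (dcoef k) + U * (b k + \sum_l b l * S l k)) * x k.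
Proof.
have -> : \sum_k \sum_l cabs (((b k * S k l)%:C)%C) * (x k * U + U * x l) =
   \sum_k (U * b k * x k) + \sum_k \sum_l b k * S k l * (U * x l).
  rewrite -big_split /=; apply: eq_bigr => k _.
  rewrite (_ : U * b k * x k = \sum_l b k * S k l * (x k * U)); last first.
    by rewrite -mulr_suml -mulr_sumr (Svar_sum W) mulr1 -mulrA mulrCA [_ * x k]mulrC.
  by rewrite -big_split /=; apply: eq_bigr => l _; rewrite cbS mulrDr.
rewrite exchange_big addrA -!big_split /=; apply: eq_bigr => k _.
by rewrite -mulr_suml; ring.
Qed.

(** Total weight of the derivative of [G_kk] in that of [dstat], the other factor of a quadratic
    term being at most [2 * (L * r ^+ 2)]. The resulting bound [Ys] enters the target through
    [p * Ys <= B ^+ 2], so statistics less sensitive to one entry obey a better bound. *)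
Definition wgt k : R := cabs (dcoef k) + 2 * (L * r ^+ 2) * (b k + \sum_l b l * S l k).
Hypothesis hY : forall M i j, hermitian M -> good2 M -> 3 * \sum_k wgt k * kap k i j M <= Ys.
Hypothesis B0 : 0 < B.
Hypothesis B1 : B <= 1.
Hypothesis hB1 : L ^+ 10 * (p * Ys) <= B ^+ 2.
Hypothesis hB2 : L ^+ 13 * p ^+ 2 <= B.
Hypothesis BV : V^-1 <= B.
Hypothesis YV : Ys <= V.
Hypothesis NV : N%:R <= V.
Hypothesis Ys0 : 0 <= Ys.

Let S_le k l : S k l <= L * (p ^+ 2 * r ^+ 2).
Proof.
have h := Svar_ub W k l; have N0 : 0 < N%:R :> R := dim_gt0 k.
rewrite -(sc_Ninv sc) ler_pdivlMr // mulrC; apply: le_trans h _; exact: sc_C sc.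
Qed.

Lemma sum_S_le k (x : 'I_N -> R) : (forall l, 0 <= x l) -> r ^+ 2 * \sum_l x l <= L ->
  \sum_l S k l * x l <= L ^+ 2 * p ^+ 2.
Proof.
move=> x0 hx; apply: (@le_trans _ _ (\sum_l L * (p ^+ 2 * r ^+ 2) * x l)).
  by apply: ler_sum => l _; rewrite ler_wpM2r.
rewrite -mulr_sumr (_ : _ * _ = L * p ^+ 2 * (r ^+ 2 * \sum_l x l)); last by ring.
rewrite (_ : L ^+ 2 * p ^+ 2 = L * p ^+ 2 * L); last by ring.
by apply: ler_wpM2l => //; have := L0; have := p0 => ? ?; pos.
Qed.

Lemma good2_gam M i : good2 M -> r ^+ 2 * gam z M (ebasis i) <= L.
Proof. by case/andP => _ /andP[/forallP /(_ i)]. Qed.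

Lemma row_arith : 96 * L * (5 * (L ^+ 9 * p ^+ 2)) <= 2 * (L * r ^+ 2).
Proof.
have p0' := ltW p0; have L0' := ltW L0.
have h1 : 480 * L ^+ 10 * p <= r ^+ 2.
  apply: le_trans (sc_pr sc); apply: ler_wpM2r => //.
  by apply: (@le_trans _ _ (L ^+ 11)); [exact: (sc_cst sc)|exact: (sc_Lpow sc)].
have r2 : 0 <= r ^+ 2 by exact: sqr_ge0.
rewrite (_ : 96 * L * (5 * (L ^+ 9 * p ^+ 2)) = 480 * L ^+ 10 * p * p); last by ring.
apply: (@le_trans _ _ (r ^+ 2 * 1)).
  apply: ler_pM.
  - apply: mulr_ge0; last exact: p0'.
    apply: mulr_ge0; last exact: exprn_ge0.
    exact: ler0n.
  - exact: p0'.
  - exact: h1.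
  - exact: sc_p1 sc.
rewrite mulr1 mulrA ler_peMl //; apply: le_trans L1 _; rewrite ler_peMl //.
by rewrite ler1n.
Qed.

Lemma kap_row k i j M : hermitian M -> good2 M -> \sum_l S k l * kap l i j M <= 2 * (L * r ^+ 2).
Proof.
move=> hM gM.
have gi := good2_gam i gM; have gj := good2_gam j gM.
have c2 (x : R[i]) : 0 <= cabs x ^+ 2 by exact: sqr_ge0.
have h1 := sum_S_le k (fun l => c2 (gq M (ebasis l) (ebasis i))) gi.
have h2 := sum_S_le k (fun l => c2 (gq M (ebasis l) (ebasis j))) gj.
rewrite -(gam_row z0 (ebasis i) hM) in gi; rewrite -(gam_row z0 (ebasis j) hM) in gj.
have h3 := sum_S_le k (fun l => c2 (gq M (ebasis i) (ebasis l))) gi.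
have h4 := sum_S_le k (fun l => c2 (gq M (ebasis j) (ebasis l))) gj.
rewrite /kap sum_lin5.
rewrite -mulr_suml (Svar_sum W) mul1r.
apply: (@le_trans _ _ (96 * L * (L ^+ 2 * p ^+ 2 + L ^+ 2 * p ^+ 2 + L ^+ 2 * p ^+ 2 + L ^+ 2 * p ^+ 2 + L ^+ 9 * p ^+ 2))).
  apply: ler_wpM2l; first by have := L0 => ?; pos.
  exact: lerD (lerD (lerD (lerD h1 h2) h3) h4) (sc_dl2 sc).
have l2 : L ^+ 2 <= L ^+ 9 by exact: (sc_Lpow sc).
apply: le_trans row_arith; apply: ler_wpM2l; first by have := L0 => ?; pos.
have : L ^+ 2 * p ^+ 2 <= L ^+ 9 * p ^+ 2 by rewrite ler_wpM2r ?sqr_ge0.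
move: (L ^+ 2 * p ^+ 2) (L ^+ 9 * p ^+ 2) => u v uv; clear h1 h2 h3 h4 gi gj l2 c2 hM gM; lra.
Qed.

Let wk0 k i j M : 0 <= wgt k * kap k i j M.
Proof.
apply: mulr_ge0; last exact: kap_ge0.
rewrite /wgt; apply: addr_ge0 => //; apply: mulr_ge0; first by have := L0; have := r0 => ? ?; pos.
by apply: addr_ge0 => //; apply: sumr_ge0 => l _; apply: mulr_ge0; [|exact: Svar_ge0].
Qed.

Lemma hs_Ys : L / n * Ys <= B.
Proof.
apply: (@le_trans _ _ (L ^+ 2 * p * Ys)); first by rewrite ler_wpM2r // (sc_hs_le sc).
apply: (@le_trans _ _ (L ^+ 10 * (p * Ys))).
  rewrite mulrA; apply: ler_wpM2r => //; apply: ler_wpM2r; [exact: ltW|exact: (sc_Lpow sc)].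
by apply: le_trans hB1 _; rewrite expr2 ger_pMl.
Qed.

(** The factor 3 in [hY] is one for the terms linear in [kap] and two for the products
    [2 * kap k * kap l], where [kap_row] bounds the inner sum by the same quantity [U] as the
    deviations. *)
Lemma dstat_jet i j M : hermitian M -> good2 M ->
  jet (M i j) (dstat M) (dstat (zer i j M)) (dstat_h i j M) (dstat_b i j M)
    (dstat_h i j (zer i j M)) (dstat_b i j (zer i j M)) (cabs (dstat M) + B) Ys Ys.
Proof.
move=> hM gM.
have J1 := jet_sum (index_enum 'I_N) (fun k => jetZ (dcoef k) (dev_jet k i j hM gM)).
have J2 := jet_sum (index_enum 'I_N) (fun k => jet_sum (index_enum 'I_N) (fun l =>
   jetZ (((b k * S k l)%:C)%C) (jetM (dev_jet k i j hM gM) (dev_jet l i j hM gM)))).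
have J := jetD J1 J2.
set U := 2 * (L * r ^+ 2) in J J1 J2.
have wE := weight_sum U (fun k => kap k i j M).
have hk := hY i j hM gM.
set Sw := \sum_k wgt k * kap k i j M in hk.
have Sw0 : 0 <= Sw by apply: sumr_ge0 => k _; exact: wk0.
have e1 : \sum_k cabs (dcoef k) * kap k i j M + \sum_k \sum_l cabs (((b k * S k l)%:C)%C) *
    (kap k i j M * U + U * kap l i j M) = Sw by rewrite wE.
have h1 : \sum_k cabs (dcoef k) * kap k i j M + \sum_k \sum_l cabs (((b k * S k l)%:C)%C) *
    (kap k i j M * U + U * kap l i j M) <= Ys.
  by rewrite e1; apply: le_trans hk; rewrite ler_peMl // ler1n.
have h2 : \sum_k cabs (dcoef k) * kap k i j M + \sum_k \sum_l cabs (((b k * S k l)%:C)%C) *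
    (kap k i j M * U + U * kap l i j M + 2 * (kap k i j M * kap l i j M)) <= Ys.
  apply: le_trans hk.
  have -> : \sum_k \sum_l cabs (((b k * S k l)%:C)%C) *
    (kap k i j M * U + U * kap l i j M + 2 * (kap k i j M * kap l i j M)) =
    \sum_k \sum_l cabs (((b k * S k l)%:C)%C) * (kap k i j M * U + U * kap l i j M) +
    \sum_k 2 * (b k * kap k i j M) * \sum_l S k l * kap l i j M.
    rewrite -big_split /=; apply: eq_bigr => k _; rewrite mulr_sumr -big_split /=; apply: eq_bigr => l _.
    by rewrite mulrDr cbS; congr (_ + _); move: (kap k i j M) (kap l i j M) (S k l) => ? ? ?; ring.
  rewrite addrA e1 (_ : 3 * Sw = Sw + 2 * Sw); last by ring.
  rewrite lerD2l /Sw [leRHS]mulr_sumr; apply: ler_sum => k _.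
  have k0 := kap_ge0 k i j M.
  apply: (@le_trans _ _ (2 * (b k * kap k i j M) * U)).
    apply: ler_wpM2l; last exact: kap_row.
    by apply: mulr_ge0 => //; exact: mulr_ge0.
  rewrite (_ : _ * U = 2 * (U * b k * kap k i j M)); last by ring.
  apply: ler_wpM2l => //; apply: ler_wpM2r => //; rewrite /wgt -/U.
  have Ub : U * b k <= U * (b k + \sum_l b l * S l k).
    apply: ler_wpM2l; first by rewrite /U; have := L0; have := r0 => ? ?; pos.
    by rewrite lerDl; apply: sumr_ge0 => l _; apply: mulr_ge0; [|exact: Svar_ge0].
  by apply: le_trans Ub _; rewrite lerDr; exact: cabs_ge0.
have {}J := jet_le (lexx _) h1 h2 J.
apply: (jet_val _ _ J); first by rewrite lerDl ltW.
have dd := jet_d J.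
change (cabs (dstat (zer i j M)) <= cabs (dstat M) + B).
rewrite (_ : dstat (zer i j M) = dstat M - (dstat M - dstat (zer i j M))); last by rewrite subKr.
apply: le_trans (cabsB _ _) _; rewrite lerD2l.
apply: le_trans dd _; apply: le_trans hs_Ys; rewrite ler_wpM2r //.
have [g1 _] := andP gM; exact: (good1_entry i j g1).
Qed.


Let c0 : 0 < c. Proof. by apply: lt_le_trans c1. Qed.
Let b_le1 i : b i <= 1.
Proof. by apply: le_trans b1; rewrite (bigD1 i) //= lerDl; apply: sumr_ge0. Qed.
Let cb i : cabs ((b i)%:C)%C = b i. Proof. by rewrite cabs_real ger0_norm. Qed.

Lemma dz_jet i j M : hermitian M -> good2 M ->
  jet (M i j) (dz i j M) (dz i j (zer i j M)) (dzh i j M) (dzb i j M) (dzh i j (zer i j M)) (dzb i j (zer i j M))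
    (b i * al z L n M (ebasis j) i) (b i * (18 * L ^+ 2))
    (b i * (60 * L ^+ 2 * (al z L n M (ebasis i) j + al z L n M (ebasis j) i))).
Proof.
move=> hM /andP[gM _].
have hx k' : cabs (gq M (ebasis j) (ebasis k')) <= L by exact: (good1_gq j k' gM).
have hy k' : cabs (gq M (ebasis k') (ebasis i)) <= L by exact: (good1_gq k' i gM).
have J := jet_vec z0 sc i j hM gM hx hy.
have l3 a a' : al z L n M (ebasis a) a' <= 3 * L by apply: (al_le sc); exact: (good1_gq a a' gM).
have a0 a a' : 0 <= al z L n M (ebasis a) a' by exact: (al_ge0 z sc).
have v1 : cabs (gq M (ebasis j) (ebasis i)) <= al z L n M (ebasis j) i.
  have := cabs_ge0 (gq M (ebasis j) (ebasis i)); have := ltW dl0.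
  by rewrite /al; move: (cabs _) (dl _ _) => u v; lra.
have v0 : cabs (gq (zer i j M) (ebasis j) (ebasis i)) <= al z L n M (ebasis j) i.
  have hg k l : cabs (gq M (ebasis k) (ebasis l)) <= L by exact: (good1_gq k l gM).
  exact: (gq_zer_row z0 hM (good1_entry i j gM) (sc_hs4 sc) hg hx (or_introl (erefl i))).
have {}J := jet_val v1 v0 J.
have k1 : jk1 z L n M i j (ebasis j) (ebasis i) <= 18 * L ^+ 2.
  rewrite /jk1 (_ : 18 * L ^+ 2 = (3 * L) * (3 * L) + (3 * L) * (3 * L)); last by ring.
  by apply: lerD; (apply: ler_pM; [exact: a0|exact: (a0 _ _)|exact: l3|exact: (l3 _ _)]).
have k2 : jk2 z L n M i j (ebasis j) (ebasis i) <= 60 * L ^+ 2 * (al z L n M (ebasis i) j + al z L n M (ebasis j) i).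
  rewrite /jk2; set o := al z L n M (ebasis i) j + al z L n M (ebasis j) i.
  have o0 : 0 <= o by apply: addr_ge0; exact: a0.
  have ao : al z L n M (ebasis j) i <= o by rewrite /o lerDr; exact: a0.
  have e1 : al z L n M (ebasis j) i * ar z L n M (ebasis i) i <= o * (3 * L).
    by apply: ler_pM; [exact: a0|exact: (a0 i i)|exact: ao|exact: (l3 i i)].
  have e2 : al z L n M (ebasis j) j * ar z L n M (ebasis i) j <= 3 * L * o.
    by apply: ler_pM; [exact: a0|exact: (a0 j i)|exact: l3|exact: ao].
  have e3 : o * jk1 z L n M i j (ebasis j) (ebasis i) <= o * (18 * L ^+ 2) by rewrite ler_wpM2l.
  have e4 : 2 * L * (al z L n M (ebasis j) i * ar z L n M (ebasis i) i + al z L n M (ebasis j) j * ar z L n M (ebasis i) j)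
     <= 2 * L * (o * (3 * L) + 3 * L * o).
    by apply: ler_wpM2l; [have := ltW L0 => ?; pos|exact: lerD].
  rewrite (_ : 60 * L ^+ 2 * o = 2 * (2 * L * (o * (3 * L) + 3 * L * o) + o * (18 * L ^+ 2))); last by ring.
  by rewrite ler_pM2l // lerD.
have := jetZ ((b i)%:C)%C (jet_le (lexx _) k1 k2 J); rewrite cb; exact.
Qed.

Let npr : n * (p * r) = 1. Proof. exact: sc_p sc. Qed.

(** Cauchy-Schwarz bounds a full row sum by [n * (L / r)], against [(L / n) ^+ 3] from the cubic
    remainder. *)
Lemma hs3_sum (x : 'I_N -> R) : (forall k, 0 <= x k) -> r ^+ 2 * \sum_k x k ^+ 2 <= L ->
  (L / n) ^+ 3 * \sum_k (2 * x k + dl L n) <= L ^+ 9 * p ^+ 2.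
Proof.
move=> x0 hx.
have rn := lt0r_neq0 r0.
have p0' := ltW p0; have L0' := ltW L0; have r0' := ltW r0.
have h1 : \sum_k x k <= n * (L / r).
  apply: (sum_le_sqrt (ltW n0) _ (sc_N sc)); first by apply: mulr_ge0 => //; rewrite invr_ge0.
  rewrite exprMn exprVn ler_pdivlMr ?exprn_gt0 // mulrC; apply: le_trans hx _.
  by rewrite -[leLHS]expr1; exact: (sc_Lpow sc).
rewrite big_split /= sumr_const card_ord -mulr_sumr -[dl L n *+ N]mulr_natl -(sc_N sc) (sc_dl sc) (sc_hs sc).
apply: (@le_trans _ _ ((L * (p * r)) ^+ 3 * (2 * (n * (L / r)) + n ^+ 2 * (2 * L ^+ 3 * (p * r))))).
  by apply: ler_wpM2l; [pos|rewrite lerD2r ler_wpM2l].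
rewrite (_ : _ * _ = 2 * L ^+ 4 * p ^+ 2 * r * (n * (p * r)) + 2 * L ^+ 6 * (p ^+ 2 * r ^+ 2) * (n * (p * r)) ^+ 2); last by field.
rewrite npr expr1n !mulr1.
have rL := sc_rL sc.
have r2 : r ^+ 2 <= L ^+ 2 by exact: ler_wXn2r.
have pp : 0 <= p ^+ 2 by pos.
apply: (@le_trans _ _ (2 * L ^+ 4 * p ^+ 2 * L + 2 * L ^+ 6 * (p ^+ 2 * L ^+ 2))).
  by apply: lerD; apply: ler_wpM2l; [pos|exact: rL|pos|exact: ler_wpM2l].
rewrite (_ : _ + _ = (2 * L ^+ 5 + 2 * L ^+ 8) * p ^+ 2); last by ring.
apply: ler_wpM2r => //; apply: le_trans (_ : 4 * L ^+ 8 <= _); last exact: (sc_cst sc).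
have : L ^+ 5 <= L ^+ 8 by exact: (sc_Lpow sc).
by move: (L ^+ 5) (L ^+ 8) => u v; lra.
Qed.

Lemma hs3_N : (L / n) ^+ 3 * N%:R <= L ^+ 4 * p.
Proof.
rewrite -(sc_N sc) (sc_hs sc) (_ : _ * _ = L ^+ 3 * p * r * (n * (p * r)) ^+ 2); last by ring.
rewrite npr expr1n mulr1 (_ : L ^+ 4 * p = L ^+ 3 * p * L); last by ring.
by apply: ler_wpM2l; [have := ltW p0; have := ltW L0 => ? ?; pos|exact: sc_rL sc].
Qed.

Lemma final_arith : 60 * L ^+ 2 * (L ^+ 9 * p ^+ 2 + L ^+ 9 * p ^+ 2) + 18 * L ^+ 2 * (L ^+ 4 * p) * (Ys / B)
  + L ^+ 9 * p ^+ 2 * (Ys / B + (Ys / B) ^+ 2) <= B.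
Proof.
have p0' := ltW p0; have L0' := ltW L0; have B0' := ltW B0.
(* In terms of [w] the hypothesis on [Ys] reads [L ^+ 10 * w <= B], and each term is a power of [L]
   times [p ^+ 2], [w], [p * w] or [w ^+ 2]. *)
set w := p * (Ys / B).
have w0 : 0 <= w by rewrite /w; pos.
have hw : L ^+ 10 * w <= B.
  rewrite /w -(ler_pM2r B0) -mulrA [_ * B]mulrC.
  rewrite (_ : B * (p * (Ys / B)) = p * Ys); last by field; exact: lt0r_neq0.
  by rewrite -expr2.
have w1 : w <= 1.
  apply: le_trans B1; apply: le_trans hw; rewrite ler_peMl //; apply: exprn_ege1; exact: L1.
have pw : p * w <= w by rewrite ler_piMl // (sc_p1 sc).
have ww : w ^+ 2 <= w by rewrite expr2 ler_piMl.
have t1 : 480 * (L ^+ 11 * p ^+ 2) <= B.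
  apply: le_trans hB2; rewrite mulrA; apply: ler_wpM2r; first by pos.
  by apply: (@le_trans _ _ (L ^+ 12)); [exact: (sc_cst sc)|exact: (sc_Lpow sc)].
have t2 : 72 * (L ^+ 6 * w) <= B.
  apply: le_trans hw; rewrite mulrA; apply: ler_wpM2r => //.
  by apply: (@le_trans _ _ (L ^+ 7)); [exact: (sc_cst sc)|exact: (sc_Lpow sc)].
have t3 : 4 * (L ^+ 9 * w) <= B.
  by apply: le_trans hw; rewrite mulrA; apply: ler_wpM2r => //; exact: (sc_cst sc).
have t4 : L ^+ 9 * (p * w) <= L ^+ 9 * w by apply: ler_wpM2l => //; pos.
have t5 : L ^+ 9 * w ^+ 2 <= L ^+ 9 * w by apply: ler_wpM2l => //; pos.
rewrite (_ : _ + _ = 120 * (L ^+ 11 * p ^+ 2) + 18 * (L ^+ 6 * w) + L ^+ 9 * (p * w) + L ^+ 9 * w ^+ 2); last first.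
  by rewrite /w; move: (Ys / B) => y; ring.
move: (L ^+ 11 * p ^+ 2) (L ^+ 6 * w) (L ^+ 9 * w) (L ^+ 9 * (p * w)) (L ^+ 9 * w ^+ 2) t1 t2 t3 t4 t5 => x1 x2 x3 x4 x5.
by clear w0 hw w1 pw ww w; lra.
Qed.


Let sumcb (x : 'I_N -> R) (A : R) : 0 <= A -> (forall i, x i <= A) -> \sum_i b i * x i <= A.
Proof.
move=> A0 hx; apply: (@le_trans _ _ (\sum_i b i * A)).
  by apply: ler_sum => i _; exact: ler_wpM2l.
by rewrite -mulr_suml ler_piMl.
Qed.

Lemma dterm4 M : hermitian M -> good2 M ->
  (L / n) ^+ 3 * \sum_i \sum_j (b i * (60 * L ^+ 2 * (al z L n M (ebasis i) j + al z L n M (ebasis j) i))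
    + b i * (18 * L ^+ 2) * (Ys / B) + b i * al z L n M (ebasis j) i * (Ys / B + (Ys / B) ^+ 2)) <= B.
Proof.
move=> hM gM.
have h1 i : (L / n) ^+ 3 * \sum_j al z L n M (ebasis j) i <= L ^+ 9 * p ^+ 2.
  by apply: (hs3_sum (x := fun j => cabs (gq M (ebasis j) (ebasis i)))) => //; exact: good2_gam.
have h2 i : (L / n) ^+ 3 * \sum_j al z L n M (ebasis i) j <= L ^+ 9 * p ^+ 2.
  apply: (hs3_sum (x := fun j => cabs (gq M (ebasis i) (ebasis j)))) => //.
  by rewrite (gam_row z0 (ebasis i) hM); exact: good2_gam.
set y := Ys / B.
have y0 : 0 <= y by rewrite /y; have := ltW B0 => ?; pos.
rewrite (eq_bigr (fun i => b i * (60 * L ^+ 2 * (\sum_j al z L n M (ebasis i) j + \sum_j al z L n M (ebasis j) i)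
   + 18 * L ^+ 2 * N%:R * y + (\sum_j al z L n M (ebasis j) i) * (y + y ^+ 2)))) => [|i _]; last first.
  by rewrite (sum_lin4 (al z L n M (ebasis i)) (fun j => al z L n M (ebasis j) i)) card_ord.
rewrite mulr_sumr (eq_bigr (fun i => b i * (60 * L ^+ 2 * ((L / n) ^+ 3 * \sum_j al z L n M (ebasis i) j + (L / n) ^+ 3 * \sum_j al z L n M (ebasis j) i)
   + 18 * L ^+ 2 * ((L / n) ^+ 3 * N%:R) * y + ((L / n) ^+ 3 * \sum_j al z L n M (ebasis j) i) * (y + y ^+ 2)))) => [|i _]; last first.
  exact: mul_lin4.
apply: sumcb => [|i]; first exact: ltW.
have := final_arith; rewrite -/y; apply: le_trans.
have L0' := ltW L0.
apply: lerD; first apply: lerD.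
- by apply: ler_wpM2l; [pos|exact: lerD].
- by apply: ler_wpM2r => //; apply: ler_wpM2l; [pos|exact: hs3_N].
- by apply: ler_wpM2r; [pos|exact: h1].
Qed.

(** The derivative of [G_ji] in the conjugate entry is [- G_jj G_ii], whose variance sum cancels
    [dq] exactly; only the pseudo-variance terms with [G_ji ^ 2] remain, and Ward's identity makes
    them of order [p ^+ 2]. *)
Lemma dterm1 M : hermitian M -> good2 M -> cabs (term1 P H dq dzh dzb M) <= B.
Proof.
move=> hM gM.
have -> : term1 P H dq dzh dzb M = \sum_i ((b i)%:C)%C * - (\sum_j Tv i j * (offd i j * gq M (ebasis j) (ebasis i) ^+ 2)).
  rewrite /term1 /dq -big_split /=; apply: eq_bigr => i _.
  have e1 : \sum_(j < N) Tv i j * dzh i j M = ((b i)%:C)%C * - (\sum_j Tv i j * (offd i j * gq M (ebasis j) (ebasis i) ^+ 2)).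
    rewrite -sumrN mulr_sumr; apply: eq_bigr => j _; rewrite /dzh /gh; move: (gq _ _ _) (Tv i j) (offd i j) => u v w; ring.
  have e2 : \sum_(j < N) ((S i j)%:C)%C * dzb i j M = - (((b i)%:C)%C * ((\sum_(l < N) ((S i l)%:C)%C * gq M (ebasis l) (ebasis l)) * gq M (ebasis i) (ebasis i))).
    rewrite mulr_suml mulr_sumr -sumrN; apply: eq_bigr => j _; rewrite /dzb /gb.
    by move: (gq _ _ _) (gq _ _ _) => u v; ring.
  by rewrite big_split /= e1 e2 subrK.
apply: le_trans (cabs_sum _ _ _) _.
apply: (@le_trans _ _ (\sum_i b i * cabs (\sum_j Tv i j * (offd i j * gq M (ebasis j) (ebasis i) ^+ 2)))).
  by apply: ler_sum => i _; rewrite cabsM cb cabsN.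
apply: sumcb => [|i]; first exact: ltW.
apply: le_trans hB2; apply: (@le_trans _ _ (L ^+ 2 * p ^+ 2)); last first.
  by apply: ler_wpM2r; [exact: sqr_ge0|exact: (sc_Lpow sc)].
apply: le_trans (sum_S_le i (fun l => sqr_ge0 (cabs (gq M (ebasis l) (ebasis i)))) (good2_gam i gM)).
apply: le_trans (cabs_sum _ _ _) _; apply: ler_sum => j _.
rewrite cabsM cabsM cabsX; apply: ler_pM; [exact: cabs_ge0|by apply: mulr_ge0 => //; exact: sqr_ge0| |].
  exact: (Tvar_le W).
by rewrite ler_piMl ?sqr_ge0 // offd_le1.
Qed.

(** Covers [term2] and [term3]. The derivatives of [dstat] are at most [Ys], and the variances times
    [sum_j |G_ji|] leave a factor [p]: this is the origin of the condition on [p * Ys]. *)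
Lemma dterm23 M (X1 X2 : 'I_N -> 'I_N -> R[i]) : hermitian M -> good2 M ->
  (forall i j, cabs (X1 i j) <= Ys) -> (forall i j, cabs (X2 i j) <= Ys) ->
  cabs (\sum_i \sum_j dz i j M * (Tv i j * X1 i j + ((S i j)%:C)%C * X2 i j)) <= B ^+ 2.
Proof.
move=> hM gM h1 h2.
have L0' := ltW L0; have p0' := ltW p0; have r0' := ltW r0.
apply: le_trans (cabs_sum _ _ _) _.
apply: (@le_trans _ _ (\sum_i b i * (2 * (L * (p ^+ 2 * r ^+ 2)) * Ys * \sum_j cabs (gq M (ebasis j) (ebasis i))))).
  apply: ler_sum => i _; rewrite mulrA mulr_sumr; apply: le_trans (cabs_sum _ _ _) _; apply: ler_sum => j _.
  rewrite cabsM /dz cabsM cb -[X in _ <= X]mulrA -mulrA; apply: ler_wpM2l => //.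
  rewrite mulrC; apply: ler_wpM2r => //.
  rewrite [2 * _](_ : _ = L * (p ^+ 2 * r ^+ 2) + L * (p ^+ 2 * r ^+ 2)); last by ring.
  rewrite mulrDl; apply: le_trans (cabsD _ _) _; rewrite !cabsM; apply: lerD.
    by apply: ler_pM => //; apply: le_trans (Tvar_le W i j) _.
  by rewrite cabs_real ger0_norm ?Svar_ge0 //; apply: ler_pM => //; exact: Svar_ge0.
apply: sumcb => [|i]; first exact: sqr_ge0.
have rn := lt0r_neq0 r0.
have hs : \sum_j cabs (gq M (ebasis j) (ebasis i)) <= n * (L / r).
  apply: (sum_le_sqrt (ltW n0) _ (sc_N sc)); first by apply: mulr_ge0 => //; rewrite invr_ge0.
  have := good2_gam i gM; rewrite /gam => hx.
  rewrite exprMn exprVn ler_pdivlMr ?exprn_gt0 // mulrC; apply: le_trans hx _.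
  by rewrite -[leLHS]expr1; exact: (sc_Lpow sc).
apply: (@le_trans _ _ (2 * (L * (p ^+ 2 * r ^+ 2)) * Ys * (n * (L / r)))).
  by apply: ler_wpM2l => //; pos.
rewrite (_ : _ * _ = 2 * L ^+ 2 * (p * Ys) * (n * (p * r))); last by field.
rewrite npr mulr1; apply: le_trans hB1; apply: ler_wpM2r; first by pos.
by apply: (@le_trans _ _ (L ^+ 3)); [exact: (sc_cst sc)|exact: (sc_Lpow sc)].
Qed.


Lemma dcoef_sum : \sum_k cabs (dcoef k) <= c.
Proof.
apply: (@le_trans _ _ (\sum_k (b k * (cabs z + 1) + \sum_l b l * S l k))).
  apply: ler_sum => k _; apply: le_trans (cabsD _ _) _; apply: lerD.
    rewrite cabsM cb; apply: ler_wpM2l => //; apply: le_trans (cabsD _ _) _; exact: lerD.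
  rewrite cabsM cabs_real ger0_norm; last by apply: sumr_ge0 => l _; exact: mulr_ge0 (b0 l) (Svar_ge0 _ _ _ _).
  by apply: ler_piMl => //; apply: sumr_ge0 => l _; exact: mulr_ge0 (b0 l) (Svar_ge0 _ _ _ _).
rewrite big_split /= -mulr_suml exchange_big /=.
under [X in _ + X]eq_bigr => l _ do rewrite -mulr_sumr (Svar_sum W) mulr1.
apply: le_trans cz2; rewrite (_ : cabs z + 2 = 1 * (cabs z + 1) + 1); last by ring.
by apply: lerD => //; apply: ler_wpM2r => //; apply: addr_ge0 => //; exact: cabs_ge0.
Qed.

Lemma crude_dev i j k M : hermitian M ->
  jet (M i j) (dev k M) (dev k (zer i j M)) (gh i j M (ebasis k) (ebasis k)) (gb i j M (ebasis k) (ebasis k))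
    (gh i j (zer i j M) (ebasis k) (ebasis k)) (gb i j (zer i j M) (ebasis k) (ebasis k))
    (2 * c) (8 * c ^+ 3) (8 * c ^+ 3).
Proof.
move=> hM; have c0' := ltW c0.
have e1 : norm2 (ebasis k : 'cV[R[i]]_N) <= 1 by rewrite norm2_ebasis.
have J := jet_gq_crude z0 i j hM c0' cz e1 e1.
have cc : 2 * c ^+ 2 <= 8 * c ^+ 3.
  rewrite (_ : 8 * c ^+ 3 = (8 * c) * c ^+ 2); last by ring.
  by apply: ler_wpM2r; [exact: sqr_ge0|move: c1; lra].
have h M' : hermitian M' -> cabs (dev k M') <= 2 * c.
  move=> hM'; apply: le_trans (cabsB _ _) _; rewrite (_ : 2 * c = c + c); last by ring.
  by apply: lerD; [exact: gq_crude|exact: le_trans m1 c1].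
exact: jet_value (h _ hM) (h _ (zer_herm i j hM)) (jet_le (lexx _) cc (lexx _) J).
Qed.

Lemma crude_dstat i j M : hermitian M ->
  jet (M i j) (dstat M) (dstat (zer i j M)) (dstat_h i j M) (dstat_b i j M)
    (dstat_h i j (zer i j M)) (dstat_b i j (zer i j M)) V V V.
Proof.
move=> hM; have c0' := ltW c0.
have J1 := jet_sum (index_enum 'I_N) (fun k => jetZ (dcoef k) (crude_dev i j k hM)).
have J2 := jet_sum (index_enum 'I_N) (fun k => jet_sum (index_enum 'I_N) (fun l =>
   jetZ (((b k * S k l)%:C)%C) (jetM (crude_dev i j k hM) (crude_dev i j l hM)))).
have bS1 : \sum_k \sum_l cabs (((b k * S k l)%:C)%C) <= 1.
  under eq_bigr => k _ do (under eq_bigr => l _ do rewrite cbS; rewrite -mulr_sumr (Svar_sum W) mulr1).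
  exact: b1.
have cs (A : R) : 0 <= A -> \sum_k cabs (dcoef k) * A <= c * A.
  by move=> A0; rewrite -mulr_suml; apply: ler_wpM2r => //; exact: dcoef_sum.
have ss (A : R) : 0 <= A -> \sum_k \sum_l cabs (((b k * S k l)%:C)%C) * A <= A.
  move=> A0; under eq_bigr => k _ do rewrite -mulr_suml.
  by rewrite -mulr_suml ler_piMl.
have pw a e : (a <= e)%N -> c ^+ a <= c ^+ e by move=> ae; exact: ler_weXn2l.
have p2 := pw 2%N 6%N isT; have p4 := pw 4%N 6%N isT; have c6 : 0 <= c ^+ 6 by exact: exprn_ge0.
have fin (x : R) : x <= 400 * c ^+ 6 -> x <= V by move=> h; exact: le_trans cV.
have := jetD J1 J2; apply: jet_le.
- apply: fin; apply: le_trans (lerD (cs _ _) (ss _ _)) _; try by pos.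
  rewrite [leLHS](_ : _ = 6 * c ^+ 2); last by ring.
  by move: (c ^+ 2) (c ^+ 6) p2 c6 => u v; lra.
- apply: fin; apply: le_trans (lerD (cs _ _) (ss _ _)) _; try by pos.
  rewrite [leLHS](_ : _ = 40 * c ^+ 4); last by ring.
  by move: (c ^+ 4) (c ^+ 6) p4 c6 => u v; lra.
- apply: fin; apply: le_trans (lerD (cs _ _) (ss _ _)) _; try by pos.
  rewrite [leLHS](_ : _ = 40 * c ^+ 4 + 128 * c ^+ 6); last by ring.
  by move: (c ^+ 4) (c ^+ 6) p4 c6 => u v; lra.
Qed.

Lemma crude_dz i j M : hermitian M ->
  jet (M i j) (dz i j M) (dz i j (zer i j M)) (dzh i j M) (dzb i j M) (dzh i j (zer i j M)) (dzb i j (zer i j M)) V V V.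
Proof.
move=> hM; have c0' := ltW c0.
have e1 k : norm2 (ebasis k : 'cV[R[i]]_N) <= 1 by rewrite norm2_ebasis.
have := jetZ ((b i)%:C)%C (jet_gq_crude z0 i j hM c0' cz (e1 j) (e1 i)); rewrite cb.
have pw a e : (a <= e)%N -> c ^+ a <= c ^+ e by move=> ae; exact: ler_weXn2l.
have p1 := pw 1%N 6%N isT; have p2 := pw 2%N 6%N isT; have p3 := pw 3%N 6%N isT; have c6 : 0 <= c ^+ 6 by exact: exprn_ge0.
have fin (x : R) : 0 <= x -> x <= 400 * c ^+ 6 -> b i * x <= V.
  move=> x0 h; apply: le_trans cV; apply: le_trans h; exact: ler_piMl.
apply: jet_le; apply: fin; try by pos.
- by move: p1; rewrite expr1; move: (c ^+ 6) c6 => u; lra.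
- by move: (c ^+ 2) (c ^+ 6) p2 c6 => u v; lra.
- by move: (c ^+ 3) (c ^+ 6) p3 c6 => u v; lra.
Qed.

Lemma dstat_tail q (tau pb l : R) : 0 < tau -> tau <= 1 -> 0 <= Cp 6 -> 1 <= l -> 0 <= pb ->
  (P [set t | ~~ good2 (H t)] <= pb%:E)%E ->
  (P [set t | ~~ (cabs (dstat (H t)) <= l * B)%R] <=
    (mom_cst q * (l ^- (q + q.+2) + V ^+ (9 * (q + q.+2) + 2) * (tau * Cp 6 + tau^-1 * pb)))%:E)%E.
Proof.
move=> tau0 tau1 C60 l1 pb0 hpb.
have hM t := wig_herm W t.
have c6 : 1 <= c ^+ 6 by exact: exprn_ege1.
have V1 : 400 <= V by apply: le_trans cV; move: (c ^+ 6) c6 => u; lra.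
have N1 : (0 < N)%N by rewrite -(ltr_nat R) -(sc_N sc) exprn_gt0.
have aal x k := admR_al L n z0 x k.
apply: (@two_regime_tail _ C Cp N d T P H W dstat dq dstat_h dstat_b dz dzh dzb (fun _ _ _ => Ys) (fun _ _ _ => Ys)
  (fun i j M => b i * al z L n M (ebasis j) i) (fun i j M => b i * (18 * L ^+ 2))
  (fun i j M => b i * (60 * L ^+ 2 * (al z L n M (ebasis i) j + al z L n M (ebasis j) i))) good2 B V (L / n)); try assumption.
- exact: adm_dstat.
- exact: adm_dq.
- exact: adm_dstat_h.
- exact: adm_dstat_b.
- exact: adm_dz.
- exact: adm_dzh.
- exact: adm_dzb.
- by move=> i j; exact: admR_cst.
- by move=> i j; exact: admR_cst.
- by move=> i j; apply: admRM; [exact: admR_cst|exact: aal].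
- by move=> i j; exact: admR_cst.
- move=> i j; apply: admRM; first exact: admR_cst.
  by apply: admRM; [exact: admR_cst|apply: admRD; exact: aal].
- exact: admb_good2.
- exact: dstat_eq.
- by move=> t i j; split; [exact: crude_dstat|exact: crude_dz].
- move=> t; apply: le_trans (cabs_sum _ _ _) _.
  apply: (@le_trans _ _ (\sum_i b i * (c ^+ 2))).
    apply: ler_sum => i _; rewrite cabsM cb; apply: ler_wpM2l => //; rewrite cabsM expr2.
    have e1 k : norm2 (ebasis k : 'cV[R[i]]_N) <= 1 by rewrite norm2_ebasis.
    have gc k : cabs (gq (H t) (ebasis k) (ebasis k)) <= c by apply: gq_crude => //; exact: ltW c0.
    apply: ler_pM; [exact: cabs_ge0|exact: cabs_ge0| |exact: gc].
    apply: le_trans (cabs_sum _ _ _) _; apply: (@le_trans _ _ (\sum_l S i l * c)).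
      apply: ler_sum => l' _; rewrite cabsM cabs_real ger0_norm ?Svar_ge0 //.
      by apply: ler_wpM2l; [exact: Svar_ge0|exact: gc].
    by rewrite -mulr_suml (Svar_sum W) mul1r.
  apply: le_trans cV; have p2 : c ^+ 2 <= c ^+ 6 by exact: ler_weXn2l.
  rewrite -mulr_suml; apply: (@le_trans _ _ (1 * c ^+ 2)); first by apply: ler_wpM2r => //; exact: sqr_ge0.
  by move: (c ^+ 2) (c ^+ 6) p2 c6 => u v; lra.
- move=> t; case: (N =P 0%N) => [E|/eqP N0]; first by rewrite E in N1.
  have i0 : 'I_N by exact: (Ordinal N1).
  exact: jet_v (crude_dstat i0 i0 (hM t)).
- move=> t gt i j; have gM := gt; case/andP: gM => gM _; split.
  + exact: dstat_jet.
  + exact: dz_jet.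
  + split => //; apply: le_trans (_ : 1 * (3 * L) <= _).
      apply: ler_pM => //; first exact: (al_ge0 z sc).
      by apply: (al_le sc); exact: (good1_gq j i gM).
    have p1 : c ^+ 1 <= c ^+ 6 by exact: ler_weXn2l.
    by apply: le_trans cV; move: p1 Lc; rewrite expr1; move: (c ^+ 6) c6 => u; lra.
  have LcX a : L ^+ a <= c ^+ a by apply: ler_wXn2r => //; exact: ltW L0.
  have pw a : (a <= 6)%N -> c ^+ a <= c ^+ 6 by move=> ae; exact: ler_weXn2l.
  split.
  + apply: le_trans (_ : 1 * (18 * L ^+ 2) <= _).
      by apply: ler_wpM2r => //; have := ltW L0 => ?; pos.
    apply: le_trans cV; have := LcX 2%N; have := pw 2%N isT.
    by move: (L ^+ 2) (c ^+ 2) (c ^+ 6) c6 => u v w; lra.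
  + have l3 a a' : al z L n (H t) (ebasis a) a' <= 3 * L by apply: (al_le sc); exact: (good1_gq a a' gM).
    apply: le_trans (_ : 1 * (60 * L ^+ 2 * (3 * L + 3 * L)) <= _).
      have L0' := ltW L0.
      apply: ler_pM => //; first by apply: mulr_ge0; [pos|apply: addr_ge0; exact: (al_ge0 z sc)].
      by apply: ler_wpM2l; [pos|exact: lerD].
    rewrite (_ : 1 * _ = 360 * L ^+ 3); last by ring.
    apply: le_trans cV; have := LcX 3%N; have := pw 3%N isT.
    by move: (L ^+ 3) (c ^+ 3) (c ^+ 6) c6 => u v w; lra.
  exact: (good1_entry i j gM).
- move=> t gt; split.
  + exact: dterm1.
  + apply: dterm23 => // i j; first exact: jet_h (dstat_jet i j (hM t) gt).
    exact: jet_b (dstat_jet i j (hM t) gt).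
  + apply: dterm23 => // i j; rewrite cabs_conj; first exact: jet_b (dstat_jet i j (hM t) gt).
    exact: jet_h (dstat_jet i j (hM t) gt).
  exact: dterm4.
- by apply: le_trans V1; rewrite ler_nat.
- by apply: le_trans B1 _; apply: le_trans V1; rewrite ler1n.
- exact: ltW.
- move=> i j; apply: le_trans (S_le i j) _; rewrite (sc_hs sc) exprMn exprMn.
  by apply: ler_wpM2r; [rewrite mulr_ge0 ?sqr_ge0|rewrite -[leLHS]expr1; exact: (sc_Lpow sc)].
- exact: mom_cst_ge0.
Qed.

End DiagonalLaw.

(** What the probabilistic part needs to know about [z] and [m]. The scale [s], the square root of
    [p], is the size of a single Dyson error; [rg_z2m] is the smallness of [z + 2 m] near the
    edge. *)
Record regime {R : realType} (N : nat) (C : R) (z m : R[i]) (L n r p s : R) : Prop := Regime {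
  rg_im : 0 < ImC z; rg_im1 : 1 <= N%:R * ImC z; rg_z : cabs z <= N%:R;
  rg_sc : scales N L n r p C; rg_s : 0 <= s; rg_sp : s ^+ 2 = p; rg_LN : L <= N%:R;
  rg_mE : (z + m) * m = -1; rg_m1 : cabs m <= 1; rg_zm : cabs (z + m) <= L;
  rg_z2m : cabs (z + 2 * m) <= L * r ^+ 2 }.

Section Regime.
Context {R : realType} (N : nat) (C : R) (z m : R[i]) (L n r p s : R).
Hypothesis rg : regime N C z m L n r p s.
Let sc := rg_sc rg.

Lemma rg_z0 : ImC z != 0. Proof. exact: lt0r_neq0 (rg_im rg). Qed.
Lemma rg_N1 : 10 ^+ 3 <= N%:R :> R. Proof. exact: le_trans (sc_L sc) (rg_LN rg). Qed.
Lemma rg_N0 : (0 < N)%N.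
Proof. by rewrite -(ltr_nat R) -(sc_N sc) exprn_gt0 // (sc_n sc). Qed.
Lemma rg_NR1 : 1 <= N%:R :> R. Proof. by rewrite ler1n rg_N0. Qed.
Lemma rg_s0 : 0 < s.
Proof.
have p0 := sc_p0 sc; rewrite lt_def (rg_s rg) andbT; apply/eqP => s0.
by move: p0; rewrite -(rg_sp rg) s0 expr0n ltxx.
Qed.
Lemma rg_Ls : L ^+ 19 * s <= 1.
Proof.
have L0 := ltW (sc_L0 sc); have s0 := rg_s rg.
rewrite -(@ler_pXn2r _ 2) ?nnegrE //; last by pos.
by rewrite expr1n exprMn -exprM (rg_sp rg); exact: (sc_p18 sc).
Qed.
Lemma rg_Lsk a : (a <= 19)%N -> L ^+ a * s <= 1.
Proof.
move=> h; have s0 := rg_s rg; have la := sc_Lpow sc h.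
by apply: le_trans rg_Ls; exact: ler_wpM2r.
Qed.
Lemma rg_s1 : s <= 1. Proof. by have := @rg_Lsk 0 isT; rewrite expr0 mul1r. Qed.
Lemma rg_Npow a b : (a <= b)%N -> N%:R ^+ a <= N%:R ^+ b :> R.
Proof. by move=> ab; apply: ler_weXn2l => //; exact: rg_NR1. Qed.
Lemma rg_cst (k : nat) a : (k <= 10 ^ 3)%N -> k%:R * N%:R ^+ a <= N%:R ^+ a.+1 :> R.
Proof.
move=> hk; rewrite exprS; apply: ler_wpM2r; first by rewrite exprn_ge0.
by apply: le_trans rg_N1; rewrite -natrX ler_nat.
Qed.
Lemma rg_p2 : N%:R ^- 3 <= p ^+ 2.
Proof.
have r0 := sc_r sc; have h := sc_Ninv sc; have N0 : 0 < N%:R :> R by apply: lt_le_trans rg_NR1.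
have p2 : 0 <= p ^+ 2 by exact: sqr_ge0.
have rN : r ^+ 2 <= N%:R ^+ 2.
  by apply: ler_wXn2r; [exact: ltW|apply: le_trans (sc_rL sc) (rg_LN rg)].
rewrite (_ : N%:R ^- 3 = N%:R^-1 * N%:R ^- 2); last by rewrite -!exprVn -exprS.
rewrite h -mulrA -[leRHS]mulr1; apply: ler_wpM2l => //.
by rewrite -exprVn exprVn ler_pdivrMr ?mul1r // exprn_gt0.
Qed.

End Regime.

(** [tail_params] must receive a nonnegative number before any matrix is given; once a matrix
    exists, its sixth moment shows that the maximum with 0 changes nothing. *)
Lemma max_Cp6 {R : realType} (C : R) Cp N d (T : measurableType d) (P : probability T R) (H : T -> 'M[R[i]]_N) :
  (0 < N)%N -> wigner C Cp P H -> Num.max (Cp 6%N) 0 = Cp 6%N.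
Proof.
move=> N0 W; apply/max_idPl; have := Ex_cabsX_le W (Ordinal N0) (Ordinal N0) 6.
by apply: le_trans; apply: mulr_ge0; [rewrite exprn_ge0 ?sqrtr_ge0|apply: Ex_ge0 => t; rewrite exprn_ge0 ?cabs_ge0].
Qed.

Lemma dstat_whp {R : realType} (C : R) (Cp : nat -> R) (th : R) (D : nat) : 0 < th ->
  exists D' N0 : nat, forall N, (N0 <= N)%N -> forall d (T : measurableType d) (P : probability T R)
   (H : T -> 'M[R[i]]_N), wigner C Cp P H -> forall (z m : R[i]) (n r p s : R),
   let L := N%:R `^ th in regime N C z m L n r p s ->
   forall (b : 'I_N -> R) (B Ys : R), (forall i, 0 <= b i) -> \sum_i b i <= 1 ->
   (forall M i j, hermitian M -> good2 z m L n r M -> 3 * \sum_k wgt P H z m L r b k * kap z L n k i j M <= Ys) ->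
   B <= 1 -> L ^+ 10 * (p * Ys) <= B ^+ 2 -> L ^+ 13 * p ^+ 2 <= B -> Ys <= L ^+ 10 -> 0 <= Ys ->
   whp P H D' (good2 z m L n r) -> whp P H D (fun M => cabs (dstat P H z m b M) <= L * B).
Proof.
move=> th0.
have C60 : 0 <= Num.max (Cp 6%N) 0 by rewrite le_max lexx orbT.
have [D' [N0 hN]] := tail_params D 13 th0 C60.
exists D', N0 => N /hN[q [tau /andP[tau0 tau1] [N1 L1 hq]]] d T P H W z m n r p s L rg b B Ys b0 b1 hY B1 hB1 hB2 YL Y0 hg.
have sc := rg_sc rg; have z0 := rg_z0 rg.
move: hq; rewrite (max_Cp6 N1 W) => hq.
have C6 : 0 <= Cp 6%N by rewrite -(max_Cp6 N1 W).
have NR1 := rg_NR1 rg; have Nk := rg_Npow rg; have N0' : 0 < N%:R :> R by apply: lt_le_trans NR1.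
have p0 := sc_p0 sc; have Lg1 := sc_L1 sc.
have p2 := rg_p2 rg.
have B0 : 0 < B by apply: lt_le_trans hB2; rewrite mulr_gt0 ?exprn_gt0 // (sc_L0 sc).
have LN := rg_LN rg; have LX a : L ^+ a <= N%:R ^+ a by apply: ler_wXn2r => //; exact: ltW (sc_L0 sc).
have h2 : 3 * N%:R ^+ 1 <= N%:R ^+ 2 :> R by exact: (rg_cst rg).
rewrite expr1 in h2.
apply: le_trans (_ : (mom_cst q * (L ^- (q + q.+2) + (N%:R ^+ 13) ^+ (9 * (q + q.+2) + 2) * (tau * Cp 6 + tau^-1 * N%:R ^- D')))%:E <= _)%E; last by rewrite lee_fin.
(* [N ^+ 2] dominates [1 / Im z], [|z| + 2] and [L], and [V = N ^+ 13] dominates [400 * c ^+ 6]. *)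
apply: (dstat_tail (c := N%:R ^+ 2) W z0 sc (rg_mE rg) (rg_m1 rg) (Ys := Ys)) => //.
- exact: exprn_ege1.
- rewrite gtr0_norm ?(rg_im rg) //; apply: le_trans (rg_im1 rg) _; apply: ler_wpM2r; first exact: ltW (rg_im rg).
  by rewrite -[leLHS]expr1 Nk.
- by apply: le_trans h2; have := rg_z rg; move: NR1; lra.
- by apply: le_trans LN _; rewrite -[leLHS]expr1 Nk.
- by rewrite -exprM; exact: (rg_cst rg).
- apply: le_trans hB2; apply: (@le_trans _ _ (1 * p ^+ 2)).
    rewrite mul1r; apply: le_trans p2; rewrite lef_pV2 ?posrE ?exprn_gt0 //; exact: Nk.
  by apply: ler_wpM2r; [exact: sqr_ge0|exact: exprn_ege1].
- by apply: le_trans YL _; apply: le_trans (LX 10%N) _; exact: Nk.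
- by rewrite -[leLHS]expr1 Nk.
Qed.

(** * The gain from averaging the diagonal errors *)

Section Weights.
Context {R : realType} (C : R) (Cp : nat -> R) (N : nat) d (T : measurableType d) (P : probability T R).
Variable H : T -> 'M[R[i]]_N.
Hypothesis W : wigner C Cp P H.
Variables (z m : R[i]) (L n r p s : R).
Hypothesis rg : regime N C z m L n r p s.
Notation S := (Svar P H).
Let sc := rg_sc rg.
Let z0 := rg_z0 rg.
Let L0 : 0 <= L. Proof. exact: ltW (sc_L0 sc). Qed.
Let p0 : 0 <= p. Proof. exact: ltW (sc_p0 sc). Qed.
Let r0 : 0 <= r. Proof. exact: ltW (sc_r sc). Qed.
Let N0 : 0 < N%:R :> R. Proof. by rewrite ltr0n; exact: rg_N0 rg. Qed.

(** Averaged over [k], the squares become [|G e_i|^2 / N], at most [L * p ^+ 2] because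
    [1 / N = p ^+ 2 * r ^+ 2]; a single [kap] is only known to be at most [L ^+ 4]. *)
Lemma kap_mean M (i j : 'I_N) : hermitian M -> good2 z m L n r M ->
  \sum_k N%:R^-1 * kap z L n k i j M <= L ^+ 11 * p ^+ 2.
Proof.
move=> hM gM.
have gi := good2_gam i gM; have gj := good2_gam j gM.
have c2 (x : R[i]) : 0 <= cabs x ^+ 2 by exact: sqr_ge0.
have one (x : 'I_N -> R) : r ^+ 2 * \sum_l x l <= L -> \sum_l N%:R^-1 * x l <= L * p ^+ 2.
  move=> hx; rewrite -mulr_sumr (sc_Ninv sc) -mulrA mulrC; apply: ler_wpM2r => //; exact: sqr_ge0.
have h1 := one _ gi; have h2 := one _ gj.
rewrite -(gam_row z0 (ebasis i) hM) in gi; rewrite -(gam_row z0 (ebasis j) hM) in gj.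
have h3 := one _ gi; have h4 := one _ gj.
rewrite /kap sum_lin5.
have -> : \sum_(l < N) N%:R^-1 * dl L n ^+ 2 = dl L n ^+ 2.
  by rewrite sumr_const card_ord -[_ *+ N]mulr_natl mulrA mulfV ?mul1r // lt0r_neq0.
have l2 : L <= L ^+ 9 by rewrite -[leLHS]expr1; exact: (sc_Lpow sc).
have lp : L * p ^+ 2 <= L ^+ 9 * p ^+ 2 by apply: ler_wpM2r => //; exact: sqr_ge0.
have hd := sc_dl2 sc.
apply: (@le_trans _ _ (96 * L * (5 * (L ^+ 9 * p ^+ 2)))).
  apply: ler_wpM2l; first by pos.
  rewrite (_ : 5 * (L ^+ 9 * p ^+ 2) = L ^+ 9 * p ^+ 2 + L ^+ 9 * p ^+ 2 + L ^+ 9 * p ^+ 2 + L ^+ 9 * p ^+ 2 + L ^+ 9 * p ^+ 2); last by ring.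
  apply: lerD; last exact: hd.
  exact: lerD (lerD (lerD (le_trans h1 lp) (le_trans h2 lp)) (le_trans h3 lp)) (le_trans h4 lp).
rewrite (_ : _ * _ = 480 * L ^+ 10 * p ^+ 2); last by ring.
by apply: ler_wpM2r; [exact: sqr_ge0|exact: (sc_cst sc)].
Qed.

(** A weight is dominated by an atom, paid at the rate [L ^+ 4] of a single [kap], plus a flat part,
    paid at the rate of [kap_mean]. *)
Lemma wgt_kap (b : 'I_N -> R) (w0 w1 : R) (k0 : 'I_N) M i j : 0 <= w0 -> 0 <= w1 ->
  (forall k, wgt P H z m L r b k <= w0 * (k == k0)%:R + w1 * N%:R^-1) ->
  hermitian M -> good2 z m L n r M ->
  3 * \sum_k wgt P H z m L r b k * kap z L n k i j M <= L ^+ 5 * w0 + L ^+ 12 * (w1 * p ^+ 2).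
Proof.
move=> w00 w10 hw hM gM.
have kp k : 0 <= kap z L n k i j M by exact: (kap_ge0 z sc).
have [gM1 _] := andP gM.
have k4 := kap_le sc k0 i j gM1.
apply: (@le_trans _ _ (3 * (w0 * L ^+ 4 + w1 * (L ^+ 11 * p ^+ 2)))).
  apply: ler_wpM2l => //.
  apply: (@le_trans _ _ (\sum_k (w0 * (k == k0)%:R * kap z L n k i j M + w1 * (N%:R^-1 * kap z L n k i j M)))).
    by apply: ler_sum => k _; rewrite [w1 * (_ * _)]mulrA -mulrDl; apply: ler_wpM2r.
  rewrite big_split /= -mulr_sumr; apply: lerD; last by apply: ler_wpM2l => //; exact: kap_mean.
  rewrite (bigD1 k0) //= big1 ?addr0 => [|k kk]; last by rewrite (negbTE kk) mulr0 mul0r.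
  by rewrite eqxx mulr1; apply: ler_wpM2l.
rewrite mulrDr; apply: lerD.
  rewrite (_ : 3 * _ = 3 * L ^+ 4 * w0); last by ring.
  by apply: ler_wpM2r => //; exact: (sc_cst sc).
rewrite (_ : 3 * _ = 3 * L ^+ 11 * (w1 * p ^+ 2)); last by ring.
by apply: ler_wpM2r; [apply: mulr_ge0 => //; exact: sqr_ge0|exact: (sc_cst sc)].
Qed.

Let S_le k l : S k l <= L * N%:R^-1.
Proof.
have h := Svar_ub W k l.
by rewrite ler_pdivlMr // mulrC; apply: le_trans h _; exact: sc_C sc.
Qed.
Let L1 : 1 <= L. Proof. exact: sc_L1 sc. Qed.
Let LL a b : (a <= b)%N -> L ^+ a <= L ^+ b. Proof. exact: (sc_Lpow sc). Qed.
Let r2 : r ^+ 2 <= L ^+ 2. Proof. by apply: ler_wXn2r; [exact: r0|exact: sc_rL sc]. Qed.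
Let Ni0 : 0 <= N%:R^-1 :> R. Proof. by rewrite invr_ge0 ltW. Qed.
Let U_le : 2 * (L * r ^+ 2) <= 2 * L ^+ 3.
Proof. by apply: ler_wpM2l => //; rewrite [L ^+ 3]exprS; exact: ler_wpM2l. Qed.
Let U0 : 0 <= 2 * (L * r ^+ 2). Proof. by have := L0; have := r0 => ? ?; pos. Qed.

Lemma dcoef_le (b : 'I_N -> R) (B1 : R) k : (forall l, 0 <= b l) -> \sum_l b l * S l k <= B1 ->
  cabs (dcoef P H z m b k) <= L * b k + B1.
Proof.
move=> b0 h; have hm := rg_m1 rg.
have s0 : 0 <= \sum_l b l * S l k by apply: sumr_ge0 => l _; exact: mulr_ge0 (b0 l) (Svar_ge0 _ _ _ _).
apply: le_trans (cabsD _ _) _; rewrite !cabsM !cabs_real (ger0_norm s0) (ger0_norm (b0 k)).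
apply: lerD; first by rewrite mulrC; apply: ler_wpM2r => //; exact: rg_zm rg.
by apply: le_trans h; apply: ler_piMl.
Qed.

Lemma wgt_le (b : 'I_N -> R) (B1 : R) k : (forall l, 0 <= b l) -> \sum_l b l * S l k <= B1 ->
  wgt P H z m L r b k <= L * b k + B1 + 2 * (L * r ^+ 2) * (b k + B1).
Proof.
move=> b0 h; rewrite /wgt; apply: lerD; first exact: dcoef_le.
by apply: ler_wpM2l => //; rewrite lerD2l.
Qed.

Lemma wgt_point (k0 k : 'I_N) :
  wgt P H z m L r (fun k => (k == k0)%:R) k <= L ^+ 4 * (k == k0)%:R + L ^+ 5 * N%:R^-1.
Proof.
have b0 l : 0 <= (l == k0)%:R :> R by rewrite ler0n.
have h : \sum_l (l == k0)%:R * S l k <= L * N%:R^-1.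
  rewrite (bigD1 k0) //= big1 ?addr0 => [|l lk]; last by rewrite (negbTE lk) mul0r.
  by rewrite eqxx mul1r; exact: S_le.
have hw := wgt_le (b := fun l => (l == k0)%:R) b0 h; apply: (le_trans hw).
set x := (k == k0)%:R in b0 *; have x0 : 0 <= x :> R by rewrite /x ler0n.
apply: (@le_trans _ _ (L * x + L * N%:R^-1 + 2 * L ^+ 3 * (x + L * N%:R^-1))).
  by rewrite lerD2l; apply: ler_wpM2r U_le; apply: addr_ge0 => //; apply: mulr_ge0 => //; exact: L0.
rewrite [leLHS](_ : _ = (L ^+ 1 + 2 * L ^+ 3) * x + (L ^+ 1 + 2 * L ^+ 4) * N%:R^-1); last by ring.
have h1 := LL (isT : (1 <= 3)%N); have h2 := LL (isT : (1 <= 4)%N).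
have h3 : 3 * L ^+ 3 <= L ^+ 4 by exact: (sc_cst sc).
have h4 : 3 * L ^+ 4 <= L ^+ 5 by exact: (sc_cst sc).
apply: lerD; apply: ler_wpM2r => //.
  by move: (L ^+ 1) (L ^+ 3) (L ^+ 4) h1 h3 => u v w; lra.
by move: (L ^+ 1) (L ^+ 4) (L ^+ 5) h2 h4 => u v w; lra.
Qed.

Lemma wgt_row (k0 k : 'I_N) : wgt P H z m L r (S k0) k <= 0 * (k == k0)%:R + L ^+ 5 * N%:R^-1.
Proof.
have b0 l : 0 <= S k0 l by exact: Svar_ge0.
have h : \sum_l S k0 l * S l k <= L * N%:R^-1.
  apply: (@le_trans _ _ (\sum_l S k0 l * (L * N%:R^-1))).
    by apply: ler_sum => l _; apply: ler_wpM2l.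
  by rewrite -mulr_suml (Svar_sum W) mul1r.
have hw := wgt_le (b := S k0) b0 h; apply: (le_trans hw).
have hS := S_le k0 k.
have e1 : L * S k0 k <= L * (L * N%:R^-1) by apply: ler_wpM2l; [exact: L0|exact: hS].
have e2 : 2 * (L * r ^+ 2) * (S k0 k + L * N%:R^-1) <= 2 * L ^+ 3 * (L * N%:R^-1 + L * N%:R^-1).
  by apply: ler_pM; [exact: U0|apply: addr_ge0 => //; apply: mulr_ge0; [exact: L0|exact: Ni0]|exact: U_le|rewrite lerD2r].
rewrite mul0r add0r; apply: le_trans (lerD (lerD e1 (lexx _)) e2) _.
rewrite [leLHS](_ : _ = (L ^+ 2 + L ^+ 1 + 4 * L ^+ 4) * N%:R^-1); last by ring.
apply: ler_wpM2r => //.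
have h1 := LL (isT : (1 <= 4)%N); have h2 := LL (isT : (2 <= 4)%N).
have h4 : 6 * L ^+ 4 <= L ^+ 5 by exact: (sc_cst sc).
by move: (L ^+ 1) (L ^+ 2) (L ^+ 4) (L ^+ 5) h1 h2 h4 => u u' v w; lra.
Qed.

(** Columns of [S] sum to one, so the coefficient is [(z + 2 m) / N]. The factor [r ^+ 2] gained
    here is what the stability constant near the edge later takes away. *)
Lemma wgt_mean (k0 k : 'I_N) :
  wgt P H z m L r (fun _ => N%:R^-1) k <= 0 * (k == k0)%:R + L ^+ 2 * r ^+ 2 * N%:R^-1.
Proof.
have b0 (l : 'I_N) : 0 <= N%:R^-1 :> R by exact: Ni0.
have hE : \sum_(l < N) N%:R^-1 * S l k = N%:R^-1 by rewrite -mulr_sumr (Svar_sum' W) mulr1.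
have h : \sum_(l < N) N%:R^-1 * S l k <= N%:R^-1 by rewrite hE.
rewrite /wgt hE.
have -> : dcoef P H z m (fun _ => N%:R^-1) k = ((N%:R^-1)%:C)%C * (z + 2 * m) by rewrite /dcoef hE; ring.
rewrite cabsM cabs_real (ger0_norm Ni0) mul0r add0r.
have e1 : N%:R^-1 * cabs (z + 2 * m) <= N%:R^-1 * (L * r ^+ 2) by apply: ler_wpM2l => //; exact: rg_z2m rg.
apply: le_trans (lerD e1 (lexx _)) _.
rewrite [leLHS](_ : _ = 5 * L ^+ 1 * r ^+ 2 * N%:R^-1); last by ring.
by apply: ler_wpM2r => //; apply: ler_wpM2r; [exact: sqr_ge0|exact: (sc_cst sc)].
Qed.

Lemma sc_s4 : L ^+ 13 * p ^+ 2 <= L ^+ 10 * s.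
Proof.
have s0 := rg_s rg; have h := rg_Lsk rg (isT : (3 <= 19)%N); have s1 := rg_s1 rg.
rewrite -(rg_sp rg) (_ : _ * _ = L ^+ 10 * s * ((L ^+ 3 * s) * (s * s))); last by ring.
apply: ler_piMr; first by have := L0 => ?; pos.
by apply: mulr_ile1 => //; [have := L0 => ?; pos|exact: mulr_ge0|exact: mulr_ile1].
Qed.

End Weights.

(** * Dyson errors: single, averaged over a row of variances, averaged uniformly *)

Section DiagonalEvent.
Context {R : realType} (N : nat) d (T : measurableType d) (P : probability T R).
Variable H : T -> 'M[R[i]]_N.
Variables (z : R[i]) (L r s : R).

(** Up to powers of [L], the sizes [s], [s ^+ 3] and [r * s ^+ 3] in the three events are the square
    roots of [p * Ys] for [Ys] of order [1], [p ^+ 2] and [p ^+ 2 * r ^+ 2]. *)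
Definition dgood1 (M : 'M[R[i]]_N) : bool := [forall k, cabs (ddiag P H z k M) <= L ^+ 11 * s].
Definition dgood2 (M : 'M[R[i]]_N) : bool :=
  [forall k, cabs (\sum_l ((Svar P H k l)%:C)%C * ddiag P H z l M) <= L ^+ 15 * s ^+ 3].
Definition dgood3 (M : 'M[R[i]]_N) : bool :=
  cabs (\sum_l ((N%:R^-1)%:C)%C * ddiag P H z l M) <= L ^+ 13 * (r * s ^+ 3).
Definition dgood M := dgood1 M && (dgood2 M && dgood3 M).

End DiagonalEvent.

Lemma adm_ddiag {R : realType} N d (T : measurableType d) (P : probability T R) (H : T -> 'M[R[i]]_N) z k :
  ImC z != 0 -> adm (ddiag P H z k).
Proof.
move=> z0; apply: admD; first exact: adm_cst.
apply: admM; last exact: adm_gq.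
by apply: admD; [exact: adm_cst|apply: adm_sum => l; apply: admZ; exact: adm_gq].
Qed.

Section AdmDgood.
Context {R : realType} (N : nat) d (T : measurableType d) (P : probability T R).
Variables (H : T -> 'M[R[i]]_N) (z : R[i]) (L r s : R).
Hypothesis z0 : ImC z != 0.
Lemma admb_dgood1 : admb (dgood1 P H z L s).
Proof. by apply: admb_forall => k; apply: admb_le; [apply: admR_cabs; exact: adm_ddiag|exact: admR_cst]. Qed.
Lemma admb_dgood2 : admb (dgood2 P H z L s).
Proof.
apply: admb_forall => k; apply: admb_le; last exact: admR_cst.
by apply: admR_cabs; apply: adm_sum => l; apply: admZ; exact: adm_ddiag.
Qed.
Lemma admb_dgood3 : admb (dgood3 P H z L r s).
Proof.
apply: admb_le; last exact: admR_cst.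
by apply: admR_cabs; apply: adm_sum => l; apply: admZ; exact: adm_ddiag.
Qed.
Lemma admb_dgood : admb (dgood P H z L r s).
Proof. by apply: admb_and; [exact: admb_dgood1|apply: admb_and; [exact: admb_dgood2|exact: admb_dgood3]]. Qed.
End AdmDgood.

Lemma diagonal_law {R : realType} (C : R) (Cp : nat -> R) (th : R) (D : nat) : 0 < th ->
  exists D' N0 : nat, forall N, (N0 <= N)%N -> forall d (T : measurableType d) (P : probability T R)
   (H : T -> 'M[R[i]]_N), wigner C Cp P H -> forall (z m : R[i]) (n r p s : R),
   let L := N%:R `^ th in regime N C z m L n r p s ->
   whp P H D' (good2 z m L n r) -> whp P H D (dgood P H z L r s).
Proof.
(* Two conjunctions and one union over the indices cost three in the exponent. *)
move=> th0; have [D' [N0 hN]] := dstat_whp C Cp D.+3 th0.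
exists D', N0 => N NN d T P H W z m n r p s L rg hg.
have sc := rg_sc rg; have z0 := rg_z0 rg; have N1 := rg_N0 rg.
have N2 : (1 < N)%N by rewrite -(ltr_nat R); apply: lt_le_trans (rg_N1 rg); rewrite -natrX ltr_nat.
have Ls := rg_Lsk rg; have s0 := rg_s rg; have s1 := rg_s1 rg; have sp := rg_sp rg.
have L1 := sc_L1 sc; have L0 := ltW (sc_L0 sc); have p0 := ltW (sc_p0 sc); have r0 := ltW (sc_r sc).
have Lp := sc_Lp sc; have hr := sc_pr sc; have s4 := sc_s4 rg.
have ls a e : (a <= 19)%N -> 0 <= e -> L ^+ a * s * e <= e.
  by move=> h e0; apply: ler_piMl => //; exact: Ls.
have F b B Ys := hN N NN d T P H W z m n r p s rg b B Ys; rewrite -/L in F.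
have i0 : 'I_N by exact: (Ordinal N1).
have b1E (k0 : 'I_N) M : \sum_i (((i == k0)%:R : R)%:C)%C * ddiag P H z i M = ddiag P H z k0 M.
  rewrite (bigD1 k0) //= big1 ?addr0 ?eqxx ?mul1r // => i ik.
  by rewrite (negbTE ik) mul0r.
apply: (whp_and W) => //; [exact: admb_dgood1|by apply: admb_and; [exact: admb_dgood2|exact: admb_dgood3]| |].
  apply: (whp_forall W (k := 1)) => //; first by rewrite card_ord expn1.
    by move=> k; apply: admb_le; [apply: admR_cabs; exact: adm_ddiag|exact: admR_cst].
  move=> k; apply: (whp_imp W (D := D.+3) (b := fun M => cabs (dstat P H z m (fun l => (l == k)%:R) M) <= L * (L ^+ 10 * s))) => //.
  - by rewrite addn1; exact: leqW.
  - by apply: admb_le; [apply: admR_cabs; exact: adm_dstat|exact: admR_cst].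
  - by apply: admb_le; [apply: admR_cabs; exact: adm_ddiag|exact: admR_cst].
  - by move=> t; rewrite (dstatE W _ (rg_mE rg)) b1E mulrA -exprS.
  apply: (F _ _ (L ^+ 10)) => //.
  - rewrite (bigD1 k) //= eqxx big1 ?addr0 // => l lk; by rewrite (negbTE lk).
  - move=> M i j hM gM; apply: le_trans (wgt_kap rg (w0 := L ^+ 4) (w1 := L ^+ 5) (k0 := k) i j _ _ (wgt_point W rg k) hM gM) _; try by pos.
    rewrite (_ : L ^+ 5 * _ + _ = L ^+ 9 + (L ^+ 17 * p) * p); last by ring.
    apply: (@le_trans _ _ (L ^+ 9 + 1)).
      by rewrite lerD2l; apply: mulr_ile1 => //; [pos|exact: Lp|exact: sc_p1 sc].
    apply: (@le_trans _ _ (2 * L ^+ 9)); last exact: (sc_cst sc).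
    by rewrite (_ : 2 * _ = L ^+ 9 + L ^+ 9); [rewrite lerD2l; exact: exprn_ege1|ring].
  - exact: Ls.
  - by rewrite -sp le_eqVlt; apply/orP; left; apply/eqP; ring.
  - by pos.
apply: (whp_and W) => //; [exact: admb_dgood2|exact: admb_dgood3| |].
  apply: (whp_forall W (k := 1)) => //; first by rewrite card_ord expn1.
    move=> k; apply: admb_le; last exact: admR_cst.
    by apply: admR_cabs; apply: adm_sum => l; apply: admZ; exact: adm_ddiag.
  move=> k; apply: (whp_imp W (D := D.+3) (b := fun M => cabs (dstat P H z m (Svar P H k) M) <= L * (L ^+ 14 * s ^+ 3))) => //.
  - by rewrite addn1.
  - by apply: admb_le; [apply: admR_cabs; exact: adm_dstat|exact: admR_cst].
  - apply: admb_le; last exact: admR_cst.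
    by apply: admR_cabs; apply: adm_sum => l; apply: admZ; exact: adm_ddiag.
  - by move=> t; rewrite (dstatE W _ (rg_mE rg)) mulrA -exprS.
  apply: (F _ _ (L ^+ 17 * p ^+ 2)) => //.
  - by move=> i; exact: Svar_ge0.
  - by rewrite (Svar_sum W).
  - move=> M i j hM gM; apply: le_trans (wgt_kap rg (w0 := 0) (w1 := L ^+ 5) (k0 := k) i j _ _ (wgt_row W rg k) hM gM) _; try by pos.
    by rewrite mulr0 add0r mulrA -exprD.
  - rewrite (_ : _ * _ = (L ^+ 14 * s) * (s * s)); last by ring.
    by apply: mulr_ile1; [pos|pos|exact: Ls|exact: mulr_ile1].
  - rewrite (_ : _ * _ = L ^+ 27 * p ^+ 3); last by ring.
    rewrite [leRHS](_ : _ = L ^+ 28 * p ^+ 3); last by rewrite -sp; ring.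
    by apply: ler_wpM2r; [pos|exact: (sc_Lpow sc)].
  - rewrite -sp -exprM (_ : _ * _ = L ^+ 13 * s * s ^+ 3); last by ring.
    apply: ler_wpM2r; first by pos.
    apply: (@le_trans _ _ (L ^+ 13 * 1)); first by apply: ler_wpM2l => //; pos.
    by rewrite mulr1; exact: (sc_Lpow sc).
  - apply: (@le_trans _ _ 1); last exact: exprn_ege1.
    rewrite expr2 mulrA; apply: mulr_ile1 => //; [pos|exact: Lp|exact: sc_p1 sc].
  - by pos.
apply: (whp_imp W (D := D.+3) (b := fun M => cabs (dstat P H z m (fun _ => N%:R^-1) M) <= L * (L ^+ 12 * (r * s ^+ 3)))) => //.
- by apply: admb_le; [apply: admR_cabs; exact: adm_dstat|exact: admR_cst].
- exact: admb_dgood3.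
- by move=> t; rewrite (dstatE W _ (rg_mE rg)) mulrA -exprS.
have NR0 : 0 < N%:R :> R by rewrite ltr0n.
apply: (F _ _ (L ^+ 14 * (p ^+ 2 * r ^+ 2))) => //.
- by rewrite sumr_const card_ord -[_ *+ N]mulr_natl mulfV // lt0r_neq0.
- move=> M i j hM gM; apply: le_trans (wgt_kap rg (w0 := 0) (w1 := L ^+ 2 * r ^+ 2) (k0 := i0) i j _ _ (wgt_mean W rg i0) hM gM) _; try by pos.
  by rewrite le_eqVlt; apply/orP; left; apply/eqP; ring.
- rewrite (_ : _ * _ = (L ^+ 13 * s) * (s * s) * (L^-1 * r)); last by field; exact: lt0r_neq0 (sc_L0 sc).
  apply: mulr_ile1.
  + by pos.
  + by pos.
  + by apply: mulr_ile1; [pos|pos|exact: Ls|exact: mulr_ile1].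
  by rewrite mulrC ler_pdivrMr ?mul1r ?(sc_L0 sc) // (sc_rL sc).
- by rewrite -sp le_eqVlt; apply/orP; left; apply/eqP; ring.
- have Lsr : L * s <= r.
    rewrite -(@ler_pXn2r _ 2) ?nnegrE //; last by pos.
    rewrite exprMn sp; apply: le_trans hr; apply: ler_wpM2r => //; exact: (sc_Lpow sc).
  rewrite -sp -exprM (_ : _ * _ = L ^+ 12 * ((L * s) * s ^+ 3)); last by ring.
  by apply: ler_wpM2l; [pos|apply: ler_wpM2r => //; pos].
- rewrite (_ : _ * _ = (L ^+ 14 * p) * p * r ^+ 2); last by ring.
  apply: (@le_trans _ _ (1 * r ^+ 2)).
    apply: ler_wpM2r; first by pos.
    by apply: mulr_ile1 => //; [pos|exact: Lp|exact: sc_p1 sc].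
  rewrite mul1r; apply: (@le_trans _ _ (L ^+ 2)); last exact: (sc_Lpow sc).
  by apply: ler_wXn2r => //; exact: sc_rL sc.
- by pos.
Qed.

(** * Deterministic stability of the Dyson equation *)

Section Stability.
Context {R : realType} (N : nat) (S : 'I_N -> 'I_N -> R) (c tau e1 e2 e3 : R) (z m : R[i]) (u : 'I_N -> R[i]).
Hypothesis N0 : (0 < N)%N.
Hypothesis Srow : forall i, \sum_l S i l = 1.
Hypothesis Scol : forall l, \sum_i S i l = 1.
Hypothesis c0 : 0 < c.
Hypothesis Slow : forall i l, c / N%:R <= S i l.
Hypothesis mE : (z + m) * m = -1.
Hypothesis m1 : cabs m <= 1.
Let a : R := N%:R^-1.
Let s i : R[i] := \sum_l ((S i l)%:C)%C * u l.
Let avg (f : 'I_N -> R[i]) : R[i] := \sum_l (a%:C)%C * f l.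
Let ub := avg u.
Let d i : R[i] := 1 + (z + \sum_l ((S i l)%:C)%C * (m + u l)) * (m + u i).
Hypothesis he1 : forall i, cabs (d i) <= e1.
Hypothesis he2 : forall i, cabs (\sum_l ((S i l)%:C)%C * d l) <= e2.
Hypothesis he3 : cabs (avg d) <= e3.
Hypothesis ut : forall i, cabs (u i) <= tau.
Hypothesis tc : 6 * tau <= c.
Hypothesis tau2 : 2 * tau <= 1.
Let x i := s i - ub.

Let NR0 : 0 < N%:R :> R. Proof. by rewrite ltr0n. Qed.
Let a0 : 0 <= a. Proof. by rewrite /a invr_ge0 ltW. Qed.
Let S0 i l : 0 <= S i l. Proof. by apply: le_trans (Slow i l); rewrite mulr_ge0 ?invr_ge0 // ltW. Qed.
Let suma : \sum_(l < N) a = 1.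
Proof. by rewrite sumr_const card_ord -[_ *+ N]mulr_natl mulfV // lt0r_neq0. Qed.
Let avgD f g : avg (fun i => f i + g i) = avg f + avg g.
Proof. by rewrite /avg -big_split /=; apply: eq_bigr => l _; rewrite mulrDr. Qed.
Let avgZ k f : avg (fun i => k * f i) = k * avg f.
Proof. by rewrite /avg mulr_sumr; apply: eq_bigr => l _; rewrite mulrCA. Qed.
Let avg_cst k : avg (fun _ => k) = k.
Proof. by rewrite /avg -mulr_suml -rmorph_sum suma rmorph1 mul1r. Qed.
Let wsum (w : 'I_N -> R) (f : 'I_N -> R[i]) (A : R) : (forall l, 0 <= w l) -> (forall l, cabs (f l) <= A) ->
  cabs (\sum_l ((w l)%:C)%C * f l) <= (\sum_l w l) * A.
Proof.
move=> w0 hf; rewrite mulr_suml; apply: le_trans (cabs_sum _ _ _) _; apply: ler_sum => l _.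
by rewrite cabsM cabs_real ger0_norm //; apply: ler_wpM2l.
Qed.
Let avg_le f A : (forall l, cabs (f l) <= A) -> cabs (avg f) <= A.
Proof. by move=> h; have := @wsum (fun _ => a) f A (fun _ => a0) h; rewrite suma mul1r. Qed.
Let rowD f g i : \sum_l ((S i l)%:C)%C * (f l + g l) = \sum_l ((S i l)%:C)%C * f l + \sum_l ((S i l)%:C)%C * g l.
Proof. by rewrite -big_split /=; apply: eq_bigr => l _; rewrite mulrDr. Qed.
Let rowZ k f i : \sum_l ((S i l)%:C)%C * (k * f l) = k * \sum_l ((S i l)%:C)%C * f l.
Proof. by rewrite mulr_sumr; apply: eq_bigr => l _; rewrite mulrCA. Qed.
Let row_cst k i : \sum_l ((S i l)%:C)%C * k = k.
Proof. by rewrite -mulr_suml -rmorph_sum Srow rmorph1 mul1r. Qed.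
Let avg_s : avg s = ub.
Proof.
rewrite /avg /s; under eq_bigr => i _ do rewrite mulr_sumr.
rewrite exchange_big /=; apply: eq_bigr => l _; under eq_bigr => i _ do rewrite mulrCA mulrA.
by rewrite -!mulr_suml -rmorph_sum Scol rmorph1 mul1r.
Qed.
Let avg_x : avg x = 0.
Proof.
have e : avg (fun i => s i - ub) = avg s - ub.
  exact: etrans (avgD s (fun _ => - ub)) (congr1 (fun w => avg s + w) (avg_cst (- ub))).
by rewrite /x e avg_s subrr.
Qed.
(** Multiply the definition of [d i] by [m] and use [(z + m) * m = -1]: the linear term in [u i]
    becomes the left-hand side. *)
Let uE i : u i = m * (m + u i) * s i - m * d i.
Proof.
rewrite /d (rowD (fun _ => m)) row_cst -/(s i).
have e : m * (z + m) = -1 by rewrite mulrC.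
rewrite (_ : z + (m + s i) = (z + m) + s i); last by ring.
have -> : m * (1 + (z + m + s i) * (m + u i)) = m + m * (z + m) * (m + u i) + m * s i * (m + u i) by ring.
by rewrite e; ring.
Qed.
Let ub_le : cabs ub <= tau. Proof. exact: avg_le. Qed.
Let tau0 : 0 <= tau. Proof. exact: le_trans ub_le. Qed.
Let cm (w : R[i]) (A : R) : cabs w <= A -> cabs (m * w) <= A.
Proof. by move=> h; rewrite cabsM; apply: le_trans (_ : 1 * cabs w <= _); [exact: ler_wpM2r|rewrite mul1r]. Qed.

Let ub_eq : ub = m ^+ 2 * ub + m * (ub ^+ 2 + avg (fun l => x l * u l)) - m * avg d.
Proof.
have h1 : ub = avg (fun i => m * (m + u i) * s i + - m * d i).
  rewrite {1}/ub /avg; apply: eq_bigr => i _; congr (_ * _); rewrite mulNr; exact: uE.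
rewrite {1}h1 avgD avgZ mulNr; congr (_ - _).
rewrite (_ : avg _ = avg (fun i => m ^+ 2 * s i + m * (ub * u i + x i * u i))); last first.
  by rewrite /avg; apply: eq_bigr => i _; congr (_ * _); rewrite /x; ring.
by rewrite avgD !avgZ avg_s avgD avgZ; rewrite -/ub; ring.
Qed.

(** Apply [S] to [uE] and subtract the averaged equation [ub_eq]; the quadratic terms in [ub]
    combine into [ub * x i]. *)
Let x_eq i : x i = m ^+ 2 * (\sum_l ((S i l)%:C)%C * x l) + m * (ub * x i)
  + (m * (\sum_l ((S i l)%:C)%C * (x l * u l) - avg (fun l => x l * u l))
  - m * (\sum_l ((S i l)%:C)%C * d l - avg d)).
Proof.
have h : s i = m ^+ 2 * (ub + \sum_l ((S i l)%:C)%C * x l) + m * (ub * s i + \sum_l ((S i l)%:C)%C * (x l * u l))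
    - m * \sum_l ((S i l)%:C)%C * d l.
  rewrite [LHS](_ : _ = \sum_l ((S i l)%:C)%C * ((m ^+ 2 * (ub + x l) + m * (ub * u l + x l * u l)) + - m * d l)); last first.
    rewrite /s; apply: eq_bigr => l _; congr (_ * _); rewrite {1}uE /x; ring.
  rewrite (rowD (fun l => m ^+ 2 * (ub + x l) + m * (ub * u l + x l * u l)) (fun l => - m * d l)).
  rewrite (rowD (fun l => m ^+ 2 * (ub + x l)) (fun l => m * (ub * u l + x l * u l))).
  rewrite (rowZ (- m) d) (rowZ (m ^+ 2) (fun l => ub + x l)) (rowZ m (fun l => ub * u l + x l * u l)).
  rewrite (rowD (fun _ => ub) x) row_cst (rowD (fun l => ub * u l) (fun l => x l * u l)) (rowZ ub u).
  by rewrite mulNr.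
have hx : x i = s i - ub by [].
rewrite hx [X in X - _ = _]h [X in _ - X = _]ub_eq.
move: (\sum_l _ * x l) (\sum_l _ * (x l * u l)) (avg _) (avg d) (s i) ub (\sum_l _ * d l) => *; ring.
Qed.

(** Since [x] has mean zero, [c / N] may be subtracted from every [S i l]; the remaining weights are
    nonnegative with total mass [1 - c]. This spectral gap is where the lower bound on the variances
    enters. *)
Let centered_row i (A : R) : (forall l, cabs (x l) <= A) -> cabs (\sum_l ((S i l)%:C)%C * x l) <= (1 - c) * A.
Proof.
move=> hA; have -> : \sum_l ((S i l)%:C)%C * x l = \sum_l ((S i l - c * a)%:C)%C * x l.
  transitivity (\sum_l ((S i l)%:C)%C * x l - (c%:C)%C * avg x); first by rewrite avg_x mulr0 subr0.
  rewrite /avg mulr_sumr -sumrB.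
  by apply: eq_bigr => l _; rewrite rmorphB rmorphM /=; ring.
have h l : 0 <= S i l - c * a by rewrite subr_ge0; exact: Slow.
by apply: le_trans (wsum h hA) _; rewrite sumrB Srow -mulr_sumr suma mulr1.
Qed.

Lemma fluct_bound i : cabs (x i) <= 2 / c * (e2 + e3).
Proof.
(* At an index maximising [|x|], [x_eq] reads [A <= (1 - c) A + 3 tau A + e2 + e3], and
   [6 * tau <= c] leaves half of [c * A] on the left. *)
have [i0 _ hi0] : exists2 i0, true & forall l, cabs (x l) <= cabs (x i0).
  case: (@Order.TotalTheory.arg_maxP _ _ _ (Ordinal N0) xpredT (fun l => cabs (x l)) isT) => i0 _ h.
  by exists i0 => // l; exact: h.
apply: le_trans (hi0 i) _; set A := cabs (x i0) in hi0 *.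
have A0 : 0 <= A by exact: cabs_ge0.
have xu l : cabs (x l * u l) <= A * tau by exact: cabsM_le.
have b1 : cabs (m ^+ 2 * (\sum_l ((S i0 l)%:C)%C * x l)) <= (1 - c) * A.
  by rewrite expr2 -mulrA; apply: cm; apply: cm; exact: centered_row.
have b2 : cabs (m * (ub * x i0)) <= tau * A by apply: cm; exact: cabsM_le.
have b3 : cabs (m * (\sum_l ((S i0 l)%:C)%C * (x l * u l) - avg (fun l => x l * u l))) <= A * tau + A * tau.
  apply: cm; apply: le_trans (cabsB _ _) _; apply: lerD; last exact: avg_le.
  by apply: le_trans (wsum (S0 i0) xu) _; rewrite Srow mul1r.
have b4 : cabs (m * (\sum_l ((S i0 l)%:C)%C * d l - avg d)) <= e2 + e3.
  by apply: cm; apply: le_trans (cabsB _ _) _; exact: lerD.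
have h : A <= (1 - c) * A + tau * A + ((A * tau + A * tau) + (e2 + e3)).
  rewrite {1}/A {1}x_eq; apply: le_trans (cabsD _ _) _; apply: lerD.
    by apply: le_trans (cabsD _ _) _; exact: lerD.
  by apply: le_trans (cabsB _ _) _; exact: lerD.
have tA : 6 * tau * A <= c * A by exact: ler_wpM2r.
have : c * A <= 2 * (e2 + e3).
  have e : (1 - c) * A = A - c * A by ring.
  move: h tA; rewrite e [A * tau]mulrC -[6 * tau * A]mulrA; move: (tau * A) (c * A) (e2 + e3) => v w y; lra.
by rewrite [2 / c * _]mulrAC ler_pdivlMr // mulrC.
Qed.

Let e4 : R := 2 / c * (e2 + e3).
Let e40 : 0 <= e4. Proof. exact: le_trans (fluct_bound (Ordinal N0)). Qed.
Let e10 : 0 <= e1. Proof. exact: le_trans (he1 (Ordinal N0)). Qed.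

(* Solving the diagonal equation for [u] with [s] and [d] replaced by [ub] and [0] gives the
   constant around which [u] is concentrated. *)
Let k := m ^+ 2 * ub / (1 - m * ub).
Let den : 2^-1 <= cabs (1 - m * ub).
Proof.
have h : cabs (m * ub) <= tau by exact: cm.
have := cabs_dist 1 (m * ub); rewrite cabs1; move: tau2 h; move: (cabs (m * ub)) (cabs _) => v w; lra.
Qed.
Let den0 : 1 - m * ub != 0.
Proof. by rewrite -cabs_gt0; apply: lt_le_trans den; rewrite invr_gt0. Qed.

Lemma diag_near i : cabs (u i - k) <= 2 * (2 * e4 + e1).
Proof.
have gi : cabs (m + u i) <= 2.
  by apply: le_trans (cabsD _ _) _; have := ut i; have := tau2; have := m1; move: (cabs m) (cabs (u i)) => v w; lra.
have e : (u i - k) * (1 - m * ub) = m * ((m + u i) * x i - d i).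
  rewrite mulrBl /k divfK // /x.
  have := uE i; move: (s i) (d i) => si di h.
  rewrite (_ : u i * (1 - m * ub) - m ^+ 2 * ub = u i - m * ub * (m + u i)); last by ring.
  by rewrite {1}h; ring.
have b : cabs (m * ((m + u i) * x i - d i)) <= 2 * e4 + e1.
  by apply: cm; apply: le_trans (cabsB _ _) _; apply: lerD => //; apply: cabsM_le => //; exact: fluct_bound.
have : cabs (u i - k) * 2^-1 <= 2 * e4 + e1.
  by apply: le_trans b; rewrite -e cabsM; apply: ler_wpM2l.
by rewrite ler_pdivrMr // mulrC.
Qed.

Hypothesis ub2 : 2 * cabs ub <= cabs (1 - m ^+ 2).

(** Because [x] has mean zero, [avg (x u) = avg (x (u - k))], a product of two small factors, and
    [ub2] absorbs [ub ^+ 2]. The error is therefore good enough to survive division by the small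
    [|1 - m ^ 2|]. *)
Lemma mean_bound : cabs (1 - m ^+ 2) * cabs ub <= 2 * (2 * e4 * (2 * e4 + e1) + e3).
Proof.
have e : (1 - m ^+ 2) * ub = m * (ub ^+ 2 + avg (fun l => x l * (u l - k))) - m * avg d.
  have -> : avg (fun l => x l * (u l - k)) = avg (fun l => x l * u l).
    rewrite (_ : avg _ = avg (fun l => x l * u l + - k * x l)); last first.
      by rewrite /avg; apply: eq_bigr => l _; congr (_ * _); rewrite mulNr mulrBr [k * _]mulrC.
    by rewrite avgD avgZ avg_x mulr0 addr0.
  by rewrite mulrBl mul1r {1}ub_eq; ring.
have b1 : cabs (avg (fun l => x l * (u l - k))) <= e4 * (2 * (2 * e4 + e1)).
  by apply: avg_le => l; apply: cabsM_le; [exact: fluct_bound|exact: diag_near].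
have b : cabs (1 - m ^+ 2) * cabs ub <= cabs ub ^+ 2 + e4 * (2 * (2 * e4 + e1)) + e3.
  rewrite -cabsM e; apply: le_trans (cabsB _ _) _; apply: lerD; last exact: cm.
  by apply: cm; apply: le_trans (cabsD _ _) _; apply: lerD => //; rewrite cabsX.
have b2 : 2 * cabs ub ^+ 2 <= cabs (1 - m ^+ 2) * cabs ub by rewrite expr2 mulrA; exact: ler_wpM2r.
rewrite (_ : 2 * (2 * e4 * (2 * e4 + e1) + e3) = 2 * (e4 * (2 * (2 * e4 + e1))) + 2 * e3); last by ring.
move: b b2; move: (cabs ub ^+ 2) (cabs _ * _) (e4 * _) => v w y; lra.
Qed.

Lemma diag_bound i : cabs (u i) <= 2 * cabs ub + 2 * (2 * e4 + e1).
Proof.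
have hk : cabs k <= 2 * cabs ub.
  rewrite /k cabsM cabsV ler_pdivrMr; last by apply: lt_le_trans den; rewrite invr_gt0.
  apply: (@le_trans _ _ (cabs ub)).
    by rewrite expr2 -mulrA; apply: cm; apply: cm.
  have := ler_wpM2l (cabs_ge0 ub) den; rewrite -mulrA.
  by move: (cabs ub) (cabs ub * cabs _) => v w; lra.
rewrite -[u i](subrK k) addrC; apply: le_trans (cabsD _ _) _; apply: lerD => //; exact: diag_near.
Qed.

End Stability.

(** * The isotropic law under a priori bounds *)

Section IsotropicSums.
Context {R : realType} (N : nat) (L n g B : R) (x A Q : 'I_N -> R).
Hypothesis L0 : 0 <= L.
Hypothesis n0 : 0 <= n.
Hypothesis g0 : 0 <= g.
Hypothesis B0 : 0 < B.
Hypothesis nN : n ^+ 2 = N%:R.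
Hypothesis x0 : forall i, 0 <= x i <= 1.
Hypothesis A0 : forall i, 0 <= A i <= 3 * L.
Hypothesis Q0 : forall i, 0 <= Q i <= 3 * L.
Hypothesis x2 : \sum_i x i ^+ 2 <= 1.
Hypothesis A2 : \sum_i A i ^+ 2 <= g ^+ 2.
Hypothesis Q2 : \sum_i Q i ^+ 2 <= g ^+ 2.

Let xx i : 0 <= x i. Proof. by case/andP: (x0 i). Qed.
Let AA i : 0 <= A i. Proof. by case/andP: (A0 i). Qed.
Let QQ i : 0 <= Q i. Proof. by case/andP: (Q0 i). Qed.
Let x2' : \sum_i x i ^+ 2 <= 1 ^+ 2. Proof. by rewrite expr1n. Qed.

(** The four sums below expand into products of an [i]-sum and a [j]-sum, each bounded by
    Cauchy-Schwarz with l2 norms 1 for [x] and [g] for [A] and [Q]; surplus factors are bounded by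
    [3 * L]. *)
Lemma double_sum (f h : 'I_N -> R) (F G : R) : 0 <= F -> (forall j, 0 <= h j) ->
  \sum_i f i <= F -> \sum_j h j <= G -> \sum_i \sum_j f i * h j <= F * G.
Proof.
move=> F0 h0 hf hh; under eq_bigr => i _ do rewrite -mulr_sumr.
rewrite -mulr_suml; apply: (@le_trans _ _ (F * \sum_j h j)).
  by apply: ler_wpM2r => //; apply: sumr_ge0.
exact: ler_wpM2l.
Qed.

Let sx : \sum_i x i <= n. Proof. by have := sum_le_sqrt n0 ler01 nN x2'; rewrite mulr1. Qed.
Let sA : \sum_i A i <= n * g. Proof. exact: sum_le_sqrt. Qed.
Let sQ : \sum_i Q i <= n * g. Proof. exact: sum_le_sqrt. Qed.
Let sxA : \sum_i x i * A i <= g. Proof. by have := sum_mul_le ler01 g0 x2' A2; rewrite mul1r. Qed.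
Let sxQ : \sum_i x i * Q i <= g. Proof. by have := sum_mul_le ler01 g0 x2' Q2; rewrite mul1r. Qed.
Let sAQ : \sum_i A i * Q i <= g ^+ 2. Proof. by rewrite expr2; exact: sum_mul_le. Qed.
Let bnd (f h : 'I_N -> R) (F : R) : (forall i, 0 <= f i) -> (forall i, 0 <= h i <= 3 * L) -> \sum_i f i <= F ->
  \sum_i f i * h i <= 3 * L * F.
Proof.
move=> f0 h0 hF; apply: (@le_trans _ _ (\sum_i 3 * L * f i)).
  by apply: ler_sum => i _; rewrite mulrC; apply: ler_wpM2r => //; case/andP: (h0 i).
by rewrite -mulr_sumr; apply: ler_wpM2l => //; pos.
Qed.
Let xA0 i : 0 <= x i * A i. Proof. exact: mulr_ge0. Qed.
Let xQ0 i : 0 <= x i * Q i. Proof. exact: mulr_ge0. Qed.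
Let AQ0 i : 0 <= A i * Q i. Proof. exact: mulr_ge0. Qed.
Let Qs0 i : 0 <= Q i ^+ 2. Proof. exact: sqr_ge0. Qed.

Lemma iso_sum1 : \sum_i \sum_j x i * (Q i + Q j) <= 2 * n ^+ 2 * g.
Proof.
rewrite (_ : 2 * n ^+ 2 * g = g * n ^+ 2 + n * (n * g)); last by ring.
have e i : \sum_j x i * (Q i + Q j) = \sum_(j < N) (x i * Q i) * 1 + \sum_j x i * Q j.
  by rewrite -big_split /=; apply: eq_bigr => j _; rewrite mulr1 mulrDr.
rewrite (eq_bigr _ (fun i _ => e i)).
rewrite big_split /=; apply: lerD; apply: double_sum => //.
by rewrite sumr_const card_ord nN.
Qed.

Lemma iso_sum2 : \sum_i \sum_j x i * (Q i + Q j) * (A i * Q j + A j * Q i) <= 6 * L * (n * g ^+ 2) + 2 * g ^+ 3.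
Proof.
rewrite (_ : _ + _ = (3 * L * g) * (n * g) + (3 * L * g) * (n * g) + g * g ^+ 2 + g * g ^+ 2); last by ring.
have e i : \sum_j x i * (Q i + Q j) * (A i * Q j + A j * Q i) = \sum_j (x i * A i * Q i) * Q j + \sum_j (x i * Q i * Q i) * A j
   + \sum_j (x i * A i) * Q j ^+ 2 + \sum_j (x i * Q i) * (A j * Q j).
  by rewrite -!big_split /=; apply: eq_bigr => j _; ring.
rewrite (eq_bigr _ (fun i _ => e i)).
have lg : 0 <= 3 * L * g by pos.
rewrite !big_split /=; apply: lerD; first apply: lerD; first apply: lerD.
- by apply: double_sum => //; exact: bnd.
- by apply: double_sum => //; exact: bnd.
- exact: double_sum.
- exact: double_sum.
Qed.

Lemma iso_sum3 : \sum_i \sum_j x i * Q j * ((A i + A j) * (Q i + Q j)) <= 6 * L * (n * g ^+ 2) + 2 * g ^+ 3.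
Proof.
rewrite (_ : _ + _ = (3 * L * g) * (n * g) + n * (3 * L * g ^+ 2) + g * g ^+ 2 + g * g ^+ 2); last by ring.
have e i : \sum_j x i * Q j * ((A i + A j) * (Q i + Q j)) = \sum_j (x i * A i * Q i) * Q j + \sum_j x i * (A j * Q j * Q j)
   + \sum_j (x i * A i) * Q j ^+ 2 + \sum_j (x i * Q i) * (A j * Q j).
  by rewrite -!big_split /=; apply: eq_bigr => j _; ring.
rewrite (eq_bigr _ (fun i _ => e i)).
have lg : 0 <= 3 * L * g by pos.
rewrite !big_split /=; apply: lerD; first apply: lerD; first apply: lerD.
- by apply: double_sum => //; exact: bnd.
- by apply: double_sum => //; [move=> j; exact: mulr_ge0|exact: bnd].
- exact: double_sum.
- exact: double_sum.
Qed.

Lemma iso_sum4 : \sum_i \sum_j x i * Q j * (A i * Q j + A j * Q i) ^+ 2 <= 36 * L ^+ 2 * g ^+ 3.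
Proof.
rewrite (_ : 36 * L ^+ 2 * g ^+ 3 = 2 * ((3 * L * g) * (3 * L * g ^+ 2) + (3 * L * g) * (3 * L * g ^+ 2))); last by ring.
apply: (@le_trans _ _ (2 * \sum_i (\sum_j (x i * A i * A i) * (Q j ^+ 2 * Q j) + \sum_j (x i * Q i * Q i) * (A j ^+ 2 * Q j)))).
  rewrite mulr_sumr; apply: ler_sum => i _; rewrite -big_split mulr_sumr /=; apply: ler_sum => j _.
  rewrite (_ : 2 * _ = x i * Q j * (2 * ((A i * Q j) ^+ 2 + (A j * Q i) ^+ 2))); last by ring.
  apply: ler_wpM2l; first exact: mulr_ge0.
  by rewrite -subr_ge0 (_ : _ - _ = (A i * Q j - A j * Q i) ^+ 2) ?sqr_ge0 //; ring.
have lg : 0 <= 3 * L * g by pos.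
rewrite big_split /=; apply: ler_wpM2l => //; apply: lerD; apply: double_sum => //.
- by move=> j; apply: mulr_ge0.
- exact: bnd.
- exact: bnd.
- by move=> j; apply: mulr_ge0 => //; exact: sqr_ge0.
- exact: bnd.
- by apply: bnd => // j; exact: sqr_ge0.
Qed.

End IsotropicSums.

Section IsotropicLaw.
Context {R : realType} (C : R) (Cp : nat -> R) (N : nat) d (T : measurableType d) (P : probability T R).
Variable H : T -> 'M[R[i]]_N.
Hypothesis W : wigner C Cp P H.
Notation Mat := 'M[R[i]]_N.
Notation Vec := 'cV[R[i]]_N.
Notation S := (Svar P H).
Notation Tv := (Tvar P H).
Variables (z m : R[i]) (L n r p s : R) (x y : Vec).
Hypothesis rg : regime N C z m L n r p s.
Hypothesis x1 : norm2 x <= 1.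
Hypothesis y1 : norm2 y <= 1.
Notation gq := (gq z).
Notation gh := (gh z).
Notation gb := (gb z).
Let sc := rg_sc rg.
Let z0 := rg_z0 rg.
Let B : R := L ^+ 14 * p.
(** By [sc_Ninv] this is [L ^+ 2 / N], matching the weighted vectors below, whose norms are at most
    [C / N]. *)
Let kp : R := L ^+ 2 * (p ^+ 2 * r ^+ 2).

(* Weighted copies of [x]; they appear when a sum over one index of the isotropic statistic is
   read as a resolvent matrix element. *)
Definition xs (j : 'I_N) : Vec := \col_i (x i 0 * ((S i j)%:C)%C).
Definition xt (j : 'I_N) : Vec := \col_i (conjc (x i 0) * Tv i j).
Definition xso (j : 'I_N) : Vec := \col_i (offd i j * (x i 0 * ((S i j)%:C)%C)).
Definition xto (j : 'I_N) : Vec := \col_i (offd i j * (conjc (x i 0) * Tv i j)).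

(** The error made by replacing the self-energy [sum_l S_il G_ll] by [m] in the isotropic
    expansion. *)
Definition sterm (M : Mat) : R[i] :=
  \sum_i conjc (x i 0) * (\sum_l ((S i l)%:C)%C * dev z m l M) * gq M (ebasis i) y.

Definition iso_good (M : Mat) : bool :=
  [&& good1 z L n M, r ^+ 2 * gam z M x <= L, r ^+ 2 * gam z M y <= L, cabs (sterm M) <= L ^+ 5 * p &
    [forall k, [&& cabs (gq M x (ebasis k)) <= L, cabs (gq M (ebasis k) y) <= L,
      cabs (gq M (xs k) y) <= kp, cabs (gq M (xt k) y) <= kp, cabs (gq M x (xso k)) <= kp,
      cabs (gq M x (xto k)) <= kp & cabs (gq M (ebasis k) (xto k)) <= kp]]].

Lemma admb_iso_good : admb iso_good.
Proof.
have ac (v w : Vec) c : admb (fun M => cabs (gq M v w) <= c).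
  by apply: admb_le; [apply: admR_cabs; exact: adm_gq|exact: admR_cst].
have ag v c : admb (fun M => r ^+ 2 * gam z M v <= c).
  by apply: admb_le; [apply: admRM; [exact: admR_cst|exact: admR_gam]|exact: admR_cst].
apply: admb_and; first exact: admb_good1.
apply: admb_and; first exact: ag.
apply: admb_and; first exact: ag.
apply: admb_and.
  apply: admb_le; last exact: admR_cst.
  apply: admR_cabs; apply: adm_sum => i; apply: admM; last exact: adm_gq.
  by apply: admZ; apply: adm_sum => l; apply: admZ; exact: adm_dev.
by apply: admb_forall => k; do 6![apply: admb_and; first exact: ac]; exact: ac.
Qed.

Definition xstat (M : Mat) : R[i] := gq M x y - m * cdot x y.
Definition xz (i j : 'I_N) (M : Mat) : R[i] := - (m * conjc (x i 0)) * gq M (ebasis j) y.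
Definition xzh i j (M : Mat) : R[i] := - (m * conjc (x i 0)) * gh i j M (ebasis j) y.
Definition xzb i j (M : Mat) : R[i] := - (m * conjc (x i 0)) * gb i j M (ebasis j) y.
Definition xq (M : Mat) : R[i] := - m ^+ 2 * gq M x y.

(** From [H G y = y + z G y] and [1 + m z = - m ^ 2], the second being the quadratic equation of
    [m]. *)
Lemma xstat_eq t : xstat (H t) = \sum_i \sum_j H t i j * xz i j (H t) + xq (H t).
Proof.
have E i : \sum_j H t i j * gq (H t) (ebasis j) y = y i 0 + z * gq (H t) (ebasis i) y.
  have := congr1 (fun A : Mat => (A *m y) i 0) (resolventK (wig_herm W t) z0).
  rewrite mul1mx mulmxBl mulmxBl -!mulmxA mul_scalar_mx !mxE => h.
  rewrite /gq cdot_ebasisl [(_ *m y) i 0]mxE -h subrK; apply: eq_bigr => j _.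
  by rewrite cdot_ebasisl.
have -> : \sum_i \sum_j H t i j * xz i j (H t) = - m * (cdot x y + z * gq (H t) x y).
  rewrite [gq _ x y]/(cdot x _) /cdot mulr_sumr -big_split mulr_sumr /=; apply: eq_bigr => i _.
  rewrite (_ : \sum_j _ = - (m * conjc (x i 0)) * \sum_j H t i j * gq (H t) (ebasis j) y).
    by rewrite E /gq cdot_ebasisl; ring.
  by rewrite mulr_sumr; apply: eq_bigr => j _; rewrite /xz mulrCA.
rewrite /xstat /xq; move: (gq (H t) x y) (cdot x y) => G D.
have e : m * z = - 1 - m ^+ 2 by rewrite -(rg_mE rg); ring.
rewrite mulrDr mulrA (_ : - m * z = - (m * z)); last by ring.
by rewrite e; ring.
Qed.


Let L0 : 0 < L. Proof. exact: sc_L0 sc. Qed.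
Let L1 : 1 <= L. Proof. exact: sc_L1 sc. Qed.
Let p0 : 0 < p. Proof. exact: sc_p0 sc. Qed.
Let r0 : 0 < r. Proof. exact: sc_r sc. Qed.
Let n0 : 0 < n. Proof. exact: sc_n sc. Qed.
Let npr : n * (p * r) = 1. Proof. exact: sc_p sc. Qed.
Let LL a b : (a <= b)%N -> L ^+ a <= L ^+ b. Proof. exact: (sc_Lpow sc). Qed.
Let xi i : R := cabs (x i 0).
Let xi1 i : xi i <= 1.
Proof.
rewrite -(@ler_pXn2r _ 2) ?nnegrE ?cabs_ge0 // expr1n; apply: le_trans x1.
by rewrite /norm2 (bigD1 i) //= lerDl; apply: sumr_ge0 => k _; exact: sqr_ge0.
Qed.
Let xi0 i : 0 <= xi i. Proof. exact: cabs_ge0. Qed.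
Let m1 : cabs m <= 1. Proof. exact: rg_m1 rg. Qed.
Let cxi i : cabs (- (m * conjc (x i 0))) <= xi i.
Proof. by rewrite cabsN cabsM cabs_conj; apply: ler_piMl. Qed.

Lemma iso_goodP M : iso_good M -> [/\ good1 z L n M, r ^+ 2 * gam z M x <= L, r ^+ 2 * gam z M y <= L &
  cabs (sterm M) <= L ^+ 5 * p] /\ forall k, [/\ [/\ cabs (gq M x (ebasis k)) <= L, cabs (gq M (ebasis k) y) <= L &
      cabs (gq M (xs k) y) <= kp], [/\ cabs (gq M (xt k) y) <= kp & cabs (gq M x (xso k)) <= kp] &
      [/\ cabs (gq M x (xto k)) <= kp & cabs (gq M (ebasis k) (xto k)) <= kp]].
Proof.
case/and5P => h1 h2 h3 h4 /forallP h; split; first by split.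
move=> k; have /andP[e1 /andP[e2 /andP[e3 /andP[e4 /andP[e5 /andP[e6 e7]]]]]] := h k.
by split; split.
Qed.

Lemma xstat_jet i j M : hermitian M -> iso_good M ->
  jet (M i j) (xstat M) (xstat (zer i j M)) (gh i j M x y) (gb i j M x y)
   (gh i j (zer i j M) x y) (gb i j (zer i j M) x y) (cabs (xstat M) + B)
   (jk1 z L n M i j x y) (12 * L * ((al z L n M x i + al z L n M x j) * (ar z L n M y i + ar z L n M y j))).
Proof.
move=> hM /iso_goodP[[gM _ _ _] hk].
have hx k : cabs (gq M x (ebasis k)) <= L by have [[]] := hk k.
have hy k : cabs (gq M (ebasis k) y) <= L by have [[]] := hk k.
have J := jet_vec z0 sc i j hM gM hx hy.
have A3 k : al z L n M x k <= 3 * L by apply: (al_le sc); exact: hx.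
have Q3 k : ar z L n M y k <= 3 * L by apply: (ar_le sc); exact: hy.
have A0 k : 0 <= al z L n M x k by exact: (al_ge0 z sc).
have Q0 k : 0 <= ar z L n M y k by exact: (ar_ge0 z sc).
have L0' := ltW L0.
have k1 : jk1 z L n M i j x y <= 18 * L ^+ 2.
  rewrite /jk1 (_ : 18 * L ^+ 2 = (3 * L) * (3 * L) + (3 * L) * (3 * L)); last by ring.
  by apply: lerD; (apply: ler_pM; [exact: A0|exact: Q0|exact: A3|exact: Q3]).
have o6 : al z L n M (ebasis i) j + al z L n M (ebasis j) i <= 6 * L.
  rewrite (_ : 6 * L = 3 * L + 3 * L); last by ring.
  by apply: lerD; apply: (al_le sc); [exact: (good1_gq i j gM)|exact: (good1_gq j i gM)].
have k2 : jk2 z L n M i j x y <= 12 * L * ((al z L n M x i + al z L n M x j) * (ar z L n M y i + ar z L n M y j)).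
  rewrite /jk2; have := ler_wpM2r (jk1_ge0 z sc M i j x y) o6.
  move: (al z L n M (ebasis i) j + _) => o; rewrite /jk1.
  move: (A0 i) (A0 j) (Q0 i) (Q0 j); move: (al _ _ _ _ _ i) (al _ _ _ _ _ j) (ar _ _ _ _ _ i) (ar _ _ _ _ _ j) => a b c e a0 b0 c0 e0 h.
  have h1 : 0 <= L * (a * c + b * e) by pos.
  rewrite (_ : 12 * L * _ = 2 * (2 * L * (a * c + b * e) + 6 * L * (a * e + b * c)) + 8 * (L * (a * c + b * e))); last by ring.
  have : 0 <= 8 * (L * (a * c + b * e)) by pos.
  by move: h; move: (o * _) (6 * L * _) (2 * L * _) (8 * _) => v w u t; lra.
have hs := ltW (sc_hs0 sc).
have hB : L / n * jk1 z L n M i j x y <= B.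
  apply: (@le_trans _ _ (L ^+ 2 * p * (18 * L ^+ 2))).
    by apply: ler_pM => //; [exact: (jk1_ge0 z sc)|exact: (sc_hs_le sc)].
  rewrite (_ : _ * _ = 18 * L ^+ 4 * p); last by ring.
  apply: ler_wpM2r; first exact: ltW.
  by apply: (@le_trans _ _ (L ^+ 5)); [exact: (sc_cst sc)|exact: LL].
have {}J := jet_le (lexx _) (lexx _) k2 J.
have B0 : 0 <= B by rewrite /B; have := ltW p0 => ?; pos.
rewrite /xstat; apply: (jet_value _ _ J); first by rewrite lerDl.
have dd := jet_d J; have hij := good1_entry i j gM.
rewrite (_ : gq (zer i j M) x y - m * cdot x y = (gq M x y - m * cdot x y) - (gq M x y - gq (zer i j M) x y)); last first.
  by move: (gq M x y) (gq _ x y) => u v; ring.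
apply: le_trans (cabsB _ _) _; rewrite lerD2l; apply: le_trans dd _; apply: le_trans hB.
by apply: ler_wpM2r => //; exact: (jk1_ge0 z sc).
Qed.

Lemma xz_jet i j M : hermitian M -> iso_good M ->
  jet (M i j) (xz i j M) (xz i j (zer i j M)) (xzh i j M) (xzb i j M) (xzh i j (zer i j M)) (xzb i j (zer i j M))
   (xi i * ar z L n M y j) (xi i * (3 * L * (ar z L n M y i + ar z L n M y j)))
   (xi i * (72 * L ^+ 2 * (ar z L n M y i + ar z L n M y j))).
Proof.
move=> hM /iso_goodP[[gM _ _ _] hk].
have hy k : cabs (gq M (ebasis k) y) <= L by have [[]] := hk k.
have hg k l : cabs (gq M (ebasis k) (ebasis l)) <= L by exact: (good1_gq k l gM).
have J := jet_vec z0 sc i j hM gM (hg j) hy.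
have Q0 k : 0 <= ar z L n M y k by exact: (ar_ge0 z sc).
have a3 a b : al z L n M (ebasis a) b <= 3 * L by apply: (al_le sc); exact: hg.
have a0 a b : 0 <= al z L n M (ebasis a) b by exact: (al_ge0 z sc).
have L0' := ltW L0.
have v1 : cabs (gq M (ebasis j) y) <= ar z L n M y j.
  have := cabs_ge0 (gq M (ebasis j) y); have := ltW (sc_dl0 sc).
  by rewrite /ar; move: (cabs _) (dl _ _) => u v; lra.
have v0 : cabs (gq (zer i j M) (ebasis j) y) <= ar z L n M y j.
  exact: (gq_zer_col z0 hM (good1_entry i j gM) (sc_hs4 sc) hg hy (or_intror (erefl j))).
have {}J := jet_val v1 v0 J.
have k1 : jk1 z L n M i j (ebasis j) y <= 3 * L * (ar z L n M y i + ar z L n M y j).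
  rewrite /jk1 [3 * L * _]mulrDr addrC; apply: lerD; apply: ler_wpM2r => //; exact: a3.
have k2 : jk2 z L n M i j (ebasis j) y <= 72 * L ^+ 2 * (ar z L n M y i + ar z L n M y j).
  rewrite /jk2.
  have o6 : al z L n M (ebasis i) j + al z L n M (ebasis j) i <= 6 * L.
    by rewrite (_ : 6 * L = 3 * L + 3 * L); [apply: lerD|ring].
  have e1 : 2 * L * (al z L n M (ebasis j) i * ar z L n M y i + al z L n M (ebasis j) j * ar z L n M y j) <=
     2 * L * (3 * L * ar z L n M y i + 3 * L * ar z L n M y j).
    by apply: ler_wpM2l; [pos|apply: lerD; apply: ler_wpM2r => //; exact: a3].
  have e2 : (al z L n M (ebasis i) j + al z L n M (ebasis j) i) * jk1 z L n M i j (ebasis j) y <=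
     6 * L * (3 * L * (ar z L n M y i + ar z L n M y j)).
    by apply: ler_pM => //; [exact: addr_ge0|exact: (jk1_ge0 z sc)].
  apply: (@le_trans _ _ (2 * (2 * L * (3 * L * ar z L n M y i + 3 * L * ar z L n M y j) + 6 * L * (3 * L * (ar z L n M y i + ar z L n M y j))))).
    by apply: ler_wpM2l => //; exact: lerD.
  rewrite [leLHS](_ : _ = 48 * L ^+ 2 * (ar z L n M y i + ar z L n M y j)); last by move: (ar _ _ _ _ _ i) (ar _ _ _ _ _ j) => u v; ring.
  apply: ler_wpM2r; first exact: addr_ge0.
  by apply: ler_wpM2r; [pos|rewrite ler_nat].
have := jetZ (- (m * conjc (x i 0))) (jet_le (lexx _) k1 k2 J); apply: jet_le.
- by apply: ler_wpM2r => //.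
- by apply: ler_wpM2r => //; apply: mulr_ge0; [pos|exact: addr_ge0].
- by apply: ler_wpM2r => //; apply: mulr_ge0; [pos|exact: addr_ge0].
Qed.

Lemma sum_weight (f : 'I_N -> R) : (forall k, 0 <= f k) -> r ^+ 2 * \sum_k f k ^+ 2 <= L ->
  \sum_k (2 * f k + dl L n) ^+ 2 <= (L ^+ 5 / r) ^+ 2.
Proof.
move=> f0 hf; have L0' := ltW L0; have p0' := ltW p0; have r0' := ltW r0.
have r2 : 0 < r ^+ 2 by rewrite exprn_gt0.
rewrite expr_div_n -exprM ler_pdivlMr // mulrC.
apply: (@le_trans _ _ (r ^+ 2 * (8 * \sum_k f k ^+ 2 + N%:R * (2 * dl L n ^+ 2)))).
  rewrite ler_pM2l // mulr_sumr (_ : N%:R * (2 * dl L n ^+ 2) = \sum_(k < N) 2 * dl L n ^+ 2); last by rewrite sumr_const card_ord mulr_natl.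
  rewrite -big_split /=; apply: ler_sum => k _.
  by rewrite -subr_ge0 (_ : _ - _ = (2 * f k - dl L n) ^+ 2) ?sqr_ge0 //; ring.
rewrite mulrDr mulrCA -(sc_N sc) (sc_dl sc).
rewrite (_ : r ^+ 2 * (n ^+ 2 * _) = 8 * L ^+ 6 * r ^+ 2 * (n * (p * r)) ^+ 2); last by ring.
rewrite npr expr1n mulr1.
apply: (@le_trans _ _ (8 * L ^+ 1 + 8 * L ^+ 8)).
  apply: lerD; first by apply: ler_wpM2l.
  rewrite -mulrA; apply: ler_wpM2l => //; rewrite (_ : L ^+ 8 = L ^+ 6 * L ^+ 2); last by ring.
  by apply: ler_wpM2l; [pos|apply: ler_wXn2r => //; exact: sc_rL sc].
have h1 := LL (isT : (1 <= 8)%N); have h2 : 16 * L ^+ 8 <= L ^+ 9 by exact: (sc_cst sc).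
have h3 := LL (isT : (9 <= 5 * 2)%N).
by move: (L ^+ 1) (L ^+ 8) (L ^+ 9) (L ^+ (5 * 2)) h1 h2 h3 => u v w t; lra.
Qed.

(** Substituting [n = (p r)^-1] cancels all powers of [r] and leaves multiples of [p]. The largest
    is [144 * L ^+ 10 * p], which fits into [B = L ^+ 14 * p]. *)
Lemma iso_arith : (L / n) ^+ 3 * (72 * L ^+ 2 * (2 * n ^+ 2 * (L ^+ 5 / r))
  + 15 * L / B * (6 * L * (n * (L ^+ 5 / r) ^+ 2) + 2 * (L ^+ 5 / r) ^+ 3)
  + (36 * L ^+ 2 * (L ^+ 5 / r) ^+ 3) / B ^+ 2) <= B.
Proof.
have L0' := ltW L0; have p0' := ltW p0.
have e : (L / n) ^+ 3 * (72 * L ^+ 2 * (2 * n ^+ 2 * (L ^+ 5 / r))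
  + 15 * L / B * (6 * L * (n * (L ^+ 5 / r) ^+ 2) + 2 * (L ^+ 5 / r) ^+ 3)
  + (36 * L ^+ 2 * (L ^+ 5 / r) ^+ 3) / B ^+ 2) = 144 * L ^+ 10 * p + 90 * L * p + 30 * (L ^+ 5 * p) * p + 36 * (L^-1) ^+ 8 * p.
  rewrite /B (sc_hs sc).
  have -> : n = (p * r)^-1 by rewrite -(sc_inv sc) invrK.
  have := lt0r_neq0 p0; have := lt0r_neq0 r0; have := lt0r_neq0 L0 => l r' q.
  by field; rewrite l r' q.
rewrite e.
have h1 : 90 * L * p <= L ^+ 2 * p by apply: ler_wpM2r => //; have := sc_cst sc (1%N) (isT : (90 <= 10 ^ 3)%N); rewrite expr1.
have h2 : 30 * (L ^+ 5 * p) * p <= 30 * p.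
  by apply: ler_wpM2r => //; rewrite -[leRHS]mulr1; apply: ler_wpM2l => //; exact: (sc_Lp sc).
have h3 : 36 * (L^-1) ^+ 8 * p <= 36 * p.
  apply: ler_wpM2r => //; rewrite -[leRHS]mulr1; apply: ler_wpM2l => //; apply: exprn_ile1; first by rewrite invr_ge0.
  by rewrite invf_le1.
have h4 : 144 * L ^+ 10 * p <= L ^+ 11 * p by apply: ler_wpM2r => //; exact: (sc_cst sc).
have h5 : p <= L ^+ 11 * p by rewrite ler_peMl // exprn_ege1.
have h6 : L ^+ 2 * p <= L ^+ 11 * p by apply: ler_wpM2r => //; exact: LL.
have h7 : 100 * L ^+ 11 * p <= L ^+ 14 * p.
  by apply: ler_wpM2r => //; apply: (@le_trans _ _ (L ^+ 12)); [exact: (sc_cst sc)|exact: LL].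
rewrite -mulrA in h7; rewrite /B.
have := lerD (lerD (lerD h4 (le_trans h1 h6)) (le_trans h2 (ler_wpM2l (ler0n _ 30) h5))) (le_trans h3 (ler_wpM2l (ler0n _ 36) h5)).
move/le_trans; apply; apply: le_trans h7; have : 0 <= L ^+ 11 * p by pos.
by move: (L ^+ 11 * p) => u; lra.
Qed.

Lemma iso_term4 M : hermitian M -> iso_good M ->
  (L / n) ^+ 3 * \sum_i \sum_j (xi i * (72 * L ^+ 2 * (ar z L n M y i + ar z L n M y j))
    + xi i * (3 * L * (ar z L n M y i + ar z L n M y j)) * (jk1 z L n M i j x y / B)
    + xi i * ar z L n M y j * (12 * L * ((al z L n M x i + al z L n M x j) * (ar z L n M y i + ar z L n M y j)) / B
         + (jk1 z L n M i j x y / B) ^+ 2)) <= B.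
Proof.
move=> hM /iso_goodP[[gM gx gy _] hk].
have L0' := ltW L0; have n0' := ltW n0; have r0' := ltW r0.
have B0 : 0 < B by rewrite /B mulr_gt0 ?exprn_gt0.
apply: le_trans iso_arith; apply: ler_wpM2l; first by rewrite exprn_ge0 // ltW // (sc_hs0 sc).
pose A k := al z L n M x k; pose Q k := ar z L n M y k.
have A3 k : 0 <= A k <= 3 * L.
  by rewrite (al_ge0 z sc) /=; apply: (al_le sc); have [[]] := hk k.
have Q3 k : 0 <= Q k <= 3 * L.
  by rewrite (ar_ge0 z sc) /=; apply: (ar_le sc); have [[]] := hk k.
have g0 : 0 <= L ^+ 5 / r by apply: mulr_ge0; [pos|rewrite invr_ge0].
have A2 : \sum_k A k ^+ 2 <= (L ^+ 5 / r) ^+ 2.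
  by apply: sum_weight => [k|]; [exact: cabs_ge0|rewrite gam_row].
have Q2 : \sum_k Q k ^+ 2 <= (L ^+ 5 / r) ^+ 2 by apply: sum_weight => [k|]; [exact: cabs_ge0|].
have x01 k : 0 <= xi k <= 1 by rewrite xi0 xi1.
have s1 : \sum_i \sum_j xi i * (Q i + Q j) <= 2 * n ^+ 2 * (L ^+ 5 / r).
  by apply: (iso_sum1 (L := L)) => //; exact: sc_N sc.
have s2 : \sum_i \sum_j xi i * (Q i + Q j) * (A i * Q j + A j * Q i) <= 6 * L * (n * (L ^+ 5 / r) ^+ 2) + 2 * (L ^+ 5 / r) ^+ 3.
  by apply: iso_sum2 => //; exact: sc_N sc.
have s3 : \sum_i \sum_j xi i * Q j * ((A i + A j) * (Q i + Q j)) <= 6 * L * (n * (L ^+ 5 / r) ^+ 2) + 2 * (L ^+ 5 / r) ^+ 3.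
  by apply: iso_sum3 => //; exact: sc_N sc.
have s4 : \sum_i \sum_j xi i * Q j * (A i * Q j + A j * Q i) ^+ 2 <= 36 * L ^+ 2 * (L ^+ 5 / r) ^+ 3.
  by apply: iso_sum4.
rewrite [leLHS](_ : _ = 72 * L ^+ 2 * (\sum_i \sum_j xi i * (Q i + Q j)) + 3 * L / B * (\sum_i \sum_j xi i * (Q i + Q j) * (A i * Q j + A j * Q i))
   + 12 * L / B * (\sum_i \sum_j xi i * Q j * ((A i + A j) * (Q i + Q j))) + B ^- 2 * (\sum_i \sum_j xi i * Q j * (A i * Q j + A j * Q i) ^+ 2)); last first.
  rewrite !mulr_sumr -!big_split /=; apply: eq_bigr => i _; rewrite !mulr_sumr -!big_split /=; apply: eq_bigr => j _.
  rewrite /jk1 -/(A i) -/(A j) -/(Q i) -/(Q j); move: (A i) (A j) (Q i) (Q j) (xi i) => a b c e w.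
  by field; exact: lt0r_neq0.
have b0 k : 0 <= k%:R * L / B by apply: mulr_ge0; [pos|rewrite invr_ge0 ltW].
have b2 : 0 <= B ^- 2 by rewrite invr_ge0 exprn_ge0 // ltW.
apply: lerD; last by rewrite [leRHS]mulrC; apply: ler_wpM2l.
rewrite [X in _ <= _ + X](_ : _ = 3 * L / B * (6 * L * (n * (L ^+ 5 / r) ^+ 2) + 2 * (L ^+ 5 / r) ^+ 3) + 12 * L / B * (6 * L * (n * (L ^+ 5 / r) ^+ 2) + 2 * (L ^+ 5 / r) ^+ 3)); last by ring.
rewrite [leRHS]addrA; apply: lerD; last by apply: ler_wpM2l; [exact: (b0 12%N)|exact: s3].
apply: lerD; last by apply: ler_wpM2l; [exact: (b0 3%N)|exact: s2].
by apply: ler_wpM2l => //; pos.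
Qed.

Let conjM (u v : R[i]) : conjc (u * v) = conjc u * conjc v. Proof. exact: rmorphM. Qed.
Let conjN (u : R[i]) : conjc (- u) = - conjc u. Proof. exact: rmorphN. Qed.
Let conjR (u : R) : conjc ((u%:C)%C) = (u%:C)%C. Proof. exact: conjc_real. Qed.
Let conj_offd (i j : 'I_N) : conjc (offd i j : R[i]) = offd i j.
Proof. by rewrite /offd; case: (i != j); [exact: rmorph1|exact: rmorph0]. Qed.

Lemma sum3_le (f g c : 'I_N -> R[i]) (k G : R) : 0 <= k -> 0 <= G ->
  \sum_j cabs (f j) ^+ 2 <= G ^+ 2 -> \sum_j cabs (g j) ^+ 2 <= G ^+ 2 -> (forall j, cabs (c j) <= k) ->
  cabs (\sum_j f j * g j * c j) <= k * G ^+ 2.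
Proof.
move=> k0 G0 hf hg hc; apply: le_trans (cabs_sum _ _ _) _.
apply: (@le_trans _ _ (\sum_j cabs (f j) * cabs (g j) * k)).
  by apply: ler_sum => j _; rewrite !cabsM; apply: ler_wpM2l; [pos|exact: hc].
rewrite -mulr_suml mulrC.
by apply: ler_wpM2l => //; rewrite expr2; exact: sum_mul_le.
Qed.

Lemma gq_row (M : Mat) (u v : Vec) : gq M u v = \sum_i conjc (u i 0) * gq M (ebasis i) v.
Proof. by rewrite {1}/gq /cdot; apply: eq_bigr => i _; rewrite /gq cdot_ebasisl. Qed.
Lemma gq_col (M : Mat) (u v : Vec) : gq M u v = \sum_i v i 0 * gq M u (ebasis i).
Proof.
by rewrite {1}/gq cdot_adj {1}/cdot; apply: eq_bigr => i _; rewrite /gq cdot_adj cdot_ebasisr mulrC.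
Qed.

Let G : R := L / r.
Let gam_G (M : Mat) (v : Vec) : r ^+ 2 * gam z M v <= L -> gam z M v <= G ^+ 2.
Proof.
move=> h; rewrite /G expr_div_n ler_pdivlMr ?exprn_gt0 // mulrC; apply: le_trans h _.
by rewrite -[leLHS]expr1; exact: LL.
Qed.
Let G0 : 0 <= G. Proof. by rewrite /G; have := ltW L0; have := ltW r0 => ? ?; pos. Qed.
Let kpG : 2 * (kp * G ^+ 2) <= B ^+ 2.
Proof.
have L0' := ltW L0; have p0' := ltW p0.
rewrite /kp /G /B [leLHS](_ : _ = 2 * L ^+ 4 * p ^+ 2); last by field; exact: lt0r_neq0.
rewrite exprMn -exprM; apply: ler_wpM2r; first exact: sqr_ge0.
by apply: (@le_trans _ _ (L ^+ 5)); [exact: (sc_cst sc)|exact: LL].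
Qed.
Let kp0 : 0 <= kp. Proof. by rewrite /kp; have := ltW L0; have := ltW p0; have := ltW r0 => ? ? ?; pos. Qed.
Let two_terms (u v : R[i]) : cabs u <= kp * G ^+ 2 -> cabs v <= kp * G ^+ 2 -> cabs (m * (u + v)) <= B ^+ 2.
Proof.
move=> hu hv; rewrite cabsM; apply: (@le_trans _ _ (1 * cabs (u + v))); first exact: ler_wpM2r.
rewrite mul1r; apply: le_trans (cabsD _ _) _; apply: le_trans kpG.
by rewrite (_ : 2 * _ = kp * G ^+ 2 + kp * G ^+ 2); [exact: lerD|ring].
Qed.

(** The variance part of the derivative of [Z] is [m] times a self-energy sum, and its value at [m]
    cancels [xq]; what remains is [sterm]. In the pseudo-variance part the sum over [i] is a
    resolvent element of [xto]. *)
Lemma xterm1 M : hermitian M -> iso_good M -> cabs (term1 P H xq xzh xzb M) <= B.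
Proof.
move=> hM /iso_goodP[[gM gx gy gs] hk].
have L0' := ltW L0; have p0' := ltW p0; have r0' := ltW r0; have n0' := ltW n0.
have -> : term1 P H xq xzh xzb M = m * (sterm M + \sum_j gq M (ebasis j) y * gq M (ebasis j) (xto j)).
  rewrite /term1 /xq (gq_row M x y) /sterm mulr_sumr.
  have e : \sum_j gq M (ebasis j) y * gq M (ebasis j) (xto j) = \sum_i \sum_j conjc (x i 0) * (Tv i j * (offd i j * (gq M (ebasis j) (ebasis i) * gq M (ebasis j) y))).
    rewrite exchange_big /=; apply: eq_bigr => j _; rewrite (gq_col M (ebasis j) (xto j)) mulr_sumr.
    by apply: eq_bigr => i _; rewrite mxE; ring.
  rewrite e -!big_split mulr_sumr /=; apply: eq_bigr => i _.
  have es : \sum_l ((S i l)%:C)%C * dev z m l M = (\sum_l ((S i l)%:C)%C * gq M (ebasis l) (ebasis l)) - m.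
    rewrite -[X in _ = _ - X]mul1r -[X in X * m]/((1%:C)%C) -(Svar_sum W i).
    rewrite raddf_sum mulr_suml -sumrB; apply: eq_bigr => l _; by rewrite /dev mulrBr.
  rewrite es.
  have eS : \sum_(j < N) ((S i j)%:C)%C * xzb i j M = m * conjc (x i 0) * gq M (ebasis i) y * \sum_l ((S i l)%:C)%C * gq M (ebasis l) (ebasis l).
    by rewrite mulr_sumr; apply: eq_bigr => j _; rewrite /xzb /gb; ring.
  have eT : \sum_(j < N) Tv i j * xzh i j M = \sum_j m * (conjc (x i 0) * (Tv i j * (offd i j * (gq M (ebasis j) (ebasis i) * gq M (ebasis j) y)))).
    by apply: eq_bigr => j _; rewrite /xzh /gh; ring.
  by rewrite big_split /= eS eT -mulr_sumr; ring.
rewrite cabsM; apply: (@le_trans _ _ (1 * (L ^+ 5 * p + L ^+ 3 * p))).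
  apply: ler_pM => //; apply: le_trans (cabsD _ _) _; apply: lerD => //.
  apply: le_trans (cabs_sum _ _ _) _; apply: (@le_trans _ _ (\sum_j cabs (gq M (ebasis j) y) * kp)).
    by apply: ler_sum => j _; rewrite cabsM; apply: ler_wpM2l => //; have [_ _ []] := hk j.
  rewrite -mulr_suml; have := sum_le_sqrt n0' G0 (sc_N sc) (gam_G gy).
  move/(ler_wpM2r (_ : 0 <= kp)) => h; apply: le_trans (h _) _; first by rewrite /kp; pos.
  rewrite /G /kp le_eqVlt; apply/orP; left; apply/eqP.
  rewrite [LHS](_ : _ = L ^+ 3 * p * (n * (p * r))); last by field; exact: lt0r_neq0.
  by rewrite npr mulr1.
rewrite mul1r -mulrDl; apply: ler_wpM2r => //.
have h1 := LL (isT : (3 <= 5)%N); have h2 : 2 * L ^+ 5 <= L ^+ 6 by exact: (sc_cst sc).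
have h3 := LL (isT : (6 <= 14)%N).
by move: (L ^+ 3) (L ^+ 5) (L ^+ 6) (L ^+ 14) h1 h2 h3 => a b c e; lra.
Qed.

(** The sum over [i] is absorbed into elements of [xto] and [xs], each at most [kp]; the remaining
    sum over [j] has two l2 factors, so [sum3_le] gives order [1 / (N rho)], that is [p ^+ 2]. *)
Lemma xterm2 M : hermitian M -> iso_good M -> cabs (term2 P H (fun i j M => gh i j M x y) (fun i j M => gb i j M x y) xz M) <= B ^+ 2.
Proof.
move=> hM /iso_goodP[[gM gx gy gs] hk].
have -> : term2 P H (fun i j M => gh i j M x y) (fun i j M => gb i j M x y) xz M =
   m * (\sum_j gq M (ebasis j) y * gq M (ebasis j) y * gq M x (xto j) + \sum_j gq M (ebasis j) y * gq M x (ebasis j) * gq M (xs j) y).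
  rewrite -big_split mulr_sumr /term2 exchange_big /=; apply: eq_bigr => j _.
  rewrite (gq_col M x (xto j)) (gq_row M (xs j) y) /xz /gh /gb; move: (gq M) => g.
  rewrite !mulr_sumr -big_split mulr_sumr /=; apply: eq_bigr => i _.
  by rewrite /xto /xs !mxE conjM conjR; ring.
have Gy := gam_G gy; have Gx := gam_G gx; rewrite -(gam_row z0 x hM) in Gx.
apply: two_terms; apply: sum3_le => // j; have := hk j; first by case=> _ _ [].
by case=> [[]].
Qed.

Lemma xterm3 M : hermitian M -> iso_good M -> cabs (term3 P H (fun i j M => gh i j M x y) (fun i j M => gb i j M x y) xz M) <= B ^+ 2.
Proof.
move=> hM /iso_goodP[[gM gx gy gs] hk].
have -> : term3 P H (fun i j M => gh i j M x y) (fun i j M => gb i j M x y) xz M =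
   m * (\sum_j gq M (ebasis j) y * conjc (gq M x (ebasis j)) * conjc (gq M (xt j) y) + \sum_j gq M (ebasis j) y * conjc (gq M (ebasis j) y) * conjc (gq M x (xso j))).
  rewrite -big_split mulr_sumr /term3 exchange_big /=; apply: eq_bigr => j _.
  rewrite (gq_col M x (xso j)) (gq_row M (xt j) y) /xz /gh /gb; move: (gq M) => g.
  rewrite !raddf_sum !mulr_sumr -big_split mulr_sumr /=; apply: eq_bigr => i _.
  by rewrite /xt /xso !mxE !(conjM, conjN) conjR conj_offd !conjcK; ring.
have Gy := gam_G gy; have Gx := gam_G gx; rewrite -(gam_row z0 x hM) in Gx.
apply: two_terms; apply: sum3_le => //; have cc (w : 'I_N -> R[i]) : \sum_j cabs (conjc (w j)) ^+ 2 = \sum_j cabs (w j) ^+ 2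
  by apply: eq_bigr => j _; rewrite cabs_conj.
- by rewrite cc.
- by move=> j; rewrite cabs_conj; have := hk j; case=> _ [].
- by rewrite cc.
- by move=> j; rewrite cabs_conj; have := hk j; case=> _ [].
Qed.



Section Crude.
Variable c : R.
Hypothesis c1 : 1 <= c.
Hypothesis cz : 1 <= c * `|ImC z|.
Let c0 : 0 <= c. Proof. by move: c1; lra. Qed.

Lemma crude_xz i j M : hermitian M ->
  jet (M i j) (xz i j M) (xz i j (zer i j M)) (xzh i j M) (xzb i j M) (xzh i j (zer i j M)) (xzb i j (zer i j M))
   (8 * c ^+ 3) (8 * c ^+ 3) (8 * c ^+ 3).
Proof.
move=> hM; have J := jet_gq_crude z0 i j hM c0 cz (_ : norm2 (ebasis j) <= 1) y1.
have {}J := jetZ (- (m * conjc (x i 0))) (J _); rewrite norm2_ebasis in J.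
have cw : cabs (- (m * conjc (x i 0))) <= 1 by apply: le_trans (cxi i) _; exact: xi1.
have c13 : c ^+ 1 <= c ^+ 3 by exact: ler_weXn2l.
have c23 : c ^+ 2 <= c ^+ 3 by exact: ler_weXn2l.
have c30 : 0 <= c ^+ 3 by exact: exprn_ge0.
have w1 a : 0 <= a -> cabs (- (m * conjc (x i 0))) * a <= a by move=> a0; apply: ler_piMl.
apply: jet_le (J (lexx _)); apply: le_trans (w1 _ _) _; try by pos.
- by move: c13 c30; rewrite expr1; move: (c ^+ 3) => u; lra.
- by move: (c ^+ 2) (c ^+ 3) c23 c30 => u v; lra.
- by [].
Qed.

Lemma crude_xstat i j M : hermitian M ->
  jet (M i j) (xstat M) (xstat (zer i j M)) (gh i j M x y) (gb i j M x y)
   (gh i j (zer i j M) x y) (gb i j (zer i j M) x y) (8 * c ^+ 3) (8 * c ^+ 3) (8 * c ^+ 3).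
Proof.
move=> hM; have J := jet_gq_crude z0 i j hM c0 cz x1 y1.
have c13 : c ^+ 1 <= c ^+ 3 by exact: ler_weXn2l.
have c23 : c ^+ 2 <= c ^+ 3 by exact: ler_weXn2l.
have c31 : 1 <= c ^+ 3 by exact: exprn_ege1.
have v M' : hermitian M' -> cabs (gq M' x y - m * cdot x y) <= 8 * c ^+ 3.
  move=> hM'; apply: le_trans (cabsB _ _) _.
  apply: (@le_trans _ _ (c ^+ 1 + 1 * 1)); last by move: (c ^+ 1) (c ^+ 3) c13 c31 => u v; lra.
  apply: lerD; first exact: gq_crude.
  rewrite cabsM; apply: ler_pM => //; rewrite -[leRHS]mul1r; apply: cdot_le => //; by rewrite expr1n.
apply: jet_value (v _ hM) (v _ (zer_herm i j hM)) (jet_le (lexx _) _ (lexx _) J).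
by move: (c ^+ 2) (c ^+ 3) c23 c31 => u v'; lra.
Qed.

Lemma adm_xz i j : adm (xz i j). Proof. by apply: admZ; exact: adm_gq. Qed.
Lemma adm_xzh i j : adm (xzh i j). Proof. by apply: admZ; exact: adm_gh. Qed.
Lemma adm_xzb i j : adm (xzb i j). Proof. by apply: admZ; exact: adm_gb. Qed.
Lemma adm_xq : adm xq. Proof. by apply: admZ; exact: adm_gq. Qed.
Lemma adm_xstat : adm xstat. Proof. by apply: admB; [exact: adm_gq|exact: adm_cst]. Qed.

Variable V : R.
Hypothesis cV : 500 * c ^+ 6 <= V.
Hypothesis Lc : L <= c.
Hypothesis NV : N%:R <= V.
Hypothesis BV : V^-1 <= B.

Lemma xstat_tail q (tau pb l : R) : 0 < tau -> tau <= 1 -> 0 <= Cp 6 -> 1 <= l -> 0 <= pb ->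
  (P [set t | ~~ iso_good (H t)] <= pb%:E)%E ->
  (P [set t | ~~ (cabs (xstat (H t)) <= l * B)%R] <=
    (mom_cst q * (l ^- (q + q.+2) + V ^+ (9 * (q + q.+2) + 2) * (tau * Cp 6 + tau^-1 * pb)))%:E)%E.
Proof.
move=> tau0 tau1 C60 l1 pb0 hpb.
have hM t := wig_herm W t.
have pw a : (a <= 6)%N -> c ^+ a <= c ^+ 6 by move=> ae; exact: ler_weXn2l.
have c6 : 1 <= c ^+ 6 by exact: exprn_ege1.
have c3V : 8 * c ^+ 3 <= V.
  by apply: le_trans cV; have := pw 3%N isT; move: (c ^+ 3) (c ^+ 6) c6 => u v; lra.
have V1 : 400 <= V by apply: le_trans cV; move: (c ^+ 6) c6 => u; lra.
have N1 := rg_N0 rg.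
have aal k := admR_al L n z0 x k; have aar k := admR_ar L n z0 y k.
have L0' := ltW L0; have p0' := ltW p0.
apply: (@two_regime_tail _ C Cp N d T P H W xstat xq (fun i j M => gh i j M x y) (fun i j M => gb i j M x y) xz xzh xzb
  (fun i j M => jk1 z L n M i j x y)
  (fun i j M => 12 * L * ((al z L n M x i + al z L n M x j) * (ar z L n M y i + ar z L n M y j)))
  (fun i j M => xi i * ar z L n M y j) (fun i j M => xi i * (3 * L * (ar z L n M y i + ar z L n M y j)))
  (fun i j M => xi i * (72 * L ^+ 2 * (ar z L n M y i + ar z L n M y j))) iso_good B V (L / n)); try assumption.
- exact: adm_xstat.
- exact: adm_xq.
- by move=> i j; exact: adm_gh.
- by move=> i j; exact: adm_gb.
- exact: adm_xz.
- exact: adm_xzh.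
- exact: adm_xzb.
- by move=> i j; exact: admR_jk1.
- by move=> i j; apply: admRM; [exact: admR_cst|apply: admRM; apply: admRD].
- by move=> i j; apply: admRM; [exact: admR_cst|].
- by move=> i j; apply: admRM; [exact: admR_cst|apply: admRM; [exact: admR_cst|exact: admRD]].
- by move=> i j; apply: admRM; [exact: admR_cst|apply: admRM; [exact: admR_cst|exact: admRD]].
- exact: admb_iso_good.
- exact: xstat_eq.
- move=> t i j; split; [have J := crude_xstat i j (hM t)|have J := crude_xz i j (hM t)]; exact: jet_le J.
- move=> t; rewrite /xq cabsM cabsN cabsX; apply: (@le_trans _ _ (1 * c)).
    by apply: ler_pM => //; [pos|exact: exprn_ile1|exact: gq_crude].
  by rewrite mul1r; apply: le_trans cV; have := pw 1%N isT; rewrite expr1; move: (c ^+ 6) c6 => u; move: c0; lra.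
- move=> t; have i0 : 'I_N by exact: (Ordinal N1).
  by apply: le_trans c3V; exact: jet_v (crude_xstat i0 i0 (hM t)).
- move=> t gt i j; have [[gM _ _ _] hk] := iso_goodP gt.
  have A3 k : al z L n (H t) x k <= 3 * L by apply: (al_le sc); have [[]] := hk k.
  have Q3 k : ar z L n (H t) y k <= 3 * L by apply: (ar_le sc); have [[]] := hk k.
  have A0 k : 0 <= al z L n (H t) x k by exact: (al_ge0 z sc).
  have Q0 k : 0 <= ar z L n (H t) y k by exact: (ar_ge0 z sc).
  have QQ : ar z L n (H t) y i + ar z L n (H t) y j <= 6 * L.
    by have := Q3 i; have := Q3 j; move: (ar _ _ _ _ _ i) (ar _ _ _ _ _ j) => u v; lra.
  have AA : al z L n (H t) x i + al z L n (H t) x j <= 6 * L.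
    by have := A3 i; have := A3 j; move: (al _ _ _ _ _ i) (al _ _ _ _ _ j) => u v; lra.
  have LcX a : L ^+ a <= c ^+ a by apply: ler_wXn2r.
  have c60 : 0 <= c ^+ 6 by exact: exprn_ge0.
  have fin a (k : nat) (w : R) : (a <= 6)%N -> w <= k%:R * L ^+ a -> (k <= 432)%N -> w <= 500 * c ^+ 6.
    move=> a6 hw k4; apply: le_trans hw _; apply: ler_pM => //; first by pos.
      by rewrite ler_nat; apply: leq_trans k4 _.
    exact: le_trans (LcX a) (pw a a6).
  have {}fin a (k : nat) (w : R) : (a <= 6)%N -> (k <= 432)%N -> w <= k%:R * L ^+ a -> w <= V.
    move=> a6 k4 hw; have := fin a k w a6 hw k4 => h; exact: le_trans h _.
  split; [exact: xstat_jet|exact: xz_jet|split|split].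
  + apply: (fin 2%N 18%N) => //.
    rewrite /jk1 (_ : 18 * L ^+ 2 = 3 * L * (3 * L) + 3 * L * (3 * L)); last by ring.
    by apply: lerD; apply: ler_pM; [exact: A0|exact: Q0|exact: A3|exact: Q3|exact: A0|exact: Q0|exact: A3|exact: Q3].
  + apply: (fin 3%N 432%N) => //; rewrite (_ : 432 * L ^+ 3 = 12 * L * (6 * L * (6 * L))); last by ring.
    by apply: ler_wpM2l; [pos|apply: ler_pM => //; exact: addr_ge0].
  + apply: (fin 1%N 3%N) => //; rewrite expr1 -[leRHS]mul1r; exact: ler_pM.
  + apply: (fin 2%N 18%N) => //; rewrite (_ : 18 * L ^+ 2 = 1 * (3 * L * (6 * L))); last by ring.
    apply: ler_pM => //; first by apply: mulr_ge0; [pos|exact: addr_ge0].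
    by apply: ler_wpM2l => //; pos.
  + apply: (fin 3%N 432%N) => //; rewrite (_ : 432 * L ^+ 3 = 1 * (72 * L ^+ 2 * (6 * L))); last by ring.
    apply: ler_pM => //; first by apply: mulr_ge0; [pos|exact: addr_ge0].
    by apply: ler_wpM2l => //; pos.
  exact: (good1_entry i j gM).
- move=> t gt; split.
  + exact: xterm1.
  + exact: xterm2.
  + exact: xterm3.
  exact: iso_term4.
- by apply: le_trans V1; rewrite ler_nat.
- apply: le_trans (_ : 1 <= _); last by apply: le_trans V1; rewrite ler1n.
  exact: (sc_Lp sc).
- exact: ltW (sc_hs0 sc).
- move=> i j; have h := Svar_ub W i j.
  rewrite exprMn exprVn (sc_N sc) ler_pdivlMr ?ltr0n // mulrC; apply: le_trans h _; apply: le_trans (sc_C sc) _.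
  by rewrite -[leLHS]expr1; exact: LL.
- exact: mom_cst_ge0.
Qed.

End Crude.

End IsotropicLaw.

Lemma isotropic_law {R : realType} (C : R) (Cp : nat -> R) (th : R) (D : nat) : 0 < th ->
  exists D' N0 : nat, forall N, (N0 <= N)%N -> forall d (T : measurableType d) (P : probability T R)
   (H : T -> 'M[R[i]]_N), wigner C Cp P H -> forall (z m : R[i]) (n r p s : R),
   let L := N%:R `^ th in regime N C z m L n r p s ->
   forall x y : 'cV[R[i]]_N, norm2 x <= 1 -> norm2 y <= 1 ->
   whp P H D' (iso_good P H z m L n r p x y) ->
   whp P H D (fun M => cabs (gq z M x y - m * cdot x y) <= L ^+ 15 * p).
Proof.
move=> th0.
have C60 : 0 <= Num.max (Cp 6%N) 0 by rewrite le_max lexx orbT.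
have [D' [N0 hN]] := tail_params D 13 th0 C60.
exists D', N0 => N /hN[q [tau /andP[tau0 tau1] [N1 L1 hq]]] d T P H W z m n r p s L rg x y x1 y1 hg.
have sc := rg_sc rg; have z0 := rg_z0 rg.
move: hq; rewrite (max_Cp6 N1 W) => hq.
have C6 : 0 <= Cp 6%N by rewrite -(max_Cp6 N1 W).
have NR1 := rg_NR1 rg; have Nk := rg_Npow rg; have N0' : 0 < N%:R :> R by apply: lt_le_trans NR1.
have p0 := sc_p0 sc; have Lg1 := sc_L1 sc.
(* One factor [L] is the parameter [l] of the tail bound; the other fourteen belong to the size
   [B]. *)
rewrite exprS -mulrA.
apply: le_trans (_ : (mom_cst q * (L ^- (q + q.+2) + (N%:R ^+ 13) ^+ (9 * (q + q.+2) + 2) * (tau * Cp 6 + tau^-1 * N%:R ^- D')))%:E <= _)%E; last by rewrite lee_fin.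
apply: (xstat_tail (c := N%:R ^+ 2) W rg x1 y1) => //.
- exact: exprn_ege1.
- rewrite gtr0_norm ?(rg_im rg) //; apply: le_trans (rg_im1 rg) _; apply: ler_wpM2r; first exact: ltW (rg_im rg).
  by rewrite -[leLHS]expr1 Nk.
- by rewrite -exprM; exact: (rg_cst rg).
- by apply: le_trans (rg_LN rg) _; rewrite -[leLHS]expr1 Nk.
- by rewrite -[leLHS]expr1 Nk.
- apply: (@le_trans _ _ (p ^+ 2)).
    apply: le_trans (rg_p2 rg); rewrite lef_pV2 ?posrE ?exprn_gt0 //; exact: Nk.
  rewrite expr2; apply: ler_wpM2r; first exact: ltW.
  by apply: le_trans (sc_p1 sc) _; exact: exprn_ege1.
Qed.

(** * The semicircle transform outside the spectrum *)

Section SemicircleTransform.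
Context {R : realType}.
Implicit Types z m w : R[i].

Definition aRe z : R := `|ReC z|.

(** Reduces an equality to a polynomial certificate for [ring]: the difference of its sides is a
    multiple of that of a known equality. *)
Lemma eq_comb (A : comPzRingType) (k a b c d : A) : a - b = k * (c - d) -> c = d -> a = b.
Proof. by move=> + cd; rewrite cd subrr mulr0 => /subr0_eq. Qed.

Lemma sqrtc_quadrant z : 0 < ImC z -> 0 < ReC (sqrtc z) /\ 0 < ImC (sqrtc z).
Proof.
case: z => a b /= b0.
have h : `|a| < Num.sqrt (a ^+ 2 + b ^+ 2).
  rewrite -sqrtr_sqr ltr_sqrt ?ltrDl ?exprn_gt0 //.
  by rewrite ltr_wpDl ?sqr_ge0 ?exprn_gt0.
have [h1 h2] : (a < Num.sqrt (a ^+ 2 + b ^+ 2)) /\ (- a < Num.sqrt (a ^+ 2 + b ^+ 2)).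
  split; apply: le_lt_trans h; first exact: ler_norm.
  by rewrite -normrN ler_norm.
rewrite (gt_eqF b0) (gtr0_sg b0) mul1r !sqrtr_gt0; split; lra.
Qed.

Lemma msc_quad z : msc z ^+ 2 + z * msc z + 1 = 0.
Proof.
have h : (sqrtc (z - 2%:R) * sqrtc (z + 2%:R)) ^+ 2 = (z - 2%:R) * (z + 2%:R).
  by rewrite exprMn !sqr_sqrtc.
rewrite /msc; move: h; move: (sqrtc _ * sqrtc _) => s h.
have -> : ((- z + s) / 2%:R) ^+ 2 + z * ((- z + s) / 2%:R) + 1 =
   (s ^+ 2 - (z - 2%:R) * (z + 2%:R)) / 4%:R by field.
by rewrite h subrr mul0r.
Qed.

Lemma msc_neq0 z : msc z != 0.
Proof.
apply/eqP => h; have := msc_quad z; rewrite h expr0n mulr0 !add0r => /eqP.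
by rewrite oner_eq0.
Qed.

Lemma msc_inv z : z + msc z = - (msc z)^-1.
Proof.
apply: (mulIf (msc_neq0 z)); rewrite mulNr mulVf ?msc_neq0 //.
by have := msc_quad z; move: (msc z) => m h; apply: (eq_comb (k := 1)) h; ring.
Qed.

Lemma cIm_inv z : ImC z^-1 = - ImC z / cabs z ^+ 2.
Proof. by rewrite cabs_sqr; case: z => a b /=; rewrite mulNr. Qed.
Lemma cRe_inv z : ReC z^-1 = ReC z / cabs z ^+ 2.
Proof. by rewrite cabs_sqr; case: z => a b. Qed.

(** This fixes the branch. The roots of [z - 2] and [z + 2] lie in the first quadrant, so [2 m + z]
    has positive imaginary part. If [Im m <= 0], then [z + m = - 1 / m] forces [Im z + Im m <= 0], a
    contradiction. *)
Lemma msc_Im_gt0 z : 0 < ImC z -> 0 < ImC (msc z).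
Proof.
move=> hz.
have [s1 s2] : 0 < ReC (sqrtc (z - 2%:R)) /\ 0 < ImC (sqrtc (z - 2%:R)).
  by apply: sqrtc_quadrant; rewrite cImD /=; lra.
have [s3 s4] : 0 < ReC (sqrtc (z + 2%:R)) /\ 0 < ImC (sqrtc (z + 2%:R)).
  by apply: sqrtc_quadrant; rewrite cImD /=; lra.
have hs : 0 < ImC (sqrtc (z - 2%:R) * sqrtc (z + 2%:R)).
  by rewrite cImM addr_gt0 ?mulr_gt0.
set s := _ * _ in hs.
have e1 : msc z + msc z + z = s by rewrite /msc -/s; field.
have e2 : ImC (msc z) + ImC (msc z) + ImC z = ImC s by rewrite -!cImD e1.
have e3 : ImC z + ImC (msc z) = ImC (msc z) / cabs (msc z) ^+ 2.
  by rewrite -cImD msc_inv cImN cIm_inv mulNr opprK.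
have r0 : 0 < cabs (msc z) ^+ 2 by rewrite exprn_gt0 // cabs_gt0 msc_neq0.
rewrite ltNge; apply/negP => hm.
have : ImC (msc z) / cabs (msc z) ^+ 2 <= 0 by rewrite pmulr_lle0 ?invr_gt0.
lra.
Qed.

(** On bounded sets outside the spectrum this is comparable to [|sqrt (z ^ 2 - 4)|] and to the
    stability factor [|1 - m ^ 2|]. *)
Definition rho z : R := Num.sqrt (aRe z - 2 + ImC z).

Section bounds.
Variables (z : R[i]) (M : R).
Let m := msc z.
Let r := cabs m.
Let c0 := (1 + 2 * M)^-1.

Lemma rho_sqr (hE : 2 < aRe z) (hz : 0 < ImC z) : rho z ^+ 2 = aRe z - 2 + ImC z.
Proof. by rewrite sqr_sqrtr //; lra. Qed.
Lemma rho_gt0 (hE : 2 < aRe z) (hz : 0 < ImC z) : 0 < rho z.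
Proof. by rewrite sqrtr_gt0; lra. Qed.
Lemma msc_r_gt0 : 0 < r. Proof. by rewrite cabs_gt0 msc_neq0. Qed.

Lemma msc_imE : ImC z * r ^+ 2 = ImC m * (1 - r ^+ 2).
Proof.
have e3 : ImC z + ImC m = ImC m / r ^+ 2.
  by rewrite -cImD msc_inv cImN cIm_inv mulNr opprK.
have r0 := msc_r_gt0.
have : (ImC z + ImC m) * r ^+ 2 = ImC m by rewrite e3 divfK // expf_neq0 // gt_eqF.
by move=> h; apply: (eq_comb (k := 1)) h; ring.
Qed.

Lemma msc_reE : ReC z * r ^+ 2 = - (ReC m * (1 + r ^+ 2)).
Proof.
have e3 : ReC z + ReC m = - (ReC m / r ^+ 2).
  by rewrite -cReD msc_inv cReN cRe_inv.
have r0 := msc_r_gt0.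
have : (ReC z + ReC m) * r ^+ 2 = - ReC m.
  by rewrite e3 mulNr divfK // expf_neq0 // gt_eqF.
by move=> h; apply: (eq_comb (k := 1)) h; ring.
Qed.

Lemma msc_r_lt1 (hz : 0 < ImC z) : r < 1.
Proof.
have r0 := msc_r_gt0; have h := msc_imE; have hm := msc_Im_gt0 hz.
rewrite ltNge; apply/negP => h1.
have : 0 < ImC z * r ^+ 2 by rewrite mulr_gt0 // exprn_gt0.
rewrite h pmulr_rgt0 // subr_gt0 expr_lt1 ?ltW //; lra.
Qed.

Lemma msc_r_ge (hE : 2 < aRe z) (hEM : aRe z <= M) (hz : 0 < ImC z) (hzM : ImC z <= M) : c0 <= r.
Proof.
have r0 := msc_r_gt0.
have h : r * cabs (z + m) = 1 by rewrite msc_inv cabsN cabsV mulfV // gt_eqF.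
have h2 : cabs (z + m) <= 1 + 2 * M.
  apply: le_trans (cabsD _ _) _; have := msc_r_lt1 hz; have := cabs_le_reim z.
  rewrite (gtr0_norm hz) -[`|ReC z|]/(aRe z) -/r; lra.
rewrite /c0 invf_ple ?posrE //; last by lra.
apply: le_trans h2; rewrite -[leLHS]mul1r -h mulrAC mulfV ?mul1r // gt_eqF //.
Qed.

(** [q = 1 / r - r]. As [z = - m - 1 / m], the circle [|m| = r] is mapped to an ellipse with
    semi-axes [1 / r + r] and [q]; [msc_q_eq] is the equation of that ellipse, with
    [(1 / r + r) ^ 2 = q ^ 2 + 4]. *)
Let q : R := (1 - r ^+ 2) / r.

Lemma msc_q_eq (hz : 0 < ImC z) : q ^+ 4 + 4 * q ^+ 2 = (ReC z ^+ 2 + ImC z ^+ 2) * q ^+ 2 + 4 * ImC z ^+ 2.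
Proof.
have r0 := msc_r_gt0; have r1 := msc_r_lt1 hz.
have rs : 0 < 1 - r ^+ 2 by rewrite subr_gt0 expr_lt1 // ltW.
have hr : ReC m ^+ 2 + ImC m ^+ 2 = r ^+ 2 by rewrite -cabs_sqr.
have rp : 1 + r ^+ 2 != 0 by rewrite gt_eqF // addr_gt0 // exprn_gt0.
have e1 : ReC m = - (ReC z * r ^+ 2) / (1 + r ^+ 2).
  by rewrite msc_reE opprK mulfK.
have e2 : ImC m = ImC z * r ^+ 2 / (1 - r ^+ 2).
  by rewrite msc_imE mulfK // gt_eqF.
move: hr; rewrite e1 e2 => hr.
have r0' : r != 0 by rewrite gt_eqF.
have rs' : 1 - r ^+ 2 != 0 by rewrite gt_eqF.
have hr2 : ReC z ^+ 2 * r ^+ 2 * (1 - r ^+ 2) ^+ 2 + ImC z ^+ 2 * r ^+ 2 * (1 + r ^+ 2) ^+ 2 =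
   (1 - r ^+ 2) ^+ 2 * (1 + r ^+ 2) ^+ 2.
  have := congr1 (fun t => t * ((1 - r ^+ 2) ^+ 2 * (1 + r ^+ 2) ^+ 2) / r ^+ 2) hr.
  move=> h; transitivity (r ^+ 2 * ((1 - r ^+ 2) ^+ 2 * (1 + r ^+ 2) ^+ 2) / r ^+ 2); last by field.
  by rewrite -h; field; rewrite r0' rs' rp.
apply/eqP; rewrite -subr_eq0; apply/eqP.
transitivity (((1 - r ^+ 2) ^+ 2 * (1 + r ^+ 2) ^+ 2 -
  (ReC z ^+ 2 * r ^+ 2 * (1 - r ^+ 2) ^+ 2 + ImC z ^+ 2 * r ^+ 2 * (1 + r ^+ 2) ^+ 2)) / r ^+ 4).
  by rewrite /q; field.
by rewrite hr2 subrr mul0r.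
Qed.

Lemma msc_q_gt0 (hz : 0 < ImC z) : 0 < q.
Proof.
have r0 := msc_r_gt0; have r1 := msc_r_lt1 hz.
by rewrite divr_gt0 // subr_gt0 expr_lt1 // ltW.
Qed.

Lemma re_sqr_norm : ReC z ^+ 2 = aRe z ^+ 2.
Proof. by rewrite /aRe real_normK ?num_real. Qed.

(** With [k = |E| - 2] and [e = Im z], the ellipse equation is [Q * (Q - (k^2 + 4 k + e^2)) = 4 e^2]
    for [Q = q^2]. It yields [Q >= 4 k] and [Q >= 2 e]. *)
Lemma rho_le_q (hE : 2 < aRe z) (hz : 0 < ImC z) : rho z <= q.
Proof.
have q0 := msc_q_gt0 hz; have h := msc_q_eq hz.
rewrite -(@ler_pXn2r _ 2) ?nnegrE ?(ltW (rho_gt0 hE hz)) ?(ltW q0) // rho_sqr //.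
set k := aRe z - 2; set e := ImC z.
have k0 : 0 < k by rewrite /k; lra.
have e0 : 0 < e := hz.
have hk : ReC z ^+ 2 = (k + 2) ^+ 2 by rewrite re_sqr_norm /k subrK.
move: h; rewrite hk -/e => h.
have Q0 : 0 < q ^+ 2 by rewrite exprn_gt0.
have h' : (q ^+ 2) * (q ^+ 2 - (k ^+ 2 + 4 * k + e ^+ 2)) = 4 * e ^+ 2 by apply: (eq_comb (k := 1)) h; ring.
have a1 : k ^+ 2 + 4 * k + e ^+ 2 <= q ^+ 2.
  rewrite leNgt; apply/negP => hlt.
  have : (q ^+ 2) * (q ^+ 2 - (k ^+ 2 + 4 * k + e ^+ 2)) < 0 by rewrite pmulr_rlt0 //; lra.
  by rewrite h'; apply/negP; rewrite -leNgt mulr_ge0 // sqr_ge0.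
have a2 : 2 * e <= q ^+ 2.
  rewrite leNgt; apply/negP => hlt; nra.
nra.
Qed.

(** The same quadratic at [Q = k^2 + 4 k + e^2 + 2 e]: its left-hand side already reaches [4 e^2]
    there, so [Q] is no larger. *)
Lemma q_le_rho (hE : 2 < aRe z) (hEM : aRe z <= M) (hz : 0 < ImC z) (hzM : ImC z <= M) : q ^+ 2 <= (M + 4) * rho z ^+ 2.
Proof.
have q0 := msc_q_gt0 hz; have h := msc_q_eq hz.
rewrite rho_sqr //.
have hkM : aRe z - 2 <= M by lra.
move: hkM; set k := aRe z - 2; set e := ImC z => hkM.
have k0 : 0 < k by rewrite /k; lra.
have e0 : 0 < e := hz. have eM : e <= M := hzM.
have hk : ReC z ^+ 2 = (k + 2) ^+ 2 by rewrite re_sqr_norm /k subrK.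
move: h; rewrite hk -/e => h.
have Q0 : 0 < q ^+ 2 by rewrite exprn_gt0.
have h' : (q ^+ 2) * (q ^+ 2 - (k ^+ 2 + 4 * k + e ^+ 2)) = 4 * e ^+ 2 by apply: (eq_comb (k := 1)) h; ring.
apply: (@le_trans _ _ (k ^+ 2 + 4 * k + e ^+ 2 + 2 * e)); last by nra.
rewrite leNgt; apply/negP => hlt.
have : 4 * e ^+ 2 < (q ^+ 2) * (q ^+ 2 - (k ^+ 2 + 4 * k + e ^+ 2)).
  by have := mulr_gt0 k0 e0; nra.
by rewrite h' ltxx.
Qed.

End bounds.

(** All estimates are read off from [q]: [1 - r ^+ 2 = q * r], [q] is comparable to [rho], and [r]
    is at least [1 / (1 + 2 M)]. *)
Lemma msc_bounds (M : R) : 1 <= M -> exists2 K : R, 1 <= K &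
  forall z, 2 < aRe z -> aRe z <= M -> 0 < ImC z -> ImC z <= M ->
  [/\ [/\ cabs (msc z) <= 1, 1 <= K * cabs (msc z) & rho z <= K],
      [/\ rho z * ImC (msc z) <= ImC z & ImC z <= K * rho z * ImC (msc z)],
      [/\ rho z <= K * cabs (1 - msc z ^+ 2),
      cabs (z + 2 * msc z) <= K * rho z & cabs (1 - msc z ^+ 2) <= K * rho z] &
      forall w, 2 < aRe w -> aRe w <= M -> 0 < ImC w -> ImC w <= M ->
        rho z * cabs (msc z - msc w) <= K * cabs (z - w)].
Proof.
move=> M1.
pose c := 1 + 2 * M.
have c1 : 3 <= c by rewrite /c; lra.
have c0 : 0 < c by lra.
have c1' : 1 <= c by lra.
have cK : 2 * c <= c * (M + 10) * 2 by nra.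
exists (c * (M + 10) * 2); first by nra.
move=> z h1 h2 h3 h4.
have r1 := msc_r_lt1 h3; have r0 := msc_r_gt0 z.
have rge := msc_r_ge h1 h2 h3 h4.
have q0 := msc_q_gt0 h3.
have k1 := rho_le_q h1 h3; have k2 := q_le_rho h1 h2 h3 h4.
have p0 := rho_gt0 h1 h3; have ps := rho_sqr h1 h3.
have him := msc_imE z; have im0 := msc_Im_gt0 h3.
set m := msc z in r1 r0 rge q0 k1 k2 him im0 *.
set r := cabs m in r1 r0 rge q0 k1 k2 him *.
set q : R := (1 - r ^+ 2) / r in q0 k1 k2.
have r1' := ltW r1; have m0' := ltW im0; have q0' := ltW q0; have p0' := ltW p0.
have qr : q * r = 1 - r ^+ 2 by rewrite divfK // gt_eqF.
have cr : 1 <= c * r.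
  have : c * c^-1 <= c * r by rewrite ler_pM2l.
  by rewrite mulfV // gt_eqF.
have imq : ImC z * r = ImC m * q.
  have r00 : r != 0 by rewrite gt_eqF.
  by apply: (mulIf r00); rewrite -[RHS]mulrA qr -him expr2 mulrA.
have e_le : ImC z <= rho z ^+ 2 by rewrite ps lerDr subr_ge0 ltW.
have qle : q <= (M + 4) * rho z.
  rewrite -(@ler_pXn2r _ 2) ?nnegrE ?(ltW q0) ?mulr_ge0 ?(ltW p0) //; last by lra.
  by apply: le_trans k2 _; rewrite exprMn ler_pM2r ?exprn_gt0 //; nra.
have pM : rho z <= M + 1.
  rewrite -(@ler_pXn2r _ 2) ?nnegrE ?(ltW p0) // ?ps; last by lra.
  nra.
have b1 : rho z * ImC m <= ImC z.
  apply: (@le_trans _ _ (q * ImC m)); first by rewrite ler_pM2r.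
  by rewrite mulrC -imq; rewrite ger_pMr.
have b2 : 1 - r ^+ 2 <= cabs (1 - m ^+ 2).
  by have := cabs_dist 1 (m ^+ 2); rewrite cabs1 cabsX.
have b3 : rho z <= c * cabs (1 - m ^+ 2).
  apply: (@le_trans _ _ (c * (q * r))); last by rewrite qr ler_pM2l.
  by apply: le_trans k1 _; rewrite mulrCA ler_peMr.
have b4 : cabs (1 - m ^+ 2) <= (M + 6) * rho z.
  (* The radial part equals [q * r] and the rest has modulus [2 * r * Im m]; the latter is of order
     [rho] because [rho * Im m <= Im z <= rho ^+ 2]. *)
  have e : 1 - m ^+ 2 = ((1 - r ^+ 2)%:C)%C + m * (conjc m - m).
    have : m * conjc m = ((r ^+ 2)%:C)%C by rewrite mulrC conjcM_norm.
    by rewrite rmorphB rmorph1 mulrBr => ->; ring.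
  have ej : cabs (conjc m - m) = 2 * ImC m.
    have -> : conjc m - m = (0 +i* (- (2 * ImC m)))%C.
      by case: m {r r1 r0 rge q0 k1 k2 him im0 q qr cr imq qle b1 b2 b3 e r1' m0' q0'} => a b; congr (_ +i* _)%C => /=; ring.
    by rewrite /cabs /= expr0n add0r sqrtr_sqr normrN ger0_norm // mulr_ge0.
  rewrite e; apply: le_trans (cabsD _ _) _.
  rewrite cabs_real cabsM ej ger0_norm -/r; last by rewrite -qr mulr_ge0 // ltW.
  rewrite -qr.
  have t1 : q * r <= q by rewrite ger_pMr.
  have t2 : r * (2 * ImC m) <= 2 * ImC m by rewrite ler_piMl // mulr_ge0.
  have t3 : ImC m <= rho z.
    by rewrite -(ler_pM2l p0); apply: le_trans b1 _; rewrite -expr2.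
  lra.
have b5 : r * cabs (z + 2 * m) = cabs (1 - m ^+ 2).
  rewrite -cabsM; have -> : m * (z + 2 * m) = - (1 - m ^+ 2) by have := msc_quad z; rewrite -/m => h; apply: (eq_comb (k := 1)) h; ring.
  by rewrite cabsN.
split.
- split; [exact: ltW| |nra].
  by rewrite -!mulrA; nra.
- split => //.
  have : ImC z <= c * (M + 4) * rho z * ImC m.
    apply: (@le_trans _ _ (c * (r * ImC z))); first by rewrite mulrA ler_peMl // ltW.
    rewrite [r * _]mulrC imq -!mulrA ler_pM2l //.
    by rewrite [ImC m * _]mulrC [(M + 4) * _]mulrA ler_pM2r.
  have hh : 0 <= rho z * ImC m by rewrite mulr_ge0 // ltW.
  move=> h; apply: le_trans h _; rewrite -!mulrA ler_pM2l //.
  by move: hh; move: (rho z * ImC m) => x hh; nra.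
- split.
  + apply: le_trans b3 _; rewrite ler_wpM2r ?cabs_ge0 //; nra.
  + have : cabs (z + 2 * m) <= c * cabs (1 - m ^+ 2).
      have hc : 0 <= cabs (z + 2 * m) by exact: cabs_ge0.
      rewrite -b5; move: cr hc; move: (cabs (z + 2 * m)) => x cr hc; nra.
    move=> h; apply: le_trans h _.
    apply: (@le_trans _ _ (c * ((M + 6) * rho z))); first by rewrite ler_pM2l.
    rewrite mulrA ler_pM2r //; nra.
  + apply: le_trans b4 _; rewrite ler_pM2r //; nra.
move=> w w1 w2 w3 w4.
have rw1 := msc_r_lt1 w3; have rw0 := msc_r_gt0 w.
(* Subtract the quadratic equations of [m] and [msc w], each multiplied by the other solution. *)
have e : (msc w - m) * (m * msc w - 1) = (z - w) * (m * msc w).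
  have g1 : msc w * (m ^+ 2 + z * m + 1) = 0 by rewrite msc_quad mulr0.
  have g2 : m * (msc w ^+ 2 + w * msc w + 1) = 0 by rewrite msc_quad mulr0.
  by move: (etrans g1 (esym g2)) => g; apply: (eq_comb (k := -1)) g; ring.
have e2 : cabs (m - msc w) * cabs (m * msc w - 1) = cabs (z - w) * (r * cabs (msc w)).
  by move: (congr1 cabs e); rewrite (cabsM (msc w - m)) (cabsM (z - w)) (cabsM m) (cabsBC (msc w) m).
have e3 : 1 - r <= cabs (m * msc w - 1).
  rewrite cabsBC; apply: le_trans (cabs_dist _ _); rewrite cabs1 cabsM -/r.
  by rewrite lerD2l lerN2 ger_pMr // ltW.
have e4 : rho z <= 2 * c * (1 - r).
  have t : 1 - r ^+ 2 <= 2 * (1 - r) by nra.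
  apply: (@le_trans _ _ (c * (1 - r ^+ 2))); last by rewrite [2 * c]mulrC -mulrA ler_pM2l.
  by rewrite -qr; apply: le_trans k1 _; rewrite mulrCA ler_peMr.
have e5 : cabs (m - msc w) * (1 - r) <= cabs (z - w).
  apply: (@le_trans _ _ (cabs (m - msc w) * cabs (m * msc w - 1))).
    by rewrite ler_wpM2l ?cabs_ge0.
  by rewrite e2 ler_piMr ?cabs_ge0 // mulr_ile1 ?cabs_ge0 ?(ltW rw1).
apply: (@le_trans _ _ (2 * c * (cabs (m - msc w) * (1 - r)))).
  rewrite [cabs _ * (1 - r)]mulrC mulrA ler_wpM2r ?cabs_ge0 //.
apply: (@le_trans _ _ (2 * c * cabs (z - w))); first by rewrite ler_pM2l // mulr_gt0.
by rewrite ler_wpM2r ?cabs_ge0.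
Qed.

End SemicircleTransform.

(** * Lowering the spectral parameter *)

Section VerticalComparison.
Context {R : realType} (N : nat).
Notation Mat := 'M[R[i]]_N.
Notation Vec := 'cV[R[i]]_N.
Implicit Types (M : Mat) (x y u v : Vec) (z w : R[i]).

Lemma norm2D u v (a b : R) : 0 <= a -> 0 <= b -> norm2 u <= a ^+ 2 -> norm2 v <= b ^+ 2 ->
  norm2 (u + v) <= (a + b) ^+ 2.
Proof.
move=> a0 b0 ha hb.
have h : cabs (cdot u v) <= a * b by exact: cdot_le.
have e : norm2 (u + v) = norm2 u + norm2 v + 2 * ReC (cdot u v).
  have : cdot (u + v) (u + v) = cdot u u + cdot v v + (cdot u v + conjc (cdot u v)).
    by rewrite !cdotDl !cdotDr -(cdotC u v) -!addrA; congr (_ + _); ring.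
  rewrite !cdot_norm2 => /(congr1 (fun t => ReC t)); rewrite !cReD !cReRC cReJ => ->; ring.
rewrite e (_ : (a + b) ^+ 2 = a ^+ 2 + b ^+ 2 + 2 * (a * b)); last by ring.
apply: lerD; first exact: lerD.
by apply: ler_wpM2l => //; apply: le_trans h; exact: re_le_cabs.
Qed.

Lemma sqrt_norm2 u : norm2 u = Num.sqrt (norm2 u) ^+ 2.
Proof. by rewrite sqr_sqrtr // norm2_ge0. Qed.

Lemma cabs_vertical z w : ReC z = ReC w -> cabs (z - w) = `|ImC z - ImC w|.
Proof.
move=> e; have := cabs_sqr (z - w); rewrite cReD cReN cImD cImN e subrr expr0n add0r => h.
by apply/eqP; rewrite -(@eqrXn2 _ 2) ?cabs_ge0 // h real_normK // num_real.
Qed.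

Lemma im_gam z M y : hermitian M -> ImC z != 0 -> ImC z * gam z M y = ImC (gq z M y y).
Proof. by move=> hM z0; rewrite gam_norm2 ward. Qed.

Lemma resolvent_split z w M y : hermitian M -> ImC z != 0 -> ImC w != 0 ->
  resolvent M z *m y = resolvent M w *m y + (z - w) *: (resolvent M z *m (resolvent M w *m y)).
Proof.
move=> hM z0 w0; rewrite mulmxA scalemxAl -resolvent_identity // mulmxBl.
by rewrite addrC subrK.
Qed.

(** From [G(w) = G(z) + (w - z) G(w) G(z)] and [|G(w)| <= 1 / Im w], the norm [|G(w) y|] exceeds
    [|G(z) y|] by a factor of at most [Im z / Im w]. *)
Lemma gam_down z w M y : hermitian M -> ReC w = ReC z -> 0 < ImC w -> ImC w <= ImC z ->
  ImC w ^+ 2 * gam w M y <= ImC z ^+ 2 * gam z M y.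
Proof.
move=> hM e w0 wz; have z0 : 0 < ImC z by apply: lt_le_trans wz.
have wn := lt0r_neq0 w0; have zn := lt0r_neq0 z0.
rewrite !gam_norm2 [resolvent M w *m y](resolvent_split (w := z)) //.
set v := resolvent M z *m y; set a := Num.sqrt (norm2 v).
have a0 : 0 <= a by exact: sqrtr_ge0.
have E : norm2 v = a ^+ 2 by exact: sqrt_norm2.
have dz : 0 <= ImC z - ImC w by rewrite subr_ge0.
have h : norm2 ((w - z) *: (resolvent M w *m v)) <= ((ImC z - ImC w) / ImC w * a) ^+ 2.
  rewrite norm2Z cabs_vertical // distrC ger0_norm // [leRHS]exprMn -E expr_div_n -[leRHS]mulrA.
  apply: ler_wpM2l; first exact: sqr_ge0.
  by rewrite mulrC ler_pdivlMr ?exprn_gt0 // mulrC; exact: resolvent_norm.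
have := norm2D a0 _ (_ : norm2 v <= a ^+ 2) h; rewrite E lexx => /(_ _ isT) h2.
apply: le_trans (_ : _ <= ImC w ^+ 2 * (a + (ImC z - ImC w) / ImC w * a) ^+ 2) _.
  apply: ler_wpM2l; first exact: sqr_ge0.
  by apply: h2; apply: mulr_ge0 => //; apply: mulr_ge0 => //; rewrite invr_ge0 ltW.
by rewrite le_eqVlt; apply/orP; left; apply/eqP; field.
Qed.

Lemma gq_diff z w M x y (a b : R) : hermitian M -> ImC z != 0 -> ImC w != 0 -> 0 <= a -> 0 <= b ->
  gam z M x <= a ^+ 2 -> gam w M y <= b ^+ 2 ->
  cabs (gq z M x y - gq w M x y) <= cabs (z - w) * (a * b).
Proof.
move=> hM z0 w0 a0 b0; rewrite !gam_norm2 => ha hb.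
rewrite /gq -cdotBr -mulmxBl resolvent_identity // -scalemxAl cdotZr cabsM.
apply: ler_wpM2l; first exact: cabs_ge0.
rewrite -mulmxA cdot_adj; apply: cdot_le; [exact: a0|exact: b0|by rewrite ward_adj|exact: hb].
Qed.

(** The Hilbert-Schmidt norm dominates the operator norm, by Cauchy-Schwarz in each row. *)
Lemma hs_bound z M v : hermitian M -> ImC z != 0 ->
  norm2 (resolvent M z *m v) <= (\sum_k gam z M (ebasis k)) * norm2 v.
Proof.
move=> hM z0; rewrite mulr_suml; apply: ler_sum => k _.
rewrite -cdot_ebasisl cdot_adj gam_norm2 -ward_adj //; exact: cdot_CS.
Qed.

(* When the resolvent at height [Im w] has small Hilbert-Schmidt norm relative to [1 / Im w], there is
   no eigenvalue within distance [Im w] of [Re w], and the height may be lowered to any value. *)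
Lemma gam_neumann z w M y : hermitian M -> ReC z = ReC w -> 0 < ImC z -> ImC z <= ImC w ->
  4 * (ImC w ^+ 2 * \sum_k gam w M (ebasis k)) <= 1 -> gam z M y <= 4 * gam w M y.
Proof.
move=> hM e z0 zw hs; have w0 : 0 < ImC w by apply: lt_le_trans zw.
have wn := lt0r_neq0 w0; have zn := lt0r_neq0 z0.
rewrite !gam_norm2; set v := resolvent M z *m y; set u := resolvent M w *m y.
set a := Num.sqrt (norm2 u); set b := Num.sqrt (norm2 v).
have a0 : 0 <= a by exact: sqrtr_ge0.
have b0 : 0 <= b by exact: sqrtr_ge0.
have Ea : norm2 u = a ^+ 2 by exact: sqrt_norm2.
have Eb : norm2 v = b ^+ 2 by exact: sqrt_norm2.
have vE : v = u + (z - w) *: (resolvent M w *m v).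
  have := resolvent_split y hM wn zn; rewrite -/v -/u => ->.
  by rewrite -addrA -scalerDl (_ : w - z + (z - w) = 0) ?scale0r ?addr0 //; ring.
have h : norm2 ((z - w) *: (resolvent M w *m v)) <= (b / 2) ^+ 2.
  rewrite norm2Z; apply: (@le_trans _ _ (ImC w ^+ 2 * ((\sum_k gam w M (ebasis k)) * norm2 v))).
    apply: ler_pM; [exact: sqr_ge0|exact: norm2_ge0| |exact: hs_bound].
    apply: ler_wXn2r => //; rewrite cabs_vertical // distrC ger0_norm ?subr_ge0 //.
    by move: z0; lra.
  rewrite mulrA Eb exprMn mulrC; apply: ler_wpM2l; first exact: sqr_ge0.
  by rewrite exprVn; move: hs; move: (ImC w ^+ 2 * _) => t; lra.
have b20 : 0 <= b / 2 by apply: mulr_ge0 => //; rewrite invr_ge0.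
have := norm2D a0 b20 (_ : norm2 u <= a ^+ 2) h; rewrite -vE Ea lexx Eb => /(_ isT).
move=> h1; have h2 : b <= a + b / 2.
  have ab0 : 0 <= a + b / 2 by apply: addr_ge0; [exact: a0|exact: b20].
  by rewrite -(@ler_pXn2r _ 2) ?nnegrE; [exact: h1|exact: isT|exact: b0|exact: ab0].
rewrite (_ : 4 * a ^+ 2 = (2 * a) ^+ 2); last by ring.
by apply: ler_wXn2r => //; move: h2; lra.
Qed.

End VerticalComparison.

(** Sum [N S_ij <= C] over a row of total variance one. *)
Lemma wigner_C_ge1 {R : realType} (C : R) Cp N d (T : measurableType d) (P : probability T R) (H : T -> 'M[R[i]]_N) :
  (0 < N)%N -> wigner C Cp P H -> 1 <= C.
Proof.
move=> N0 W; have N0' : 0 < N%:R :> R by rewrite ltr0n.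
have e : \sum_j N%:R * Svar P H (Ordinal N0) j = N%:R by rewrite -mulr_sumr (Svar_sum W) mulr1.
rewrite -(ler_pM2l N0') mulr1 -[leLHS]e.
apply: (@le_trans _ _ (\sum_(j < N) C)); first by apply: ler_sum => j _; exact: (Svar_ub W).
by rewrite sumr_const card_ord mulr_natl.
Qed.

Definition mean_dev {R : realType} N (z m : R[i]) (M : 'M[R[i]]_N) : R[i] := \sum_l ((N%:R^-1)%:C)%C * dev z m l M.

(** * Self-improvement of the diagonal bounds *)

Section LocalStability.
Context {R : realType} (C : R) (Cp : nat -> R) (N : nat) d (T : measurableType d) (P : probability T R).
Variable H : T -> 'M[R[i]]_N.
Hypothesis W : wigner C Cp P H.
Notation S := (Svar P H).
Variables (z m : R[i]) (L n r p s K : R).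
Hypothesis rg : regime N C z m L n r p s.
Hypothesis KL : K <= L.
Hypothesis rK : r ^+ 2 <= K * cabs (1 - m ^+ 2).
Let sc := rg_sc rg.
Let L0 : 0 < L. Proof. exact: sc_L0 sc. Qed.
Let L1 : 1 <= L. Proof. exact: sc_L1 sc. Qed.
Let p0 : 0 < p. Proof. exact: sc_p0 sc. Qed.
Let r0 : 0 < r. Proof. exact: sc_r sc. Qed.
Let s0 : 0 < s. Proof. exact: rg_s0 rg. Qed.
Let LL a b : (a <= b)%N -> L ^+ a <= L ^+ b. Proof. exact: (sc_Lpow sc). Qed.
Let LX a : 0 <= L ^+ a. Proof. exact: (sc_Lpow0 sc). Qed.

Lemma sc_sr : L ^+ 20 * s <= r.
Proof.
rewrite -(@ler_pXn2r _ 2) ?nnegrE ?(ltW r0) //; last by apply: mulr_ge0 => //; exact: ltW.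
by rewrite exprMn -exprM (rg_sp rg); exact: sc_pr sc.
Qed.

(** The separation of scales in [sc_pr], expressed through the stability factor: the target error is
    far smaller than the gap in which the quadratic equation for the mean can be linearised. *)
Lemma rho_gap : L ^+ 39 * p <= cabs (1 - m ^+ 2).
Proof.
rewrite -(ler_pM2l L0) mulrA -exprS; apply: le_trans (sc_pr sc) _; apply: le_trans rK _.
exact: ler_wpM2r.
Qed.

Let e1 := L ^+ 11 * s.
Let e2 := L ^+ 15 * s ^+ 3.
Let e3 := L ^+ 13 * (r * s ^+ 3).
Let c := C^-1.
Let e4 := 2 / c * (e2 + e3).
Let C1 : 1 <= C. Proof. exact: wigner_C_ge1 (rg_N0 rg) W. Qed.
Let s3 : 0 <= s ^+ 3. Proof. by rewrite exprn_ge0 // ltW. Qed.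

Let e4_le : e4 <= L ^+ 17 * s ^+ 3.
Proof.
rewrite /e4 /c invrK.
have h : e2 + e3 <= 2 * L ^+ 15 * s ^+ 3.
  rewrite (_ : 2 * L ^+ 15 * s ^+ 3 = L ^+ 15 * s ^+ 3 + L ^+ 15 * s ^+ 3); last by ring.
  rewrite lerD2l /e3 mulrA; apply: ler_wpM2r => //.
  apply: (@le_trans _ _ (L ^+ 13 * L)); first by apply: ler_wpM2l => //; exact: sc_rL sc.
  by rewrite -exprSr; exact: LL.
apply: (@le_trans _ _ (2 * L * (2 * L ^+ 15 * s ^+ 3))).
  apply: ler_pM => //.
  - by apply: mulr_ge0 => //; move: C1; lra.
  - by apply: addr_ge0; [exact: mulr_ge0|apply: mulr_ge0 => //; apply: mulr_ge0 => //; exact: ltW].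
  - by rewrite ler_pM2l //; exact: sc_C sc.
rewrite (_ : _ * _ = 4 * L ^+ 16 * s ^+ 3); last by ring.
by apply: ler_wpM2r => //; exact: (sc_cst sc).
Qed.

Let e41_le : 2 * e4 + e1 <= 2 * (L ^+ 11 * s).
Proof.
have h : 2 * e4 <= L ^+ 18 * s ^+ 3.
  apply: (@le_trans _ _ (2 * (L ^+ 17 * s ^+ 3))); first by rewrite ler_pM2l.
  by rewrite mulrA; apply: ler_wpM2r => //; exact: (sc_cst sc).
have h2 : L ^+ 18 * s ^+ 3 <= L ^+ 11 * s.
  rewrite (_ : _ * _ = L ^+ 18 * s ^+ 2 * s); last by ring.
  rewrite (rg_sp rg); apply: ler_wpM2r; first exact: ltW.
  apply: (@le_trans _ _ 1); first exact: (sc_Lp sc).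
  exact: exprn_ege1.
by rewrite /e1; move: h h2; move: (L ^+ 11 * s) (L ^+ 18 * s ^+ 3) => u v; lra.
Qed.

(** The hypotheses ask only for a small constant and for half the gap, while the conclusions are
    smaller by powers of [N]. This slack makes propagation along a grid possible. *)
Lemma local_stability M : dgood P H z L r s M -> (forall k, cabs (dev z m k M) <= (6 * C)^-1) ->
  2 * cabs (mean_dev z m M) <= cabs (1 - m ^+ 2) ->
  [/\ cabs (mean_dev z m M) <= p, forall k, cabs (dev z m k M) <= L ^+ 13 * s &
    forall k, cabs (\sum_l ((S k l)%:C)%C * dev z m l M - mean_dev z m M) <= L ^+ 17 * s ^+ 3].
Proof.
move=> /andP[/forallP d1 /andP[/forallP d2 d3]] ut ub2.
have N0 := rg_N0 rg; have C0 : 0 < C by move: C1; lra.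
have c0 : 0 < c by rewrite /c invr_gt0.
have Slow i l : c / N%:R <= S i l.
  by rewrite ler_pdivrMr ?ltr0n // mulrC; exact: (Svar_lb W).
pose u i := dev z m i M.
have uE i : m + u i = gq z M (ebasis i) (ebasis i) by rewrite /u /dev addrC subrK.
have dE i : 1 + (z + \sum_l ((S i l)%:C)%C * (m + u l)) * (m + u i) = ddiag P H z i M.
  by rewrite /ddiag uE; under eq_bigr => l _ do rewrite uE.
have h1 i : cabs (1 + (z + \sum_l ((S i l)%:C)%C * (m + u l)) * (m + u i)) <= e1 by rewrite dE.
have h2 i : cabs (\sum_l ((S i l)%:C)%C * (1 + (z + \sum_k ((S l k)%:C)%C * (m + u k)) * (m + u l))) <= e2.
  by under eq_bigr => l _ do rewrite dE; exact: d2.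
have h3 : cabs (\sum_l ((N%:R^-1)%:C)%C * (1 + (z + \sum_k ((S l k)%:C)%C * (m + u k)) * (m + u l))) <= e3.
  by under eq_bigr => l _ do rewrite dE; exact: d3.
have tc : 6 * (6 * C)^-1 <= c.
  by rewrite invfM mulrA mulfV ?mul1r // ltr0n.
have t2 : 2 * (6 * C)^-1 <= 1.
  by rewrite ler_pdivrMr ?mul1r ?mulr_gt0 //; move: C1; lra.
have f := fluct_bound N0 (Svar_sum W) (Svar_sum' W) c0 Slow (rg_mE rg) (rg_m1 rg) h2 h3 ut tc.
have g := mean_bound N0 (Svar_sum W) (Svar_sum' W) c0 Slow (rg_mE rg) (rg_m1 rg) h1 h2 h3 ut tc t2 ub2.
have k := diag_bound N0 (Svar_sum W) (Svar_sum' W) c0 Slow (rg_mE rg) (rg_m1 rg) h1 h2 h3 ut tc t2.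
rewrite -/(mean_dev z m M) -/e4 in f g k.
have e40 : 0 <= e4 by apply: le_trans (f (Ordinal N0)).
(* The stability constant is only [r ^+ 2], so the error must reach [p * r ^+ 2]. Its two parts have
   orders [s ^+ 4 = p ^+ 2] and [r * s ^+ 3], and both suffice by [L ^+ 40 * p <= r ^+ 2]. *)
have pm : cabs (mean_dev z m M) <= p.
  have r2 : 0 < r ^+ 2 by rewrite exprn_gt0.
  rewrite -(ler_pM2l r2).
  have t : 2 * e4 * (2 * e4 + e1) + e3 <= 2 * (L ^+ 17 * s ^+ 3) * (2 * (L ^+ 11 * s)) + e3.
    by rewrite lerD2r; apply: ler_pM => //; [pos|apply: addr_ge0; [pos|exact: le_trans (h1 (Ordinal N0))]|rewrite ler_pM2l].
  apply: (@le_trans _ _ (L * (2 * (2 * (L ^+ 17 * s ^+ 3) * (2 * (L ^+ 11 * s)) + e3)))).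
    apply: (@le_trans _ _ (L * (cabs (1 - m ^+ 2) * cabs (mean_dev z m M)))).
      rewrite mulrA; apply: ler_wpM2r => //; apply: le_trans rK _; exact: ler_wpM2r.
    by rewrite ler_pM2l //; apply: le_trans g _; rewrite ler_pM2l.
  have q1 : 8 * L ^+ 29 * p ^+ 2 <= L ^+ 30 * p ^+ 2 by apply: ler_wpM2r; [exact: sqr_ge0|exact: (sc_cst sc)].
  have q2 : 2 * L ^+ 14 * (r * s ^+ 3) <= L ^+ 15 * (r * s ^+ 3).
    by apply: ler_wpM2r; [apply: mulr_ge0 => //; exact: ltW|exact: (sc_cst sc)].
  rewrite /e3 [leLHS](_ : _ = 8 * L ^+ 29 * p ^+ 2 + 2 * L ^+ 14 * (r * s ^+ 3)); last by rewrite -(rg_sp rg); ring.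
  have L2 : 2 <= L by apply: le_trans (sc_L sc); rewrite -natrX ler_nat.
  have q3 : 2 * (L ^+ 30 * p ^+ 2) <= p * r ^+ 2.
    apply: (@le_trans _ _ (p * (L ^+ 40 * p))); last by rewrite ler_pM2l //; exact: sc_pr sc.
    rewrite (_ : 2 * _ = 2 * L ^+ 30 * p ^+ 2); last by ring.
    rewrite (_ : p * _ = L ^+ 40 * p ^+ 2); last by ring.
    apply: ler_wpM2r; first exact: sqr_ge0.
    by apply: (@le_trans _ _ (L ^+ 31)); [exact: (sc_cst sc)|exact: LL].
  have q4 : 2 * (L ^+ 15 * (r * s ^+ 3)) <= p * r ^+ 2.
    rewrite (_ : 2 * _ = p * r * (2 * L ^+ 15 * s)); last by rewrite -(rg_sp rg); ring.
    rewrite (_ : p * r ^+ 2 = p * r * r); last by ring.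
    rewrite ler_pM2l ?mulr_gt0 //; apply: le_trans sc_sr; apply: ler_wpM2r; first exact: ltW.
    by apply: (@le_trans _ _ (L ^+ 16)); [exact: (sc_cst sc)|exact: LL].
  rewrite [r ^+ 2 * p]mulrC.
  by move: q1 q2 q3 q4; move: (8 * _ * _) (2 * _ * _) (L ^+ 30 * _) (L ^+ 15 * _) (p * _) => a b a' b' e; lra.
have ps : p <= s by rewrite -(rg_sp rg) expr2 ger_pMl // (rg_s1 rg).
split => // [i|i]; last exact: le_trans (f i) e4_le.
apply: le_trans (k i) _; apply: (@le_trans _ _ (2 * s + 2 * (2 * (L ^+ 11 * s)))).
  by apply: lerD; rewrite ler_pM2l //; exact: le_trans ps.
have q1 : s <= L ^+ 12 * s by rewrite ler_peMl ?exprn_ege1 // ltW.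
have q2 : L ^+ 11 * s <= L ^+ 12 * s by apply: ler_wpM2r; [exact: ltW|exact: LL].
have q3 : 6 * L ^+ 12 * s <= L ^+ 13 * s by apply: ler_wpM2r; [exact: ltW|exact: (sc_cst sc)].
rewrite -mulrA in q3.
by move: q1 q2 q3; move: (L ^+ 11 * s) (L ^+ 12 * s) (L ^+ 13 * s) => a b e; lra.
Qed.

End LocalStability.

(** * A priori bounds on a short vertical segment *)

Section Segment.
Context {R : realType} (N : nat) (B K l c3 : R).
Hypothesis B1 : 1 <= B.
Hypothesis K1 : 1 <= K.
Hypothesis l10 : 10 <= l.
Hypothesis Kl : K <= l.
Hypothesis c30 : 0 <= c3 <= 1.
Notation Mat := 'M[R[i]]_N.
Notation Vec := 'cV[R[i]]_N.

Definition msc_facts (z : R[i]) : Prop :=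
  [/\ [/\ cabs (msc z) <= 1, 1 <= K * cabs (msc z) & rho z <= K],
      [/\ rho z * ImC (msc z) <= ImC z & ImC z <= K * rho z * ImC (msc z)],
      [/\ rho z <= K * cabs (1 - msc z ^+ 2),
      cabs (z + 2 * msc z) <= K * rho z & cabs (1 - msc z ^+ 2) <= K * rho z] &
      forall w, 2 < aRe w -> aRe w <= B -> 0 < ImC w -> ImC w <= B ->
        rho z * cabs (msc z - msc w) <= K * cabs (z - w)].
Definition msc_domain (z : R[i]) : Prop := [/\ 2 < aRe z, aRe z <= B, 0 < ImC z & ImC z <= B].
Hypothesis msc_ok : forall z, msc_domain z -> msc_facts z.

(** The property carried down by the bootstrap. For [c3 = (12 * C)^-1] and basis vectors, the third
    clause and [|1 - m ^ 2| <= 2] give the bound [(6 * C)^-1] that starts [local_stability]. *)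
Definition stable (z : R[i]) (x y : Vec) (M : Mat) : bool :=
  [&& rho z * gam z M x <= 2, rho z * gam z M y <= 2 &
    cabs (gq z M x y - msc z * cdot x y) <= c3 * cabs (1 - msc z ^+ 2)].

Lemma admb_stable z x y : ImC z != 0 -> admb (stable z x y).
Proof.
move=> z0.
apply: admb_and; first by apply: admb_le; [apply: admRM; [exact: admR_cst|exact: admR_gam]|exact: admR_cst].
apply: admb_and; first by apply: admb_le; [apply: admRM; [exact: admR_cst|exact: admR_gam]|exact: admR_cst].
apply: admb_le; last exact: admR_cst.
by apply: admR_cabs; apply: admB; [exact: adm_gq|exact: adm_cst].
Qed.

Variables (z w : R[i]) (M : Mat).
Hypothesis hM : hermitian M.
Hypothesis dz : msc_domain z.
Hypothesis dw : msc_domain w.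
Hypothesis zw : ReC w = ReC z.
Hypothesis wz : ImC w <= ImC z.
Hypothesis lw : ImC z <= l * ImC w.

Let z2 : 2 < aRe z. Proof. by case: dz. Qed.
Let z0 : 0 < ImC z. Proof. by case: dz. Qed.
Let w0 : 0 < ImC w. Proof. by case: dw. Qed.
Let zn := lt0r_neq0 z0.
Let wn := lt0r_neq0 w0.
Let aw : aRe w = aRe z. Proof. by rewrite /aRe zw. Qed.
Let rz : 0 < rho z. Proof. exact: rho_gt0. Qed.
Let w2 : 2 < aRe w. Proof. by rewrite aw. Qed.
Let rw : 0 < rho w. Proof. exact: rho_gt0. Qed.
Let l0 : 0 < l. Proof. by move: l10; lra. Qed.
Let l1 : 1 <= l. Proof. by move: l10; lra. Qed.
Let sz : rho z ^+ 2 = aRe z - 2 + ImC z. Proof. exact: rho_sqr. Qed.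
Let sw : rho w ^+ 2 = aRe z - 2 + ImC w. Proof. by rewrite rho_sqr // aw. Qed.

Lemma rho_mono : rho w <= rho z.
Proof. by rewrite -(@ler_pXn2r _ 2) ?nnegrE ?(ltW rz) ?(ltW rw) // sz sw; move: wz; lra. Qed.

Lemma rho_scale : rho z <= l * rho w.
Proof.
rewrite -(@ler_pXn2r _ 2) ?nnegrE ?(ltW rz) ?mulr_ge0 ?(ltW rw) ?(ltW l0) // exprMn sz sw.
apply: (@le_trans _ _ (l * (aRe z - 2 + ImC w))).
  rewrite mulrDr; apply: lerD => //; rewrite ler_peMl //; move: z2; lra.
apply: ler_wpM2r; first by move: z2 w0; lra.
by rewrite expr2 ler_peMl // ltW.
Qed.

Let gam_l x : gam w M x <= l ^+ 2 * gam z M x.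
Proof.
have h := gam_down x hM zw w0 wz; have i2 : 0 < ImC w ^+ 2 by rewrite exprn_gt0.
rewrite -(ler_pM2l i2); apply: (le_trans h); rewrite mulrA; apply: ler_wpM2r.
  by rewrite gam_norm2; exact: norm2_ge0.
by rewrite -exprMn mulrC; apply: ler_wXn2r => //; exact: ltW.
Qed.

Lemma segment_gam x : rho z * gam z M x <= 2 -> rho w * gam w M x <= l ^+ 3.
Proof.
move=> h; have g0 v u : 0 <= gam v M u by rewrite gam_norm2; exact: norm2_ge0.
apply: (@le_trans _ _ (rho z * (l ^+ 2 * gam z M x))).
  by apply: ler_pM => //; [exact: ltW|exact: rho_mono].
rewrite mulrCA; apply: (@le_trans _ _ (l ^+ 2 * 2)); first by rewrite ler_pM2l ?exprn_gt0.
by rewrite [l ^+ 3]exprSr ler_pM2l ?exprn_gt0 //; move: l10; lra.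
Qed.

(** The resolvent applied to [x] or [y] has norm of order [rho ^ (-1/2)] at both ends, and
    [|z - w| <= rho ^+ 2]; hence the resolvent element moves by order [rho], and so does [msc]. *)
Lemma segment_stat x y : norm2 x <= 1 -> norm2 y <= 1 -> stable z x y M ->
  cabs (gq w M x y - msc w * cdot x y) <= l ^+ 3 * rho w.
Proof.
move=> x1 y1 /and3P[gx gy hX].
have [[m1 _ rK] _ [_ _ rm] ml] := msc_ok dz.
have c1 : cabs (cdot x y) <= 1.
  by rewrite -[leRHS]mul1r; apply: cdot_le => //; rewrite expr1n.
set q := Num.sqrt (rho z); have q0 : 0 < q by rewrite sqrtr_gt0.
have q2 : q ^+ 2 = rho z by rewrite sqr_sqrtr // ltW.
have ga u : rho z * gam z M u <= 2 -> gam z M u <= (2 / q) ^+ 2.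
  move=> h; rewrite expr_div_n q2 ler_pdivlMr // mulrC; apply: le_trans h _.
  by rewrite -natrX ler_nat.
have gb u : rho z * gam z M u <= 2 -> gam w M u <= (2 * l / q) ^+ 2.
  move=> h; apply: le_trans (gam_l u) _; rewrite (_ : (2 * l / q) ^+ 2 = l ^+ 2 * (2 / q) ^+ 2); last by ring.
  by rewrite ler_pM2l ?exprn_gt0 //; exact: ga.
have qi : 0 <= 2 / q by apply: mulr_ge0 => //; rewrite invr_ge0 ltW.
have qj : 0 <= 2 * l / q by apply: mulr_ge0; [apply: mulr_ge0 => //; exact: ltW|rewrite invr_ge0 ltW].
have D := gq_diff hM wn zn qj qi (gb x gx) (ga y gy).
have vz : cabs (w - z) <= rho z ^+ 2.
  rewrite cabs_vertical // sz distrC ger0_norm ?subr_ge0 //; by move: z2 w0; lra.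
have D1 : cabs (gq w M x y - gq z M x y) <= 4 * l * rho z.
  apply: (le_trans D); apply: (@le_trans _ _ (rho z ^+ 2 * (2 * l / q * (2 / q)))).
    by apply: ler_wpM2r => //; exact: mulr_ge0.
  by rewrite -q2 le_eqVlt; apply/orP; left; apply/eqP; field; exact: lt0r_neq0.
have D2 : cabs (msc z - msc w) <= K * rho z.
  have [_ u1 _ u2] := dw; have h := ml w w2 u1 w0 u2.
  rewrite -(ler_pM2l rz); apply: (le_trans h); rewrite cabsBC mulrCA -expr2.
  by rewrite ler_pM2l //; move: K1; lra.
have D3 : c3 * cabs (1 - msc z ^+ 2) <= K * rho z.
  by apply: le_trans rm; case/andP: c30 => _ h; apply: ler_piMl.
rewrite (_ : _ - _ = (gq w M x y - gq z M x y) + (gq z M x y - msc z * cdot x y) + (msc z - msc w) * cdot x y); last by ring.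
apply: le_trans (cabsD _ _) _; apply: (@le_trans _ _ (4 * l * rho z + K * rho z + K * rho z)).
  apply: lerD; first by apply: le_trans (cabsD _ _) _; apply: lerD => //; exact: le_trans D3.
  by rewrite cabsM -[leRHS]mulr1; apply: ler_pM.
rewrite -!mulrDl; apply: (@le_trans _ _ (l ^+ 2 * rho z)).
  by rewrite ler_pM2r // expr2; move: l10 Kl => a b; nra.
by rewrite [l ^+ 3]exprSr -[leRHS]mulrA ler_pM2l ?exprn_gt0 //; exact: rho_scale.
Qed.

Lemma segment_gq x y : norm2 x <= 1 -> norm2 y <= 1 -> stable z x y M -> cabs (gq w M x y) <= l ^+ 5.
Proof.
move=> x1 y1 st; have h := segment_stat x1 y1 st.
have [[m1 _ rK] _ _ _] := msc_ok dw.
have c1 : cabs (cdot x y) <= 1.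
  by rewrite -[leRHS]mul1r; apply: cdot_le => //; rewrite expr1n.
rewrite -[gq w M x y](subrK (msc w * cdot x y)); apply: le_trans (cabsD _ _) _.
apply: (@le_trans _ _ (l ^+ 3 * l + 1 * 1)).
  apply: lerD; first by apply: (le_trans h); rewrite ler_pM2l ?exprn_gt0 //; exact: le_trans Kl.
  by rewrite cabsM; apply: ler_pM.
rewrite -exprSr mulr1 [leRHS]exprS; have h4 : 1 <= l ^+ 4 by exact: exprn_ege1.
by move: (l ^+ 4) l10 h4 => u a b; nra.
Qed.

End Segment.

Section Scales.
Context {R : realType} (N : nat).
Definition rr (z : R[i]) : R := Num.sqrt (rho z).
Definition pp (z : R[i]) : R := (Num.sqrt (N%:R : R) * rr z)^-1.
Definition ss (z : R[i]) : R := Num.sqrt (pp z).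
End Scales.

(** The condition [160 * th <= 3 * om] is the fourth power of [L ^+ 40 * p <= r ^+ 2]: it amounts to
    [L ^+ 160 <= N ^+ 2 * rho ^+ 6], and [rho ^+ 2 >= N ^ (- 2/3 + om)]. *)
Lemma regime_eventually {R : realType} (om C B K th : R) : 0 < th -> th <= 1 -> 160 * th <= 3 * om -> 1 <= B ->
  exists N0 : nat, forall N, (N0 <= N)%N -> forall z : R[i],
  2 + N%:R `^ (- (2 / 3) + om) <= aRe z -> aRe z <= B -> 1 <= N%:R * ImC z -> ImC z <= B -> msc_facts B K z ->
  regime N C z (msc z) (N%:R `^ th) (Num.sqrt N%:R) (rr z) (pp N z) (ss N z).
Proof.
move=> th0 th1 tho B1.
have [N0 hN] := powR_archi (Num.max (10 ^+ 3) (Num.max C (Num.max K (2 * B + 1)))) th0.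
exists N0 => N NN z zE zB zN zI [[m1 _ rK] _ [_ rz _] _].
have [N1] := hN N NN; rewrite !ge_max => /andP[_ /andP[_ /andP[_ NB]]].
move=> /andP[L3 /andP[LC /andP[LK LB]]].
have N0' : 0 < N%:R :> R by rewrite ltr0n.
have NR1 : 1 <= N%:R :> R by rewrite ler1n.
set L := N%:R `^ th in L3 LC LK LB *.
have L1 : 1 <= L by apply: le_trans L3; rewrite exprn_ege1 // ler1n.
set ka := N%:R `^ (- (2 / 3) + om) in zE *.
have ka0 : 0 < ka by rewrite powR_gt0.
have z2 : 2 < aRe z by move: zE ka0; lra.
have z0 : 0 < ImC z by rewrite -(pmulr_rgt0 _ N0'); apply: lt_le_trans zN.
have r0 : 0 < rho z by exact: rho_gt0.
have rr0 : 0 < rr z by rewrite sqrtr_gt0.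
have r2 : rr z ^+ 2 = rho z by rewrite sqr_sqrtr // ltW.
set n := Num.sqrt N%:R.
have n0 : 0 < n by rewrite sqrtr_gt0.
have n2 : n ^+ 2 = N%:R by rewrite sqr_sqrtr // ltW.
have p0 : 0 < pp N z by rewrite invr_gt0 mulr_gt0.
have cz : cabs z <= 2 * B.
  apply: le_trans (cabs_le_reim z) _; rewrite (_ : 2 * B = B + B); last by ring.
  by apply: lerD => //; rewrite ger0_norm // ltW.
have LN : L <= N%:R by rewrite -[leRHS]powRr1 //; apply: ler_powR.
split=> //.
- by move: cz NB; lra.
- split=> //.
  + have h : rr z ^+ 2 <= L ^+ 2.
      by rewrite r2 (le_trans rK) // (le_trans LK) // expr2 ler_peMl // (le_trans _ L1).
    by move: h; rewrite ler_pXn2r ?nnegrE ?(ltW rr0) // (le_trans _ L1).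
  + by rewrite /pp -/n mulrCA mulVf // lt0r_neq0 // mulr_gt0.
  + rewrite /pp ler_pdivrMr ?mulr_gt0 // -/n.
    have nr0 : 0 <= rr z ^+ 2 * (n * rr z) by rewrite ltW // !mulr_gt0 // exprn_gt0.
    rewrite -(@ler_pXn2r _ 4) ?nnegrE //; last by rewrite exprn_ge0 // (le_trans _ L1).
    rewrite [leRHS](_ : _ = (n ^+ 2) ^+ 2 * ((rr z ^+ 2) ^+ 2) ^+ 3); last by ring.
    rewrite n2 r2 (rho_sqr z2 z0); apply: (@le_trans _ _ (N%:R ^+ 2 * ka ^+ 3)).
      rewrite -exprM -!powR_mulrn ?(ltW ka0) ?(ltW N0') ?powR_ge0 // -!powRrM -powRD; last by rewrite lt0r_neq0 ?implybT.
      apply: ler_powR => //; rewrite natrM; move: tho; lra.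
    apply: ler_wpM2l; first exact: exprn_ge0 (ltW N0').
    by apply: ler_wXn2r; [exact: ltW|move: zE z0; lra].
- exact: sqrtr_ge0.
- by rewrite sqr_sqrtr // ltW.
- by have h := msc_quad z; apply: (eq_comb (k := 1)) h; ring.
- apply: le_trans (cabsD _ _) _; move: cz m1 LB; lra.
- by rewrite r2; apply: le_trans rz _; rewrite ler_pM2r.
Qed.

(** * Continuity between neighbouring grid points *)

Section OneStep.
Context {R : realType} (C : R) (N : nat) (B K L : R).
Notation Mat := 'M[R[i]]_N.
Hypothesis C1 : 1 <= C.
Hypothesis K1 : 1 <= K.
Hypothesis KL : K <= L.
Hypothesis msc_ok : forall z : R[i], msc_domain B z -> msc_facts B K z.
Notation Rg := (fun w => regime N C w (msc w) L (Num.sqrt N%:R) (rr w) (pp N w) (ss N w)).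

Variables (w w' : R[i]) (M : Mat).
Hypothesis hM : hermitian M.
Hypothesis dw : msc_domain B w.
Hypothesis dw' : msc_domain B w'.
Hypothesis rw : Rg w.
Hypothesis rw' : Rg w'.
Hypothesis ww' : ReC w' = ReC w.
Hypothesis wI : ImC w' <= ImC w.
Hypothesis wd : N%:R ^+ 3 * cabs (w - w') <= 1.

Let sc' := rg_sc rw'.
Let NR1 := rg_NR1 rw.
Let w0 := rg_im rw.
Let w0' := rg_im rw'.
Let N0' : 0 < N%:R :> R. Proof. by apply: lt_le_trans NR1. Qed.

Lemma pp_mono : pp N w <= pp N w'.
Proof.
have n0 := sc_n sc'; have r0' := sc_r sc'; have r0 := sc_r (rg_sc rw).
rewrite /pp lef_pV2 ?posrE ?mulr_gt0 // ler_pM2l //; apply: ler_wsqrtr.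
by apply: (rho_mono dw dw').
Qed.

Lemma Ninv_pp : 2 * N%:R^-1 <= pp N w'.
Proof.
have p0 := sc_p0 sc'; have r0 := ltW (sc_r sc'); have L0 := ltW (sc_L0 sc').
rewrite (sc_Ninv sc') (_ : 2 * _ = (2 * pp N w' * rr w' ^+ 2) * pp N w'); last by ring.
rewrite ger_pMl //; apply: (@le_trans _ _ (2 * pp N w' * L ^+ 2)).
  by rewrite ler_pM2l ?mulr_gt0 //; apply: ler_wXn2r => //; exact: sc_rL sc'.
rewrite (_ : _ * _ = 2 * L ^+ 2 * pp N w'); last by ring.
apply: le_trans (sc_Lp sc' (a := 3) isT); apply: ler_wpM2r; [exact: ltW|exact: (sc_cst sc')].
Qed.

(** Since [Im] and [rho] are at least [1 / N], both [G] and [msc] are Lipschitz with constant at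
    most [N ^+ 2]; a step of length [N ^- 3] moves a deviation by at most [2 / N], below [p]. *)
Lemma dev_step k : cabs (dev w (msc w) k M - dev w' (msc w') k M) <= pp N w'.
Proof.
apply: le_trans Ninv_pp.
have gN v : 1 <= N%:R * ImC v -> 0 < ImC v -> gam v M (ebasis k) <= N%:R ^+ 2.
  move=> v1 v0; rewrite gam_norm2; have := resolvent_norm (ebasis k) hM (lt0r_neq0 v0).
  rewrite norm2_ebasis => h; have v2 : 0 < ImC v ^+ 2 by rewrite exprn_gt0.
  rewrite -(ler_pM2l v2); apply: le_trans h _; rewrite -exprMn exprn_ege1 // mulrC; exact: v1.
have D := gq_diff (y := ebasis k) hM (lt0r_neq0 w0) (lt0r_neq0 w0') (ltW N0') (ltW N0') (gN w (rg_im1 rw) w0) (gN w' (rg_im1 rw') w0').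
have [[_ _ _] _ _ ml] := msc_ok dw; have [u1 u2 u3 u4] := dw'.
have D2 := ml w' u1 u2 u3 u4.
have rN : N%:R^-1 <= rho w.
  have rr2 : rr w ^+ 2 = rho w by rewrite sqr_sqrtr //; exact: sqrtr_ge0.
  rewrite -rr2 (sc_Ninv (rg_sc rw)); apply: ler_piMl; first exact: sqr_ge0.
  by apply: exprn_ile1; [exact: ltW (sc_p0 (rg_sc rw))|exact: sc_p1 (rg_sc rw)].
have D3 : cabs (msc w - msc w') <= N%:R * K * cabs (w - w').
  rewrite -mulrA -ler_pdivrMl //; apply: le_trans D2; exact: ler_wpM2r.
rewrite /dev (_ : _ - _ = (gq w M (ebasis k) (ebasis k) - gq w' M (ebasis k) (ebasis k)) - (msc w - msc w')); last by ring.
apply: le_trans (cabsB _ _) _.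
apply: (@le_trans _ _ (cabs (w - w') * N%:R ^+ 2 + cabs (w - w') * N%:R ^+ 2)).
  apply: lerD; first exact: D.
  apply: (le_trans D3); rewrite [leRHS]mulrC; apply: ler_wpM2r => //.
  rewrite expr2 ler_pM2l //; apply: le_trans KL _; exact: rg_LN rw.
rewrite [leLHS](_ : _ = 2 * (cabs (w - w') * N%:R ^+ 2)); last by ring.
rewrite ler_pM2l // -(ler_pM2l N0') mulfV ?lt0r_neq0 //.
by move: wd; rewrite mulrCA [cabs _ * _]mulrC -exprS.
Qed.

Lemma mean_dev_step : cabs (mean_dev w (msc w) M - mean_dev w' (msc w') M) <= pp N w'.
Proof.
rewrite /mean_dev -sumrB; apply: le_trans (cabs_sum _ _ _) _.
apply: (@le_trans _ _ (\sum_(k < N) N%:R^-1 * pp N w')).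
  apply: ler_sum => k _; rewrite -mulrBr cabsM cabs_real ger0_norm ?invr_ge0 ?(ltW N0') //.
  by apply: ler_wpM2l; [rewrite invr_ge0 ltW|exact: dev_step].
by rewrite sumr_const card_ord -[_ *+ N]mulr_natl mulrA mulfV ?mul1r // lt0r_neq0.
Qed.

Lemma one_step : cabs (mean_dev w (msc w) M) <= pp N w -> (forall k, cabs (dev w (msc w) k M) <= L ^+ 13 * ss N w) ->
  (forall k, cabs (dev w' (msc w') k M) <= (6 * C)^-1) /\ 2 * cabs (mean_dev w' (msc w') M) <= cabs (1 - msc w' ^+ 2).
Proof.
move=> hu hd; have L0 := sc_L0 sc'; have p0 := sc_p0 sc'; have s0 := rg_s rw; split=> [k|].
  have C0 : 0 < C by move: C1; lra.
  rewrite -[dev w' _ k M](subKr (dev w (msc w) k M)); apply: le_trans (cabsB _ _) _.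
  apply: (@le_trans _ _ (L ^+ 13 * ss N w + pp N w')); first by apply: lerD => //; exact: dev_step.
  rewrite -[leRHS]mul1r ler_pdivlMr ?mulr_gt0 //.
  apply: (@le_trans _ _ ((L ^+ 13 * ss N w + pp N w') * (6 * L))).
    apply: ler_wpM2l; first by apply: addr_ge0; [apply: mulr_ge0 => //; exact: (sc_Lpow0 sc')|exact: ltW].
    by rewrite ler_pM2l //; exact: sc_C sc'.
  rewrite [leLHS](_ : _ = 6 * L ^+ 14 * ss N w + 6 * L ^+ 1 * pp N w'); last by ring.
  have h1 : 6 * L ^+ 14 * ss N w <= L ^+ 15 * ss N w by apply: ler_wpM2r => //; exact: (sc_cst sc').
  have h2 : 6 * L ^+ 1 * pp N w' <= L ^+ 2 * pp N w' by apply: ler_wpM2r; [exact: ltW|exact: (sc_cst sc')].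
  have h3 : 2 * L ^+ 15 * ss N w <= L ^+ 16 * ss N w by apply: ler_wpM2r => //; exact: (sc_cst sc').
  have h4 : 2 * L ^+ 2 * pp N w' <= L ^+ 3 * pp N w' by apply: ler_wpM2r; [exact: ltW|exact: (sc_cst sc')].
  have h5 := rg_Lsk rw (isT : (16 <= 19)%N); have h6 := sc_Lp sc' (isT : (3 <= 38)%N).
  move: h1 h2 h3 h4 h5 h6; rewrite -![2 * _ * _]mulrA.
  by move: (_ * ss N w) (6 * _ * pp N w') (L ^+ 15 * _) (L ^+ 16 * _) (L ^+ 2 * _) (L ^+ 3 * _) => a b e f g h; lra.
have [_ _ [rK _ _] _] := msc_ok dw'.
have rr2 : rr w' ^+ 2 = rho w' by rewrite sqr_sqrtr //; exact: sqrtr_ge0.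
have g := rho_gap rw' KL (_ : rr w' ^+ 2 <= K * cabs (1 - msc w' ^+ 2)); rewrite rr2 in g.
apply: le_trans (g rK).
rewrite -[mean_dev w' _ M](subKr (mean_dev w (msc w) M)).
apply: (@le_trans _ _ (2 * (pp N w' + pp N w'))).
  rewrite ler_pM2l //; apply: le_trans (cabsB _ _) _; apply: lerD; last exact: mean_dev_step.
  exact: le_trans pp_mono.
rewrite (_ : 2 * _ = 4 * L ^+ 0 * pp N w'); last by rewrite expr0; ring.
apply: ler_wpM2r; first exact: ltW.
by apply: (@le_trans _ _ (L ^+ 1)); [exact: (sc_cst sc')|exact: (sc_Lpow sc')].
Qed.

End OneStep.

Lemma whp_le {R : realType} (C : R) (Cp : nat -> R) N d (T : measurableType d) (P : probability T R)
  (H : T -> 'M[R[i]]_N) (D D' : nat) (b : 'M[R[i]]_N -> bool) : wigner C Cp P H -> (0 < N)%N -> (D' <= D)%N ->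
  admb b -> whp P H D b -> whp P H D' b.
Proof. by move=> W N0 DD ab; apply: (whp_imp W N0 DD ab ab) => t ->. Qed.

(** * Propagation along a segment *)

Section SegmentEvents.
Context {R : realType} (C : R) (Cp : nat -> R) (N : nat) d (T : measurableType d) (P : probability T R).
Variable H : T -> 'M[R[i]]_N.
Hypothesis W : wigner C Cp P H.
Notation Mat := 'M[R[i]]_N.
Notation Vec := 'cV[R[i]]_N.
Notation S := (Svar P H).
Notation Tv := (Tvar P H).
Notation n := (Num.sqrt (N%:R : R)).
Variables (B K l L : R).
Hypothesis K1 : 1 <= K.
Hypothesis l10 : 10 <= l.
Hypothesis Kl : K <= l.
Hypothesis lL : L = l ^+ 5.
Hypothesis C1 : 1 <= C.
Let c3 : R := (12 * C)^-1.
Hypothesis msc_ok : forall z : R[i], msc_domain B z -> msc_facts B K z.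
Notation Rg := (fun w => regime N C w (msc w) L (Num.sqrt N%:R) (rr w) (pp N w) (ss N w)).

Let l0 : 0 < l. Proof. by move: l10; lra. Qed.
Let l1 : 1 <= l. Proof. by move: l10; lra. Qed.
Let c30 : 0 <= c3 <= 1.
Proof.
have C0 : 0 < 12 * C by move: C1; lra.
by rewrite /c3 invr_ge0 (ltW C0) /= invf_le1 //; move: C1; lra.
Qed.
Let lpow a b : (a <= b)%N -> l ^+ a <= l ^+ b. Proof. by move=> ab; exact: ler_weXn2l. Qed.
Let K_L : K <= L.
Proof. by apply: le_trans Kl _; rewrite lL -[leLHS]expr1; exact: lpow. Qed.

Definition seg_good (z : R[i]) (M : Mat) : bool :=
  good_entries L n M && [forall k, [forall j, stable c3 z (ebasis k) (ebasis j) M]].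

Lemma admb_seg_good z : ImC z != 0 -> admb (seg_good z).
Proof.
move=> z0; apply: admb_and; first exact: admb_good_entries.
by apply: admb_forall => k; apply: admb_forall => j; exact: admb_stable.
Qed.

Definition onseg (z w : R[i]) : Prop :=
  [/\ msc_domain B w, ReC w = ReC z, ImC w <= ImC z, ImC z <= l * ImC w & Rg w].

Variable z : R[i].
Hypothesis dz : msc_domain B z.

Let e1 k : norm2 (ebasis k : Vec) <= 1. Proof. by rewrite norm2_ebasis. Qed.
Let rr2 w : rr w ^+ 2 = rho w :> R. Proof. by rewrite sqr_sqrtr // sqrtr_ge0. Qed.

Lemma seg_good2 w M : hermitian M -> onseg z w -> seg_good z M -> good2 w (msc w) L n (rr w) M.
Proof.
move=> hM [dw zw wz lw rg] /andP[ge /forallP st].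
have st' k j : stable c3 z (ebasis k) (ebasis j) M by have /forallP := st k.
have r0 : 0 <= rho w by rewrite -rr2 sqr_ge0.
apply/andP; split; [apply/andP; split => //|apply/andP; split]; apply/forallP => k.
- apply/forallP => j; rewrite lL; exact: (segment_gq K1 l10 Kl c30 msc_ok hM dz dw zw wz lw).
- rewrite rr2 lL; have /and3P[g _ _] := st' k k.
  apply: le_trans (segment_gam l10 hM dz dw zw wz lw g) _; exact: lpow.
- have := segment_stat K1 l10 Kl c30 msc_ok hM dz dw zw wz lw (e1 k) (e1 k) (st' k k).
  rewrite cdot_norm2 norm2_ebasis mulr1 rr2 => h; apply: le_trans h _.
  by apply: ler_wpM2r => //; rewrite lL; exact: lpow.
Qed.

Let rK w : msc_domain B w -> rr w ^+ 2 <= K * cabs (1 - msc w ^+ 2).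
Proof. by move=> dw; rewrite rr2; have [_ _ []] := msc_ok dw. Qed.

(** Induction along the grid: [one_step] turns the strong bounds at one point into the weak
    hypotheses at the next, and [local_stability] restores the strong bounds. At the top the weak
    hypotheses come from [seg_good]. *)
Lemma grid_stability (w : nat -> R[i]) (J : nat) M : hermitian M -> w 0%N = z ->
  (forall j, (j <= J)%N -> onseg z (w j) /\ dgood P H (w j) L (rr (w j)) (ss N (w j)) M) ->
  (forall j, (j < J)%N -> ImC (w j.+1) <= ImC (w j) /\ N%:R ^+ 3 * cabs (w j - w j.+1) <= 1) ->
  seg_good z M ->
  [/\ cabs (mean_dev (w J) (msc (w J)) M) <= pp N (w J),
    forall k, cabs (dev (w J) (msc (w J)) k M) <= L ^+ 13 * ss N (w J) &
    forall k, cabs (\sum_j ((S k j)%:C)%C * dev (w J) (msc (w J)) j M - mean_dev (w J) (msc (w J)) M) <= L ^+ 17 * ss N (w J) ^+ 3].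
Proof.
move=> hM wz hw hd /andP[_ /forallP st].
have {hw} : forall j, (j <= J)%N -> [/\ cabs (mean_dev (w j) (msc (w j)) M) <= pp N (w j),
    forall k, cabs (dev (w j) (msc (w j)) k M) <= L ^+ 13 * ss N (w j) &
    forall k, cabs (\sum_i ((S k i)%:C)%C * dev (w j) (msc (w j)) i M - mean_dev (w j) (msc (w j)) M) <= L ^+ 17 * ss N (w j) ^+ 3]; last exact.
elim=> [|j IH] jJ.
  have [[d0 _ _ _ rg] dg] := hw _ jJ.
  have u k : cabs (dev (w 0%N) (msc (w 0%N)) k M) <= c3 * cabs (1 - msc (w 0%N) ^+ 2).
    have /forallP /(_ k) /and3P[_ _] := st k.
    by rewrite cdot_norm2 norm2_ebasis mulr1 wz.
  have m2 : cabs (1 - msc (w 0%N) ^+ 2) <= 2.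
    apply: le_trans (cabsB _ _) _; rewrite cabs1 cabsX.
    have [[m1 _ _] _ _ _] := msc_ok d0.
    by rewrite (_ : 2 = 1 + 1) // lerD2l; apply: exprn_ile1.
  have C0 : 0 < C by move: C1; lra.
  have N0 : 0 < N%:R :> R by rewrite ltr0n; exact: rg_N0 rg.
  apply: (local_stability W rg K_L (rK d0) dg) => [k|].
    apply: le_trans (u k) _; apply: (@le_trans _ _ (c3 * 2)).
      by apply: ler_wpM2l => //; case/andP: c30.
    by rewrite /c3 le_eqVlt; apply/orP; left; apply/eqP; field; exact: lt0r_neq0.
  have mm : cabs (mean_dev (w 0%N) (msc (w 0%N)) M) <= c3 * cabs (1 - msc (w 0%N) ^+ 2).
    apply: le_trans (cabs_sum _ _ _) _.
    apply: (@le_trans _ _ (\sum_(k < N) N%:R^-1 * (c3 * cabs (1 - msc (w 0%N) ^+ 2)))).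
      apply: ler_sum => k _; rewrite cabsM cabs_real ger0_norm ?invr_ge0 ?(ltW N0) //.
      by apply: ler_wpM2l => //; rewrite invr_ge0 ltW.
    by rewrite sumr_const card_ord -[_ *+ N]mulr_natl mulrA mulfV ?mul1r // lt0r_neq0.
  apply: (@le_trans _ _ (2 * (c3 * cabs (1 - msc (w 0%N) ^+ 2)))); first by rewrite ler_pM2l.
  rewrite mulrA; apply: ler_piMl => //; rewrite /c3 ler_pdivrMr ?mul1r ?mulr_gt0 //; move: C1; lra.
have [i1 i2 _] := IH (ltnW jJ).
have [[dj zj _ _ rgj] _] := hw _ (ltnW jJ); have [[dj' zj' _ _ rgj'] dg] := hw _ jJ.
have [hI hD] := hd _ jJ.
have [o1 o2] := one_step C1 K_L msc_ok hM dj dj' rgj rgj' (etrans zj' (esym zj)) hI hD i1 i2.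
exact: (local_stability W rgj' K_L (rK dj') dg o1 o2).
Qed.

(** The weighted vectors have norm at most [C / N]; rescaled to the unit ball they fall under the
    hypothesis on pairs of vectors. *)
Definition resc (v : Vec) : Vec := ((N%:R / C)%:C)%C *: v.

Definition iso_stable (x y : Vec) (M : Mat) : bool :=
  seg_good z M && (stable c3 z x y M &&
    [forall k, [&& stable c3 z x (ebasis k) M, stable c3 z (ebasis k) y M,
      stable c3 z (resc (xs P H x k)) y M, stable c3 z (resc (xt P H x k)) y M, stable c3 z x (resc (xso P H x k)) M,
      stable c3 z x (resc (xto P H x k)) M & stable c3 z (ebasis k) (resc (xto P H x k)) M]]).

Lemma norm2_resc (x v : Vec) : (0 < N)%N -> norm2 x <= 1 -> (forall i, cabs (v i 0) <= cabs (x i 0) * (C / N%:R)) -> norm2 (resc v) <= 1.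
Proof.
move=> N0 x1 h; have N0' : 0 < N%:R :> R by rewrite ltr0n.
have C0 : 0 < C by move: C1; lra.
rewrite norm2Z cabs_real ger0_norm ?divr_ge0 ?(ltW C0) ?(ltW N0') //.
apply: le_trans x1; rewrite /norm2 mulr_sumr; apply: ler_sum => i _.
rewrite -exprMn; apply: ler_wXn2r; first by apply: mulr_ge0 => //; rewrite divr_ge0 ?ltW.
rewrite -[leRHS](_ : N%:R / C * (cabs (x i 0) * (C / N%:R)) = _); last by field; rewrite !lt0r_neq0.
by apply: ler_wpM2l => //; rewrite divr_ge0 ?ltW.
Qed.

Variables (x y : Vec).
Hypothesis x1 : norm2 x <= 1.
Hypothesis y1 : norm2 y <= 1.
Hypothesis N0 : (0 < N)%N.
Let N0' : 0 < N%:R :> R. Proof. by rewrite ltr0n. Qed.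
Let SC i j : S i j <= C / N%:R.
Proof. by rewrite ler_pdivlMr // mulrC; exact: Svar_ub W _ _. Qed.
Let TC i j : cabs (Tv i j) <= C / N%:R. Proof. by apply: le_trans (SC i j); exact: Tvar_le W _ _. Qed.

Lemma resc_xs k : norm2 (resc (xs P H x k)) <= 1.
Proof.
apply: norm2_resc x1 _ => // i; rewrite mxE cabsM cabs_real ger0_norm ?Svar_ge0 //; exact: ler_wpM2l.
Qed.
Lemma resc_xt k : norm2 (resc (xt P H x k)) <= 1.
Proof. by apply: norm2_resc x1 _ => // i; rewrite mxE cabsM cabs_conj; exact: ler_wpM2l. Qed.
Lemma resc_xso k : norm2 (resc (xso P H x k)) <= 1.
Proof.
apply: norm2_resc x1 _ => // i; rewrite mxE !cabsM cabs_real ger0_norm ?Svar_ge0 //.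
rewrite -[leRHS]mul1r; apply: ler_pM => //; [by apply: mulr_ge0 => //; exact: Svar_ge0|exact: offd_le1|exact: ler_wpM2l].
Qed.
Lemma resc_xto k : norm2 (resc (xto P H x k)) <= 1.
Proof.
apply: norm2_resc x1 _ => // i; rewrite mxE !cabsM cabs_conj.
by rewrite -[leRHS]mul1r; apply: ler_pM => //; [exact: mulr_ge0|exact: offd_le1|exact: ler_wpM2l].
Qed.

Lemma whp_seg_good D : (1 < N)%N -> whp P H D.+1 (good_entries L n) ->
  (forall u v : Vec, norm2 u <= 1 -> norm2 v <= 1 -> whp P H D.+3 (stable c3 z u v)) -> whp P H D (seg_good z).
Proof.
move=> N1 h1 h2; have z0 : ImC z != 0 by case: dz => _ _ h _; exact: lt0r_neq0.
have cN : (#|'I_N| <= N ^ 1)%N by rewrite card_ord expn1.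
apply: (whp_and W N1); [exact: admb_good_entries| |exact: h1|].
  by apply: admb_forall => k; apply: admb_forall => j; exact: admb_stable.
apply: (whp_forall W N0 cN) => [k|k]; first by apply: admb_forall => j; exact: admb_stable.
apply: (whp_forall W N0 cN) => [j|j]; first exact: admb_stable.
by rewrite !addn1; apply: h2; exact: e1.
Qed.

Lemma admb_iso_stable : admb (iso_stable x y).
Proof.
have z0 : ImC z != 0 by case: dz => _ _ h _; exact: lt0r_neq0.
apply: admb_and; first exact: admb_seg_good.
apply: admb_and; first exact: admb_stable.
by apply: admb_forall => k; do 6![apply: admb_and; first exact: admb_stable]; exact: admb_stable.
Qed.

(** The nested conjunctions and the union over [k] use up to nine of the ten spare exponents. *)
Lemma whp_iso_stable D : (1 < N)%N -> whp P H (D + 10) (good_entries L n) ->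
  (forall u v : Vec, norm2 u <= 1 -> norm2 v <= 1 -> whp P H (D + 10) (stable c3 z u v)) -> whp P H D (iso_stable x y).
Proof.
move=> N1 h1 h2; have z0 : ImC z != 0 by case: dz => _ _ h _; exact: lt0r_neq0.
have cN : (#|'I_N| <= N ^ 1)%N by rewrite card_ord expn1.
have Dk k : (k <= 10)%N -> (k + D <= D + 10)%N by move=> k10; rewrite addnC leq_add2l.
have st u v D' : (D' <= D + 10)%N -> norm2 u <= 1 -> norm2 v <= 1 -> whp P H D' (stable c3 z u v).
  move=> DD u1 v1; apply: (whp_le W N0 DD _ (h2 u v u1 v1)); exact: admb_stable.
have as_ u v : admb (stable c3 z u v) by exact: admb_stable.
apply: (whp_and W N1); first exact: admb_seg_good.
- apply: admb_and; first exact: as_.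
  by apply: admb_forall => k; do 6![apply: admb_and; first exact: as_]; exact: as_.
- apply: whp_seg_good; first exact: N1.
    apply: (whp_le W N0 _ _ h1); [exact: (Dk 2%N isT)|exact: admb_good_entries].
  by move=> u v u1 v1; apply: st; [exact: (Dk 4%N isT)|exact: u1|exact: v1].
apply: (whp_and W N1); first exact: as_.
- by apply: admb_forall => k; do 6![apply: admb_and; first exact: as_]; exact: as_.
- by apply: st; [exact: (Dk 2%N isT)|exact: x1|exact: y1].
apply: (whp_forall W N0 cN) => k; first by do 6![apply: admb_and; first exact: as_]; exact: as_.
have rs := resc_xs k; have rt := resc_xt k; have rso := resc_xso k; have rto := resc_xto k.
have ek := e1 k; rewrite addn1.
apply: (whp_and W N1); [exact: as_|by do 5![apply: admb_and; first exact: as_]; exact: as_|apply: st; [exact: (Dk 4%N isT)|exact: x1|exact: ek]|].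
apply: (whp_and W N1); [exact: as_|by do 4![apply: admb_and; first exact: as_]; exact: as_|apply: st; [exact: (Dk 5%N isT)|exact: ek|exact: y1]|].
apply: (whp_and W N1); [exact: as_|by do 3![apply: admb_and; first exact: as_]; exact: as_|apply: st; [exact: (Dk 6%N isT)|exact: rs|exact: y1]|].
apply: (whp_and W N1); [exact: as_|by do 2![apply: admb_and; first exact: as_]; exact: as_|apply: st; [exact: (Dk 7%N isT)|exact: rt|exact: y1]|].
apply: (whp_and W N1); [exact: as_|by apply: admb_and; [exact: as_|exact: as_]|apply: st; [exact: (Dk 8%N isT)|exact: x1|exact: rso]|].
apply: (whp_and W N1); [exact: as_|exact: as_|apply: st; [exact: (Dk 9%N isT)|exact: x1|exact: rto]|apply: st; [exact: (Dk 9%N isT)|exact: ek|exact: rto]].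
Qed.

(** For [sterm], split [S] applied to the deviations into its mean, which multiplies [<x, G y>], and
    a fluctuation of order [s ^+ 3], which meets [|x| |G y| <= L / r]; the latter is at most of
    order [p] because [L ^+ 17 * s <= r]. *)
Lemma iso_from_stable w M : hermitian M -> onseg z w -> iso_stable x y M ->
  cabs (mean_dev w (msc w) M) <= pp N w ->
  (forall k, cabs (\sum_j ((S k j)%:C)%C * dev w (msc w) j M - mean_dev w (msc w) M) <= L ^+ 17 * ss N w ^+ 3) ->
  iso_good P H w (msc w) L n (rr w) (pp N w) x y M.
Proof.
move=> hM os /andP[sg /andP[st /forallP hk]] hm hf.
have /andP[g1 _] := seg_good2 hM os sg.
have [dw zw wz lw rg] := os; have sc := rg_sc rg.
have L0 := sc_L0 sc; have p0 := sc_p0 sc; have r0 := sc_r sc; have s0 := rg_s rg.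
have C0 : 0 < C by move: C1; lra.
have gqL u v : norm2 u <= 1 -> norm2 v <= 1 -> stable c3 z u v M -> cabs (gq w M u v) <= L.
  by move=> u1 v1 s; rewrite lL; exact: (segment_gq K1 l10 Kl c30 msc_ok hM dz dw zw wz lw u1 v1 s).
have gL u : rho z * gam z M u <= 2 -> rr w ^+ 2 * gam w M u <= L.
  move=> g; rewrite rr2 lL; apply: le_trans (segment_gam l10 hM dz dw zw wz lw g) _; exact: lpow.
have [gx gy _] := and3P st.
have kpE : C / N%:R * L <= L ^+ 2 * (pp N w ^+ 2 * rr w ^+ 2).
  rewrite -(sc_Ninv sc) mulrAC; apply: ler_wpM2r; first by rewrite invr_ge0 ltW.
  by rewrite expr2 ler_pM2r //; exact: sc_C sc.
have unl u v : gq w M (resc u) v = ((N%:R / C)%:C)%C * gq w M u v.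
  by rewrite /gq /resc cdotZl conjc_real.
have unr u v : gq w M u (resc v) = ((N%:R / C)%:C)%C * gq w M u v.
  by rewrite /gq /resc -scalemxAr cdotZr.
have ncE (g : R[i]) : cabs (((N%:R / C)%:C)%C * g) <= L -> cabs g <= L ^+ 2 * (pp N w ^+ 2 * rr w ^+ 2).
  rewrite cabsM cabs_real ger0_norm ?divr_ge0 ?(ltW C0) ?(ltW N0') // => h; apply: le_trans kpE.
  rewrite (_ : cabs g = C / N%:R * (N%:R / C * cabs g)); last by field; rewrite !lt0r_neq0.
  by apply: ler_wpM2l => //; rewrite divr_ge0 ?ltW.
have e1' := e1.
apply/and5P; split; [exact: g1|exact: gL|exact: gL| |].
- rewrite /sterm.
  pose f i : R[i] := \sum_j ((S i j)%:C)%C * dev w (msc w) j M - mean_dev w (msc w) M.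
  rewrite (_ : \sum_i _ = mean_dev w (msc w) M * gq w M x y + \sum_i conjc (x i 0) * f i * gq w M (ebasis i) y); last first.
    rewrite (gq_row w M x y) mulr_sumr -big_split /=; apply: eq_bigr => i _; rewrite /f.
    by move: (\sum_j _) (mean_dev _ _ _) (gq _ _ _ _) => a b e; ring.
  apply: le_trans (cabsD _ _) _.
  have F0 : 0 <= L ^+ 17 * ss N w ^+ 3 by apply: mulr_ge0; [exact: (sc_Lpow0 sc)|exact: exprn_ge0].
  have h1 : cabs (mean_dev w (msc w) M * gq w M x y) <= L * pp N w.
    by rewrite cabsM mulrC; apply: ler_pM => //; exact: gqL.
  have h2 : cabs (\sum_i conjc (x i 0) * f i * gq w M (ebasis i) y) <= L * pp N w.
    apply: le_trans (cabs_sum _ _ _) _.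
    apply: (@le_trans _ _ (L ^+ 17 * ss N w ^+ 3 * (1 * (L / rr w)))); last first.
      rewrite mul1r mulrA ler_pdivrMr // -(rg_sp rg).
      rewrite [leLHS](_ : _ = L * ss N w ^+ 2 * (L ^+ 17 * ss N w)); last by ring.
      apply: ler_wpM2l; first by apply: mulr_ge0; [exact: ltW|exact: exprn_ge0].
      apply: le_trans (sc_sr rg); apply: ler_wpM2r => //; exact: (sc_Lpow sc).
    have cs : \sum_i cabs (x i 0) * cabs (gq w M (ebasis i) y) <= 1 * (L / rr w).
      apply: sum_mul_le => //; [by rewrite divr_ge0 ?ltW|by rewrite expr1n|].
      have g := gL y gy; rewrite -/(gam w M y) expr_div_n ler_pdivlMr ?exprn_gt0 // mulrC.
      by apply: (le_trans g); rewrite -[leLHS]expr1; exact: (sc_Lpow sc).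
    apply: le_trans (ler_wpM2l F0 cs); rewrite mulr_sumr; apply: ler_sum => i _.
    rewrite !cabsM cabs_conj mulrAC mulrC; apply: ler_wpM2r; first exact: mulr_ge0.
    exact: hf.
  apply: le_trans (lerD h1 h2) _.
  rewrite (_ : _ + _ = 2 * L ^+ 1 * pp N w); last by ring.
  by apply: ler_wpM2r; [exact: ltW|apply: (@le_trans _ _ (L ^+ 2)); [exact: (sc_cst sc)|exact: (sc_Lpow sc)]].
apply/forallP => k; have := hk k; case/and5P => s1 s2 s3 s4 /and3P[s5 s6 s7].
have rs := resc_xs k; have rt := resc_xt k; have rso := resc_xso k; have rto := resc_xto k; have ek := e1' k.
apply/and5P; split.
- by apply: gqL.
- by apply: gqL.
- by apply: ncE; rewrite -unl; apply: gqL.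
- by apply: ncE; rewrite -unl; apply: gqL.
by apply/and3P; split; apply: ncE; rewrite -unr; apply: gqL.
Qed.

End SegmentEvents.

(** * The vertical grid *)

Section VerticalGrid.
Context {R : realType} (N : nat) (z1 z2 : R[i]).
Hypothesis N0 : (0 < N)%N.
Hypothesis z12 : ReC z2 = ReC z1.
Hypothesis zI : ImC z2 <= ImC z1.
Let N0' : 0 < N%:R :> R. Proof. by rewrite ltr0n. Qed.
Let N4 : 0 < N%:R ^+ 4 :> R. Proof. exact: exprn_gt0. Qed.

(** With [N ^ 4] equal steps on a segment of length at most [N], each step is at most [N ^- 3], as
    [one_step] requires, while the number of points stays polynomial for the union bound. *)
Definition vgrid (j : nat) : R[i] := (ReC z1 +i* (ImC z1 - (ImC z1 - ImC z2) * (j%:R / N%:R ^+ 4)))%C.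

Lemma vgrid0 : vgrid 0 = z1.
Proof. by apply: complex_ext => //=; rewrite mul0r mulr0 subr0. Qed.
Lemma vgridJ : vgrid (N ^ 4) = z2.
Proof. by apply: complex_ext => //=; rewrite natrX mulfV ?lt0r_neq0 // mulr1; ring. Qed.
Lemma vgrid_Re j : ReC (vgrid j) = ReC z1. Proof. by []. Qed.
Lemma vgrid_le j : ImC (vgrid j) <= ImC z1.
Proof. by rewrite /= gerBl; apply: mulr_ge0; [rewrite subr_ge0|rewrite divr_ge0 // ltW]. Qed.
Lemma vgrid_ge j : (j <= N ^ 4)%N -> ImC z2 <= ImC (vgrid j).
Proof.
move=> jJ /=; have : (ImC z1 - ImC z2) * (j%:R / N%:R ^+ 4) <= ImC z1 - ImC z2.
  apply: ler_piMr; first by rewrite subr_ge0.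
  by rewrite ler_pdivrMr // mul1r -natrX ler_nat.
by move: (_ * (j%:R / _)) => t; lra.
Qed.
Lemma vgrid_step (B : R) j : ImC z1 - ImC z2 <= B -> B <= N%:R ->
  ImC (vgrid j.+1) <= ImC (vgrid j) /\ N%:R ^+ 3 * cabs (vgrid j - vgrid j.+1) <= 1.
Proof.
move=> hB BN; have e : ImC (vgrid j) - ImC (vgrid j.+1) = (ImC z1 - ImC z2) / N%:R ^+ 4.
  by rewrite /= -natr1; field; exact: lt0r_neq0.
have d0 : 0 <= (ImC z1 - ImC z2) / N%:R ^+ 4 by apply: divr_ge0; [rewrite subr_ge0|exact: ltW].
split; first by rewrite -subr_ge0 e.
rewrite cabs_vertical // e ger0_norm // mulrA ler_pdivrMr // mul1r [leRHS]exprSr.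
apply: ler_wpM2l; first exact: exprn_ge0 (ltW N0').
exact: le_trans BN.
Qed.
End VerticalGrid.

Lemma bootstrap_exponents (Di Da D De : nat) : De = (Di + D).+1 ->
  [/\ Da.+1 <= Da + De + 20, Da.+3 <= Da + De + 20, De.+1 + 10 <= Da + De + 20, Di <= De & D.+1 <= De]%N.
Proof. by move=> ->; split; lia. Qed.

Lemma exp5_gt (N : nat) : (1 < N)%N -> ((N ^ 4).+1 <= N ^ 5)%N.
Proof.
move=> N1; rewrite ltn_exp2l //.
Qed.

(* One step of the bootstrap: stability at height [Im z1] gives the a priori bounds on the whole segment
   down to [Im z2]; on a fine grid the diagonal law and the deterministic stability of the Dyson equation
   propagate smallness of the diagonal downwards, and the isotropic law then applies at [z2]. *)
Lemma bootstrap_step {R : realType} (C : R) (Cp : nat -> R) (om B K th : R) (D : nat) :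
  0 < th -> th <= 1 -> 160 * th <= 3 * om -> 1 <= B -> 1 <= K -> 1 <= C ->
  (forall z : R[i], msc_domain B z -> msc_facts B K z) ->
  exists D' N0 : nat, forall N, (N0 <= N)%N -> forall d (T : measurableType d) (P : probability T R)
   (H : T -> 'M[R[i]]_N), wigner C Cp P H -> forall z1 z2 : R[i],
   2 + N%:R `^ (- (2 / 3) + om) <= aRe z1 -> msc_domain B z1 -> ReC z2 = ReC z1 -> ImC z2 <= ImC z1 ->
   ImC z1 <= N%:R `^ (th / 5) * ImC z2 -> 1 <= N%:R * ImC z2 ->
   (forall u v : 'cV[R[i]]_N, norm2 u <= 1 -> norm2 v <= 1 -> whp P H D' (stable (12 * C)^-1 z1 u v)) ->
   forall x y : 'cV[R[i]]_N, norm2 x <= 1 -> norm2 y <= 1 ->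
   whp P H D (fun M => (cabs (mean_dev z2 (msc z2) M) <= pp N z2) &&
     (cabs (gq z2 M x y - msc z2 * cdot x y) <= (N%:R `^ th) ^+ 15 * pp N z2)).
Proof.
move=> th0 th1 tho B1 K1 C1 ok.
have [Di [Ni hNi]] := isotropic_law C Cp D.+1 th0.
pose De := (Di + D).+1.
(* The extra 5 pays for the union over the [N ^ 4 + 1] grid points, at most [N ^ 5] of them. *)
have [Da [Na hNa]] := diagonal_law C Cp (De.+1 + 5) th0.
have [Ne hNe] := whp_entries C Cp (Da + De + 20) th0.
have [Nr hNr] := regime_eventually C K th0 th1 tho B1.
have th5 : 0 < th / 5 by rewrite divr_gt0.
have [Nl hNl] := powR_archi (Num.max 10 (Num.max K B)) th5.
exists (Da + De + 20)%N, (maxn Ni (maxn Na (maxn Ne (maxn Nr (maxn Nl 2))))) => N NN d T P H W z1 z2 zE dz1 z12 zI zl zN hst x y x1 y1.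
move: NN; rewrite !geq_max => /andP[Q1 /andP[Q2 /andP[Q3 /andP[Q4 /andP[Q5 N1]]]]].
have N0 := ltnW N1.
have [a1 a2 a3 a4 a5] := bootstrap_exponents Da (erefl De).
have a6 := exp5_gt N1.
have N0' : 0 < N%:R :> R by rewrite ltr0n.
have [_] := hNl N Q5; rewrite !ge_max => /andP[_ /andP[_ BN]] /andP[l10 /andP[Kl _]].
set L := N%:R `^ th; set l := N%:R `^ (th / 5) in l10 Kl zl.
(* Descending by a factor [l] costs up to [l ^+ 5] in the resolvent elements ([segment_gq]), so the
   ratio of heights is the fifth root of [L]. *)
have lL : L = l ^+ 5.
  by rewrite /L /l -powR_mulrn ?powR_ge0 // -powRrM; congr (_ `^ _); field.
have [e1 e2 e3 e4] := dz1.
have z20 : 0 < ImC z2 by rewrite -(pmulr_rgt0 _ N0'); apply: lt_le_trans zN.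
have l0 : 0 <= l by exact: powR_ge0.
have aR w : ReC w = ReC z1 -> aRe w = aRe z1 by move=> e; rewrite /aRe e.
have seg w : ReC w = ReC z1 -> ImC z2 <= ImC w -> ImC w <= ImC z1 -> onseg C N B l L z1 w.
  move=> wz w2 w1; have w0 : 0 < ImC w by apply: lt_le_trans w2.
  have dw : msc_domain B w by split; rewrite ?aR //; exact: le_trans e4.
  split => //; first by apply: le_trans zl _; apply: ler_wpM2l.
  apply: (hNr N Q4 w) => //; rewrite ?aR //; [|exact: le_trans e4|exact: ok].
  by apply: le_trans zN _; rewrite ler_pM2l.
have z10 : ImC z1 != 0 by exact: lt0r_neq0.
have hent := hNe N Q3 d T P H W.
have age := admb_good_entries L (Num.sqrt (N%:R : R)) (N := N).
have hent' D'' : (D'' <= Da + De + 20)%N -> whp P H D'' (good_entries L (Num.sqrt (N%:R : R))).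
  by move=> DD; apply: (whp_le W N0 DD age); exact: hent.
have hst' D'' u v : (D'' <= Da + De + 20)%N -> norm2 u <= 1 -> norm2 v <= 1 -> whp P H D'' (stable (12 * C)^-1 z1 u v).
  by move=> DD u1 v1; apply: (whp_le W N0 DD); [exact: admb_stable|exact: hst].
have asg : admb (seg_good C L z1 : 'M[R[i]]_N -> bool) by apply: admb_seg_good.
have hseg : whp P H Da (seg_good C L z1).
  by apply: (whp_seg_good W dz1 N0 N1); [exact: hent'|move=> u v u1 v1; exact: hst'].
have hdg w : onseg C N B l L z1 w -> whp P H (De.+1 + 5) (dgood P H w L (rr w) (ss N w)).
  move=> os; have [_ _ _ _ rg] := os; have w0 := rg_z0 rg.
  apply: (hNa N Q2 d T P H W _ _ _ _ _ _ rg).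
  apply: (whp_imp W N0 (leqnn _) asg _ _ hseg); first exact: admb_good2.
  by move=> t; apply: (seg_good2 K1 l10 Kl lL C1 ok dz1 (wig_herm W t) os).
pose w := vgrid N z1 z2.
have sw j : (j <= N ^ 4)%N -> onseg C N B l L z1 (w j).
  by move=> jJ; apply: seg; [exact: vgrid_Re|exact: vgrid_ge|exact: vgrid_le].
have hgrid : whp P H De.+1 (fun M => [forall j : 'I_(N ^ 4).+1, dgood P H (w j) L (rr (w j)) (ss N (w j)) M]).
  apply: (whp_forall W N0 (k := 5)) => [|j|j]; first by rewrite card_ord.
    by apply: admb_dgood; have [_ _ _ _ rg] := sw j (ltn_ord j); exact: rg_z0 rg.
  by apply: hdg; apply: sw; exact: (ltn_ord j).
have ag : admb (fun M => [forall j : 'I_(N ^ 4).+1, dgood P H (w j) L (rr (w j)) (ss N (w j)) M]).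
  by apply: admb_forall => j; apply: admb_dgood; have [_ _ _ _ rg] := sw j (ltn_ord j); exact: rg_z0 rg.
have ai : admb (iso_stable C P H L z1 x y) by exact: (admb_iso_stable C P H L dz1 x y).
have hiso : whp P H De.+1 (iso_stable C P H L z1 x y).
  by apply: (whp_iso_stable W C1 dz1 x1 y1 N0 N1) => [|u v u1 v1]; [exact: hent'|exact: hst'].
have hE := whp_and W N1 ai ag hiso hgrid.
have aE := admb_and ai ag.
have os2 : onseg C N B l L z1 z2 by apply: seg.
have [_ _ _ _ rg2] := os2; have z2n := rg_z0 rg2.
have wJ : w (N ^ 4)%N = z2 by apply: vgridJ.
have det t : iso_stable C P H L z1 x y (H t) && [forall j : 'I_(N ^ 4).+1, dgood P H (w j) L (rr (w j)) (ss N (w j)) (H t)] ->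
    cabs (mean_dev z2 (msc z2) (H t)) <= pp N z2 /\ iso_good P H z2 (msc z2) L (Num.sqrt N%:R) (rr z2) (pp N z2) x y (H t).
  case/andP => hi /forallP hg; have hM := wig_herm W t.
  have [sg _] := andP hi.
  have := @grid_stability R C Cp N d T P H W B K l L l10 Kl lL C1 ok z1 w (N ^ 4)%N (H t) hM (vgrid0 _ _ _).
  rewrite wJ; case=> //.
  - move=> j jJ; split; first exact: sw.
    exact: (hg (Ordinal (jJ : (j < (N ^ 4).+1)%N))).
  - by move=> j _; apply: (vgrid_step N0 zI (B := B)) => //; move: e4 z20; lra.
  move=> h1 _ h3; split=> //.
  exact: (iso_from_stable W K1 l10 Kl lL C1 ok dz1 x1 y1 N0 hM os2 hi h1 h3).
have am : admb (fun M : 'M[R[i]]_N => cabs (mean_dev z2 (msc z2) M) <= pp N z2).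
  apply: admb_le; last exact: admR_cst.
  by apply: admR_cabs; apply: adm_sum => k; apply: admZ; exact: adm_dev.
have ax : admb (fun M : 'M[R[i]]_N => cabs (gq z2 M x y - msc z2 * cdot x y) <= L ^+ 15 * pp N z2).
  apply: admb_le; last exact: admR_cst.
  by apply: admR_cabs; apply: admB; [exact: adm_gq|exact: adm_cst].
apply: (whp_and W N1 am ax).
  by apply: (whp_imp W N0 a5 aE am _ hE) => t /det[].
apply: (hNi N Q1 d T P H W _ _ _ _ _ _ rg2 x y x1 y1).
apply: (whp_imp W N0 a4 aE _ _ hE); first exact: (admb_iso_good P H x y rg2).
by move=> t /det[].
Qed.

Lemma whp_true {R : realType} N d (T : measurableType d) (P : probability T R) (H : T -> 'M[R[i]]_N) D
  (b : 'M[R[i]]_N -> bool) : (forall t, b (H t)) -> whp P H D b.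
Proof.
move=> h; rewrite /whp (_ : [set t | ~~ b (H t)] = set0); last by apply/seteqP; split => t //=; rewrite h.
by rewrite measure0 lee_fin invr_ge0 exprn_ge0.
Qed.

(** As [Im m > 0], [Im z <= Im (z + m) <= |z + m| = 1 / |m|]. *)
Lemma msc_le_inv {R : realType} (z : R[i]) : 0 < ImC z -> ImC z * cabs (msc z) <= 1.
Proof.
move=> z0; have m0 := msc_Im_gt0 z0; have r0 := msc_r_gt0 z.
have h : ImC z <= (cabs (msc z))^-1.
  rewrite -cabsV -cabsN -msc_inv; apply: le_trans (im_le_cabs _).
  by rewrite cImD lerDl ltW.
by rewrite -(ler_pdivlMr _ _ r0) div1r.
Qed.

(** * Starting height and descent to the threshold *)

Section Base.
Context {R : realType} (N : nat) (C B : R).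
Hypothesis C1 : 1 <= C.
Hypothesis BC : 48 * C <= B.

(** At height [B] both [G] and [msc] are at most [1 / B], so the error is at most [2 / B], and
    [B >= 48 * C] makes this at most half of [(12 * C)^-1]; the other half is lost to
    [|1 - m ^ 2| >= 1 / 2]. *)
Lemma stable_base (z : R[i]) (M : 'M[R[i]]_N) x y : hermitian M -> 2 < aRe z -> aRe z <= B -> ImC z = B ->
  norm2 x <= 1 -> norm2 y <= 1 -> stable (12 * C)^-1 z x y M.
Proof.
move=> hM z2 zB zI x1 y1.
have B48 : 48 <= B by move: C1 BC; lra.
have B0 : 0 < B by move: B48; lra.
have C0 : 0 < C by move: C1; lra.
have z0 : 0 < ImC z by rewrite zI.
have rB : rho z <= B ^+ 2.
  have r0 := rho_gt0 z2 z0.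
  rewrite -(@ler_pXn2r _ 2) ?nnegrE ?(ltW r0) ?exprn_ge0 ?(ltW B0) // (rho_sqr z2 z0) zI.
  apply: (@le_trans _ _ (2 * B)); first by move: zB; lra.
  rewrite -exprM (_ : B ^+ (2 * 2) = B ^+ 3 * B); last by ring.
  rewrite ler_pM2r //; apply: (@le_trans _ _ B); first by move: B48; lra.
  by rewrite -[leLHS]expr1; apply: ler_weXn2l => //; move: B48; lra.
have gB u : norm2 u <= 1 -> rho z * gam z M u <= 2.
  move=> u1; apply: (@le_trans _ _ 1); last by rewrite ler1n.
  apply: (@le_trans _ _ (B ^+ 2 * gam z M u)).
    by apply: ler_wpM2r => //; rewrite gam_norm2 norm2_ge0.
  rewrite gam_norm2 -zI; apply: le_trans u1; exact: resolvent_norm (lt0r_neq0 z0).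
apply/and3P; split; [exact: gB|exact: gB|].
have mB : cabs (msc z) <= B^-1.
  by rewrite -[leRHS]mul1r ler_pdivlMr // mulrC -zI; exact: msc_le_inv.
have iB : 0 <= B^-1 by rewrite invr_ge0 ltW.
have i2 : B^-1 <= 2^-1 by rewrite lef_pV2 ?posrE //; move: B48; lra.
have gq1 : cabs (gq z M x y) <= B^-1.
  by apply: gq_crude => //; [exact: lt0r_neq0|rewrite zI gtr0_norm // mulVf // lt0r_neq0].
have c1 : cabs (cdot x y) <= 1.
  by rewrite -[leRHS]mul1r; apply: cdot_le => //; rewrite expr1n.
apply: (@le_trans _ _ (B^-1 + B^-1 * 1)).
  apply: le_trans (cabsB _ _) _; apply: lerD => //; rewrite cabsM; exact: ler_pM.
have h1 : 2^-1 <= cabs (1 - msc z ^+ 2).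
  have := cabs_dist 1 (msc z ^+ 2); rewrite cabs1 cabsX => h; apply: le_trans h.
  have : cabs (msc z) ^+ 2 <= 2^-1 ^+ 2 by apply: ler_wXn2r => //; exact: le_trans i2.
  rewrite (_ : 2^-1 ^+ 2 = 4^-1 :> R); last by field.
  by move: (cabs _ ^+ 2) => t; lra.
apply: (@le_trans _ _ ((12 * C)^-1 * 2^-1)); last first.
  by apply: ler_wpM2l => //; rewrite invr_ge0; move: C0; lra.
rewrite -invfM -[leRHS]mul1r ler_pdivlMr ?mulr_gt0 // mulr1.
rewrite [leLHS](_ : _ = 48 * C * B^-1); last by move: B^-1 => b; ring.
by rewrite ler_pdivrMr // mul1r.
Qed.

End Base.

Section StableFromLaw.
Context {R : realType} (C B K L : R) (N : nat).
Hypothesis C1 : 1 <= C.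
Hypothesis KL : K <= L.
Variable z : R[i].
Notation n := (Num.sqrt (N%:R : R)).
Hypothesis ok : msc_facts B K z.
Hypothesis rg : regime N C z (msc z) L n (rr z) (pp N z) (ss N z).
Let sc := rg_sc rg.
Let L0 : 0 < L. Proof. exact: sc_L0 sc. Qed.
Let p0 : 0 < pp N z. Proof. exact: sc_p0 sc. Qed.
Let r0 : 0 < rr z. Proof. exact: sc_r sc. Qed.
Let rr2 : rr z ^+ 2 = rho z. Proof. by rewrite sqr_sqrtr // sqrtr_ge0. Qed.

(** Since [n * p * r = 1], the threshold says [rho * L ^+ 15 * p <= Im z]. By Ward's identity
    [Im z * rho * gam] is then at most [rho * Im m + Im z], which is at most [2 * Im z]. *)
Lemma stable_of_law (M : 'M[R[i]]_N) x y : hermitian M -> L ^+ 15 * rr z <= n * ImC z ->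
  norm2 x <= 1 -> norm2 y <= 1 ->
  cabs (gq z M x x - msc z * cdot x x) <= L ^+ 15 * pp N z ->
  cabs (gq z M y y - msc z * cdot y y) <= L ^+ 15 * pp N z ->
  cabs (gq z M x y - msc z * cdot x y) <= L ^+ 15 * pp N z -> stable (12 * C)^-1 z x y M.
Proof.
move=> hM thr x1 y1 hx hy hxy; have z0 := rg_im rg; have n0 := sc_n sc.
have [_ [im1 _] [rK _ _] _] := ok.
have g u : norm2 u <= 1 -> cabs (gq z M u u - msc z * cdot u u) <= L ^+ 15 * pp N z -> rho z * gam z M u <= 2.
  move=> u1 hu; rewrite -(ler_pM2l z0) mulrCA im_gam ?lt0r_neq0 //.
  have e : ImC (gq z M u u) = ImC (msc z) * norm2 u + ImC (gq z M u u - msc z * cdot u u).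
    rewrite cdot_norm2; move: (gq z M u u) (msc z) (norm2 u) => v w a.
    by rewrite cImD cImN cImM /=; ring.
  have m0 := msc_Im_gt0 z0.
  apply: (@le_trans _ _ (rho z * (ImC (msc z) + L ^+ 15 * pp N z))).
    apply: ler_wpM2l; first by rewrite -rr2 sqr_ge0.
    rewrite e; apply: lerD; first by apply: ler_piMr => //; exact: ltW.
    by apply: le_trans hu; exact: im_le_cabs.
  rewrite mulrDr (_ : ImC z * 2 = ImC z + ImC z); last by ring.
  apply: lerD => //; rewrite -(ler_pM2l n0); apply: le_trans thr.
  rewrite -rr2 (_ : n * _ = L ^+ 15 * rr z * (n * (pp N z * rr z))); last by ring.
  by rewrite (sc_p sc) mulr1.
apply/and3P; split; [exact: g|exact: g|].
apply: (le_trans hxy); have C0 : 0 < C by move: C1; lra.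
have gap := rho_gap rg KL; rewrite rr2 in gap.
apply: (@le_trans _ _ ((12 * C)^-1 * (L ^+ 39 * pp N z))); last first.
  by apply: ler_wpM2l; [rewrite invr_ge0; move: C0; lra|exact: gap].
rewrite [leRHS]mulrC ler_pdivlMr ?mulr_gt0 // [L ^+ 15 * _]mulrC.
apply: (@le_trans _ _ (pp N z * L ^+ 15 * (12 * L))).
  apply: ler_wpM2l; first by apply: mulr_ge0; [exact: ltW|exact: (sc_Lpow0 sc)].
  by rewrite ler_pM2l //; exact: sc_C sc.
rewrite (_ : _ * _ = 12 * L ^+ 16 * pp N z); last by ring.
apply: ler_wpM2r; first exact: ltW.
by apply: (@le_trans _ _ (L ^+ 17)); [exact: (sc_cst sc)|exact: (sc_Lpow sc)].
Qed.

End StableFromLaw.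

(** Raising the height by a factor [t] multiplies the right-hand side by [t], but [rr] by at most
    [t], because its fourth power is affine in the height with a positive constant term. *)
Lemma threshold_mono {R : realType} (n a : R) (z w : R[i]) : 0 <= n -> 0 <= a -> 2 < aRe z -> ReC w = ReC z -> 0 < ImC z ->
  ImC z <= ImC w -> a * rr z <= n * ImC z -> a * rr w <= n * ImC w.
Proof.
move=> n0 a0 z2 wz z0 zw h; set t := ImC w / ImC z.
have t1 : 1 <= t by rewrite ler_pdivlMr // mul1r.
have t0 : 0 <= t by apply: le_trans t1.
have aw : aRe w = aRe z by rewrite /aRe wz.
have w2 : 2 < aRe w by rewrite aw.
have w0 : 0 < ImC w by apply: lt_le_trans zw.
have wE : ImC w = t * ImC z by rewrite divfK // lt0r_neq0.
have r4 (v : R[i]) : 2 < aRe v -> 0 < ImC v -> rr v ^+ 4 = aRe v - 2 + ImC v.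
  move=> v2 v0; rewrite (_ : 4 = 2 * 2)%N // exprM sqr_sqrtr ?sqrtr_ge0 //; exact: rho_sqr.
have rw : rr w <= t * rr z.
  have a1 : 0 <= rr w by exact: sqrtr_ge0.
  have a2 : 0 <= t * rr z by apply: mulr_ge0 => //; exact: sqrtr_ge0.
  rewrite -(@ler_pXn2r _ 4) ?nnegrE // exprMn !r4 // aw wE.
  apply: (@le_trans _ _ (t ^+ 1 * (aRe z - 2 + ImC z))).
    by rewrite expr1 mulrDr lerD2r ler_peMl //; move: z2; lra.
  by apply: ler_wpM2r; [move: z2 z0; lra|exact: ler_weXn2l].
apply: (@le_trans _ _ (t * (a * rr z))); first by rewrite mulrCA; exact: ler_wpM2l.
by rewrite wE [leRHS]mulrCA; apply: ler_wpM2l.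
Qed.

(** Induction on the number of ratios [N ^ (th / 5)] separating [Im z] from the top height [B]. Each
    step obtains the law at [z] from [bootstrap_step] and converts it back into [stable] by the
    threshold condition. *)
Lemma stable_law {R : realType} (C : R) (Cp : nat -> R) (om B K th : R) :
  0 < th -> th <= 1 -> 160 * th <= 3 * om -> 1 <= K -> 1 <= C -> 48 * C <= B ->
  (forall z : R[i], msc_domain B z -> msc_facts B K z) -> forall D : nat,
  exists N0 : nat, forall N, (N0 <= N)%N -> forall d (T : measurableType d) (P : probability T R)
   (H : T -> 'M[R[i]]_N), wigner C Cp P H -> forall z : R[i],
   2 + N%:R `^ (- (2 / 3) + om) <= aRe z -> msc_domain B z -> 1 <= N%:R * ImC z ->
   (N%:R `^ th) ^+ 15 * rr z <= Num.sqrt N%:R * ImC z ->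
   forall x y : 'cV[R[i]]_N, norm2 x <= 1 -> norm2 y <= 1 -> whp P H D (stable (12 * C)^-1 z x y).
Proof.
move=> th0 th1 tho K1 C1 BC ok.
have B1 : 1 <= B by move: C1 BC; lra.
have B0 : 0 < B by move: B1; lra.
have th5 : 0 < th / 5 by rewrite divr_gt0.
have claim (k : nat) : forall D : nat, exists N0 : nat, forall N, (N0 <= N)%N -> forall d (T : measurableType d) (P : probability T R)
   (H : T -> 'M[R[i]]_N), wigner C Cp P H -> forall z : R[i],
   2 + N%:R `^ (- (2 / 3) + om) <= aRe z -> msc_domain B z -> 1 <= N%:R * ImC z ->
   (N%:R `^ th) ^+ 15 * rr z <= Num.sqrt N%:R * ImC z -> B <= (N%:R `^ (th / 5)) ^+ k * ImC z ->
   forall x y : 'cV[R[i]]_N, norm2 x <= 1 -> norm2 y <= 1 -> whp P H D (stable (12 * C)^-1 z x y).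
  elim: k => [|k IH] D.
    exists 0%N => N _ d T P H W z zE [z2 zB z0 zI] zN thr hB x y x1 y1.
    apply: whp_true => t; apply: (stable_base C1 BC (wig_herm W t)) => //.
    by apply/eqP; rewrite eq_le zI /=; rewrite expr0 mul1r in hB.
  have [D' [Na hNa]] := bootstrap_step Cp D.+2 th0 th1 tho B1 K1 C1 ok.
  have [Nb hNb] := IH D'.
  have [Nr hNr] := regime_eventually C K th0 th1 tho B1.
  have [Nl hNl] := powR_archi (Num.max 10 K) th5.
  exists (maxn Na (maxn Nb (maxn Nr (maxn Nl 2)))) => N NN d T P H W z zE dz zN thr hB x y x1 y1.
  move: NN; rewrite !geq_max => /andP[Q1 /andP[Q2 /andP[Q3 /andP[Q4 N1]]]].
  have N0 := ltnW N1.
  have [_ _] := hNl N Q4; rewrite !ge_max; set l := N%:R `^ (th / 5) => /andP[l10 Kl].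
  have l1 : 1 <= l by move: l10; lra.
  have [z2 zB z0 zI] := dz.
  (* One ratio higher, cut off at [B] to remain in the domain where the facts about [msc] hold. *)
  pose w : R[i] := (ReC z +i* Num.min B (l * ImC z))%C.
  have wz : ImC z <= ImC w by rewrite /= le_min zI /= ler_peMl // ltW.
  have wB : ImC w <= B by rewrite /= ge_min lexx.
  have wl : ImC w <= l * ImC z by rewrite /= ge_min lexx orbT.
  have w0 : 0 < ImC w by apply: lt_le_trans wz.
  have dw : msc_domain B w by split.
  have n0 : 0 <= Num.sqrt (N%:R : R) by exact: sqrtr_ge0.
  have La : 0 <= (N%:R `^ th) ^+ 15 :> R by rewrite exprn_ge0 // powR_ge0.
  have thw := threshold_mono n0 La z2 (erefl : ReC w = ReC z) z0 wz thr.
  have Nw : 1 <= N%:R * ImC w by apply: le_trans zN _; apply: ler_wpM2l.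
  have hBw : B <= l ^+ k * ImC w.
    rewrite /= ; case: (leP B (l * ImC z)) => h; last by rewrite mulrA -exprSr.
    by rewrite ler_peMl ?exprn_ege1 // ltW.
  have hw : forall u v : 'cV[R[i]]_N, norm2 u <= 1 -> norm2 v <= 1 -> whp P H D' (stable (12 * C)^-1 w u v).
    exact: (hNb N Q2 d T P H W w zE dw Nw thw hBw).
  have hz := hNa N Q1 d T P H W w z zE dw (erefl : ReC z = ReC w) wz wl zN hw.
  have rg := hNr N Q3 z zE zB zN zI (ok _ dz).
  have z0' := lt0r_neq0 z0.
  set L := N%:R `^ th in thr La thw hz rg *.
  have ax u v : admb (fun M : 'M[R[i]]_N => (cabs (mean_dev z (msc z) M) <= pp N z) &&
     (cabs (gq z M u v - msc z * cdot u v) <= L ^+ 15 * pp N z)).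
    apply: admb_and.
      apply: admb_le; last exact: admR_cst.
      by apply: admR_cabs; apply: adm_sum => i; apply: admZ; exact: adm_dev.
    apply: admb_le; last exact: admR_cst.
    by apply: admR_cabs; apply: admB; [exact: adm_gq|exact: adm_cst].
  have h3 := whp_and W N1 (ax x y) (ax y y) (hz x y x1 y1) (hz y y y1 y1).
  have h4 : whp P H D.+1 (fun M : 'M[R[i]]_N => (cabs (mean_dev z (msc z) M) <= pp N z) &&
     (cabs (gq z M x x - msc z * cdot x x) <= L ^+ 15 * pp N z)).
    by apply: (whp_le W N0 _ (ax x x) (hz x x x1 x1)).
  have h5 := whp_and W N1 (ax x x) (admb_and (ax x y) (ax y y)) h4 h3.
  apply: (whp_imp W N0 (leqnn D) _ _ _ h5).
  - by apply: admb_and; [exact: ax|apply: admb_and; exact: ax].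
  - exact: admb_stable.
  move=> t /andP[/andP[_ e1] /andP[/andP[_ e2] /andP[_ e3]]].
  have KL : K <= L.
    apply: (le_trans Kl); rewrite /l /L; apply: ler_powR; first by rewrite ler1n.
    by move: th0; clear; lra.
  exact: (stable_of_law C1 KL (ok _ dz) rg (wig_herm W t) thr x1 y1 e1 e3 e2).
(* With this [k], the product of the ratios is at least [N ^+ 2], and [N ^+ 2 * Im z >= N >= B]: the
   number of steps does not depend on [N]. *)
move=> D; have [k hk] := natr_archi (2 / (th / 5)).
have [N0 hN] := claim k D; have [Nb hNb] := powR_archi B th0.
exists (maxn N0 Nb) => N; rewrite geq_max => /andP[Q1 Q2] d T P H W z zE dz zN thr.
apply: (hN N Q1 d T P H W z zE dz zN thr).
have [N1 BN _] := hNb N Q2; have NR1 : 1 <= N%:R :> R by rewrite ler1n.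
have [_ _ z0 _] := dz.
apply: (@le_trans _ _ (N%:R * (N%:R * ImC z))).
  by apply: (le_trans BN); rewrite ler_peMr.
rewrite mulrA; apply: ler_wpM2r; first exact: ltW.
rewrite -expr2 -!powR_mulrn ?powR_ge0 ?ler0n // -powRrM; apply: ler_powR => //.
by have := hk k (leqnn k); rewrite ler_pdivrMr // mulrC.
Qed.

(** * The whole domain *)

Section LowRange.
Context {R : realType} (C : R) (Cp : nat -> R) (om B K th : R).
Hypothesis th0 : 0 < th.
Hypothesis th1 : 85 * th <= 1.
Hypothesis tho : 160 * (85 * th) <= 3 * om.
Hypothesis K1 : 1 <= K.
Hypothesis C1 : 1 <= C.
Hypothesis BC : 48 * C <= B.
Hypothesis ok : forall z : R[i], msc_domain B z -> msc_facts B K z.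
Let B1 : 1 <= B. Proof. by move: C1 BC; lra. Qed.
Let B0 : 0 < B. Proof. by move: B1; lra. Qed.

Let om_ge0 : 0 <= om. Proof. by move: tho th0; lra. Qed.

Let imZ (a : R) (v : R[i]) : ImC ((a%:C)%C * v) = a * ImC v.
Proof. by case: v => b c /=; ring. Qed.
Let mul_div (a b c : R) : 0 < a -> 0 < b -> a * (b * (c / (a * b))) = c.
Proof. by move=> a0 b0; field; rewrite !lt0r_neq0. Qed.

Let one_three (v : R) : 1 <= v -> 1 + 2 * v <= 3 * v. Proof. by move=> h; lra. Qed.
Let seven_eight (v : R) : 1 <= v -> 6 * v + v + 1 <= 8 * v. Proof. by move=> h; lra. Qed.
Let two_halves (u v : R) : 8 * v <= 1 -> 8 * u <= 1 -> 4 * u + 4 * v <= 1. Proof. by move=> h k; lra. Qed.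
Let two_pow4 : 2 ^+ 4 = 16 :> R. Proof. by ring. Qed.
Let le16 (i k : R) : i <= k -> 0 < k -> k + i <= 16 * k. Proof. by move=> h h'; lra. Qed.
Let lt0_8 (v : R) : 8 <= v -> 0 < v. Proof. by move=> h; lra. Qed.
Let le1_8 (v : R) : 8 <= v -> 1 <= v. Proof. by move=> h; lra. Qed.
Let gap_le (t a : R) : 2 + t <= a -> t <= a - 2. Proof. by move=> h; lra. Qed.
Let gap_B (i a : R) : i <= a - 2 -> a <= B -> i <= B. Proof. by move=> h k; lra. Qed.

Definition kap4 (z : R[i]) : R := Num.sqrt (Num.sqrt (aRe z - 2)).
Lemma kap4_ge0 z : 0 <= kap4 z. Proof. exact: sqrtr_ge0. Qed.
Lemma kap4E z : 2 < aRe z -> kap4 z ^+ 4 = aRe z - 2.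
Proof.
move=> z2; rewrite (_ : 4 = 2 * 2)%N // exprM sqr_sqrtr ?sqrtr_ge0 // sqr_sqrtr //; move: z2; lra.
Qed.
Lemma rr4E (z : R[i]) : 2 < aRe z -> 0 < ImC z -> rr z ^+ 4 = aRe z - 2 + ImC z.
Proof.
move=> z2 z0; rewrite (_ : 4 = 2 * 2)%N // exprM sqr_sqrtr ?sqrtr_ge0 //; exact: rho_sqr.
Qed.

Lemma edge_distance (N : nat) (z : R[i]) : (0 < N)%N -> 2 + N%:R `^ (- (2 / 3) + om) <= aRe z ->
  2 < aRe z /\ N%:R `^ (3 * om) <= N%:R ^+ 2 * (aRe z - 2) ^+ 3.
Proof.
move=> N0 h; have N0' : 0 < N%:R :> R by rewrite ltr0n.
have k0 : 0 < N%:R `^ (- (2 / 3) + om) by rewrite powR_gt0.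
split; first by move: h k0; move: (_ `^ _) => t; lra.
apply: (@le_trans _ _ (N%:R ^+ 2 * (N%:R `^ (- (2 / 3) + om)) ^+ 3)).
  rewrite -!powR_mulrn ?powR_ge0 ?ler0n // -powRrM -powRD; last by rewrite lt0r_neq0 ?implybT.
  by apply: ler_powR; [rewrite ler1n|lra].
apply: ler_wpM2l; first by rewrite exprn_ge0.
by apply: ler_wXn2r; [exact: ltW|move: h; move: (_ `^ _) => t; lra].
Qed.

(** A single longer bootstrap step with exponent [85 * th], hence ratio [L ^+ 17], crosses the
    threshold of [stable_law]: it starts above the threshold and ends below it by a power of [L],
    low enough for [gam_neumann]. *)
Lemma low_range (D : nat) : exists N0 : nat, forall N, (N0 <= N)%N -> forall d (T : measurableType d) (P : probability T R)
   (H : T -> 'M[R[i]]_N), wigner C Cp P H -> forall z : R[i],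
   2 + N%:R `^ (- (2 / 3) + om) <= aRe z -> msc_domain B z -> 1 <= N%:R * ImC z ->
   kap4 z <= Num.sqrt N%:R * (N%:R `^ th * ImC z) ->
   forall x y : 'cV[R[i]]_N, norm2 x <= 1 -> norm2 y <= 1 ->
   whp P H D (fun M => (cabs (mean_dev z (msc z) M) <= pp N z) &&
     (cabs (gq z M x y - msc z * cdot x y) <= (N%:R `^ (85 * th)) ^+ 15 * pp N z)).
Proof.
have th85 : 0 < 85 * th by rewrite mulr_gt0.
have t1 : th <= 1 by move: th0 th1; lra.
have t2 : 160 * th <= 3 * om by move: th0 tho; lra.
have [D' [Na hNa]] := bootstrap_step Cp D th85 th1 tho B1 K1 C1 ok.
have [Nb hNb] := stable_law Cp th0 t1 t2 K1 C1 BC ok D'.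
have [Nl hNl] := powR_archi 2 th0.
exists (maxn Na (maxn Nb (maxn Nl 1))) => N; rewrite !geq_max => /andP[Q1 /andP[Q2 /andP[Q3 N0]]].
move=> d T P H W z zE dz zN hk x y x1 y1.
have [_ _ L2] := hNl N Q3; set L := N%:R `^ th in L2 hk.
have N0' : 0 < N%:R :> R by rewrite ltr0n.
have NR1 : 1 <= N%:R :> R by rewrite ler1n.
have L0 : 0 < L by move: L2; lra.
have L1 : 1 <= L by move: L2; lra.
set n := Num.sqrt N%:R in hk; have n0 : 0 < n by rewrite sqrtr_gt0.
have n2 : n ^+ 2 = N%:R by rewrite sqr_sqrtr // ltW.
have lE : N%:R `^ (85 * th / 5) = L ^+ 17 :> R.
  by rewrite /L -powR_mulrn ?powR_ge0 // -powRrM; congr (_ `^ _); field.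
have [z2 zB z0 zI] := dz.
pose w : R[i] := (ReC z +i* Num.min B (L ^+ 17 * ImC z))%C.
have L17 : 1 <= L ^+ 17 by exact: exprn_ege1.
have wz : ImC z <= ImC w by rewrite /= le_min zI /= ler_peMl // ltW.
have wB : ImC w <= B by rewrite /= ge_min lexx.
have wl : ImC w <= L ^+ 17 * ImC z by rewrite /= ge_min lexx orbT.
have w0 : 0 < ImC w by apply: lt_le_trans wz.
have dw : msc_domain B w by split.
apply: (hNa N Q1 d T P H W w z zE dw (erefl : ReC z = ReC w) wz _ zN _ x y x1 y1); first by rewrite lE.
case: (leP B (L ^+ 17 * ImC z)) => hB.
  move=> u v u1 v1; apply: whp_true => t.
  by apply: (stable_base C1 BC (wig_herm W t)) => //=; rewrite min_l.
have wE : ImC w = L ^+ 17 * ImC z by rewrite /= min_r // ltW.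
apply: (hNb N Q2 d T P H W w zE dw); first by apply: le_trans zN _; rewrite ler_pM2l.
have w2 : 2 < aRe w by [].
have [_ edge] := edge_distance N0 zE.
have ka0 : 0 < aRe z - 2 by move: z2; lra.
have nw : 0 <= n * ImC w by rewrite mulr_ge0 // ltW.
have lw : 0 <= L ^+ 15 * rr w by rewrite mulr_ge0 ?sqrtr_ge0 // exprn_ge0 // ltW.
rewrite -/L -/n -(@ler_pXn2r _ 4) ?nnegrE // exprMn (rr4E w2 w0) -exprM.
have -> : aRe w = aRe z by [].
(* If [Im w] is at most [|E| - 2], the fourth power of [rr w] is at most twice [kap4 z ^+ 4] and the
   hypothesis on [kap4] suffices. Otherwise it is at most [2 * Im w], and the edge distance gives [N
   ^+ 2 * Im w ^+ 3 >= N ^ (3 * om) >= L ^+ 61]. *)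
case: (leP (ImC w) (aRe z - 2)) => hc.
  apply: (@le_trans _ _ (L ^+ 61 * (aRe z - 2))).
    rewrite [L ^+ 61](_ : _ = L ^+ 60 * L); last by rewrite -exprSr.
    rewrite -mulrA ler_pM2l ?exprn_gt0 //; apply: (@le_trans _ _ (2 * (aRe z - 2))).
      by move: hc; lra.
    by rewrite ler_pM2r.
  rewrite -(kap4E z2); apply: (@le_trans _ _ (L ^+ 64 * (n * (L * ImC z)) ^+ 4)).
    apply: ler_pM; [exact: exprn_ge0 (ltW L0)|exact: exprn_ge0 (kap4_ge0 z)|exact: ler_weXn2l|].
    by apply: ler_wXn2r => //; exact: kap4_ge0.
  by rewrite wE (_ : L ^+ 64 = (L ^+ 16) ^+ 4) -?exprM // le_eqVlt; apply/orP; left; apply/eqP; ring.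
apply: (@le_trans _ _ (L ^+ 61 * ImC w)).
  rewrite [L ^+ 61](_ : _ = L ^+ 60 * L); last by rewrite -exprSr.
  rewrite -mulrA ler_pM2l ?exprn_gt0 //; apply: (@le_trans _ _ (2 * ImC w)); first by move: hc; lra.
  by rewrite ler_pM2r.
rewrite (_ : (n * ImC w) ^+ 4 = (n ^+ 2) ^+ 2 * ImC w ^+ 3 * ImC w); last by ring.
rewrite n2 ler_pM2r //; apply: (@le_trans _ _ (N%:R `^ (3 * om))).
  rewrite /L -powR_mulrn ?powR_ge0 // -powRrM; apply: ler_powR => //.
  by move: tho th0; lra.
apply: (le_trans edge); apply: ler_wpM2l; first by rewrite exprn_ge0.
by apply: ler_wXn2r; [exact: ltW|exact: ltW].
Qed.


(* Below the height [kap4 z / (sqrt N * N ^ th)] the trace of the imaginary part is too small for an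
   eigenvalue to be close, and the law is transported down by [gam_neumann]. *)
Lemma full_range (D : nat) : exists N0 : nat, forall N, (N0 <= N)%N -> forall d (T : measurableType d) (P : probability T R)
   (H : T -> 'M[R[i]]_N), wigner C Cp P H -> forall z : R[i],
   2 + N%:R `^ (- (2 / 3) + om) <= aRe z -> msc_domain B z ->
   forall x y : 'cV[R[i]]_N, norm2 x <= 1 -> norm2 y <= 1 ->
   whp P H D (fun M => cabs (gq z M x y - msc z * cdot x y) <= (N%:R `^ (85 * th)) ^+ 16 * pp N z).
Proof.
have [Na hNa] := low_range D; have [Nb hNb] := low_range D.+2.
have [Nl hNl] := powR_archi (Num.max 8 K) th0.
exists (maxn Na (maxn Nb (maxn Nl 2))) => N; rewrite !geq_max => /andP[Q1 /andP[Q2 /andP[Q3 N1]]].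
move=> d T P H W z zE dz x y x1 y1; have N0 := ltnW N1.
have [_ _] := hNl N Q3; rewrite ge_max => /andP[L8 LK]; set L := N%:R `^ th in L8 LK.
set A := N%:R `^ (85 * th).
have N0' : 0 < N%:R :> R by rewrite ltr0n.
have NR1 : 1 <= N%:R :> R by rewrite ler1n.
have L0 : 0 < L by exact: lt0_8.
have L1 : 1 <= L by exact: le1_8.
have LA : L <= A by apply: ler_powR => //; move: th0; lra.
have A0 : 0 < A by apply: lt_le_trans LA.
have A1 : 1 <= A by apply: le_trans LA.
have A15 : 0 <= A ^+ 15 by rewrite exprn_ge0 // ltW.
have A15' : 1 <= A ^+ 15 by rewrite exprn_ege1.
set n := Num.sqrt (N%:R : R); have n0 : 0 < n by rewrite sqrtr_gt0.
have n2 : n ^+ 2 = N%:R by rewrite sqr_sqrtr // ltW.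
have [z2 zB z0 zI] := dz; have zn := lt0r_neq0 z0.
have [_ edge] := edge_distance N0 zE.
have ka0 : 0 < aRe z - 2 by rewrite subr_gt0.
have k0 := kap4_ge0 z; have k4 := kap4E z2; set k := kap4 z in k0 k4.
have kp : 0 < k by rewrite lt_def k0 andbT; apply/eqP => e; move: k4 ka0; rewrite e expr0n /= => <-; rewrite ltxx.
have edge1 : 1 <= N%:R ^+ 2 * (aRe z - 2) ^+ 3.
  apply: le_trans edge; apply: (@le_trans _ _ (N%:R `^ 0)); first by rewrite powRr0.
  by apply: ler_powR => //; move: om_ge0; lra.
have ax (w : R[i]) u v D' : ImC w != 0 -> admb (fun M : 'M[R[i]]_N => (cabs (mean_dev w (msc w) M) <= pp N w) &&
     (cabs (gq w M u v - msc w * cdot u v) <= A ^+ D' * pp N w)).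
  move=> wn; apply: admb_and.
    apply: admb_le; last exact: admR_cst.
    by apply: admR_cabs; apply: adm_sum => i; apply: admZ; exact: adm_dev.
  apply: admb_le; last exact: admR_cst.
  by apply: admR_cabs; apply: admB; [exact: adm_gq|exact: adm_cst].
have ay (w : R[i]) u v D' : ImC w != 0 -> admb (fun M : 'M[R[i]]_N => cabs (gq w M u v - msc w * cdot u v) <= A ^+ D' * pp N w).
  move=> wn; apply: admb_le; last exact: admR_cst.
  by apply: admR_cabs; apply: admB; [exact: adm_gq|exact: adm_cst].
have pp0 (w : R[i]) : 2 < aRe w -> 0 < ImC w -> 0 < pp N w.
  by move=> w2 w0; rewrite invr_gt0 mulr_gt0 // sqrtr_gt0; exact: rho_gt0.
have Nka : 1 <= N%:R * (aRe z - 2).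
  apply: (@le_trans _ _ (N%:R * N%:R `^ (- (2 / 3) + om))); last first.
    by rewrite ler_pM2l //; exact: gap_le.
  rewrite -[X in X * _]powRr1 // -powRD; last by rewrite lt0r_neq0 ?implybT.
  apply: (@le_trans _ _ (N%:R `^ 0)); first by rewrite powRr0.
  by apply: ler_powR => //; move: om_ge0; lra.
have Lnk : L <= n * k.
  rewrite -(@ler_pXn2r _ 4) ?nnegrE ?(ltW L0) ?mulr_ge0 ?(ltW n0) // exprMn k4 (_ : 4 = 2 * 2)%N // [n ^+ _]exprM n2.
  apply: (@le_trans _ _ N%:R); last by rewrite expr2 -mulrA ler_peMr // ltW.
  rewrite /L -powR_mulrn ?powR_ge0 // -powRrM -[leRHS]powRr1 ?ler0n //; apply: ler_powR => //.
  by move: th1; lra.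
have NnL v : k <= n * (L * v) -> 1 <= N%:R * v.
  move=> hv; rewrite -(ler_pM2l L0) mulr1; apply: (le_trans Lnk).
  by rewrite -n2 (_ : L * _ = n * (n * (L * v))); [rewrite ler_pM2l|ring].
case: (leP k (n * (L * ImC z))) => hk.
  have h := hNa N Q1 d T P H W z zE dz (NnL _ hk) hk x y x1 y1.
  apply: (whp_imp W N0 (leqnn D) (ax z x y 15%N zn) (ay z x y 16%N zn) _ h) => t /andP[_ h'].
  apply: (le_trans h'); rewrite ler_pM2r ?pp0 //; exact: ler_weXn2l.
pose w : R[i] := (ReC z +i* (k / (n * L)))%C.
have nL0 : 0 < n * L by rewrite mulr_gt0.
have wz : ImC z <= ImC w by rewrite /= ler_pdivlMr // mulrC -mulrA ltW.
have w0 : 0 < ImC w by apply: lt_le_trans wz.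
have wn := lt0r_neq0 w0.
have wE : n * (L * ImC w) = k.
  have -> : ImC w = k / (n * L) by [].
  exact: mul_div.
(* Equivalent to [1 <= k ^+ 3 * n * L], which follows from [N ^+ 2 * (|E| - 2) ^+ 3 >= 1]. Hence
   [rr w] lies between [k] and [2 * k]. *)
have wk : ImC w <= aRe z - 2.
  have kn : 1 <= k ^+ 3 * n.
    rewrite -(@ler_pXn2r _ 4) ?nnegrE //; last by rewrite mulr_ge0 ?exprn_ge0 // ltW.
    rewrite expr1n (_ : (k ^+ 3 * n) ^+ 4 = (n ^+ 2) ^+ 2 * (k ^+ 4) ^+ 3); last by ring.
    by rewrite n2 k4.
  rewrite /= -k4 ler_pdivrMr // (_ : k ^+ 4 * (n * L) = k * ((k ^+ 3 * n) * L)); last by ring.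
  by rewrite ler_peMr // mulr_ege1.
have w2 : 2 < aRe w by [].
have dw : msc_domain B w by split => //; exact: gap_B wk zB.
have hwk : kap4 w <= n * (L * ImC w) by rewrite wE.
have wr : ReC z = ReC w by [].
have wa : aRe w = aRe z by [].
have wzE : 2 + N%:R `^ (- (2 / 3) + om) <= aRe w by [].
clearbody w.
have Nw : 1 <= N%:R * ImC w by apply: NnL; rewrite wE.
have h u v := hNb N Q2 d T P H W w wzE dw Nw hwk u v.
have hyy := h y y y1 y1; have hxy := h x y x1 y1.
have hxx := whp_le W N0 (leqnSn D.+1) (ax w x x 15%N wn) (h x x x1 x1).
have h3 := whp_and W N1 (ax w x y 15%N wn) (ax w y y 15%N wn) hxy hyy.
have h5 := whp_and W N1 (ax w x x 15%N wn) (admb_and (ax w x y 15%N wn) (ax w y y 15%N wn)) hxx h3.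
apply: (whp_imp W N0 (leqnn D) (admb_and (ax w x x 15%N wn) (admb_and (ax w x y 15%N wn) (ax w y y 15%N wn))) (ay z x y 16%N zn) _ h5).
move=> t /andP[/andP[hm exx] /andP[/andP[_ exy] /andP[_ eyy]]] {h hyy hxy hxx h3 h5 hNa hNb hNl}.
have hM := wig_herm W t; set M := H t in hm exx exy eyy hM *.
have [_ [im1 _] [_ _ _] mz] := ok dw.
have rw0 := rho_gt0 w2 w0; have q0 : 0 < rr w by rewrite sqrtr_gt0.
have q2 : rr w ^+ 2 = rho w by rewrite sqr_sqrtr // ltW.
have q4 := rr4E w2 w0.
have p0 := pp0 w w2 w0; have pE : n * (pp N w * rr w) = 1.
  by rewrite /pp -/n mulrCA mulVf // lt0r_neq0 // mulr_gt0.
have kq : k <= rr w.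
  by rewrite -(@ler_pXn2r _ 4) ?nnegrE ?(ltW q0) // k4 q4 wa lerDl ltW.
have qk : rr w <= 2 * k.
  rewrite -(@ler_pXn2r _ 4) ?nnegrE ?(ltW q0) ?mulr_ge0 // exprMn k4 q4.
  rewrite wa (_ : 2 ^+ 4 = 16 :> R); [exact: le16|exact: two_pow4].
have im0 := msc_Im_gt0 w0.
have kE : k = n * L * ImC w by rewrite -mulrA wE.
have wp : L * ImC w <= pp N w * rho w.
  rewrite -(ler_pM2l n0) wE -q2 (_ : n * _ = n * (pp N w * rr w) * rr w); last by ring.
  by rewrite pE mul1r.
(* By Ward's identity the sum times [Im w] is [N] times the imaginary part of the mean diagonal
   entry. After multiplication by [Im w], the part from [msc] is at most [L ^- 2] and the error, of
   size [p], contributes at most [1 / L]. *)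
have hs : 4 * (ImC w ^+ 2 * \sum_j gam w M (ebasis j)) <= 1.
  have e : ImC w * \sum_j gam w M (ebasis j) = N%:R * (ImC (msc w) + ImC (mean_dev w (msc w) M)).
    rewrite /mean_dev cIm_sum mulrDr mulr_sumr [N%:R * \sum_i _]mulr_sumr.
    rewrite -[N%:R * ImC _](_ : \sum_(j < N) ImC (msc w) = _); last by rewrite sumr_const card_ord mulr_natl.
    rewrite -big_split /=; apply: eq_bigr => j _; rewrite im_gam // imZ mulrA mulfV ?lt0r_neq0 // mul1r.
    by rewrite /dev cImD cImN addrC subrK.
  rewrite expr2 -mulrA e; set X := ImC (msc w) + _.
  have hX : X <= ImC (msc w) + pp N w.
    by rewrite lerD2l; apply: le_trans hm; exact: im_le_cabs.
  apply: (@le_trans _ _ (4 * (ImC w * (N%:R * (ImC (msc w) + pp N w))))).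
    by rewrite ler_pM2l // ler_pM2l // ler_pM2l.
  rewrite (_ : 4 * _ = 4 * (N%:R * ImC w * ImC (msc w)) + 4 * (N%:R * ImC w * pp N w)); last by ring.
  have X1 : L ^+ 2 * (N%:R * ImC w * ImC (msc w)) <= 1.
    rewrite -(ler_pM2l rw0) mulr1 (_ : rho w * _ = L ^+ 2 * N%:R * ImC w * (rho w * ImC (msc w))); last by ring.
    apply: (@le_trans _ _ (L ^+ 2 * N%:R * ImC w * ImC w)).
      by apply: ler_wpM2l => //; rewrite !mulr_ge0 ?exprn_ge0 ?(ltW L0) ?(ltW w0) ?(ltW N0').
    rewrite -n2 (_ : _ * _ = (n * L * ImC w) ^+ 2); last by ring.
    by rewrite -kE -q2; apply: ler_wXn2r.
  have X2 : L * (N%:R * ImC w * pp N w) <= 1.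
    rewrite -n2 (_ : L * _ = n * (n * L * ImC w * pp N w)); last by ring.
    by rewrite -kE -pE ler_pM2l // mulrC ler_pM2l.
  have X10 : 0 <= N%:R * ImC w * ImC (msc w) by rewrite !mulr_ge0 ?(ltW w0) ?(ltW im0) ?(ltW N0').
  have X20 : 0 <= N%:R * ImC w * pp N w by rewrite !mulr_ge0 ?(ltW w0) ?(ltW p0) ?(ltW N0').
  have X3 := le_trans (ler_wpM2r X20 L8) X2.
  have X4 : 8 * (N%:R * ImC w * ImC (msc w)) <= 1.
    apply: le_trans X1; apply: ler_wpM2r => //; apply: (le_trans L8).
    by rewrite expr2 ler_peMl // ltW.
  exact: two_halves.
have gz u : gam z M u <= 4 * gam w M u by exact: (gam_neumann u hM wr z0 wz hs).
(* At this height the error in the law may exceed [Im m], so Ward's identity gives the a priori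
   bound only up to the factor [L * A ^+ 15]. *)
have gw u : norm2 u <= 1 -> cabs (gq w M u u - msc w * cdot u u) <= A ^+ 15 * pp N w ->
    rho w * gam w M u <= 3 * L * A ^+ 15.
  move=> u1 hu; rewrite -(ler_pM2l w0) mulrCA im_gam //.
  have e : ImC (gq w M u u) = ImC (msc w) * norm2 u + ImC (gq w M u u - msc w * cdot u u).
    rewrite cdot_norm2; move: (gq w M u u) (msc w) (norm2 u) => v m' a.
    by rewrite cImD cImN cImM /=; ring.
  apply: (@le_trans _ _ (rho w * (ImC (msc w) + A ^+ 15 * pp N w))).
    apply: ler_wpM2l; first exact: ltW.
    rewrite e; apply: lerD; first by apply: ler_piMr => //; exact: ltW.
    by apply: le_trans hu; exact: im_le_cabs.
  have pr : pp N w * rho w <= 2 * L * ImC w.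
    rewrite -(ler_pM2l n0) -q2 (_ : n * _ = n * (pp N w * rr w) * rr w); last by ring.
    rewrite pE mul1r; apply: (le_trans qk); rewrite [X in 2 * X]kE.
    by rewrite le_eqVlt; apply/orP; left; apply/eqP; ring.
  rewrite mulrDr; apply: (@le_trans _ _ (ImC w + A ^+ 15 * (2 * L * ImC w))).
    by apply: lerD => //; rewrite mulrCA; apply: ler_wpM2l => //; rewrite mulrC.
  have AL : 1 <= L * A ^+ 15 by exact: mulr_ege1.
  rewrite (_ : _ + _ = ImC w * (1 + 2 * (L * A ^+ 15))); last by ring.
  by rewrite ler_pM2l // -mulrA; exact: one_three.
set g := Num.sqrt (3 * L * A ^+ 15 / rho w).
have g0 : 0 <= g by exact: sqrtr_ge0.
have g2 : g ^+ 2 = 3 * L * A ^+ 15 / rho w.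
  by rewrite sqr_sqrtr // divr_ge0 ?(ltW rw0) // mulr_ge0 // mulr_ge0 // ltW.
have gwg u : norm2 u <= 1 -> cabs (gq w M u u - msc w * cdot u u) <= A ^+ 15 * pp N w -> gam w M u <= g ^+ 2.
  by move=> u1 hu; rewrite g2 ler_pdivlMr // mulrC; exact: gw.
have gzg : gam z M x <= (2 * g) ^+ 2.
  apply: le_trans (gz x) _; rewrite exprMn (_ : 2 ^+ 2 = 4 :> R); last by ring.
  by rewrite ler_pM2l //; exact: gwg.
have zw1 : cabs (z - w) <= ImC w.
  by rewrite cabs_vertical // distrC ger0_norm ?subr_ge0 // gerBl ltW.
(* The resolvent identity gives [Im w * 2 * g ^+ 2], which is [6 * A ^+ 15] times
   [L * Im w / rho w], and [wp] bounds the last factor by [p]: the loss in [gw] is compensated by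
   the short distance. *)
have D1 : cabs (gq z M x y - gq w M x y) <= 6 * A ^+ 15 * pp N w.
  apply: le_trans (gq_diff hM zn wn (mulr_ge0 (ler0n _ 2) g0) g0 gzg (gwg y y1 eyy)) _.
  apply: (@le_trans _ _ (ImC w * (2 * g * g))).
    by apply: ler_wpM2r => //; apply: mulr_ge0 => //; apply: mulr_ge0.
  rewrite (_ : 2 * g * g = 2 * g ^+ 2); last by ring.
  rewrite g2 (_ : _ * _ = L * ImC w * (6 * A ^+ 15) / rho w); last by ring.
  by rewrite ler_pdivrMr // [leLHS]mulrC -[leRHS]mulrA; apply: ler_wpM2l => //; apply: mulr_ge0.
have D2 : cabs (msc w - msc z) <= pp N w.
  rewrite -(ler_pM2l rw0); apply: le_trans (mz z z2 zB z0 zI) _; rewrite cabsBC mulrC [leRHS]mulrC.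
  apply: le_trans wp; rewrite mulrC; apply: ler_pM => //; exact: le_trans ler01 K1.
have c1 : cabs (cdot x y) <= 1.
  by rewrite -[leRHS]mul1r; apply: cdot_le => //; rewrite expr1n.
rewrite (_ : _ - _ = (gq z M x y - gq w M x y) + (gq w M x y - msc w * cdot x y) + (msc w - msc z) * cdot x y); last first.
  by move: (gq z M x y) (gq w M x y) (msc z) (msc w) (cdot x y) => a b e f h; ring.
apply: le_trans (cabsD _ _) _.
apply: (@le_trans _ _ (6 * A ^+ 15 * pp N w + A ^+ 15 * pp N w + pp N w)).
  apply: lerD; first by apply: le_trans (cabsD _ _) _; exact: lerD.
  by rewrite cabsM -[leRHS]mulr1; apply: ler_pM.
have ppm : pp N w <= pp N z.
  have rzw : rr z <= rr w by apply: ler_wsqrtr; exact: (rho_mono dw dz wr).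
  have rz0 : 0 < rr z by rewrite sqrtr_gt0; exact: rho_gt0.
  have a1 : 0 < n * rr w by exact: mulr_gt0.
  have a2 : 0 < n * rr z by exact: mulr_gt0.
  by rewrite /pp -/n lef_pV2 ?posrE; [rewrite ler_pM2l|exact: a1|exact: a2].
apply: (@le_trans _ _ (A ^+ 16 * pp N w)); last by apply: ler_wpM2l => //; exact: exprn_ge0 (ltW A0).
rewrite -mulrDl -[X in _ + X]mul1r -mulrDl ler_pM2r // [A ^+ 16]exprS.
apply: (@le_trans _ _ (8 * A ^+ 15)); first exact: seven_eight.
by apply: ler_wpM2r => //; apply: le_trans LA.
Qed.

End LowRange.

Unset Implicit Arguments. Unset Strict Implicit.
Theorem mainTheorem16 (R : realType) (omega C : R) (Cp : nat -> R) :
  0 < omega < 1 -> 0 < C ->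
  forall eps D : R, 0 < eps -> 0 < D ->
  exists N0 : nat,
  forall (d : measure_display) (T : nat -> measurableType d)
    (P : forall N : nat, probability (T N) R)
    (H : forall N : nat, T N -> 'M[R[i]]_N),
    (* measurability of real and imaginary parts of the entries *)
    (forall N (i j : 'I_N), measurable_fun setT (fun t => complex.Re (H N t i j)) /\
                            measurable_fun setT (fun t => complex.Im (H N t i j))) ->
    (* H = H^* *)
    (forall N t (i j : 'I_N), H N t j i = conjc (H N t i j)) ->
    (* independence of the entries H_ij, i <= j *)
    (forall N, mutually_independent (P N) [set p : 'I_N * 'I_N | (p.1 <= p.2)%N]
                 (fun p t => cpair (H N t p.1 p.2))) ->
    (* centered entries *)
    (forall N (i j : 'I_N), ('E_(P N)[fun t => complex.Re (H N t i j)] = 0)%E /\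
                            ('E_(P N)[fun t => complex.Im (H N t i j)] = 0)%E) ->
    (* variance profile: C^-1 <= N S_ij <= C *)
    (forall N (i j : 'I_N),
       ((C^-1)%:E <= (N%:R)%:E * 'E_(P N)[fun t => (cabs (H N t i j) ^+ 2)%R])%E /\
       ((N%:R)%:E * 'E_(P N)[fun t => (cabs (H N t i j) ^+ 2)%R] <= C%:E)%E) ->
    (* sum_j S_ij = 1 *)
    (forall N (i : 'I_N), (\sum_(j < N) 'E_(P N)[fun t => (cabs (H N t i j) ^+ 2)%R])%E = 1%E) ->
    (* moment bounds E|sqrt N H_ij|^p <= C_p *)
    (forall (p N : nat) (i j : 'I_N),
       ('E_(P N)[fun t => (cabs (((Num.sqrt (N%:R))%:C)%C * H N t i j) ^+ p)%R] <= (Cp p)%:E)%E) ->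
    forall N : nat, (N0 <= N)%N ->
    forall (z : R[i]) (v w : 'cV[R[i]]_N),
      SW omega N z -> unit_vec v -> unit_vec w ->
      (P N [set t | (N%:R `^ eps
                      * Num.sqrt (complex.Im (msc z) / (N%:R * complex.Im z))
                    < cabs (cdot v (resolvent (H N t) z *m w) - msc z * cdot v w))%R]
       <= ((N%:R `^ (- D))%R)%:E)%E.
Proof.
move=> /andP[om0 om1] C0 eps D eps0 D0.
(* For [C < 1] the hypotheses are contradictory in every positive dimension, so [N0 = 1] works. *)
case: (ltP C 1) => C1.
  exists 1%N => d T P H mH hH iH eH vH sH pH N N1 z v w _ _ _.
  have W : wigner C Cp (P N) (H N).
    by split; [exact: mH|move=> t i j; exact: hH|exact: iH|exact: eH|exact: vH|exact: sH|move=> p i j; exact: pH].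
  by have := wigner_C_ge1 N1 W; rewrite leNgt C1.
(* The first argument makes the domain of the theorem fit, the second provides the starting height
   for [stable_base]. *)
set B := Num.max omega^-1 (48 * C).
have BC : 48 * C <= B by rewrite le_max lexx orbT.
have oB : omega^-1 <= B by rewrite le_max lexx.
have B1 : 1 <= B by move: BC; move: (B) => b; lra.
have [K K1 ok0] := @msc_bounds R B B1.
have ok (z : R[i]) : msc_domain B z -> msc_facts B K z by case=> a b c e; exact: ok0.
(* Small enough for [160 * 85 * th <= 3 * omega], the edge condition at exponent [85 * th], and for
   [17 * 85 * th <= eps], the total loss [A ^+ 17]. *)
set th := Num.min (omega / 100 / 100) (eps / 100 / 100).
have th0 : 0 < th by rewrite lt_min !divr_gt0.
have th_om : th <= omega / 100 / 100 by rewrite ge_min lexx.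
have th_eps : th <= eps / 100 / 100 by rewrite ge_min lexx orbT.
have th85 : 0 < 85 * th by rewrite mulr_gt0.
have h1 : 85 * th <= 1 by move: th_om om1; move: (th) => u; lra.
have h2 : 160 * (85 * th) <= 3 * omega by move: th_om om0; move: (th) => u; lra.
have h3 : 85 * th * 17 <= eps by move: th_eps eps0; move: (th) => u; lra.
have [Dn hDn] := natr_archi D.
have [N1 hN1] := full_range Cp th0 h1 h2 K1 C1 BC ok Dn.
have [N2 hN2] := powR_archi K th85.
exists (maxn N1 N2) => d T P H mH hH iH eH vH sH pH N NN z v w.
move: NN; rewrite geq_max => /andP[Q1 Q2] [/andP[zE zO] /andP[z0 zI]] v1 w1.
have W : wigner C Cp (P N) (H N).
  by split; [exact: mH|move=> t i j; exact: hH|exact: iH|exact: eH|exact: vH|exact: sH|move=> p i j; exact: pH].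
have [N0 _ KA] := hN2 N Q2; set A := N%:R `^ (85 * th) in KA.
have N0' : 0 < N%:R :> R by rewrite ltr0n.
have NR1 : 1 <= N%:R :> R by rewrite ler1n.
have A0 : 0 < A by exact: powR_gt0.
have [z2 _] := edge_distance N0 (zE : 2 + N%:R `^ (- (2 / 3) + omega) <= aRe z).
have dz : msc_domain B z by split => //; [exact: le_trans oB|exact: le_trans oB].
have v1' : norm2 v <= 1 by rewrite le_eqVlt; apply/orP; left; apply/eqP; exact: v1.
have w1' : norm2 w <= 1 by rewrite le_eqVlt; apply/orP; left; apply/eqP; exact: w1.
have h := hN1 N Q1 d (T N) (P N) (H N) W z zE dz v w v1' w1'.
have zn := lt0r_neq0 z0.
have al c : admb (fun M : 'M[R[i]]_N => cabs (gq z M v w - msc z * cdot v w) <= c).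
  apply: admb_le; last exact: admR_cst.
  by apply: admR_cabs; apply: admB; [exact: adm_gq|exact: adm_cst].
set c := N%:R `^ eps * Num.sqrt (complex.Im (msc z) / (N%:R * complex.Im z)).
have rz0 := rho_gt0 z2 z0.
have rr0 : 0 < rr z by rewrite sqrtr_gt0.
have rr2 : rr z ^+ 2 = rho z by rewrite sqr_sqrtr // ltW.
have n0 : 0 < Num.sqrt (N%:R : R) by rewrite sqrtr_gt0.
have p0 : 0 < pp N z by rewrite invr_gt0 mulr_gt0.
(* One further factor [A] converts [p = (N rho) ^ (-1/2)] into the stated square root, since
   [Im z <= K * rho * Im m] and [K <= A ^+ 2]. *)
have hc : A ^+ 16 * pp N z <= c.
  have [_ [_ im2] _ _] := ok z dz.
  have A17 : A ^+ 17 <= N%:R `^ eps.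
    by rewrite /A -powR_mulrn ?powR_ge0 // -powRrM; apply: ler_powR.
  have root : pp N z / A <= Num.sqrt (complex.Im (msc z) / (N%:R * complex.Im z)).
    rewrite -[leLHS]ger0_norm; last by rewrite divr_ge0 // ltW.
    rewrite -sqrtr_sqr; apply: ler_wsqrtr.
    rewrite expr_div_n /pp exprVn exprMn rr2 sqr_sqrtr ?(ltW N0') //.
    rewrite ler_pdivlMr ?mulr_gt0 // -invfM ler_pdivrMl; last by rewrite !mulr_gt0 // exprn_gt0.
    rewrite [leRHS](_ : _ = N%:R * (A ^+ 2 * rho z * complex.Im (msc z))); last by ring.
    rewrite ler_pM2l //; apply: (le_trans im2); apply: ler_wpM2r; first exact: ltW (msc_Im_gt0 z0).
    apply: ler_wpM2r; first exact: ltW.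
    by apply: (le_trans KA); rewrite expr2 ler_peMl ?(ltW A0) // (le_trans K1).
  rewrite /c; apply: le_trans (ler_pM _ _ A17 root); rewrite ?exprn_ge0 ?divr_ge0 ?(ltW A0) ?(ltW p0) //.
  by rewrite le_eqVlt; apply/orP; left; apply/eqP; field; exact: lt0r_neq0.
have h' : whp (P N) (H N) Dn (fun M => cabs (gq z M v w - msc z * cdot v w) <= c).
  by apply: (whp_imp W N0 (leqnn Dn) (al _) (al c) _ h) => t ht; exact: le_trans hc.
rewrite (_ : [set t | _] = [set t | ~~ (cabs (gq z (H N t) v w - msc z * cdot v w) <= c)]); last first.
  by apply/seteqP; split => t /=; rewrite -ltNge.
apply: (le_trans h'); rewrite lee_fin powRN lef_pV2 ?posrE ?powR_gt0 ?exprn_gt0 //.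
by rewrite -powR_mulrn ?ler0n //; apply: ler_powR => //; exact: hDn.
Qed.
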